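(* Let $\mathbb{K}$ denote the Kleene–Vesley relative partial combinatory algebra. For each of the following theories $\mathcal{T}$ there exists an idempotent jump operator $\mathbf{j}$ on $\mathbb{K}$ such that every axiom of $\mathcal{T}$ is $\mathbf{j}$-realizable over $\mathbb{K}_\mathbf{j}$: (1) $\mathbf{IZF}+\mathsf{LLPO}+\neg\mathsf{RDIV}+\neg\mathsf{BE}$; (2) $\mathbf{IZF}+\mathsf{RDIV}+\neg\mathsf{BE}$; (3) $\mathbf{IZF}+\mathsf{BE}+\neg\mathsf{RDIV}$; (4) $\mathbf{IZF}+\mathsf{RDIV}+\mathsf{BE}+\neg\mathsf{IVT}$; (5) $\mathbf{IZF}+\mathsf{IVT}+\neg\mathsf{WKL}$. Here $\mathbf{IZF}$ is intuitionistic Zermelo–Fraenkel set theory.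
   Context: Relative pca: a triple $\mathbb{P}=(P,\omega^\omega,\cdot)$ where $\cdot$ is a partial binary operation on $\omega^\omega$, $P\subseteq\omega^\omega$, both $(\omega^\omega,\cdot)$ and $(P,\cdot|_P)$ are partial combinatory algebras (combinatorially complete partial magmas) sharing the combinators $\mathsf{s},\mathsf{k}$. The Kleene–Vesley algebra $\mathbb{K}$ has $P$ = the computable elements of $\omega^\omega$ and $\cdot$ = Kleene's second-algebra (type-2) application. For a partial multifunction $\mathbf{j}\colon\subseteq\omega^\omega\rightrightarrows\omega^\omega$, composition is $(h\circ g)(x)=\bigcup\{h(y):y\in g(x)\}$ if $g(x)$ is defined and $g(x)\subseteq\mathrm{dom}(h)$, undefined otherwise; $a\mathbf{j}(x)=\{a\cdot y:y\in\mathbf{j}(x)\}$. $\mathbf{j}$ is an idempotent jump operator on $\mathbb{P}$ if: (1) there is $u\in P$ with $a\mathbf{j}(x)=\mathbf{j}(uax)$ for all $a,x$; (2) there is $\iota\in P$ with $\{x\}=\mathbf{j}(\iota x)$ for all $x$; (3) there is $j_0\in P$ with $\mathbf{j}\circ\mathbf{j}(x)=\mathbf{j}(j_0x)$ for all $x$. If $\mathbf{j}(a)$ is a singleton write $a'$ for its element; define $a\ast_\mathbf{j}b\simeq a'\cdot b$ (undefined if $\mathbf{j}(a)$ is not a singleton), $P_\mathbf{j}=\{a':a\in P,\ \mathbf{j}(a)\text{ a singleton}\}$, and $\mathbb{P}_\mathbf{j}=(P_\mathbf{j},\omega^\omega,\ast_\mathbf{j})$. Realizability: work in a universe with a set $\mathbb{N}$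 of urelements; let $V_\alpha=\bigcup_{\beta<\alpha}\mathcal{P}(\omega^\omega\times(V_\beta\cup\mathbb{N}))$, $V_{\rm set}=\bigcup_\alpha V_\alpha$, $V=V_{\rm set}\cup\mathbb{N}$ (the names). Sentences are in the language of IZF (with predicates $\mathbf{N}$, $\mathbf{Set}$ and primitive recursive relations) with parameters from $V$. Using the application of the algebra (here $\ast_\mathbf{j}$), pairing projections $\pi_0,\pi_1$ and numerals $\underline{n}$, and writing $\forall^+x\in X\,A$ for ''$X\neq\emptyset$ and $\forall x\in X\,A$'', define $e\Vdash\varphi$ for $e\in\omega^\omega$: $e\Vdash R(\bar a)$ iff $\mathbb{N}\models R(\bar a)$; $e\Vdash\mathbf{N}(a)$ iff $a\in\mathbb{N}$ and $e=\underline{a}$; $e\Vdash\mathbf{Set}(a)$ iff $a\in V_{\rm set}$; $e\Vdash a\in b$ iff $\forall^+d\in\mathbf{j}(e)\exists c[(\pi_0d,c)\in b\wedge \pi_1d\Vdash a=c]$; $e\Vdash a=b$ iff ($a,b\in\mathbb{N}$, $a=b$) or ($a,b\in V_{\rm set}$ and $\forall^+d\in\mathbf{j}(e)$: for all $(p,c)\in a$, $(\pi_0d)p\Vdash c\in b$, and for all $(p,c)\in b$, $(\pi_1d)p\Vdash c\in a$); $e\Vdash A\wedge B$ iff $\pi_0e\Vdash A$ and $\pi_1e\Vdash B$; $e\Vdash A\vee B$ iff $\forall^+d\in\mathbf{j}(e)[(\pi_0d=0\wedge\pi_1d\Vdash A)\vee(\pi_0d=1\wedge\pi_1d\Vdash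 B)]$; $e\Vdash\neg A$ iff no $a\in\omega^\omega$ realizes $A$; $e\Vdash A\to B$ iff for all $a$, $a\Vdash A$ implies $ea\Vdash B$; $e\Vdash\forall xA$ iff $\forall^+d\in\mathbf{j}(e)\,\forall c\in V\ d\Vdash A[c/x]$; $e\Vdash\exists xA$ iff $\forall^+d\in\mathbf{j}(e)\,\exists c\in V\ d\Vdash A[c/x]$. A sentence is $\mathbf{j}$-realizable over the algebra if it is realized by some $e$ in the lightface part ($P_\mathbf{j}$). Principles (reals are regular Cauchy reals, i.e. given by rational sequences $(q_n)$ with $|q_n-q_m|<2^{-n}$ for $m\ge n$): $\mathsf{LLPO}$: for all reals $x,y$, $x\le y$ or $y\le x$. $\mathsf{RDIV}$: for all $x,y\in[0,1]$ with $x\le y$ there is $z\in[0,1]$ with $x=yz$. $\mathsf{BE}$: every real in $[0,1]$ has a binary expansion. $\mathsf{IVT}$: for every continuous $f\colon[0,1]\to[-1,1]$ with $f(0),f(1)$ of different signs there is a real $x\in[0,1]$ with $f(x)=0$. $\mathsf{WKL}$: every infinite binary tree has an infinite path. *)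

(* Defs.v *)
From mathcomp Require Import all_boot.

Set Implicit Arguments.
Unset Strict Implicit.
Unset Printing Implicit Defensive.

(* Codes are read as functions of an argument list of any length; missing
   arguments count as 0. [PRec f g] recurses on its first argument:
   h(0, x) = f(x) and h(n+1, x) = g(n, h(n, x), x). *)
Inductive prf : Type :=
| PZero
| PSucc
| PProj of nat
| PComp of prf & seq prf
| PRec of prf & prf.

Fixpoint eval (f : prf) (xs : seq nat) : nat :=
  match f with
  | PZero => 0
  | PSucc => (nth 0 xs 0).+1
  | PProj i => nth 0 xs i
  | PComp g hs => eval g [seq eval h xs | h <- hs]
  | PRec g h =>
      iteri (nth 0 xs 0) (fun n y => eval h [:: n, y & behead xs])
            (eval g (behead xs))
  end.

Inductive recf : Type :=
| RPrim of prf
| RComp of recf & seq recf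
| RRec of recf & recf
| RMu of recf.

Inductive reval : recf -> seq nat -> nat -> Prop :=
| reval_prim f xs : reval (RPrim f) xs (eval f xs)
| reval_comp f gs xs ys z :
    revals gs xs ys -> reval f ys z -> reval (RComp f gs) xs z
| reval_rec0 f g xs y : reval f xs y -> reval (RRec f g) (0 :: xs) y
| reval_recS f g n xs y z :
    reval (RRec f g) (n :: xs) y -> reval g [:: n, y & xs] z ->
    reval (RRec f g) (n.+1 :: xs) z
| reval_mu f xs n :
    reval f (n :: xs) 0 ->
    (forall m, m < n -> exists k, reval f (m :: xs) k.+1) ->
    reval (RMu f) xs n
with revals : seq recf -> seq nat -> seq nat -> Prop :=
| revals_nil xs : revals [::] xs [::]
| revals_cons g gs xs y ys :
    reval g xs y -> revals gs xs ys -> revals (g :: gs) xs (y :: ys).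

Definition baire : Type := nat -> nat.

Definition computable (a : baire) : Prop :=
  exists f, forall n, reval f [:: n] (a n).

(* [kapp a b c] is "a . b is defined and equal to c": c(n) = a(<n> * b|k) - 1
   for the least k with a(<n> * b|k) > 0, and such a k exists for every n. *)
Definition kapp (a b c : baire) : Prop :=
  forall n, exists k,
    a (CodeSeq.code (n :: mkseq b k)) = (c n).+1
    /\ forall i, i < k -> a (CodeSeq.code (n :: mkseq b i)) = 0.

(* The data (P, omega^omega, .) of a relative pca with boldface part Baire
   space; the partial operation is given by its graph. *)
Record algebra : Type := Algebra {
  light : baire -> Prop;
  app : baire -> baire -> baire -> Prop
}.

Definition KV : algebra := Algebra computable kapp.

(* A partial multifunction; being undefined at x is having no value at x. *)
Definition multifun : Type := baire -> baire -> Prop.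

Definition mdom (g : multifun) (x : baire) : Prop := exists y, g x y.

Definition mcomp (h g : multifun) : multifun := fun x z =>
  [/\ mdom g x, forall y, g x y -> mdom h y & exists2 y, g x y & h y z].

(* a j(x) is the composite of j with the partial function y |-> a . y: it is
   undefined as soon as a . y is undefined for some y in j(x). *)
Definition idempotent_jump (A : algebra) (j : multifun) : Prop :=
  [/\ exists2 u, light A u &
        forall a x z, mcomp (app A a) j x z <->
          exists v w, [/\ app A u a v, app A v x w & j w z],
      exists2 i, light A i &
        forall x, exists2 v, app A i x v & forall z, j v z <-> z = x
    & exists2 j0, light A j0 &
        forall x z, mcomp j j x z <-> exists2 v, app A j0 x v & j v z].

(* [derived j a b]: j(a) is the singleton {b}, i.e. b = a'. *)
Definition derived (j : multifun) (a b : baire) : Prop :=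
  forall z, j a z <-> z = b.

Definition jump_algebra (A : algebra) (j : multifun) : algebra :=
  Algebra (fun b => exists2 a, light A a & derived j a b)
          (fun a b c => exists2 a', derived j a a' & app A a' b c).

Definition pr0 (e : baire) : baire := fun n => e n.*2.
Definition pr1 (e : baire) : baire := fun n => e n.*2.+1.
Definition numeral (n : nat) : baire := fun _ => n.

(* [Coll p x] is the set of all pairs (p i, x i). *)
Inductive name : Type :=
| Urel of nat
| Coll (J : Type) of (J -> baire) & (J -> name).

Definition is_set (a : name) : Prop := if a is Coll _ _ _ then True else False.

Definition pmem (p : baire) (c : name) (a : name) : Prop :=
  if a is Coll J q x then exists i : J, q i = p /\ x i = c else False.

(* Variables are natural numbers. [FRel f g xs] is the atom R(xs) for the
   primitive recursive relation R(x) :<-> f(x) = g(x); every primitive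
   recursive relation has this form. *)
Inductive form : Type :=
| FRel of prf & prf & seq nat
| FNat of nat
| FSet of nat
| FIn of nat & nat
| FEq of nat & nat
| FAnd of form & form
| FOr of form & form
| FNot of form
| FImp of form & form
| FAll of nat & form
| FEx of nat & form.

Definition FIff (A B : form) : form := FAnd (FImp A B) (FImp B A).

Fixpoint fv (A : form) : seq nat :=
  match A with
  | FRel _ _ xs => xs
  | FNat x | FSet x => [:: x]
  | FIn x y | FEq x y => [:: x; y]
  | FAnd B C | FOr B C | FImp B C => fv B ++ fv C
  | FNot B => fv B
  | FAll x B | FEx x B => [seq y <- fv B | y != x]
  end.

Fixpoint allvars (A : form) : seq nat :=
  match A with
  | FRel _ _ xs => xs
  | FNat x | FSet x => [:: x]
  | FIn x y | FEq x y => [:: x; y]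
  | FAnd B C | FOr B C | FImp B C => allvars B ++ allvars C
  | FNot B => allvars B
  | FAll x B | FEx x B => x :: allvars B
  end.

(* A[y/x]; used only with y not occurring in A, so that nothing is captured. *)
Fixpoint rename (x y : nat) (A : form) : form :=
  let r z := if z == x then y else z in
  match A with
  | FRel f g xs => FRel f g (map r xs)
  | FNat z => FNat (r z)
  | FSet z => FSet (r z)
  | FIn z w => FIn (r z) (r w)
  | FEq z w => FEq (r z) (r w)
  | FAnd B C => FAnd (rename x y B) (rename x y C)
  | FOr B C => FOr (rename x y B) (rename x y C)
  | FNot B => FNot (rename x y B)
  | FImp B C => FImp (rename x y B) (rename x y C)
  | FAll z B => if z == x then A else FAll z (rename x y B)
  | FEx z B => if z == x then A else FEx z (rename x y B)
  end.

Definition close (A : form) : form := foldr FAll A (undup (fv A)).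

Section Realizability.

Variables (A : algebra) (j : multifun).

(* The simultaneous recursion of the clauses for = and \in on names; names
   being well-founded, the least solution of the clauses is the only one. *)
Inductive rlz_eq : baire -> name -> name -> Prop :=
| rlz_eq_nat e n : rlz_eq e (Urel n) (Urel n)
| rlz_eq_set e a b :
    is_set a -> is_set b ->
    (exists d, j e d) ->
    (forall d, j e d ->
       (forall p c, pmem p c a ->
          exists2 v, app A (pr0 d) p v & rlz_in v c b) /\
       (forall p c, pmem p c b ->
          exists2 v, app A (pr1 d) p v & rlz_in v c a)) ->
    rlz_eq e a b
with rlz_in : baire -> name -> name -> Prop :=
| rlz_in_intro e a b :
    (exists d, j e d) ->
    (forall d, j e d -> exists2 c, pmem (pr0 d) c b & rlz_eq (pr1 d) a c) ->
    rlz_in e a b.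

(* [forall_plus X Q] is "X is nonempty and all its elements satisfy Q". *)
Definition forall_plus (X Q : baire -> Prop) : Prop :=
  (exists d, X d) /\ (forall d, X d -> Q d).

Definition upd (rho : nat -> name) (x : nat) (c : name) : nat -> name :=
  fun y => if y == x then c else rho y.

(* [rlz phi rho e]: e realizes the sentence with parameters obtained from phi
   by replacing each free variable x by the name rho x. *)
Fixpoint rlz (phi : form) (rho : nat -> name) (e : baire) : Prop :=
  match phi with
  | FRel f g xs =>
      exists2 ns, map rho xs = map Urel ns & eval f ns = eval g ns
  | FNat x => exists2 n, rho x = Urel n & e = numeral n
  | FSet x => is_set (rho x)
  | FIn x y => rlz_in e (rho x) (rho y)
  | FEq x y => rlz_eq e (rho x) (rho y)
  | FAnd B C => rlz B rho (pr0 e) /\ rlz C rho (pr1 e)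
  | FOr B C =>
      forall_plus (j e) (fun d =>
        (pr0 d = numeral 0 /\ rlz B rho (pr1 d)) \/
        (pr0 d = numeral 1 /\ rlz C rho (pr1 d)))
  | FNot B => forall a, ~ rlz B rho a
  | FImp B C =>
      forall a, rlz B rho a -> exists2 v, app A e a v & rlz C rho v
  | FAll x B =>
      forall_plus (j e) (fun d => forall c, rlz B (upd rho x c) d)
  | FEx x B =>
      forall_plus (j e) (fun d => exists c, rlz B (upd rho x c) d)
  end.

End Realizability.

(* j-realizability of a sentence (a formula without free variables, so that
   rho is immaterial) over the algebra A_j. *)
Definition j_realizable (A : algebra) (j : multifun) (phi : form) : Prop :=
  exists2 e, light (jump_algebra A j) e &
    forall rho, rlz (jump_algebra A j) j phi rho e.

Definition j_realizes (A : algebra) (j : multifun) (T : form -> Prop) : Prop :=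
  forall phi, T phi -> j_realizable A j phi.

(* The atom f(xs) = y. *)
Definition graph (f : prf) (xs : seq nat) (y : nat) : form :=
  FRel (PComp f [seq PProj i.+1 | i <- iota 0 (size xs)]) (PProj 0) (y :: xs).

Definition is_zero (y : nat) : form := graph PZero [::] y.
Definition is_succ (x y : nat) : form := graph PSucc [:: x] y.

Definition FAllN (x : nat) (B : form) : form := FAll x (FImp (FNat x) B).
Definition FExN (x : nat) (B : form) : form := FEx x (FAnd (FNat x) B).
Definition FAllsN (xs : seq nat) (B : form) : form := foldr FAllN B xs.

(* [izf_rel] to [izf_recS] are the defining equations of the primitive recursive
   symbols, with the convention above on missing arguments. *)
Inductive IZF : form -> Prop :=
| izf_refl x : IZF (FAll x (FEq x x))
| izf_leibniz B x y :
    x != y -> y \notin allvars B ->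
    IZF (close (FAll x (FAll y
      (FImp (FEq x y) (FImp B (rename x y B))))))
| izf_disjoint x : IZF (FAll x (FNot (FAnd (FNat x) (FSet x))))
| izf_urelement x y :
    x != y -> IZF (FAll x (FAll y (FImp (FIn x y) (FSet y))))
| izf_rel f g xs y :
    uniq (y :: xs) ->
    IZF (FAllsN xs (FIff (FRel f g xs)
      (FExN y (FAnd (graph f xs y) (graph g xs y)))))
| izf_total f xs y :
    uniq (y :: xs) -> IZF (FAllsN xs (FExN y (graph f xs y)))
| izf_functional f xs y z :
    uniq [:: y, z & xs] ->
    IZF (FAllsN [:: y, z & xs]
      (FImp (FAnd (graph f xs y) (graph f xs z)) (FEq y z)))
| izf_zero xs y :
    uniq (y :: xs) ->
    IZF (FAllsN (y :: xs) (FIff (graph PZero xs y) (is_zero y)))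
| izf_succ xs y z :
    uniq [:: y, z & xs] ->
    IZF (FAllsN (y :: xs) (FIff (graph PSucc xs y)
      (FExN z (FAnd (graph (PProj 0) xs z) (is_succ z y)))))
| izf_proj i xs y :
    uniq (y :: xs) ->
    IZF (FAllsN (y :: xs) (FIff (graph (PProj i) xs y)
      (if i < size xs then FEq (nth 0 xs i) y else is_zero y)))
| izf_comp f gs xs ys z :
    uniq (z :: ys ++ xs) -> size ys = size gs ->
    IZF (FAllsN (z :: ys ++ xs)
      (foldr FImp (graph (PComp f gs) xs z)
         (graph f ys z :: [seq graph p.1 xs p.2 | p <- zip gs ys])))
| izf_rec_nil f g y :
    IZF (FAllN y (FImp (graph f [::] y) (graph (PRec f g) [::] y)))
| izf_rec0 f g xs y n :
    uniq [:: y, n & xs] ->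
    IZF (FAllsN [:: y, n & xs]
      (FImp (FAnd (is_zero n) (graph f xs y)) (graph (PRec f g) (n :: xs) y)))
| izf_recS f g xs y z n m :
    uniq [:: y, z, n, m & xs] ->
    IZF (FAllsN [:: y, z, n, m & xs]
      (FImp (FAnd (is_succ n m)
               (FAnd (graph (PRec f g) (n :: xs) y)
                     (graph g [:: n, y & xs] z)))
            (graph (PRec f g) (m :: xs) z)))
| izf_succ_neq0 x y :
    x != y ->
    IZF (FAllsN [:: x; y] (FNot (FAnd (is_succ x y) (is_zero y))))
| izf_succ_inj x y z :
    uniq [:: x; y; z] ->
    IZF (FAllsN [:: x; y; z]
      (FImp (FAnd (is_succ x z) (is_succ y z)) (FEq x y)))
| izf_nat_induction B x y :
    x != y -> y \notin allvars B ->
    IZF (close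
      (FImp (FAllN x (FImp (is_zero x) B))
      (FImp (FAllN x (FAllN y (FImp (FAnd (is_succ x y) B) (rename x y B))))
            (FAllN x B))))
| izf_extensionality x y z :
    uniq [:: x; y; z] ->
    IZF (FAll x (FAll y (FImp (FAnd (FSet x) (FSet y))
      (FImp (FAll z (FIff (FIn z x) (FIn z y))) (FEq x y)))))
| izf_pairing x y z u :
    uniq [:: x; y; z; u] ->
    IZF (FAll x (FAll y (FEx u (FAnd (FSet u)
      (FAll z (FIff (FIn z u) (FOr (FEq z x) (FEq z y))))))))
| izf_union x y z u :
    uniq [:: x; y; z; u] ->
    IZF (FAll x (FImp (FSet x) (FEx u (FAnd (FSet u)
      (FAll z (FIff (FIn z u) (FEx y (FAnd (FIn y x) (FIn z y)))))))))
| izf_infinity z u :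
    z != u ->
    IZF (FEx u (FAnd (FSet u) (FAll z (FIff (FIn z u) (FNat z)))))
| izf_powerset x y z u :
    uniq [:: x; y; z; u] ->
    IZF (FAll x (FImp (FSet x) (FEx u (FAnd (FSet u)
      (FAll z (FIff (FIn z u)
        (FAnd (FSet z) (FAll y (FImp (FIn y z) (FIn y x))))))))))
| izf_separation B x a b :
    uniq [:: x; a; b] -> b \notin fv B ->
    IZF (close (FAll a (FImp (FSet a) (FEx b (FAnd (FSet b)
      (FAll x (FIff (FIn x b) (FAnd (FIn x a) B))))))))
| izf_collection B x y a b :
    uniq [:: x; y; a; b] -> b \notin fv B ->
    IZF (close (FAll a (FImp (FSet a)
      (FImp (FAll x (FImp (FIn x a) (FEx y B)))
            (FEx b (FAnd (FSet b)
              (FAll x (FImp (FIn x a) (FEx y (FAnd (FIn y b) B))))))))))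
| izf_set_induction B x y :
    x != y -> y \notin allvars B ->
    IZF (close
      (FImp (FAll x (FImp (FAll y (FImp (FIn y x) (rename x y B))) B))
            (FAll x B))).

Definition extend (T : form -> Prop) (B : form) : form -> Prop :=
  fun phi => T phi \/ phi = B.

(* A scheme gives a formula for each first unused variable; [hAll] and [hEx]
   bind that variable, so no name is ever bound within its own scope. *)
Definition scheme : Type := nat -> form.

Definition sentence (F : scheme) : form := F 0.

Definition hAll (F : nat -> scheme) : scheme := fun d => FAll d (F d d.+1).
Definition hEx (F : nat -> scheme) : scheme := fun d => FEx d (F d d.+1).
Definition hAnd (F G : scheme) : scheme := fun d => FAnd (F d) (G d).
Definition hOr (F G : scheme) : scheme := fun d => FOr (F d) (G d).
Definition hImp (F G : scheme) : scheme := fun d => FImp (F d) (G d).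
Definition hIff (F G : scheme) : scheme := fun d => FIff (F d) (G d).
Definition hNot (F : scheme) : scheme := fun d => FNot (F d).
Definition hIn (x y : nat) : scheme := fun _ => FIn x y.
Definition hEq (x y : nat) : scheme := fun _ => FEq x y.
Definition hNat (x : nat) : scheme := fun _ => FNat x.
Definition hSet (x : nat) : scheme := fun _ => FSet x.

Declare Scope scheme_scope.
Delimit Scope scheme_scope with S.
Bind Scope scheme_scope with scheme.
Local Open Scope scheme_scope.

Notation "∀ x .. y , F" := (hAll (fun x => .. (hAll (fun y => F)) ..))
  (at level 200, x binder, y binder, right associativity) : scheme_scope.
Notation "∃ x .. y , F" := (hEx (fun x => .. (hEx (fun y => F)) ..))
  (at level 200, x binder, y binder, right associativity) : scheme_scope.
Notation "x ∈ y" := (hIn x y) (at level 70, no associativity) : scheme_scope.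
Notation "x ≐ y" := (hEq x y) (at level 70, no associativity) : scheme_scope.
Notation "¬ F" := (hNot F) (at level 75, right associativity) : scheme_scope.
Notation "F ∧ G" := (hAnd F G) (at level 80, right associativity) : scheme_scope.
Notation "F ∨ G" := (hOr F G) (at level 85, right associativity) : scheme_scope.
Notation "F ⇒ G" := (hImp F G) (at level 90, right associativity) : scheme_scope.
Notation "F ⇔ G" := (hIff F G) (at level 95, no associativity) : scheme_scope.

Definition hAllN (F : nat -> scheme) : scheme := ∀ n, hNat n ⇒ F n.
Definition hExN (F : nat -> scheme) : scheme := ∃ n, hNat n ∧ F n.

Notation "∀ᴺ x .. y , F" := (hAllN (fun x => .. (hAllN (fun y => F)) ..))
  (at level 200, x binder, y binder, right associativity) : scheme_scope.
Notation "∃ᴺ x .. y , F" := (hExN (fun x => .. (hExN (fun y => F)) ..))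
  (at level 200, x binder, y binder, right associativity) : scheme_scope.

Definition padd : prf := PRec (PProj 0) (PComp PSucc [:: PProj 1]).
Definition pmul : prf := PRec PZero (PComp padd [:: PProj 1; PProj 2]).
Definition ppred : prf := PRec PZero (PProj 0).
(* (x, y) |-> y - x, truncated *)
Definition prsub : prf := PRec (PProj 0) (PComp ppred [:: PProj 1]).
Definition ppow2 : prf :=
  PRec (PComp PSucc [:: PZero]) (PComp padd [:: PProj 1; PProj 1]).

Inductive aexp : Type :=
| AVar of nat
| ACst of nat
| AAdd of aexp & aexp
| AMul of aexp & aexp
| APow2 of aexp.

(* One entry for each occurrence of a variable. *)
Fixpoint avars (t : aexp) : seq nat :=
  match t with
  | AVar x => [:: x]
  | ACst _ => [::]
  | AAdd s r | AMul s r => avars s ++ avars r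
  | APow2 s => avars s
  end.

(* The function of the variable occurrences denoted by t, its arguments
   starting at position o of the argument list. *)
Fixpoint acode (t : aexp) (o : nat) : prf :=
  match t with
  | AVar _ => PProj o
  | ACst n => iter n (fun p => PComp PSucc [:: p]) PZero
  | AAdd s r => PComp padd [:: acode s o; acode r (o + size (avars s))]
  | AMul s r => PComp pmul [:: acode s o; acode r (o + size (avars s))]
  | APow2 s => PComp ppow2 [:: acode s o]
  end.

Definition aeq (s t : aexp) : scheme := fun _ =>
  FRel (acode s 0) (acode t (size (avars s))) (avars s ++ avars t).
Definition ale (s t : aexp) : scheme := fun _ =>
  FRel (PComp prsub [:: acode t (size (avars s)); acode s 0]) PZero
       (avars s ++ avars t).
Definition alt (s t : aexp) : scheme := ale (AAdd s (ACst 1)) t.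

Fixpoint aval (v : nat -> nat) (t : aexp) : nat :=
  match t with
  | AVar x => v x
  | ACst n => n
  | AAdd s r => aval v s + aval v r
  | AMul s r => aval v s * aval v r
  | APow2 s => 2 ^ aval v s
  end.

Lemma eval_padd x y xs : eval padd [:: x, y & xs] = x + y.
Proof. by rewrite /=; elim: x => //= x ->. Qed.

Lemma eval_pmul x y xs : eval pmul [:: x, y & xs] = x * y.
Proof.
have -> : eval pmul [:: x, y & xs] =
    iteri x (fun _ z => eval padd [:: z; y]) 0 by [].
elim: x => // x IH; rewrite -[LHS]/(eval padd [:: iteri x _ _; y]) IH.
by rewrite eval_padd mulSn addnC.
Qed.

Lemma eval_ppow2 x xs : eval ppow2 (x :: xs) = 2 ^ x.
Proof.
have -> : eval ppow2 (x :: xs) =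
    iteri x (fun _ z => eval padd [:: z; z]) 1 by [].
elim: x => // x IH.
rewrite -[LHS]/(eval padd [:: iteri x _ _; iteri x _ _]) IH.
by rewrite eval_padd expnS mul2n addnn.
Qed.

Lemma eval_prsub x y xs : eval prsub [:: x, y & xs] = y - x.
Proof.
rewrite /=; elim: x => [|x IH] /=; first by rewrite subn0.
by rewrite IH subnS; case: (y - x).
Qed.

Lemma eval_acode v t s1 s2 :
  eval (acode t (size s1)) (s1 ++ map v (avars t) ++ s2) = aval v t.
Proof.
elim: t s1 s2 => [x|n|s IHs r IHr|s IHs r IHr|s IHs] s1 s2.
- by rewrite /= nth_cat ltnn subnn.
- by elim: n => //= n ->.
- rewrite -[LHS]/(eval padd [:: eval (acode s _) _; eval (acode r _) _]).
  rewrite eval_padd /= map_cat -catA IHs.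
  by rewrite -(size_map v (avars s)) -size_cat catA IHr.
- rewrite -[LHS]/(eval pmul [:: eval (acode s _) _; eval (acode r _) _]).
  rewrite eval_pmul /= map_cat -catA IHs.
  by rewrite -(size_map v (avars s)) -size_cat catA IHr.
- rewrite -[LHS]/(eval ppow2 [:: eval (acode s _) _]).
  by rewrite eval_ppow2 /= IHs.
Qed.

(* The expression (a, b, d) denotes the rational (a - b) / d, where d > 0. *)
Definition qexp : Type := (aexp * aexp * aexp)%type.

Definition qadd (u v : qexp) : qexp :=
  let: (a, b, d) := u in let: (a', b', d') := v in
  (AAdd (AMul a d') (AMul a' d), AAdd (AMul b d') (AMul b' d), AMul d d').
Definition qmul (u v : qexp) : qexp :=
  let: (a, b, d) := u in let: (a', b', d') := v in
  (AAdd (AMul a a') (AMul b b'), AAdd (AMul a b') (AMul b a'), AMul d d').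
Definition q0 : qexp := (ACst 0, ACst 0, ACst 1).
Definition q1 : qexp := (ACst 1, ACst 0, ACst 1).
Definition qN1 : qexp := (ACst 0, ACst 1, ACst 1).
(* 2^-k *)
Definition q2N (k : nat) : qexp := (ACst 1, ACst 0, APow2 (AVar k)).

Definition qlt (u v : qexp) : scheme :=
  let: (a, b, d) := u in let: (a', b', d') := v in
  alt (AAdd (AMul a d') (AMul b' d)) (AAdd (AMul a' d) (AMul b d')).
(* |u - v| < w *)
Definition qdist_lt (u v w : qexp) : scheme :=
  qlt u (qadd v w) ∧ qlt v (qadd u w).

Definition upair (p x y : nat) : scheme :=
  hSet p ∧ ∀ z, z ∈ p ⇔ (z ≐ x ∨ z ≐ y).
(* p is the Kuratowski pair (x, y) *)
Definition opair (p x y : nat) : scheme :=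
  ∃ s t, upair s x x ∧ upair t x y ∧ upair p s t.
Definition maps (f x y : nat) : scheme := ∃ p, opair p x y ∧ p ∈ f.

Definition natseq (f : nat) : scheme :=
  hSet f
  ∧ (∀ p, p ∈ f ⇒ ∃ᴺ n m, opair p n m)
  ∧ (∀ᴺ n, ∃ᴺ m, maps f n m)
  ∧ (∀ n m m', maps f n m ∧ maps f n m' ⇒ m ≐ m').

(* The rational (a - b) / (c + 1) is represented by the triple (a, (b, c)) of
   natural numbers. *)
Definition triple (v a b c : nat) : scheme :=
  ∃ w, opair w b c ∧ opair v a w.
Definition rational (v : nat) : scheme := ∃ᴺ a b c, triple v a b c.

Definition ratseq (x : nat) : scheme :=
  hSet x
  ∧ (∀ p, p ∈ x ⇒ ∃ᴺ n, ∃ v, rational v ∧ opair p n v)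
  ∧ (∀ᴺ n, ∃ v, rational v ∧ maps x n v)
  ∧ (∀ n v v', maps x n v ∧ maps x n v' ⇒ v ≐ v').

(* A sequence operand applied to n and F says that F holds of its n-th term. *)
Definition operand : Type := nat -> (qexp -> scheme) -> scheme.

Definition rvar (x : nat) : operand := fun n F =>
  ∃ v, maps x n v
       ∧ ∃ᴺ a b c, triple v a b c ∧ F (AVar a, AVar b, AAdd (AVar c) (ACst 1)).
Definition rcst (q : qexp) : operand := fun _ F => F q.
Definition radd (X Y : operand) : operand := fun n F =>
  X n (fun u => Y n (fun v => F (qadd u v))).
Definition rmul (X Y : operand) : operand := fun n F =>
  X n (fun u => Y n (fun v => F (qmul u v))).
(* s(n) / 2^n for a sequence s of natural numbers *)
Definition rdyadic (s : nat) : operand := fun n F =>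
  ∃ᴺ m, maps s n m ∧ F (AVar m, ACst 0, APow2 (AVar n)).

Definition eventually (F : nat -> scheme) : scheme :=
  ∃ᴺ i, ∀ᴺ n, ale (AVar i) (AVar n) ⇒ F n.

Definition rlt (X Y : operand) : scheme :=
  ∃ᴺ k, eventually (fun n =>
    X n (fun u => Y n (fun v => qlt (qadd u (q2N k)) v))).
Definition rle (X Y : operand) : scheme :=
  ∀ᴺ k, eventually (fun n =>
    X n (fun u => Y n (fun v => qlt u (qadd v (q2N k))))).
Definition req (X Y : operand) : scheme :=
  ∀ᴺ k, eventually (fun n =>
    X n (fun u => Y n (fun v => qdist_lt u v (q2N k)))).
(* |X - Y| < 2^-k *)
Definition rclose (k : nat) (X Y : operand) : scheme :=
  rlt X (radd Y (rcst (q2N k))) ∧ rlt Y (radd X (rcst (q2N k))).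

Definition real (x : nat) : scheme :=
  ratseq x
  ∧ (∀ᴺ n m, ale (AVar n) (AVar m) ⇒
       rvar x n (fun u => rvar x m (fun v => qdist_lt u v (q2N n)))).
Definition real_in (lo hi : qexp) (x : nat) : scheme :=
  real x ∧ rle (rcst lo) (rvar x) ∧ rle (rvar x) (rcst hi).

Notation real01 := (real_in q0 q1).
Notation real11 := (real_in qN1 q1).

(* f : [0,1] -> [-1,1]. Reals being given by regular sequences, f is a
   relation between sequences that is total and respects equality of reals
   (equivalently, a function between the quotients). *)
Definition realfun (f : nat) : scheme :=
  hSet f
  ∧ (∀ p, p ∈ f ⇒ ∃ x y, real01 x ∧ real11 y ∧ opair p x y)
  ∧ (∀ x, real01 x ⇒ ∃ y, real11 y ∧ maps f x y)
  ∧ (∀ x y x' y', maps f x y ∧ maps f x' y' ∧ req (rvar x) (rvar x')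
       ⇒ req (rvar y) (rvar y')).

Definition continuous (f : nat) : scheme :=
  ∀ x y, maps f x y ⇒ ∀ᴺ k, ∃ᴺ m, ∀ x' y',
    maps f x' y' ∧ rclose m (rvar x) (rvar x') ⇒ rclose k (rvar y) (rvar y').

Definition value_at (f : nat) (q : qexp) (y : nat) : scheme :=
  ∃ x, req (rvar x) (rcst q) ∧ maps f x y.

(* b is a 0-1 sequence and s is the sequence of natural numbers with
   s(0) = i and s(n+1) = 2 s(n) + b(n). *)
Definition binary (i : nat) (b s : nat) : scheme :=
  natseq b ∧ natseq s
  ∧ (∀ᴺ n m, maps b n m ⇒ ale (AVar m) (ACst 1))
  ∧ (∀ᴺ n m, maps s n m ∧ aeq (AVar n) (ACst 0) ⇒ aeq (AVar m) (ACst i))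
  ∧ (∀ᴺ n n' m m' k,
       maps s n m ∧ maps s n' m' ∧ maps b n k
       ∧ aeq (AVar n') (AAdd (AVar n) (ACst 1))
       ⇒ aeq (AVar m') (AAdd (AMul (ACst 2) (AVar m)) (AVar k))).

Definition LLPO : form := sentence
  (∀ x y, real x ∧ real y ⇒ rle (rvar x) (rvar y) ∨ rle (rvar y) (rvar x)).

Definition RDIV : form := sentence
  (∀ x y, real01 x ∧ real01 y ∧ rle (rvar x) (rvar y)
     ⇒ ∃ z, real01 z ∧ req (rvar x) (rmul (rvar y) (rvar z))).

(* With s(0) = 0, s(n) / 2^n is the n-th partial sum of sum_i b(i) 2^-(i+1). *)
Definition BE : form := sentence
  (∀ x, real01 x ⇒ ∃ b s, binary 0 b s ∧ req (rvar x) (rdyadic s)).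

Definition IVT : form := sentence
  (∀ f, realfun f ∧ continuous f
     ∧ (∃ y z, value_at f q0 y ∧ value_at f q1 z
          ∧ ((rlt (rvar y) (rcst q0) ∧ rlt (rcst q0) (rvar z))
             ∨ (rlt (rvar z) (rcst q0) ∧ rlt (rcst q0) (rvar y))))
     ⇒ ∃ x y, real01 x ∧ maps f x y ∧ req (rvar y) (rcst q0)).

(* A binary string is coded by the positive number whose binary notation is
   the digit 1 followed by the string: the empty string is 1, and the string
   coded by c has the extensions 2 c and 2 c + 1; the codes of the strings of
   length n are the c with 2^n <= c < 2^(n+1). *)
Definition binary_tree (t : nat) : scheme :=
  hSet t
  ∧ (∀ c, c ∈ t ⇒ hNat c ∧ alt (ACst 0) (AVar c))
  ∧ (∀ᴺ c, c ∈ t ∨ ¬ c ∈ t)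
  ∧ (∀ᴺ c c', alt (ACst 0) (AVar c) ∧ c' ∈ t
       ∧ (aeq (AVar c') (AMul (ACst 2) (AVar c))
          ∨ aeq (AVar c') (AAdd (AMul (ACst 2) (AVar c)) (ACst 1)))
       ⇒ c ∈ t).

Definition infinite_tree (t : nat) : scheme :=
  ∀ᴺ n, ∃ᴺ c, c ∈ t ∧ ale (APow2 (AVar n)) (AVar c)
    ∧ alt (AVar c) (APow2 (AAdd (AVar n) (ACst 1))).

(* With s(0) = 1, s(n) codes the initial segment of b of length n. *)
Definition WKL : form := sentence
  (∀ t, binary_tree t ∧ infinite_tree t
     ⇒ ∃ b s, binary 1 b s ∧ ∀ᴺ n m, maps s n m ⇒ m ∈ t).

Declare Scope theory_scope.
Delimit Scope theory_scope with T.
Notation "T ⊕ B" := (extend T B) (at level 50, left associativity)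
  : theory_scope.

(* Main.v *)
From mathcomp Require Import all_boot all_order all_algebra zify lra ring.
From mathcomp Require Import boolp.
Require Import Defs.

(** Each model is given by a class [Q] of closed subsets of [{0,1,2}^omega],
    coded by their complements. The jump operator [jop Q A] reads its argument
    as a well-founded program that may return, apply a code to all outcomes,
    compose, choose a point of a nonempty set of the class [Q], or query the
    advice [A]. Its values are compact and upper semicontinuous in the argument,
    so that a unique outcome is a continuous function of the program. Hence
    realizability over the derived algebra reduces to plain Kleene application
    together with one modality [Jp], for which IZF is sound. As every continuous
    function has a code, realizers need only be produced uniformly in [A]; the
    advice is chosen at the end to contain all of them, which makes each of
    them an element of the lightface part.

    The classes are: sets of constant sequences (LLPO), sets that contain
    [0^omega] or are singletons (RDIV), sets of at most two points (BE), the
    union of the last two (RDIV and BE), and lexicographically convex sets of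
    0-1 sequences (IVT). The refutations use what composition preserves:
    finiteness of the outcomes (RDIV), existence of finitely many local
    continuous selectors (BE) or of countably many (WKL), and a bounded rank
    that is lower semicontinuous with finitely many outcomes, upper
    semicontinuous on each level (IVT). *)

Set Implicit Arguments.
Unset Strict Implicit.
Unset Printing Implicit Defensive.

Import Order.TTheory GRing.Theory Num.Theory.

Notation code := CodeSeq.code.
Notation decode := CodeSeq.decode.

(** * Continuous partial functions on Baire space *)

(** The advice has to contain realizers of sentences whose realizability already refers to the
    advice. The circle is broken by building every realizer as a code that takes the advice as an
    input and is correct for all of them: a query applies a column of the advice to the advice
    itself, and the program [scons 4 (numeral n)] that asks for column [n] is computable. A negation
    speaks about all of Baire space, so a refutation has to face arbitrary continuous functions and
    not only computable ones. Only topological invariants of the outcomes can help, and they must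
    survive the composition of programs. Compactness makes this possible: the outer program meets
    the outcomes of the inner one in finitely many neighbourhoods. In the derived algebra an index
    acts through its unique outcome. Continuity of that outcome in the index is what lets plain
    application simulate the derived one. *)

Definition agree (k : nat) (x y : baire) : Prop := forall i, i < k -> x i = y i.

Lemma agree_sym k x y : agree k x y -> agree k y x.
Proof. by move=> xy i /xy. Qed.

Lemma agree_trans k x y z : agree k x y -> agree k y z -> agree k x z.
Proof. by move=> xy yz i ik; rewrite xy // yz. Qed.

Lemma agree_le k l x y : k <= l -> agree l x y -> agree k x y.
Proof. by move=> kl xy i ik; apply: xy; apply: leq_trans ik kl. Qed.

Lemma agree_mkseq k x y : agree k x y <-> mkseq x k = mkseq y k.
Proof.
split=> [xy|xy i ik]; first by apply/eq_in_map => i; rewrite mem_iota => /xy.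
by have := congr1 (nth 0 ^~ i) xy; rewrite !nth_mkseq.
Qed.

Definition cont (f : baire -> baire) : Prop :=
  forall x n, exists k, forall x', agree k x x' -> f x' n = f x n.

(** With [x' = x] the condition contains single-valuedness; off the domain of [F] nothing is
    asked. *)
Definition pcont (F : baire -> baire -> Prop) : Prop :=
  forall x y, F x y -> forall n, exists k,
    forall x' y', agree k x x' -> F x' y' -> y' n = y n.

Definition code_val (F : baire -> baire -> Prop) n (s : seq nat) m : Prop :=
  (exists x y, [/\ F x y, mkseq x (size s) = s & y n = m])
  /\ forall x y, F x y -> mkseq x (size s) = s -> y n = m.

(** Kleene's associate: entry [n] is answered on the string [s] once all points of the domain above
    [s] agree on it. The values are picked classically, so every partial continuous function gets a
    code, in general not a computable one. *)
Definition code_of (F : baire -> baire -> Prop) : baire := fun c =>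
  if decode c is n :: s then
    if pselect (exists m, code_val F n s m) is left h then (sval (cid h)).+1
    else 0
  else 0.

Lemma code_ofP F x y : pcont F -> F x y -> kapp (code_of F) x y.
Proof.
move=> cF Fxy n; pose P k := code_of F (code (n :: mkseq x k)) != 0.
have exP : exists k, P k.
  have [k hk] := cF _ _ Fxy n; exists k; rewrite /P /code_of CodeSeq.codeK.
  case: pselect => // -[]; exists (y n); rewrite /code_val size_mkseq; split.
    by exists x, y.
  by move=> x' y' F' /agree_mkseq/agree_sym ag; apply: hk ag F'.
exists (ex_minn exP); case: ex_minnP => k Pk kmin; split; last first.
  move=> i ik; apply/eqP; apply: contraTT ik => /kmin; by rewrite -leqNgt.
move: Pk; rewrite /P /code_of CodeSeq.codeK; case: pselect => // h _.
case: (cid h) => m /= -[_ hm]; congr S; apply/esym.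
by apply: (hm x y) => //; rewrite size_mkseq.
Qed.

Definition fcode (f : baire -> baire) : baire := code_of (fun x y => y = f x).

Lemma fcodeP f x : cont f -> kapp (fcode f) x (f x).
Proof.
move=> cf; apply: code_ofP => // {}x y -> n; have [k hk] := cf x n.
by exists k => x' y' ag ->; apply: hk.
Qed.

Lemma kapp_fun a b c c' : kapp a b c -> kapp a b c' -> c = c'.
Proof.
move=> h h'; apply: funext => n; have [k [hk kmin]] := h n.
have [k' [hk' kmin']] := h' n.
case: (ltngtP k k') => [lt|lt|e].
- by move: (kmin' _ lt); rewrite hk.
- by move: (kmin _ lt); rewrite hk'.
- by move: hk; rewrite e hk' => -[].
Qed.

Lemma kapp_cont a b c : kapp a b c -> forall n, exists k, forall a' b' c',
  agree k a a' -> agree k b b' -> kapp a' b' c' -> c' n = c n.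
Proof.
move=> h n; have [k [hk kmin]] := h n.
(* The sum exceeds the code of each query up to the successful one, so agreement that far fixes all
   their answers. *)
exists (k + \sum_(i < k.+1) (code (n :: mkseq b i)).+1) => a' b' c' aa bb h'.
have lecode i : i <= k -> a' (code (n :: mkseq b' i)) = a (code (n :: mkseq b i)).
  move=> ik; have -> : mkseq b' i = mkseq b i.
    by apply/agree_mkseq/agree_sym/(agree_le _ bb); lia.
  rewrite -aa // (bigD1 (Ordinal (ik : i < k.+1))) //=; lia.
have [k' [hk' kmin']] := h' n; case: (ltngtP k k') => [lt|lt|e].
- by move: (kmin' _ lt); rewrite lecode // hk.
- by move: (kmin _ lt); rewrite -lecode ?hk' // ltnW.
- by move: hk'; rewrite -e lecode // hk => -[].
Qed.

Definition bp (x y : baire) : baire := fun n => if odd n then y n./2 else x n./2.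

Lemma pr0_bp x y : pr0 (bp x y) = x.
Proof. by apply: funext => n; rewrite /pr0 /bp odd_double doubleK. Qed.

Lemma pr1_bp x y : pr1 (bp x y) = y.
Proof. by apply: funext => n; rewrite /pr1 /bp /= odd_double uphalf_double. Qed.

Lemma bp_pr e : bp (pr0 e) (pr1 e) = e.
Proof.
apply: funext => n; rewrite /bp /pr0 /pr1; case: ifP => on; congr (e _); lia.
Qed.

Lemma cont_id : cont id.
Proof. by move=> x n; exists n.+1 => x' ->. Qed.

Lemma cont_cst c : cont (fun=> c).
Proof. by move=> x n; exists 0. Qed.

Lemma cont_modulus f (m : nat -> nat) :
  (forall n x x', agree (m n) x x' -> f x' n = f x n) -> cont f.
Proof. by move=> h x n; exists (m n) => x'; apply: h. Qed.

Lemma cont_agree f : cont f -> forall x k, exists l,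
  forall x', agree l x x' -> agree k (f x) (f x').
Proof.
move=> cf x; elim=> [|k [l hl]]; first by exists 0.
have [m hm] := cf x k; exists (maxn l m) => x' ag i.
rewrite ltnS leq_eqVlt => /predU1P[->|].
  by rewrite hm //; apply: agree_le ag; rewrite leq_maxr.
by apply: hl; apply: agree_le ag; rewrite leq_maxl.
Qed.

Lemma cont_comp f g : cont f -> cont g -> cont (fun x => f (g x)).
Proof.
move=> cf cg x n; have [k hk] := cf (g x) n; have [l hl] := cont_agree cg x k.
by exists l => x' /hl /hk.
Qed.

Lemma cont_pr0 : cont pr0.
Proof. by apply: (@cont_modulus _ (fun n => n.*2.+1)) => n x x' h; rewrite /pr0 h. Qed.

Lemma cont_pr1 : cont pr1.
Proof. by apply: (@cont_modulus _ (fun n => n.*2.+2)) => n x x' h; rewrite /pr1 h. Qed.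

Lemma cont_bp f g : cont f -> cont g -> cont (fun x => bp (f x) (g x)).
Proof.
move=> cf cg x n; rewrite /bp; case: (odd n); [have := cg x n./2|have := cf x n./2].
  by case=> k hk; exists k => x' /hk.
by case=> k hk; exists k => x' /hk.
Qed.

Lemma bp_agree k x y x' y' :
  agree k x x' -> agree k y y' -> agree k (bp x y) (bp x' y').
Proof.
by move=> xx yy i ik; rewrite /bp; case: odd; [apply: yy|apply: xx]; lia.
Qed.

Definition ccomp (t s : baire) : baire :=
  code_of (fun x z => exists2 y, kapp s x y & kapp t y z).

Lemma kapp_agree a b c : kapp a b c -> forall n, exists k, forall a' b' c',
  agree k a a' -> agree k b b' -> kapp a' b' c' -> agree n c c'.
Proof.
move=> h; elim=> [|n [k hk]]; first by exists 0.
have [l hl] := kapp_cont h n; exists (maxn k l) => a' b' c' aa bb h' i.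
rewrite ltnS leq_eqVlt => /predU1P[->|].
  by apply/esym/(hl a' b' c') => //; apply: (agree_le (leq_maxr k l)).
by apply: (hk a' b' c') => //; apply: (agree_le (leq_maxl k l)).
Qed.

Lemma ccompP t s x y z : kapp s x y -> kapp t y z -> kapp (ccomp t s) x z.
Proof.
move=> sx ty; apply: code_ofP; last by exists y.
move=> {x y z sx ty} x z [y sx ty] n.
have [k hk] := kapp_cont ty n; have [l hl] := kapp_agree sx k.
exists l => x' z' xx [y' sx' ty']; apply: (hk t y') => //; exact: (hl s x').
Qed.

Definition capp (t s : baire) : baire :=
  code_of (fun x z => exists a b, [/\ kapp t x a, kapp s x b & kapp a b z]).

Lemma cappP t s x a b z :
  kapp t x a -> kapp s x b -> kapp a b z -> kapp (capp t s) x z.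
Proof.
move=> tx sx ab; apply: code_ofP; last by exists a, b.
move=> {x a b z tx sx ab} x z [a [b [tx sx ab]]] n.
have [k hk] := kapp_cont ab n.
have [l hl] := kapp_agree tx k; have [m hm] := kapp_agree sx k.
exists (maxn l m) => x' z' xx [a' [b' [tx' sx' ab']]]; apply: (hk a' b') => //.
  by apply: (hl t x') => //; apply: agree_le xx; rewrite leq_maxl.
by apply: (hm s x') => //; apply: agree_le xx; rewrite leq_maxr.
Qed.

Definition cpair (t s : baire) : baire :=
  code_of (fun x z => exists a b, [/\ kapp t x a, kapp s x b & z = bp a b]).

Lemma cpairP t s x a b :
  kapp t x a -> kapp s x b -> kapp (cpair t s) x (bp a b).
Proof.
move=> tx sx; apply: code_ofP; last by exists a, b.
move=> {x a b tx sx} x z [a [b [tx sx ->]]] n.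
have [l hl] := kapp_agree tx n.+1; have [m hm] := kapp_agree sx n.+1.
exists (maxn l m) => x' z' xx [a' [b' [tx' sx' ->]]].
apply/esym/bp_agree; last exact: ltnSn.
  by apply: (hl t x') => //; apply: agree_le xx; rewrite leq_maxl.
by apply: (hm s x') => //; apply: agree_le xx; rewrite leq_maxr.
Qed.

(** On a string [s] of entries of [y], the code [t] is tried on the initial segments of the pair up
    to length twice [size s], the part that [x] and [s] determine. The definition is explicit
    because [cont_cur] needs a code that depends continuously on [x]. *)
Definition cur (t x : baire) : baire := fun c =>
  if decode c is n :: s then
    let ans k := t (code (n :: mkseq (bp x (nth 0 s)) k)) in
    if [seq k <- iota 0 (size s).*2.+1 | ans k != 0] is k :: _ then ans k else 0
  else 0.

Lemma curP t x y z : kapp t (bp x y) z -> kapp (cur t x) y z.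
Proof.
(* [uphalf k] is the least length whose double reaches [k]; shorter strings allow only queries below
   [k], which are all unanswered. *)
move=> h n; have [k [hk kmin]] := h n; exists (uphalf k).
have eqm l i : l <= i.*2 ->
    mkseq (bp x (nth 0 (mkseq y i))) l = mkseq (bp x y) l.
  move=> li; apply/agree_mkseq => m ml; rewrite /bp; case: ifP => // om.
  by rewrite nth_mkseq //; lia.
have zero i : i < uphalf k -> forall l, l <= i.*2 ->
    t (code (n :: mkseq (bp x (nth 0 (mkseq y i))) l)) = 0.
  by move=> ik l li; rewrite eqm // kmin //; lia.
split; last first.
  move=> i ik; rewrite /cur CodeSeq.codeK size_mkseq.
  case e: (filter _ _) => [//|l ls].
  have : l \in l :: ls by rewrite inE eqxx.
  rewrite -e mem_filter mem_iota => /andP[/eqP nz li]; case: nz.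
  by apply: zero => //; lia.
rewrite /cur CodeSeq.codeK size_mkseq.
have -> : (uphalf k).*2.+1 = k + ((uphalf k).*2.+1 - k) by lia.
rewrite iotaD filter_cat add0n.
rewrite (_ : [seq l <- iota 0 k | _] = [::]); last first.
  rewrite -(filter_pred0 (iota 0 k)); apply: eq_in_filter => l.
  rewrite mem_iota => /andP[_ lk]; rewrite eqm ?kmin ?eqxx //; lia.
have -> : (uphalf k).*2.+1 - k = ((uphalf k).*2 - k).+1 by lia.
have E : k <= (uphalf k).*2 by lia.
by rewrite cat0s /= (eqm _ _ E) hk /= (eqm _ _ E) hk.
Qed.

Lemma cont_cur t : cont (cur t).
Proof.
apply: (@cont_modulus _ (fun c => (size (decode c)).*2)) => c x x' xx.
rewrite /cur; case: (decode c) xx => [//|n s] xx.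
have {}xx : agree (size s).*2 x x' by apply: agree_le xx; rewrite leq_double.
have E k : k <= (size s).*2 ->
    mkseq (bp x' (nth 0 s)) k = mkseq (bp x (nth 0 s)) k.
  move=> ks; apply/agree_mkseq => i ik; rewrite /bp; case: ifP => // _.
  by apply/esym/xx; lia.
have F : [seq k <- iota 0 (size s).*2.+1
            | t (code (n :: mkseq (bp x' (nth 0 s)) k)) != 0]
       = [seq k <- iota 0 (size s).*2.+1
            | t (code (n :: mkseq (bp x (nth 0 s)) k)) != 0].
  by apply: eq_in_filter => k; rewrite mem_iota => /andP[_ kl]; rewrite E //; lia.
rewrite [in LHS]F; case e: [seq k <- _ | _] => [//|l ls].
have : l \in l :: ls by rewrite inE eqxx.
by rewrite -e mem_filter mem_iota => /andP[_ ?]; rewrite E //; lia.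
Qed.

(** The recursion theorem by self-application: [S x] at [y] is [x] at the pair of [x] and [y], and
    for [x] one takes [t] after replacing the first component [x] by [S x]. All recursion on names
    rests on it. *)
Lemma fixpoint_code (t : baire) :
  exists e, forall y v, kapp t (bp e y) v -> kapp e y v.
Proof.
pose self := capp (fcode pr0) (fcode id).
pose S x := cur self x.
have SP x y z : kapp x (bp x y) z -> kapp (S x) y z.
  move=> h; apply: curP; apply: (@cappP _ _ _ x (bp x y)) => //.
    by have := @fcodeP pr0 (bp x y) cont_pr0; rewrite pr0_bp.
  exact: fcodeP cont_id.
pose g x := bp (S (pr0 x)) (pr1 x).
have cg : cont g.
  apply: cont_bp cont_pr1; apply: cont_comp cont_pr0; exact: cont_cur.
exists (S (ccomp t (fcode g))) => y v h; apply: SP; apply: ccompP.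
  exact: fcodeP cg.
by rewrite /g pr0_bp pr1_bp.
Qed.

(** * Primitive recursive access to sequence codes *)

(** The axioms of a jump operator and the lightface part ask for computable codes. Those needed are
    primitive recursive as soon as sequence codes can be taken apart by primitive recursion, which
    is the aim here. *)
Definition prec (f : seq nat -> nat) : Prop := exists p, forall xs, eval p xs = f xs.
Definition prec1 (f : nat -> nat) : Prop :=
  exists p, forall xs, eval p xs = f (nth 0 xs 0).
Definition prec2 (f : nat -> nat -> nat) : Prop :=
  exists p, forall xs, eval p xs = f (nth 0 xs 0) (nth 0 xs 1).

Lemma prec_app1 f g : prec1 f -> prec g -> prec (fun xs => f (g xs)).
Proof. by case=> p hp [q hq]; exists (PComp p [:: q]) => xs /=; rewrite hp /= hq. Qed.

Lemma prec_app2 f g h :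
  prec2 f -> prec g -> prec h -> prec (fun xs => f (g xs) (h xs)).
Proof.
by case=> p hp [q hq] [r hr]; exists (PComp p [:: q; r]) => xs /=; rewrite hp /= hq hr.
Qed.

Lemma prec_nth i : prec (fun xs => nth 0 xs i).
Proof. by exists (PProj i). Qed.

Lemma prec_cst n : prec (fun=> n).
Proof. by exists (iter n (fun p => PComp PSucc [:: p]) PZero) => xs; elim: n => //= n ->. Qed.

Lemma prec1_succ : prec1 S. Proof. by exists PSucc. Qed.

Lemma prec2_rec (g : nat -> nat) (h : nat -> nat -> nat -> nat) :
  prec1 g -> prec (fun xs => h (nth 0 xs 0) (nth 0 xs 1) (nth 0 xs 2)) ->
  prec2 (fun n x => iteri n (fun i y => h i y x) (g x)).
Proof.
case=> p hp [q hq]; exists (PRec p q) => xs /=; rewrite hp nth_behead.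
by elim: (nth 0 xs 0) => //= n ->; rewrite hq /= nth_behead.
Qed.

Lemma prec1_rec (c : nat) (h : nat -> nat -> nat) :
  prec2 h -> prec1 (fun n => iteri n h c).
Proof.
case=> q hq; have [r hr] := prec_cst c; exists (PRec r q) => xs /=; rewrite hr.
by elim: (nth 0 xs 0) => //= n ->; rewrite hq.
Qed.

Lemma prec2_ext f g : (forall x y, f x y = g x y) -> prec2 f -> prec2 g.
Proof. by move=> e [p hp]; exists p => xs; rewrite hp e. Qed.

Lemma prec1_ext f g : f =1 g -> prec1 f -> prec1 g.
Proof. by move=> e [p hp]; exists p => xs; rewrite hp e. Qed.

Lemma prec2_add : prec2 addn.
Proof.
apply: (@prec2_ext (fun n x => iteri n (fun i y => y.+1) x)).
  by move=> x y; elim: x => //= x ->.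
apply: (@prec2_rec id (fun i y x => y.+1)); first exact: (prec_nth 0).
exact: prec_app1 prec1_succ (prec_nth 1).
Qed.

Lemma prec2_mul : prec2 muln.
Proof.
apply: (@prec2_ext (fun n x => iteri n (fun i y => x + y) 0)).
  by move=> x y; elim: x => //= x ->; rewrite mulSn.
apply: (@prec2_rec (fun=> 0) (fun i y x => x + y)); first exact: (prec_cst 0).
exact: prec_app2 prec2_add (prec_nth 2) (prec_nth 1).
Qed.

Lemma prec1_pred : prec1 predn.
Proof.
apply: (@prec1_ext (fun n => iteri n (fun i y => i) 0)); first by case.
exact: prec1_rec (prec_nth 0).
Qed.

Lemma prec2_sub : prec2 subn.
Proof.
have h : prec2 (fun n x => iteri n (fun i y => y.-1) x).
  apply: (@prec2_rec id (fun i y x => y.-1)); first exact: (prec_nth 0).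
  exact: prec_app1 prec1_pred (prec_nth 1).
apply: (@prec2_ext (fun x y => iteri y (fun i z => z.-1) x)).
  by move=> x y; elim: y => [|y IH] /=; rewrite ?subn0 // IH subnS.
exact: prec_app2 h (prec_nth 1) (prec_nth 0).
Qed.

Lemma prec_if0 f g h : prec f -> prec g -> prec h ->
  prec (fun xs => if f xs == 0 then g xs else h xs).
Proof.
move=> pf pg ph.
have e xs : (if f xs == 0 then g xs else h xs) =
    (1 - f xs) * g xs + (1 - (1 - f xs)) * h xs.
  by case: (f xs) => [|n] /=; rewrite ?subn0 ?mul1n ?addn0 // subSS sub0n subn0 mul1n.
rewrite (funext e); apply: (prec_app2 prec2_add).
  by apply: (prec_app2 prec2_mul) => //; apply: (prec_app2 prec2_sub) (prec_cst 1) _.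
apply: (prec_app2 prec2_mul) => //; apply: (prec_app2 prec2_sub) (prec_cst 1) _.
exact: (prec_app2 prec2_sub) (prec_cst 1) pf.
Qed.

Lemma prec1_odd : prec1 odd.
Proof.
apply: (@prec1_ext (fun n => iteri n (fun i y => 1 - y) 0)).
  by elim=> //= n ->; case: odd.
exact/prec1_rec/(prec_app2 prec2_sub (prec_cst 1))/prec_nth.
Qed.

Lemma prec1_half : prec1 half.
Proof.
apply: (@prec1_ext (fun n => iteri n (fun i y => y + odd i) 0)).
  by elim=> // n /= ->; rewrite addnC uphalf_half.
apply/prec1_rec/(prec_app2 prec2_add (prec_nth 1)).
exact: prec_app1 prec1_odd (prec_nth 0).
Qed.

Lemma prec2_iter_half : prec2 (fun n x => iter n half x).
Proof.
apply: (@prec2_ext (fun n x => iteri n (fun i y => y./2) x)).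
  by move=> n x; elim: n => //= n ->.
apply: (@prec2_rec id (fun i y x => y./2)); first exact: (prec_nth 0).
exact: prec_app1 prec1_half (prec_nth 1).
Qed.

Lemma prec1_exp2 : prec1 (expn 2).
Proof. by exists ppow2 => -[|x xs]; rewrite ?eval_ppow2. Qed.

(** Since [code (n :: s)] is [2 ^ n * (2 * code s + 1)], the head is the 2-adic valuation. The
    summand is 1 exactly when [2 ^ i.+1] divides [c], and [c] rounds are enough because
    [n < 2 ^ n]. *)
Definition hd_code c :=
  iteri c (fun i y => y + (1 - (c - 2 ^ i.+1 * iter i.+1 half c))) 0.
Definition tl_code c := iter (hd_code c).+1 half c.

Lemma iter_half_code i n m :
  i <= n -> iter i half (2 ^ n * m) = 2 ^ (n - i) * m.
Proof.
elim: i => [|i IH] lin /=; first by rewrite subn0.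
rewrite IH; last exact: ltnW.
by rewrite -[n - i]prednK ?subn_gt0 // -subnS expnS -mulnA mul2n doubleK.
Qed.

Lemma iter_half_le i x : 2 ^ i * iter i half x <= x.
Proof.
elim: i => [|i IH] /=; first by rewrite mul1n.
apply: leq_trans IH; rewrite expnSr -mulnA leq_mul2l mul2n.
by rewrite -{2}(odd_double_half (iter i half x)) leq_addl orbT.
Qed.

Lemma iter_half_code_odd n m : iter n.+1 half (2 ^ n * m.*2.+1) = m.
Proof.
rewrite iterS iter_half_code // subnn mul1n.
by rewrite -[m.*2.+1]add1n halfD /= odd_double add0n doubleK.
Qed.

Lemma hd_codeE n s : hd_code (code (n :: s)) = n.
Proof.
rewrite /hd_code /=; set q := code s; set c := 2 ^ n * _.
have lenc : n < c by apply: leq_trans (ltn_expl n (isT : 1 < 2)) _; rewrite leq_pmulr.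
have step i : 1 - (c - 2 ^ i.+1 * iter i.+1 half c) = (i < n).
  case: (ltnP i n) => lin.
    rewrite /c iter_half_code // mulnA -expnD subnKC //; lia.
  suff : 2 ^ i.+1 * iter i.+1 half c < c by lia.
  rewrite -(subnK lin) -addnS iterD {1}/c iter_half_code_odd addnC.
  rewrite expnD -mulnA; apply: leq_ltn_trans (_ : 2 ^ n.+1 * q < _).
    by rewrite leq_mul2l iter_half_le orbT.
  by rewrite /c expnSr -mulnA mul2n ltn_mul2l expn_gt0 /=.
suff -> k : iteri k (fun i y => y + (1 - (c - 2 ^ i.+1 * iter i.+1 half c))) 0
    = minn k n by apply/minn_idPr/ltnW.
elim: k => [|k IH]; first by rewrite min0n.
rewrite [LHS]/= IH; have /= -> := step k; lia.
Qed.

Lemma tl_codeE n s : tl_code (code (n :: s)) = code s.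
Proof. by rewrite /tl_code hd_codeE iter_half_code_odd. Qed.

Lemma prec1_hd : prec1 hd_code.
Proof.
suff h : prec2 (fun n c =>
    iteri n (fun i y => y + (1 - (c - 2 ^ i.+1 * iter i.+1 half c))) 0).
  exact: prec_app2 h (prec_nth 0) (prec_nth 0).
apply: (@prec2_rec (fun=> 0)
  (fun i y c => y + (1 - (c - 2 ^ i.+1 * iter i.+1 half c)))).
  exact: (prec_cst 0).
apply: (prec_app2 prec2_add); first exact: prec_nth.
apply: (prec_app2 prec2_sub); first exact: (prec_cst 1).
apply: (prec_app2 prec2_sub); first exact: (prec_nth 2).
have s0 : prec (fun xs => (nth 0 xs 0).+1) := prec_app1 prec1_succ (prec_nth 0).
apply: (prec_app2 prec2_mul); first exact: (prec_app1 prec1_exp2).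
exact: (prec_app2 prec2_iter_half s0 (prec_nth 2)).
Qed.

Lemma prec1_tl : prec1 tl_code.
Proof.
apply: (prec_app2 prec2_iter_half); last exact: (prec_nth 0).
exact: (prec_app1 prec1_succ (prec_app1 prec1_hd (prec_nth 0))).
Qed.

(* 0 when the entry k does not exist, and its successor otherwise *)
Definition lookup c k := let d := iter k tl_code c in
  if d == 0 then 0 else (hd_code d).+1.

Lemma lookupE s k : lookup (code s) k = if k < size s then (nth 0 s k).+1 else 0.
Proof.
rewrite /lookup; elim: s k => [|n s IH] [|k] //=.
- have -> : iter k tl_code (code [::]) = 0 by elim: k => //= k ->.
  by [].
- by rewrite -/(code (n :: s)) hd_codeE muln_eq0 expn_eq0.
- by rewrite -iterS iterSr -/(code (n :: s)) tl_codeE ltnS IH.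
Qed.

Lemma prec2_lookup : prec2 lookup.
Proof.
have h : prec2 (fun k c => iter k tl_code c).
  apply: (@prec2_ext (fun k c => iteri k (fun i y => tl_code y) c)).
    by move=> k c; elim: k => //= k ->.
  apply: (@prec2_rec id (fun i y x => tl_code y)); first exact: (prec_nth 0).
  exact: prec_app1 prec1_tl (prec_nth 1).
have {}h := prec_app2 h (prec_nth 1) (prec_nth 0).
apply: prec_if0 => //; first exact: (prec_cst 0).
exact: (prec_app1 prec1_succ (prec_app1 prec1_hd h)).
Qed.

Lemma prec1_computable f : prec1 f -> computable f.
Proof. by case=> p hp; exists (RPrim p) => n; have := reval_prim p [:: n]; rewrite hp. Qed.

Definition scons (t : nat) (x : baire) : baire := fun n => if n is m.+1 then x m else t.
Definition stail (x : baire) : baire := fun n => x n.+1.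

Lemma stail_scons t x : stail (scons t x) = x. Proof. by []. Qed.

Definition cons_code (t : nat) : baire := fun c =>
  if hd_code c == 0 then t.+1 else lookup (tl_code c) (hd_code c).-1.

Lemma cons_code_computable t : computable (cons_code t).
Proof.
have h := prec_app1 prec1_hd (prec_nth 0).
apply: prec1_computable; apply: prec_if0 => //; first exact: prec_cst.
apply: (prec_app2 prec2_lookup); first exact: (prec_app1 prec1_tl (prec_nth 0)).
exact: (prec_app1 prec1_pred h).
Qed.

Lemma cons_codeP t x : kapp (cons_code t) x (scons t x).
Proof.
move=> n; exists n; rewrite /cons_code; split=> [|i lin].
  rewrite hd_codeE tl_codeE; case: n => [//|n].
  by rewrite -[_ == 0]/false -[n.+1.-1]/n lookupE size_mkseq ltnSn nth_mkseq.
rewrite hd_codeE tl_codeE lookupE size_mkseq; case: n lin => //= n lin.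
by rewrite ltnNge -ltnS lin.
Qed.

(** Code of the map that prefixes opcode 1 and the code [a] to a program. Answers are values plus
    one, so the opcode appears as 2 here, and as 3 in [map_code], whose answers are the entries of
    [map_fun a] increased once more. *)
Definition map_fun (a : baire) : baire := fun c =>
  if hd_code c == 0 then 2
  else if nat_of_bool (odd (hd_code c).-1) == 0 then (a ((hd_code c).-1)./2).+1
       else lookup (tl_code c) ((hd_code c).-1)./2.

Definition map_code : baire := fun c =>
  let m := hd_code c in
  if hd_code m == 0 then 3
  else if nat_of_bool (odd (hd_code m).-1) == 0
       then let l := lookup (tl_code c) ((hd_code m).-1)./2 in
            if l == 0 then 0 else l.+1
       else (lookup (tl_code m) ((hd_code m).-1)./2).+1.

Lemma map_code_computable : computable map_code.
Proof.
have m := prec_app1 prec1_hd (prec_nth 0).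
have n := prec_app1 prec1_hd m; have n1 := prec_app1 prec1_pred n.
have k := prec_app1 prec1_half n1.
have l := prec_app2 prec2_lookup (prec_app1 prec1_tl (prec_nth 0)) k.
apply: prec1_computable; apply: prec_if0 => //; first exact: (prec_cst 3).
apply: prec_if0; first exact: prec_app1 prec1_odd n1.
  apply: prec_if0 => //; first exact: (prec_cst 0).
  exact: prec_app1 prec1_succ l.
apply: (prec_app1 prec1_succ).
exact: prec_app2 prec2_lookup (prec_app1 prec1_tl m) k.
Qed.

Lemma map_codeP a : kapp map_code a (map_fun a).
Proof.
move=> m; rewrite /map_code /map_fun; case: (eqVneq (hd_code m) 0) => [e|ne].
  by exists 0; split=> //; rewrite hd_codeE e eqxx.
case: ifP => od; last first.
  by exists 0; split=> //; rewrite hd_codeE (negbTE ne) od.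
exists ((hd_code m).-1)./2.+1; split=> [|i].
  by rewrite hd_codeE (negbTE ne) od tl_codeE lookupE size_mkseq ltnSn nth_mkseq.
rewrite ltnS => lin; rewrite hd_codeE (negbTE ne) od tl_codeE lookupE size_mkseq.
by rewrite ltnNge lin.
Qed.

Lemma map_funP a x : kapp (map_fun a) x (scons 1 (bp a x)).
Proof.
rewrite /map_fun; case=> [|n]; first by exists 0; rewrite hd_codeE.
have E s : hd_code (code (n.+1 :: s)) = n.+1 by rewrite hd_codeE.
case od: (odd n).
  exists n./2.+1; rewrite !E -[n.+1.-1]/n od tl_codeE lookupE size_mkseq ltnSn.
  rewrite nth_mkseq // /scons /bp od; split=> // i; rewrite ltnS => lin.
  by rewrite E od tl_codeE lookupE size_mkseq ltnNge lin.
by exists 0; rewrite !E -[n.+1.-1]/n od /scons /bp od.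
Qed.

Lemma computable_advice n : computable (scons 4 (numeral n)).
Proof.
apply: prec1_computable.
apply: (@prec1_ext (fun m => if m == 0 then 4 else n)); first by case.
by apply: prec_if0; [apply: (prec_nth 0)|apply: prec_cst|apply: prec_cst].
Qed.

(** * Compactness *)

(** [E s] says that [T] contains extensions of [s] of every length. If each child of [s] failed at
    some length, an extension of [s] longer than all these lengths would contradict the failure of
    its own first digit. *)
Lemma koenig (b : nat) (T : seq nat -> Prop) :
  (forall s k, T s -> T (take k s)) ->
  (forall N, exists2 s, T s & size s = N /\ all (leq^~ b) s) ->
  exists2 z : baire, (forall n, z n <= b) & forall n, T (mkseq z n).
Proof.
move=> cl ex; pose E s := forall N, exists2 t, T (s ++ t) & size t = N /\ all (leq^~ b) t.
have step s : exists i, E s -> i <= b /\ E (rcons s i).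
  apply: contrapT => /forallNP no.
  have Es : E s by apply: contrapT => nE; apply: (no 0) => /nE.
  have /choice[N hN] : forall i : nat, exists N, i <= b ->
      ~ exists2 t, T (rcons s i ++ t) & size t = N /\ all (leq^~ b) t.
    move=> i; have /not_implyP[_ /not_andP[ib|/existsNP[N hN]]] := no i.
      by exists 0 => /ib.
    by exists N.
  have [t Tt [st al]] := Es (\sum_(i < b.+1) N i).+1.
  case: t Tt st al => // i t Tt st /andP[ib al].
  apply: (hN i ib); exists (take (N i) t).
    have := cl _ (size s + (N i).+1) Tt.
    by rewrite take_cat ltnNge leq_addr /= addKn /= -cat_rcons.
  split; last by apply/allP => x /mem_take; apply: (allP al).
  rewrite size_takel //; case: st => ->.
  by rewrite (bigD1 (Ordinal (ib : i < b.+1))) //= leq_addr.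
have [f hf] := choice step.
pose P n := iter n (fun s => rcons s (f s)) [::].
have EP n : E (P n).
  elim: n => [N|n IH]; first by have [s Ts h] := ex N; exists s.
  by have [] := hf _ IH.
have PE n : P n = mkseq (fun k => f (P k)) n.
  by elim: n => // n IH; rewrite mkseqS -IH.
exists (fun n => f (P n)) => n; first by have [] := hf _ (EP n).
rewrite -PE; have [t Tt _] := EP n 0.
by have := cl _ (size (P n)) Tt; rewrite take_size_cat.
Qed.

Fixpoint strings (b n : nat) : seq (seq nat) :=
  if n is m.+1 then flatten [seq [seq i :: s | i <- iota 0 b.+1] | s <- strings b m]
  else [:: [::]].

Lemma mem_strings b s : all (leq^~ b) s -> s \in strings b (size s).
Proof.
elim: s => //= i s IH /andP[ib /IH h]; apply/flattenP.
exists [seq i :: s | i <- iota 0 b.+1]; first exact: (map_f (fun s => [seq i :: s | i <- iota 0 b.+1])).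
by apply: (map_f (cons^~ s)); rewrite mem_iota.
Qed.

Definition kset (p z : baire) : Prop :=
  forall n, z n <= 2 /\ p (code (mkseq z n)) = 0.

(** Compactness together with upper semicontinuity in [p]: by König's lemma there is a depth [N] at
    which every string has been excluded or has met the cover, and only the finitely many strings up
    to that depth are consulted. *)
Lemma kset_fan p (S : seq nat -> Prop) :
  (forall z, kset p z -> exists k, S (mkseq z k)) ->
  exists (L : seq (seq nat)) k, (forall s, s \in L -> S s) /\
    forall p' z, agree k p p' -> kset p' z -> exists m, mkseq z m \in L.
Proof.
move=> cov; have [N hN] : exists N, forall s, size s = N -> all (leq^~ 2) s ->
    (forall k, p (code (take k s)) = 0) -> exists k, S (take k s).
  apply: contrapT => /forallNP no.
  pose T s := forall k, p (code (take k s)) = 0 /\ ~ S (take k s).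
  have [||z zb zT] := @koenig 2 T.
  - by move=> s k Ts l; rewrite -take_min; apply: Ts.
  - move=> N; have /existsNP[s] := no N.
    move=> /not_implyP[ss /not_implyP[al /not_implyP[ps nS]]]; exists s => // k.
    by split=> // h; apply: nS; exists k.
  have zk : kset p z by move=> n; have := zT n n; rewrite take_oversize ?size_mkseq // => -[].
  by have [k Sk] := cov _ zk; have [_] := zT k k; rewrite take_oversize ?size_mkseq.
pose U := flatten [seq strings 2 n | n <- iota 0 N.+1].
have inU s : size s <= N -> all (leq^~ 2) s -> s \in U.
  move=> sN al; apply/flattenP; exists (strings 2 (size s)); last exact: mem_strings.
  by apply: map_f; rewrite mem_iota.
(* [U] lists the strings of length at most [N]; the sum exceeds all their codes, so [p'] excludes
   the same ones as [p]. *)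
exists [seq s <- U | `[<S s>]], (\sum_(s <- U) (code s).+1); split.
  by move=> s; rewrite mem_filter => /andP[/asboolP].
move=> p' z pp zk.
have al n : all (leq^~ 2) (mkseq z n).
  by apply/allP => x /mapP[i _ ->]; case: (zk i).
have tk k n : take k (mkseq z n) = mkseq z (minn k n).
  rewrite /mkseq -map_take; congr (map _ _).
  by elim: n k 0 => [|n IH] [|k] m //=; rewrite ?minnSS //= IH.
have [|||k Sk] := hN (mkseq z N); rewrite ?size_mkseq //.
  move=> k; rewrite tk pp; first by case: (zk (minn k N)).
  have : mkseq z (minn k N) \in U by apply: inU => //; rewrite size_mkseq geq_minr.
  by move=> h; rewrite (big_rem _ h) /=; lia.
exists (minn k N); rewrite mem_filter -tk; apply/andP; split; first exact/asboolP.
by rewrite tk; apply: inU => //; rewrite size_mkseq geq_minr.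
Qed.

(** * The jump operators *)

Definition col (A : baire) (n : nat) : baire := fun k => A (code [:: n; k]).

Lemma cont_col n : cont (col^~ n).
Proof. by apply: (@cont_modulus _ (fun k => (code [:: n; k]).+1)) => k x x' h; rewrite /col h. Qed.

(** Entry 0 is the opcode. The values do not depend on the class [Q], which restricts only the
    domain. Opcode 4 feeds the whole advice to one of its own columns. *)
Inductive jv (A : baire) : baire -> baire -> Prop :=
| jv_ret x : x 0 = 0 -> jv A x (stail x)
| jv_map x y z : x 0 = 1 -> jv A (pr1 (stail x)) y ->
    kapp (pr0 (stail x)) y z -> jv A x z
| jv_bind x y z : x 0 = 2 -> jv A (stail x) y -> jv A y z -> jv A x z
| jv_base x z : x 0 = 3 -> kset (stail x) z -> jv A x z
| jv_adv x z : x 0 = 4 -> kapp (col A (x 1)) A z -> jv A x z.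

Inductive jdom (Q : baire -> Prop) (A : baire) : baire -> Prop :=
| jdom_ret x : x 0 = 0 -> jdom Q A x
| jdom_map x : x 0 = 1 -> jdom Q A (pr1 (stail x)) ->
    (forall y, jv A (pr1 (stail x)) y -> exists z, kapp (pr0 (stail x)) y z) ->
    jdom Q A x
| jdom_bind x : x 0 = 2 -> jdom Q A (stail x) ->
    (forall y, jv A (stail x) y -> jdom Q A y) -> jdom Q A x
| jdom_base x : x 0 = 3 -> Q (stail x) -> (exists z, kset (stail x) z) ->
    jdom Q A x
| jdom_adv x : x 0 = 4 -> (exists z, kapp (col A (x 1)) A z) -> jdom Q A x.

Definition jop (Q : baire -> Prop) (A : baire) : multifun :=
  fun x z => jdom Q A x /\ jv A x z.

Section JumpTheory.

Variable Q : baire -> Prop.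

Lemma jdom_ex A x : jdom Q A x -> exists z, jv A x z.
Proof.
elim=> {}x.
- by move=> x0; exists (stail x); apply: jv_ret.
- by move=> x0 _ [y hy] h; have [z hz] := h _ hy; exists z; apply: jv_map hy hz.
- by move=> x0 _ [y hy] _ h; have [z hz] := h _ hy; exists z; apply: jv_bind hy hz.
- by move=> x0 _ [z hz]; exists z; apply: jv_base.
- by move=> x0 [z hz]; exists z; apply: jv_adv.
Qed.

Lemma mdom_jop A x : mdom (jop Q A) x <-> jdom Q A x.
Proof. by split=> [[z []]//|h]; have [z hz] := jdom_ex h; exists z. Qed.

Lemma jv_inv A x z : jv A x z ->
  [/\ x 0 = 0 -> z = stail x,
      x 0 = 1 -> exists2 y, jv A (pr1 (stail x)) y & kapp (pr0 (stail x)) y z,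
      x 0 = 2 -> exists2 y, jv A (stail x) y & jv A y z,
      x 0 = 3 -> kset (stail x) z
    & x 0 = 4 -> kapp (col A (x 1)) A z].
Proof.
case=> {x z}.
- by move=> x x0; split; rewrite x0.
- by move=> x y z x0 xy yz; split; rewrite x0 //; exists y.
- by move=> x y z x0 xy yz; split; rewrite x0 //; exists y.
- by move=> x z x0 xz; split; rewrite x0.
- by move=> x z x0 xz; split; rewrite x0.
Qed.

Lemma jdom_inv A x : jdom Q A x ->
  [/\ x 0 = 1 -> jdom Q A (pr1 (stail x)) /\
        forall y, jv A (pr1 (stail x)) y -> exists z, kapp (pr0 (stail x)) y z,
      x 0 = 2 -> jdom Q A (stail x) /\ forall y, jv A (stail x) y -> jdom Q A y
    & x 0 = 3 -> Q (stail x)].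
Proof. by case=> {}x x0; split; rewrite x0. Qed.

(** Opcodes 1, 0 and 2 are made for the three axioms. The clauses of [jdom] reproduce the rule that
    a composite is defined only if the outer map is defined at all intermediate values. *)
Lemma jop_idempotent A : idempotent_jump KV (jop Q A).
Proof.
split.
- exists map_code => [|a x z]; first exact: map_code_computable.
  split=> [[/mdom_jop dx total [y [_ xy] yz]]|[v [w [av vw []]]]].
    exists (map_fun a), (scons 1 (bp a x)); split; [exact: map_codeP|exact: map_funP|].
    split.
      apply: jdom_map; rewrite ?stail_scons ?pr1_bp ?pr0_bp // => y' hy'.
      by apply: total.
    by apply: (@jv_map _ _ y); rewrite ?stail_scons ?pr1_bp ?pr0_bp.
  have ? := kapp_fun av (map_codeP a); subst v.
  have ? := kapp_fun vw (map_funP a x); subst w.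
  move=> /jdom_inv[/(_ erefl)]; rewrite stail_scons pr1_bp pr0_bp => -[dx h] _ _.
  move=> /jv_inv[_ /(_ erefl)]; rewrite stail_scons pr1_bp pr0_bp => -[y xy yz] _ _ _.
  split; first exact/mdom_jop.
    by move=> y' [_ /h].
  by exists y.
- exists (cons_code 0) => [|x]; first exact: cons_code_computable.
  exists (scons 0 x) => [|z]; first exact: cons_codeP.
  split=> [[_ /jv_inv[/(_ erefl)]]//|->]; split; first exact: jdom_ret.
  exact: (@jv_ret A (scons 0 x)).
- exists (cons_code 2) => [|x z]; first exact: cons_code_computable.
  split=> [[/mdom_jop dx h [y [_ xy] [_ yz]]]|[v /kapp_fun/(_ (cons_codeP 2 x)) -> []]].
    exists (scons 2 x); first exact: cons_codeP.
    split; last exact: (@jv_bind _ _ y).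
    by apply: jdom_bind => // y' hy'; apply/mdom_jop/h.
  move=> /jdom_inv[_ /(_ erefl)[dx h] _] /jv_inv[_ _ /(_ erefl)[y xy yz] _ _].
  split; first exact/mdom_jop.
    by move=> y' [_ /h]/mdom_jop.
  by exists y => //; split=> //; apply: h.
Qed.

Lemma list_uniform (T : eqType) (S : seq nat -> Prop) (R : T -> nat -> seq (seq nat) -> Prop)
    (L : seq T) :
  (forall t k (K : seq (seq nat)) k' (K' : seq (seq nat)), R t k K -> k <= k' -> {subset K <= K'} -> R t k' K') ->
  (forall t, t \in L -> exists k (K : seq (seq nat)), (forall s, s \in K -> S s) /\ R t k K) ->
  exists k (K : seq (seq nat)), (forall s, s \in K -> S s) /\ forall t, t \in L -> R t k K.
Proof.
move=> mono; elim: L => [_|t L IH h]; first by exists 0, [::].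
have [k [K [KS KR]]] := IH (fun u uL => h u (mem_behead (s := t :: L) uL)).
have [k' [K' [KS' KR']]] := h t (mem_head _ _).
exists (maxn k k'), (K ++ K'); split.
  by move=> s; rewrite mem_cat => /orP[/KS|/KS'].
move=> u; rewrite inE => /predU1P[->|uL].
  by apply: mono KR' _ _; rewrite ?leq_maxr // => s; rewrite mem_cat orbC => ->.
by apply: mono (KR _ uL) _ _; rewrite ?leq_maxl // => s; rewrite mem_cat => ->.
Qed.

(** Induction on the program. To cover the outcomes of a composite, those of the inner program are
    covered by strings on each of which the outer step already admits a finite cover; finitely many
    of these strings remain, and [list_uniform] takes a common bound. *)
Lemma jop_usco A e : jdom Q A e -> forall S : seq nat -> Prop,
  (forall z, jv A e z -> exists k, S (mkseq z k)) ->
  exists (L : seq (seq nat)) k, (forall s, s \in L -> S s) /\ forall A' e',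
    agree k A A' -> agree k e e' -> jdom Q A' e' ->
    forall z, jv A' e' z -> exists m, mkseq z m \in L.
Proof.
elim=> {}e e0.
- move=> S /(_ _ (jv_ret A e0))[k Sk]; exists [:: mkseq (stail e) k], k.+1; split.
    by move=> s; rewrite inE => /eqP ->.
  move=> A' e' _ ee _ z /jv_inv[+ _ _ _ _]; rewrite -ee // => /(_ e0) ->.
  exists k; rewrite inE; apply/eqP/agree_mkseq => i ik.
  by rewrite /stail ee.
- move=> dy IH tot S cov; set a := pr0 (stail e) in tot *.
  set y := pr1 (stail e) in dy IH tot *.
  pose R (t : seq nat) k (L : seq (seq nat)) := forall a' y' z', agree k a a' ->
    mkseq y' (size t) = t -> kapp a' y' z' -> exists m, mkseq z' m \in L.
  have [|L1 [k1 [L1S hL1]]] := IH (fun t => exists k (L : seq (seq nat)), (forall s, s \in L -> S s) /\ R t k L).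
    move=> y0 yy0; have [z az] := tot _ yy0.
    have [n Sn] := cov z (jv_map e0 yy0 az); have [k hk] := kapp_agree az n.
    exists k, k, [:: mkseq z n]; split; first by move=> s; rewrite inE => /eqP ->.
    move=> a' y' z' aa; rewrite size_mkseq => /agree_mkseq/agree_sym yy az'.
    exists n; rewrite inE; apply/eqP/agree_mkseq/agree_sym; exact: hk aa yy az'.
  have [|k [K [KS hK]]] := @list_uniform _ S R L1 _ L1S.
    move=> t k K k' K' h kk KK a' y' z' aa yy az.
    by have [m mK] := h _ _ _ (agree_le kk aa) yy az; exists m; apply: KK.
  exists K, (maxn k k1).*2.+3; split=> // A' e' AA ee /jdom_inv[d' _ _] z /jv_inv[_ + _ _ _].
  rewrite -!ee // => /(_ e0)[y' jy' az']; move: d'; rewrite -ee // => /(_ e0)[dy' _].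
  have [m mL] : exists m, mkseq y' m \in L1.
    apply: hL1 jy' => //; first by apply: agree_le AA; lia.
    by move=> i ik; rewrite /y /pr1 /stail ee //; lia.
  apply: (hK _ mL) az'; last by rewrite size_mkseq.
  by move=> i ik; rewrite /a /pr0 /stail ee //; lia.
- move=> dx IHx dy IHy S cov.
  pose R (t : seq nat) k (L : seq (seq nat)) := forall A' y', agree k A A' -> mkseq y' (size t) = t ->
    jdom Q A' y' -> forall z, jv A' y' z -> exists m, mkseq z m \in L.
  have [|L1 [k1 [L1S hL1]]] := IHx (fun t => exists k (L : seq (seq nat)), (forall s, s \in L -> S s) /\ R t k L).
    move=> y xy; have [|L [k [LS hL]]] := IHy y xy S.
      by move=> z yz; apply: cov; apply: jv_bind xy yz.
    exists k, k, L; split=> // A' y' AA.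
    by rewrite size_mkseq => /agree_mkseq/agree_sym; apply: hL.
  have [|k [K [KS hK]]] := @list_uniform _ S R L1 _ L1S.
    move=> t k K k' K' h kk KK A' y' AA yy d z jz.
    by have [m mK] := h _ _ (agree_le kk AA) yy d z jz; exists m; apply: KK.
  exists K, (maxn k k1).+1; split=> // A' e' AA ee /jdom_inv[_ d' _] z /jv_inv[_ _ + _ _].
  rewrite -!ee // => /(_ e0)[y' jy' yz]; move: d'; rewrite -ee // => /(_ e0)[dx' dy'].
  have [m mL] : exists m, mkseq y' m \in L1.
    apply: hL1 jy' => //; first by apply: agree_le AA; lia.
    by move=> i ik; rewrite /stail ee //; lia.
  apply: (hK _ mL) yz; [|by rewrite size_mkseq|exact: dy'].
  by apply: agree_le AA; lia.
- move=> Qe _ S cov; have [z kz|L [k [LS hL]]] := @kset_fan (stail e) S.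
    by apply: cov; apply: jv_base.
  exists L, k.+1; split=> // A' e' _ ee _ z /jv_inv[_ _ _ + _].
  rewrite -ee // => /(_ e0); apply: hL => i ik; exact: ee.
- move=> [z az] S cov; have [n Sn] := cov z (jv_adv e0 az).
  have [k hk] := kapp_agree az n; have [l hl] := cont_agree (cont_col (e 1)) A k.
  exists [:: mkseq z n], (maxn k l).+2; split; first by move=> s; rewrite inE => /eqP ->.
  move=> A' e' AA ee _ z' /jv_inv[_ _ _ _]; rewrite -!ee // => /(_ e0) az'.
  exists n; rewrite inE; apply/eqP/agree_mkseq/agree_sym; apply: hk az'.
    by apply: hl; apply: agree_le AA; lia.
  by apply: agree_le AA; lia.
Qed.

Definition cuniq : baire :=
  code_of (fun x z => derived (jop Q (pr0 x)) (pr1 x) z).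

(** The cover by the single string [mkseq z n.+1] shows that entry [n] of a unique outcome depends
    on finitely many entries of advice and program. So the passage from an index to its derived
    element is itself given by a code. *)
Lemma cuniqP A e z : derived (jop Q A) e z -> kapp cuniq (bp A e) z.
Proof.
move=> h; apply: code_ofP; last by rewrite pr0_bp pr1_bp.
move=> {h z A e} x z h n; have [dx jz] : jop Q (pr0 x) (pr1 x) z by apply/h.
have [|L [k [LS hL]]] := jop_usco dx (S := fun s => s = mkseq z n.+1).
  by move=> z' jz'; exists n.+1; have -> : z' = z by apply/h; split.
exists k.*2 => x' z' xx h'; have [dx' jz'] : jop Q (pr0 x') (pr1 x') z' by apply/h'.
have [m /LS e] : exists m, mkseq z' m \in L.
  by apply: hL jz' => //; move=> i ik; rewrite /pr0 /pr1 xx //; lia.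
have m1 : m = n.+1 by have := congr1 size e; rewrite !size_mkseq.
by move: e; rewrite m1 => /agree_mkseq; apply.
Qed.

End JumpTheory.

(** * Programs *)

Definition prop : Type := baire -> Prop.

(* A program receives the advice A together with its environment, a nested
   pair of values. *)
Definition wp (A t env : baire) (P : prop) : Prop :=
  exists2 v, kapp t (bp A env) v & P v.

Definition PAnd (P R : prop) : prop := fun e => P (pr0 e) /\ R (pr1 e).
Definition PImp (P R : prop) : prop :=
  fun e => forall a, P a -> exists2 v, kapp e a v & R v.
Definition PNot (P : prop) : prop := fun=> forall a, ~ P a.
Definition PAll (X : Type) (P : X -> prop) : prop := fun e => forall x, P x e.

Definition pself : baire := fcode pr1.
Definition pvar0 : baire := fcode (fun x => pr0 (pr1 x)).
Definition pshift (t : baire) : baire :=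
  ccomp t (fcode (fun x => bp (pr0 x) (pr1 (pr1 x)))).
Definition pfun (f : baire -> baire) (t : baire) : baire := ccomp (fcode f) t.
Definition pcall (c t : baire) : baire := ccomp c (cpair (fcode pr0) t).
Definition plam (t : baire) : baire :=
  fcode (cur (ccomp t
    (fcode (fun x => bp (pr0 (pr0 x)) (bp (pr1 x) (pr1 (pr0 x))))))).

Ltac solve_cont := repeat first
  [ exact: cont_id | exact: cont_pr0 | exact: cont_pr1 | exact: cont_cst
  | exact: cont_cur | apply: cont_bp
  | apply: (cont_comp cont_pr0) | apply: (cont_comp cont_pr1) ].

Section Programs.

Variable A : baire.
Implicit Types (t s c env a : baire) (P R : prop).

Lemma wp_mono t env P R : (forall v, P v -> R v) -> wp A t env P -> wp A t env R.
Proof. by move=> h [v tv Pv]; exists v => //; apply: h. Qed.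

Lemma wp_here env P : P env -> wp A pself env P.
Proof.
exists env => //; have := @fcodeP pr1 (bp A env) cont_pr1; by rewrite pr1_bp.
Qed.

Lemma wp_var0 a env P : P a -> wp A pvar0 (bp a env) P.
Proof.
exists a => //; have := @fcodeP (fun x => pr0 (pr1 x)) (bp A (bp a env)).
by rewrite pr1_bp pr0_bp; apply; solve_cont.
Qed.

Lemma wp_shift t a env P : wp A t env P -> wp A (pshift t) (bp a env) P.
Proof.
case=> v tv Pv; exists v => //; apply: ccompP; first by apply: fcodeP; solve_cont.
by rewrite pr1_bp pr0_bp pr1_bp.
Qed.

Lemma wp_fun f t env P : cont f -> wp A t env (fun v => P (f v)) ->
  wp A (pfun f t) env P.
Proof.
by move=> cf [v tv Pv]; exists (f v) => //; apply: ccompP tv _; apply: fcodeP.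
Qed.

Lemma wp_cst c env P : P c -> wp A (fcode (fun=> c)) env P.
Proof. by exists c => //; apply: (@fcodeP (fun=> c)); solve_cont. Qed.

Lemma wp_call c t env P R :
  wp A t env P -> (forall a, P a -> wp A c a R) -> wp A (pcall c t) env R.
Proof.
case=> v tv Pv /(_ _ Pv)[w cw Rw]; exists w => //; apply: ccompP cw.
apply: cpairP tv; have := @fcodeP pr0 (bp A env) cont_pr0; by rewrite pr0_bp.
Qed.

Lemma wp_lam t env P R :
  (forall a, P a -> wp A t (bp a env) R) -> wp A (plam t) env (PImp P R).
Proof.
move=> h; eexists; first by apply: fcodeP; apply: cont_cur.
move=> a /h[v tv Rv]; exists v => //; apply: curP; apply: ccompP.
  by apply: fcodeP; solve_cont.
by rewrite !(pr0_bp, pr1_bp).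
Qed.

Lemma wp_app t s env P R :
  wp A t env (PImp P R) -> wp A s env P -> wp A (capp t s) env R.
Proof.
by move=> [f tf fP] [a sa /fP[v fv Rv]]; exists v => //; apply: cappP fv.
Qed.

Lemma wp_pair t s env P R :
  wp A t env P -> wp A s env R -> wp A (cpair t s) env (PAnd P R).
Proof.
move=> [v tv Pv] [w sw Rw]; exists (bp v w); first exact: cpairP.
by split; rewrite ?pr0_bp ?pr1_bp.
Qed.

Lemma wp_fst t env P R : wp A t env (PAnd P R) -> wp A (pfun pr0 t) env P.
Proof. by move=> h; apply: (wp_fun cont_pr0); apply: wp_mono h => v []. Qed.

Lemma wp_snd t env P R : wp A t env (PAnd P R) -> wp A (pfun pr1 t) env R.
Proof. by move=> h; apply: (wp_fun cont_pr1); apply: wp_mono h => v []. Qed.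

Lemma wp_bp t s env P Q R : wp A t env P -> wp A s env Q ->
  (forall v w, P v -> Q w -> R (bp v w)) -> wp A (cpair t s) env R.
Proof.
by move=> [v tv Pv] [w sw Rw] h; exists (bp v w); [exact: cpairP|exact: h].
Qed.

(** The value of [t] is found without looking at [x], so one value meets all instances; [x0]
    provides its existence. This makes universal quantification over names free of cost. *)
Lemma wp_forall X (x0 : X) t env (P : X -> prop) :
  (forall x, wp A t env (P x)) -> wp A t env (PAll P).
Proof.
move=> h; have [v tv _] := h x0; exists v => // x.
by have [w tw] := h x; rewrite (kapp_fun tv tw).
Qed.

Lemma wp_let t s env P R :
  wp A t env P -> (forall a, P a -> wp A s (bp a env) R) ->
  wp A (pcall s (cpair t pself)) env R.
Proof.
move=> ht hs; apply: (@wp_call _ _ _ (fun v => wp A s v R)) => //.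
by apply: (wp_bp (Q := eq env)) ht (wp_here _) _ => // v w Pv <-; apply: hs.
Qed.

End Programs.

(** The branches are an arbitrary sequence of codes, so a case distinction over all numbers needs no
    uniformity between the cases. *)
Definition pcasen (s : baire) (t : nat -> baire) : baire :=
  code_of (fun x z => exists2 v, kapp s x v & kapp (t (v 0)) x z).

Lemma wp_nat A s (t : nat -> baire) env n P :
  wp A s env (eq (numeral n)) -> wp A (t n) env P -> wp A (pcasen s t) env P.
Proof.
case=> v0 sv e0; subst v0; case=> z tz Pz; exists z => //; apply: code_ofP; last by exists (numeral n).
move=> {sv tz} x w [v sv tv] m; have [k hk] := kapp_cont sv 0.
have [l hl] := kapp_cont tv m; exists (maxn k l) => x' w' xx [v' sv' tv'].
apply: (hl (t (v' 0)) x') => //; last by apply: agree_le xx; lia.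
by rewrite (hk _ _ _ _ _ sv') //; apply: agree_le xx; lia.
Qed.

Definition pcollect (t : baire) : baire :=
  code_of (fun x z => forall n, exists2 v,
    kapp t (bp (pr0 x) (bp (numeral n) (pr1 x))) v & z n = v 0).

Lemma wp_collect A t env (f : baire) :
  (forall n, wp A t (bp (numeral n) env) (fun v => v 0 = f n)) ->
  wp A (pcollect t) env (eq f).
Proof.
move=> h; exists f => //; apply: code_ofP; last first.
  by move=> n; rewrite pr0_bp pr1_bp; have [v tv e] := h n; exists v.
move=> {h f} x z h n; have [v tv zn] := h n; have [k hk] := kapp_cont tv 0.
exists k.*2 => x' z' xx /(_ n)[v' tv' zn']; rewrite zn zn'; apply: hk tv' => //.
apply: bp_agree; first by move=> i ik; rewrite /pr0 xx //; lia.
by apply: bp_agree => // i ik; rewrite /pr1 xx //; lia.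
Qed.

Lemma wp_fix (t : baire) :
  {e | forall A env P, wp A t (bp e env) P -> wp A e env P}.
Proof.
apply: cid; pose g x := bp (pr0 (pr1 x)) (bp (pr0 x) (pr1 (pr1 x))).
have [e he] := fixpoint_code (ccomp t (fcode g)).
exists e => A env P [v tv Pv]; exists v => //; apply: he; apply: ccompP.
  by apply: fcodeP; solve_cont.
by rewrite /g !(pr0_bp, pr1_bp).
Qed.

Definition pcallf (f u : baire) : baire := capp f (cpair (fcode pr0) u).

Lemma wp_callf A f u env e P :
  wp A f env (eq e) -> wp A u env (fun v => wp A e v P) -> wp A (pcallf f u) env P.
Proof.
move=> [e' fe e1]; subst e'; case=> v uv [w ew Pw]; exists w => //; apply: cappP fe _ ew.
apply: cpairP uv; have := @fcodeP pr0 (bp A env) cont_pr0; by rewrite pr0_bp.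
Qed.

Ltac whyp H := first
  [ eapply wp_here; exact H | eapply wp_var0; exact H | eapply wp_shift; whyp H ].

(** * The modality of a jump operator *)

Section Modality.

Variable Q : baire -> Prop.

Definition Jp (A : baire) (P : prop) : prop :=
  fun e => jdom Q A e /\ forall d, jv A e d -> P d.

Definition POr A (P R : prop) : prop := Jp A (fun d =>
  (pr0 d = numeral 0 /\ P (pr1 d)) \/ (pr0 d = numeral 1 /\ R (pr1 d))).
Definition PEx A (X : Type) (P : X -> prop) : prop := Jp A (fun d => exists x, P x d).

Lemma JpE A P e : Jp A P e <-> forall_plus (jop Q A e) P.
Proof.
split=> [[de h]|[[d []] // de _ h]]; last by split=> // d' jd; apply: h.
by have [d jd] := jdom_ex de; split=> [|d' [_ /h]//]; exists d.
Qed.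

Lemma Jp_ex A P e : Jp A P e -> exists d, P d.
Proof. by case=> /jdom_ex[d jd] /(_ _ jd); exists d. Qed.

Lemma Jp_mono A (P R : prop) e : (forall d, P d -> R d) -> Jp A P e -> Jp A R e.
Proof. by move=> h [de hd]; split=> // d /hd/h. Qed.

Lemma cont_scons n : cont (scons n).
Proof.
apply: (@cont_modulus _ id) => -[|m] x x' h //=; exact/esym/h.
Qed.

Definition pret (t : baire) : baire := pfun (scons 0) t.

Lemma Jp_ret A (P : prop) v : P v -> Jp A P (scons 0 v).
Proof. by move=> Pv; split; [exact: jdom_ret|move=> d /jv_inv[/(_ erefl) ->]]. Qed.

Lemma wp_ret A t env P : wp A t env P -> wp A (pret t) env (Jp A P).
Proof.
by move=> h; apply: (wp_fun (cont_scons 0)); apply: wp_mono h => v; apply: Jp_ret.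
Qed.

Definition pmapj (t s : baire) : baire := pfun (scons 1) (cpair (plam s) t).

Lemma Jp_map A (P R : prop) c e :
  PImp P R c -> Jp A P e -> Jp A R (scons 1 (bp c e)).
Proof.
move=> hc [de he]; split.
  apply: jdom_map; rewrite ?stail_scons ?pr1_bp ?pr0_bp // => y /he/hc[v cv _].
  by exists v.
move=> d /jv_inv[_ /(_ erefl)]; rewrite stail_scons pr1_bp pr0_bp => -[y /he/hc[v cv Rv] cd].
by rewrite (kapp_fun cd cv).
Qed.

Lemma wp_mapj A t s env (P R : prop) :
  wp A t env (Jp A P) -> (forall a, P a -> wp A s (bp a env) R) ->
  wp A (pmapj t s) env (Jp A R).
Proof.
move=> ht hs; apply: (wp_fun (cont_scons 1)).
by apply: (wp_bp (wp_lam hs) ht) => c e hc; apply: Jp_map.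
Qed.

Lemma Jp_join A (P : prop) e : Jp A (Jp A P) e -> Jp A P (scons 2 e).
Proof.
move=> [de he]; split; first by apply: jdom_bind => // y /he[].
by move=> d /jv_inv[_ _ /(_ erefl)[y /he[_ h] yz] _ _]; apply: h.
Qed.

Lemma wp_join A t env P : wp A t env (Jp A (Jp A P)) -> wp A (pfun (scons 2) t) env (Jp A P).
Proof.
by move=> h; apply: (wp_fun (cont_scons 2)); apply: wp_mono h => v; apply: Jp_join.
Qed.

(** When at most one point satisfies [P], all outcomes coincide and [cuniq] finds the common one, so
    the modality disappears. *)
Lemma wp_uniq A t env (P : prop) : (forall v w, P v -> P w -> v = w) ->
  wp A t env (Jp A P) -> wp A (pcall (cuniq Q) t) env P.
Proof.
move=> uP h; apply: (wp_call h) => e [de he]; have [d jd] := jdom_ex de.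
exists d; last exact: he.
apply: cuniqP => z; split=> [[_ /he Pz]|->]; last by split.
by apply: uP => //; apply: he.
Qed.

(** These are the algebras of the modality. Eliminating a disjunction, an existential or a
    membership yields its conclusion only under [Jp], so the conclusion must be able to absorb it;
    by [closed_sem] every formula can. *)
Definition closedby A c (P : prop) : Prop := forall e, Jp A P e -> wp A c e P.

Definition pbind (c t s : baire) : baire := pcall c (pmapj t s).

Lemma wp_bind A t s c env P R :
  wp A t env (Jp A P) -> (forall a, P a -> wp A s (bp a env) R) ->
  closedby A c R -> wp A (pbind c t s) env R.
Proof. by move=> ht hs hc; apply: wp_call (wp_mapj ht hs) _. Qed.

Definition pjoin : baire := pfun (scons 2) pself.

Lemma closed_Jp A P : closedby A pjoin (Jp A P).
Proof. by move=> e he; apply: wp_join; apply: wp_here. Qed.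

Lemma closed_uniq A (P : prop) : (forall v w, P v -> P w -> v = w) ->
  closedby A (pcall (cuniq Q) pself) P.
Proof. by move=> uP e he; apply: wp_uniq => //; apply: wp_here. Qed.

Lemma closed_const A (P : prop) : (forall v w, P v -> P w) -> closedby A (fcode (fun=> numeral 0)) P.
Proof. by move=> cP e /Jp_ex[d Pd]; apply: wp_cst; apply: cP Pd. Qed.

Lemma closed_and A c c' P R : closedby A c P -> closedby A c' R ->
  closedby A (cpair (pcall c (pmapj pself (pfun pr0 pvar0)))
                    (pcall c' (pmapj pself (pfun pr1 pvar0)))) (PAnd P R).
Proof.
move=> hP hR e he; apply: wp_pair; (apply: wp_call; last by eauto).
  apply: wp_mapj; first by apply: wp_here; exact: he.
  by move=> a h; apply: wp_fst; apply: wp_var0; exact: h.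
apply: wp_mapj; first by apply: wp_here; exact: he.
by move=> a h; apply: wp_snd; apply: wp_var0; exact: h.
Qed.

Lemma closed_imp A c P R : closedby A c R ->
  closedby A (plam (pcall c (pmapj (pshift pself) (capp pvar0 (pshift pvar0))))) (PImp P R).
Proof.
move=> hR e he; apply: wp_lam => a Pa; apply: wp_call; last by eauto.
apply: wp_mapj; first by whyp he.
by move=> f hf; apply: wp_app; [whyp hf|whyp Pa].
Qed.

Lemma closed_all A X (x0 : X) c (P : X -> prop) :
  (forall x, closedby A c (P x)) -> closedby A c (PAll P).
Proof.
move=> h e he; apply: (wp_forall x0) => x; apply: h.
by apply: Jp_mono he => d.
Qed.

(** * The interpretation with plain application *)

Definition PIn A (a b : name) : prop :=
  fun e => rlz_in (jump_algebra KV (jop Q A)) (jop Q A) e a b.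
Definition PEq A (a b : name) : prop :=
  fun e => rlz_eq (jump_algebra KV (jop Q A)) (jop Q A) e a b.
Definition PNat (a : name) : prop := fun e => exists2 n, a = Urel n & e = numeral n.
Definition PSet (a : name) : prop := fun=> is_set a.
Definition PRel (f g : prf) (cs : seq name) : prop := fun=>
  exists2 ns, cs = map Urel ns & eval f ns = eval g ns.
Definition PMem (c b : name) : prop := fun p => pmem p c b.

Fixpoint sem A (phi : form) (rho : nat -> name) : prop :=
  match phi with
  | FRel f g xs => PRel f g (map rho xs)
  | FNat x => PNat (rho x)
  | FSet x => PSet (rho x)
  | FIn x y => PIn A (rho x) (rho y)
  | FEq x y => PEq A (rho x) (rho y)
  | FAnd B C => PAnd (sem A B rho) (sem A C rho)
  | FOr B C => POr A (sem A B rho) (sem A C rho)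
  | FNot B => PNot (sem A B rho)
  | FImp B C => PImp (sem A B rho) (sem A C rho)
  | FAll x B => PAll (fun c => sem A B (upd rho x c))
  | FEx x B => PEx A (fun c => sem A B (upd rho x c))
  end.

Lemma PInE A a b :
  PIn A a b = Jp A (fun d => exists c, PAnd (PMem c b) (PEq A a c) d).
Proof.
apply: funext => e; apply: propext; rewrite JpE; split.
  move=> h; inversion h; subst; split=> // d /H0[c h1 h2].
  by exists c; split.
by move=> [h1 h2]; apply: rlz_in_intro => // d /h2[c []]; exists c.
Qed.

Lemma closed_PIn A a b : closedby A pjoin (PIn A a b).
Proof. by rewrite PInE; apply: closed_Jp. Qed.

Definition PEq_body A a b : prop := fun d =>
  (forall p c, pmem p c a ->
     exists2 v, (exists2 f, derived (jop Q A) (pr0 d) f & kapp f p v) & PIn A c b v) /\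
  (forall p c, pmem p c b ->
     exists2 v, (exists2 f, derived (jop Q A) (pr1 d) f & kapp f p v) & PIn A c a v).

Lemma PEq_setE A a b : is_set a -> is_set b -> PEq A a b = Jp A (PEq_body A a b).
Proof.
move=> sa sb; apply: funext => e; apply: propext; rewrite JpE; split.
  by move=> h; inversion h; subst.
by case=> h1 h2; apply: rlz_eq_set.
Qed.

Definition same_kind (a b : name) : Prop :=
  (is_set a /\ is_set b) \/ exists2 n, a = Urel n & b = Urel n.

Lemma PEq_kind A a b e : PEq A a b e -> same_kind a b.
Proof. by case=> [_ n|_ {}a {}b sa sb _ _]; [right; exists n|left]. Qed.

Lemma PEq_urel A n m e : PEq A (Urel n) (Urel m) e <-> n = m.
Proof.
split=> [/PEq_kind[[]//|[k [->] [->]]] //|->]; exact: rlz_eq_nat.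
Qed.

Lemma closed_PEq A a b : closedby A pjoin (PEq A a b).
Proof.
move=> e he; have [d /PEq_kind[[sa sb]|[n -> ->]]] := Jp_ex he.
  by move: he; rewrite PEq_setE // => he; apply: closed_Jp.
by apply: (wp_fun (cont_scons 2)); apply: wp_here; apply/PEq_urel.
Qed.

Definition peqE1 (t s : baire) : baire :=
  pbind pjoin t (capp (pcall (cuniq Q) (pfun pr0 pvar0)) (pshift s)).
Definition peqE2 (t s : baire) : baire :=
  pbind pjoin t (capp (pcall (cuniq Q) (pfun pr1 pvar0)) (pshift s)).

Lemma pmem_set p c a : pmem p c a -> is_set a. Proof. by case: a. Qed.

Lemma derived_wp A t env f :
  wp A t env (fun e => derived (jop Q A) e f) ->
  wp A (pcall (cuniq Q) t) env (eq f).
Proof.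
move=> h; apply: (wp_uniq (P := eq f)) => [v w <- <- //|].
apply: wp_mono h => e he; split; last by move=> d jd; apply/esym/he; split=> //; case/he: (erefl f).
by have [] : jop Q A e f by apply/he.
Qed.

Lemma wp_eqE1 A t s env a b c :
  wp A t env (PEq A a b) -> wp A s env (PMem c a) -> wp A (peqE1 t s) env (PIn A c b).
Proof.
move=> ht [p sp pa]; have sa := pmem_set pa.
have sb : is_set b by have [e _ /PEq_kind[[]//|[n e1]]] := ht; move: pa; rewrite e1.
rewrite PEq_setE // in ht; apply: (wp_bind ht _ (@closed_PIn _ _ _)) => d [h _].
have [v [f df fv] cv] := h p c pa.
apply: (@wp_app _ _ _ _ (eq p)); last by apply: wp_shift; exists p.
apply: (@wp_mono _ _ _ (eq f)) => [_ <- _ <-|]; first by exists v.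
apply: derived_wp; apply: (wp_fun cont_pr0); exact: wp_var0.
Qed.

Lemma wp_eqE2 A t s env a b c :
  wp A t env (PEq A a b) -> wp A s env (PMem c b) -> wp A (peqE2 t s) env (PIn A c a).
Proof.
move=> ht [p sp pb]; have sb := pmem_set pb.
have sa : is_set a by have [e _ /PEq_kind[[]//|[n _ e1]]] := ht; move: pb; rewrite e1.
rewrite PEq_setE // in ht; apply: (wp_bind ht _ (@closed_PIn _ _ _)) => d [_ h].
have [v [f df fv] cv] := h p c pb.
apply: (@wp_app _ _ _ _ (eq p)); last by apply: wp_shift; exists p.
apply: (@wp_mono _ _ _ (eq f)) => [_ <- _ <-|]; first by exists v.
apply: derived_wp; apply: (wp_fun cont_pr1); exact: wp_var0.
Qed.

Definition peqI (t s : baire) : baire := pret (cpair (pret (plam t)) (pret (plam s))).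

Lemma derived_ret A v : derived (jop Q A) (scons 0 v) v.
Proof.
move=> z; split=> [[_ /jv_inv[/(_ erefl)]]//|->]; split; first exact: jdom_ret.
exact: (@jv_ret A (scons 0 v)).
Qed.

(** The outer [pret] is for the modality in the clause of equality; the inner two are there because
    application in the derived algebra goes through the unique outcome of an index. *)
Lemma wp_eqI A t s env a b : same_kind a b ->
  (forall c p, pmem p c a -> wp A t (bp p env) (PIn A c b)) ->
  (forall c p, pmem p c b -> wp A s (bp p env) (PIn A c a)) ->
  wp A (peqI t s) env (PEq A a b).
Proof.
move=> kab h1 h2.
(* The code of the abstraction mentions no element, so a single function serves all members [c] at
   once. *)
have l1 : wp A (plam t) env (fun f => forall p c, pmem p c a ->
    exists2 v, kapp f p v & PIn A c b v).
  have [f tf hf] := @wp_lam A t env (fun p => exists c, pmem p c a)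
    (fun v => True) (fun p '(ex_intro c h) => wp_mono (fun _ _ => I) (h1 c p h)).
  exists f => // p c pa; have [] := @wp_lam A t env (PMem c a) (PIn A c b) (h1 c).
  by move=> f' tf' h; rewrite (kapp_fun tf tf'); apply: h.
have l2 : wp A (plam s) env (fun f => forall p c, pmem p c b ->
    exists2 v, kapp f p v & PIn A c a v).
  have [f tf hf] := @wp_lam A s env (fun p => exists c, pmem p c b)
    (fun v => True) (fun p '(ex_intro c h) => wp_mono (fun _ _ => I) (h2 c p h)).
  exists f => // p c pa; have [] := @wp_lam A s env (PMem c b) (PIn A c a) (h2 c).
  by move=> f' tf' h; rewrite (kapp_fun tf tf'); apply: h.
pose G x y : prop := fun g => exists2 f, derived (jop Q A) g f &
  forall p c, pmem p c x -> exists2 v, kapp f p v & PIn A c y v.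
have m1 : wp A (pret (plam t)) env (G a b).
  apply: (wp_fun (cont_scons 0)); apply: wp_mono l1 => f hf.
  by exists f => //; exact: derived_ret.
have m2 : wp A (pret (plam s)) env (G b a).
  apply: (wp_fun (cont_scons 0)); apply: wp_mono l2 => f hf.
  by exists f => //; exact: derived_ret.
have h : wp A (peqI t s) env (Jp A (PEq_body A a b)).
  apply: wp_ret; apply: (wp_bp m1 m2) => v w [f df hf] [g dg hg].
  split=> p c pm; rewrite ?pr0_bp ?pr1_bp.
    by have [u fu cu] := hf p c pm; exists u => //; exists f.
  by have [u fu cu] := hg p c pm; exists u => //; exists g.
case: kab => [[sa sb]|[n ea eb]]; first by rewrite PEq_setE.
by apply: wp_mono h => v _; rewrite ea eb; apply/PEq_urel.
Qed.

Lemma closed_sem phi : {c | forall A rho, closedby A c (sem A phi rho)}.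
Proof.
elim: phi => [f g xs|x|x|x y|x y|B [c hc] C [c' hc']|B _ C _|B _|B _ C [c' hc']|x B [c hc]|x B _] /=.
(* The code is an existential variable created before [A] and [rho] are introduced. Unification
   fills it in while the rules are applied backwards, so uniformity in both is automatic; most
   programs below arise in this way. *)
- by eexists=> A rho; apply: closed_const.
- by eexists=> A rho; apply: closed_uniq => v w [n -> ->] [m [->] ->].
- by eexists=> A rho; apply: closed_const.
- by eexists=> A rho; apply: closed_PIn.
- by eexists=> A rho; apply: closed_PEq.
- by eexists=> A rho; apply: closed_and.
- by eexists=> A rho; apply: closed_Jp.
- by eexists=> A rho; apply: closed_const.
- by eexists=> A rho; apply: closed_imp.
- by exists c => A rho; apply: (closed_all (Urel 0)).
- by eexists=> A rho; apply: closed_Jp.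
Qed.

Definition rlzj A phi rho : prop :=
  rlz (jump_algebra KV (jop Q A)) (jop Q A) phi rho.

(** Both translations are built together because implication is contravariant. A realizer of an
    implication in the derived algebra is an index and is opened by [cuniq]; a plain one becomes an
    index by opcode 0. The modality that [sem] omits at universal quantifiers is absorbed by
    [closed_sem]. *)
Lemma rlz_sem phi :
  {t | forall A rho e, rlzj A phi rho e -> wp A t e (sem A phi rho)} *
  {t | forall A rho e, sem A phi rho e -> wp A t e (rlzj A phi rho)}.
Proof.
rewrite /rlzj.
have triv (P R : baire -> (nat -> name) -> prop) : (forall A rho e, P A rho e -> R A rho e) ->
    {t | forall A rho e, P A rho e -> wp A t e (R A rho)}.
  by move=> h; eexists=> A rho e /h H; whyp H.
elim: phi => [f g xs|x|x|x y|x y|B [[t ht] [t' ht']] C [[s hs] [s' hs']]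
  |B [[t ht] [t' ht']] C [[s hs] [s' hs']]|B [[t ht] [t' ht']]
  |B [[t ht] [t' ht']] C [[s hs] [s' hs']]|x B [[t ht] [t' ht']]|x B [[t ht] [t' ht']]] /=;
  try by split; apply: triv.
- split; eexists=> A rho e h.
    apply: wp_pair; (apply: wp_call; last by eauto).
      by apply: (wp_fst (P := rlzj A B rho)); whyp h.
    by apply: (wp_snd (R := rlzj A C rho)); whyp h.
  apply: wp_pair; (apply: wp_call; last by eauto).
    by apply: (wp_fst (P := sem _ B rho)); whyp h.
  by apply: (wp_snd (R := sem _ C rho)); whyp h.
- have orcase A (P P' R R' : prop) a b env d :
      (forall e, P e -> wp A a e P') -> (forall e, R e -> wp A b e R') ->
      (pr0 d = numeral 0 /\ P (pr1 d)) \/ (pr0 d = numeral 1 /\ R (pr1 d)) ->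
      wp A (cpair (pfun pr0 pvar0) (pcasen (pfun pr0 pvar0)
        (fun n => if n is 0 then pcall a (pfun pr1 pvar0) else pcall b (pfun pr1 pvar0))))
        (bp d env)
        (fun d => (pr0 d = numeral 0 /\ P' (pr1 d)) \/ (pr0 d = numeral 1 /\ R' (pr1 d))).
    move=> ha hb [[d0 Pd]|[d0 Rd]].
      apply: (wp_bp (P := eq (numeral 0)) (Q := P')) => [||v w <- Pw]; last by left; rewrite pr0_bp pr1_bp.
        by apply: (wp_fun cont_pr0); apply: wp_var0.
      apply: (wp_nat (n := 0)); first by apply: (wp_fun cont_pr0); apply: wp_var0.
      apply: (wp_call (P := P)) => //; by apply: (wp_fun cont_pr1); apply: wp_var0.
    apply: (wp_bp (P := eq (numeral 1)) (Q := R')) => [||v w <- Pw]; last by right; rewrite pr0_bp pr1_bp.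
      by apply: (wp_fun cont_pr0); apply: wp_var0.
    apply: (wp_nat (n := 1)); first by apply: (wp_fun cont_pr0); apply: wp_var0.
    apply: (wp_call (P := R)) => //; by apply: (wp_fun cont_pr1); apply: wp_var0.
  split; eexists=> A rho e.
    move=> /JpE h; apply: wp_mapj; first by whyp h.
    by move=> d; apply: orcase; [apply: ht|apply: hs].
  move=> h; apply: (wp_mono (P := Jp _ _)) => [v|]; first exact: (proj1 (JpE _ _ _)).
  apply: wp_mapj; first by whyp h.
  by move=> d; apply: orcase; [apply: ht'|apply: hs'].
- split; apply: triv => A rho e h a.
    by case/ht' => v _ /h.
  by case/ht => v _ /h.
- split; eexists=> A rho e h.
    apply: wp_lam => a Ba; apply: wp_call; last by eauto.
    have [b tb Bb] := ht' A rho a Ba.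
    have [v [f df fb] Cv] := h b Bb.
    apply: (@wp_app _ _ _ _ (eq b)).
      apply: (@wp_mono _ _ _ (eq f)) => [_ <- _ <-|]; first by exists v; [exact: fb|exact: Cv].
      by apply: derived_wp; whyp df.
    apply: (wp_call (P := eq a)); first by apply: wp_var0.
    by move=> _ <-; exists b.
  apply: (@wp_mono _ _ _ (fun e => exists2 f, derived (jop Q A) e f &
      PImp (rlzj A B rho) (rlzj A C rho) f)).
    by move=> g [f df hf] a Ba; have [v fv Cv] := hf a Ba; exists v => //; exists f.
  apply: (wp_fun (cont_scons 0)).
  apply: (@wp_mono _ _ _ (PImp (rlzj A B rho) (rlzj A C rho))).
    by move=> f hf; exists f => //; apply: derived_ret.
  apply: wp_lam => a Ba; apply: wp_call; last by eauto.
  apply: wp_app; first by whyp h.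
  by apply: wp_call; [whyp Ba|eauto].
- split; eexists=> A rho e.
    move=> /JpE h; apply: wp_bind; first by whyp h.
      move=> d hd; apply: (wp_forall (Urel 0)) => c.
      by apply: wp_call; [whyp (hd c)|eauto].
    by apply: (closed_all (Urel 0)) => c; apply: (proj2_sig (closed_sem B)).
  move=> h; apply: (wp_mono (P := Jp _ _)) => [v|]; first exact: (proj1 (JpE _ _ _)).
  apply: wp_ret; apply: (wp_forall (Urel 0)) => c.
  by apply: wp_call; [whyp (h c)|eauto].
- split; eexists=> A rho e.
    move=> /JpE h; apply: wp_mapj; first by whyp h.
    move=> d [c hd]; apply: (wp_mono (P := sem A B (upd rho x c))); first by exists c.
    by apply: wp_call; [whyp hd|eauto].
  move=> h; apply: (wp_mono (P := Jp _ _)) => [v|]; first exact: (proj1 (JpE _ _ _)).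
  apply: wp_mapj; first by whyp h.
  move=> d [c hd]; apply: (wp_mono (P := rlzj A B (upd rho x c))); first by exists c.
  by apply: wp_call; [whyp hd|eauto].
Qed.

End Modality.

(** * Equality and membership of names *)

Ltac closed := repeat first
  [ exact: closed_PIn | exact: closed_PEq | exact: closed_Jp
  | apply: closed_and | apply: closed_imp
  | apply: (closed_all (Urel 0)) => ?
  | exact: (proj2_sig (closed_sem _ _)) ].

Section Equality.

Variable Q : baire -> Prop.

Lemma wp_inI A t s env a b c :
  wp A t env (PMem c b) -> wp A s env (PEq Q A a c) ->
  wp A (pret (cpair t s)) env (PIn Q A a b).
Proof.
move=> ht hs; rewrite PInE; apply: wp_ret.
by apply: wp_mono (wp_pair ht hs) => v; exists c.
Qed.

Lemma wp_inE A t s k env a b R :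
  wp A t env (PIn Q A a b) ->
  (forall c d, PAnd (PMem c b) (PEq Q A a c) d -> wp A s (bp d env) R) ->
  closedby Q A k R -> wp A (pbind k t s) env R.
Proof.
by rewrite PInE => ht hs hk; apply: (wp_bind ht _ hk) => d [c]; apply: hs.
Qed.

Lemma wp_exI A X (x : X) t env (P : X -> prop) :
  wp A t env (P x) -> wp A (pret t) env (PEx Q A P).
Proof. by move=> h; apply: wp_ret; apply: wp_mono h => v; exists x. Qed.

Lemma wp_exE A X t s k env (P : X -> prop) R :
  wp A t env (PEx Q A P) -> (forall x a, P x a -> wp A s (bp a env) R) ->
  closedby Q A k R -> wp A (pbind k t s) env R.
Proof. by move=> ht hs hk; apply: (wp_bind ht _ hk) => a [x]; apply: hs. Qed.

Lemma wp_orI1 A t env P R : wp A t env P ->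
  wp A (pret (cpair (fcode (fun=> numeral 0)) t)) env (POr Q A P R).
Proof.
move=> h; apply: wp_ret; apply: (wp_bp (P := eq (numeral 0)) (wp_cst _ _ _) h) => // v w <- Pw.
by left; rewrite pr0_bp pr1_bp.
Qed.

Lemma wp_orI2 A t env P R : wp A t env R ->
  wp A (pret (cpair (fcode (fun=> numeral 1)) t)) env (POr Q A P R).
Proof.
move=> h; apply: wp_ret; apply: (wp_bp (P := eq (numeral 1)) (wp_cst _ _ _) h) => // v w <- Pw.
by right; rewrite pr0_bp pr1_bp.
Qed.

Definition porcase (s1 s2 : baire) : baire := pcasen (pfun pr0 pvar0) (fun n =>
  pcall (if n is 0 then s1 else s2) (cpair (pfun pr1 pvar0) (pshift pself))).

Lemma wp_orE A t s1 s2 k env P1 P2 R :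
  wp A t env (POr Q A P1 P2) ->
  (forall a, P1 a -> wp A s1 (bp a env) R) ->
  (forall a, P2 a -> wp A s2 (bp a env) R) ->
  closedby Q A k R -> wp A (pbind k t (porcase s1 s2)) env R.
Proof.
move=> ht h1 h2 hk; apply: (wp_bind ht _ hk) => d hd.
have cl s (P : prop) : P (pr1 d) -> (forall a, P a -> wp A s (bp a env) R) ->
    wp A (pcall s (cpair (pfun pr1 pvar0) (pshift pself))) (bp d env) R.
  move=> Pd hs; apply: (wp_call (P := fun v => wp A s v R)) => //.
  apply: (wp_bp (P := P) (Q := eq env)) => [||v w Pv <-]; last exact: hs.
    by apply: (wp_fun cont_pr1); apply: wp_var0.
  by apply: wp_shift; apply: wp_here.
case: hd => -[d0 Pd].
  apply: (wp_nat (n := 0)); first by apply: (wp_fun cont_pr0); apply: wp_var0.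
  exact: cl Pd h1.
apply: (wp_nat (n := 1)); first by apply: (wp_fun cont_pr0); apply: wp_var0.
exact: cl Pd h2.
Qed.

(** The realizer has to be the same for all names, so it is a fixed point; only its correctness is
    proved by induction on the name. *)
Lemma refl_prog : {t | forall A a env, wp A t env (PEq Q A a a)}.
Proof.
have [T hT] : {T | forall A f env a,
    (forall c p env', pmem p c a -> wp A f env' (PEq Q A c c)) ->
    wp A T (bp f env) (PEq Q A a a)}.
  eexists=> A f env a IH; apply: wp_eqI.
  - by case: a {IH} => [n|J p x]; [right; exists n|left].
  - move=> c p h; apply: wp_inI; first by whyp (h : PMem c a p).
    apply: wp_callf; first by whyp (erefl f).
    by eapply wp_here; apply: IH h.
  - move=> c p h; apply: wp_inI; first by whyp (h : PMem c a p).
    apply: wp_callf; first by whyp (erefl f).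
    by eapply wp_here; apply: IH h.
have [e he] := wp_fix T.
exists e => A; elim=> [n|J p x IH] env; apply: he; apply: hT => //.
by move=> c q env' [i [_ <-]]; apply: IH.
Qed.

Lemma wp_refl A a env : wp A (sval refl_prog) env (PEq Q A a a).
Proof. exact: (proj2_sig refl_prog). Qed.

Lemma same_kind_sym a b : same_kind a b -> same_kind b a.
Proof. by case=> [[]|[n]]; [left|right; exists n]. Qed.

Lemma same_kind_trans a b c : same_kind a b -> same_kind b c -> same_kind a c.
Proof.
case=> [[sa sb]|[n -> ->]] [[sb' sc]|[m e1 e2]]; first by left.
- by rewrite e1 in sb.
- by [].
by right; exists n => //; rewrite e2 -e1.
Qed.

Lemma sym_prog : {t | forall A a b e, PEq Q A a b e -> wp A t e (PEq Q A b a)}.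
Proof.
eexists=> A a b e h; apply: wp_eqI; first exact: same_kind_sym (PEq_kind h).
  by move=> c p hp; apply: wp_eqE2; [whyp h|whyp (hp : PMem c b p)].
by move=> c p hp; apply: wp_eqE1; [whyp h|whyp (hp : PMem c a p)].
Qed.

Lemma wp_sym A t env a b : wp A t env (PEq Q A a b) ->
  wp A (pcall (sval sym_prog) t) env (PEq Q A b a).
Proof. by move=> h; apply: (wp_call h) => e; apply: (proj2_sig sym_prog). Qed.

(** In both directions the recursive call concerns an element of the first name, on which the
    induction runs. The second direction therefore reverses the equalities before and after the
    call. *)
Lemma trans_prog : {t | forall A a b c e,
  PAnd (PEq Q A a b) (PEq Q A b c) e -> wp A t e (PEq Q A a c)}.
Proof.
have [T hT] : {T | forall A f a b c e,
    (forall x p b c e, pmem p x a -> PAnd (PEq Q A x b) (PEq Q A b c) e ->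
       wp A f e (PEq Q A x c)) ->
    PAnd (PEq Q A a b) (PEq Q A b c) e -> wp A T (bp f e) (PEq Q A a c)}.
  eexists=> A f a b c e IH h; have [hab hbc] := h; apply: wp_eqI.
  - exact: same_kind_trans (PEq_kind hab) (PEq_kind hbc).
  - move=> x p hp; apply: wp_inE; last closed.
      apply: wp_eqE1; first by apply: wp_fst; whyp h.
      by whyp (hp : PMem x a p).
    move=> y d hd; apply: wp_inE; last closed.
      apply: wp_eqE1; first by apply: wp_snd; whyp h.
      by apply: wp_fst; whyp hd.
    move=> z d' hd'; apply: wp_inI; first by apply: wp_fst; whyp hd'.
    apply: wp_callf; first by whyp (erefl f).
    apply: (wp_mono (P := PAnd (PEq Q A x y) (PEq Q A y z))) => [v|].
      exact: IH hp.
    by apply: wp_pair; apply: wp_snd; [whyp hd|whyp hd'].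
  - move=> z p hp; apply: wp_inE; last closed.
      apply: wp_eqE2; first by apply: wp_snd; whyp h.
      by whyp (hp : PMem z c p).
    move=> y d hd; apply: wp_inE; last closed.
      apply: wp_eqE2; first by apply: wp_fst; whyp h.
      by apply: wp_fst; whyp hd.
    move=> x d' hd'; apply: wp_inI; first by apply: wp_fst; whyp hd'.
    apply: wp_sym; apply: wp_callf; first by whyp (erefl f).
    apply: (wp_mono (P := PAnd (PEq Q A x y) (PEq Q A y z))) => [v|].
      by case: hd' => hx _; exact: IH hx.
    by apply: wp_pair; apply: wp_sym; apply: wp_snd; [whyp hd'|whyp hd].
have [f hf] := wp_fix T.
exists f => A; elim=> [n|J p x IH] b c e h; apply: hf; apply: hT h => //.
by move=> y q b' c' e' [i [_ <-]]; apply: IH.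
Qed.

Lemma wp_trans A t s env a b c :
  wp A t env (PEq Q A a b) -> wp A s env (PEq Q A b c) ->
  wp A (pcall (sval trans_prog) (cpair t s)) env (PEq Q A a c).
Proof.
move=> ht hs; apply: (wp_call (wp_pair ht hs)) => e; apply: (proj2_sig trans_prog).
Qed.

Lemma in_eql_prog : {t | forall A a a' b e,
  PAnd (PEq Q A a a') (PIn Q A a b) e -> wp A t e (PIn Q A a' b)}.
Proof.
eexists=> A a a' b e h; apply: wp_inE; last closed.
  by apply: wp_snd; whyp h.
move=> c d hd; apply: wp_inI; first by apply: wp_fst; whyp hd.
apply: wp_trans; last by apply: wp_snd; whyp hd.
by apply: wp_sym; apply: wp_fst; whyp h.
Qed.

Lemma wp_in_eql A t s env a a' b :
  wp A t env (PEq Q A a a') -> wp A s env (PIn Q A a b) ->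
  wp A (pcall (sval in_eql_prog) (cpair t s)) env (PIn Q A a' b).
Proof.
by move=> ht hs; apply: (wp_call (wp_pair ht hs)) => e; apply: (proj2_sig in_eql_prog).
Qed.

Lemma in_eqr_prog : {t | forall A a b b' e,
  PAnd (PEq Q A b b') (PIn Q A a b) e -> wp A t e (PIn Q A a b')}.
Proof.
eexists=> A a b b' e h; apply: wp_inE; last closed.
  by apply: wp_snd; whyp h.
move=> c d hd; apply: wp_in_eql; first by apply: wp_sym; apply: wp_snd; whyp hd.
apply: wp_eqE1; first by apply: wp_fst; whyp h.
by apply: wp_fst; whyp hd.
Qed.

Lemma wp_in_eqr A t s env a b b' :
  wp A t env (PEq Q A b b') -> wp A s env (PIn Q A a b) ->
  wp A (pcall (sval in_eqr_prog) (cpair t s)) env (PIn Q A a b').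
Proof.
by move=> ht hs; apply: (wp_call (wp_pair ht hs)) => e; apply: (proj2_sig in_eqr_prog).
Qed.

Lemma wp_mem_in A t env b c : wp A t env (PMem c b) ->
  wp A (pret (cpair t (sval refl_prog))) env (PIn Q A c b).
Proof. by move=> h; apply: wp_inI h _; apply: wp_refl. Qed.

Lemma PIn_set A a b e : PIn Q A a b e -> is_set b.
Proof. by rewrite PInE => /Jp_ex[d [c [/pmem_set]]]. Qed.

(** * Substitutivity *)

Lemma upd_upd rho x a b : upd (upd rho x a) x b = upd rho x b.
Proof. by apply: funext => y; rewrite /upd; case: eqP. Qed.

Lemma upd_swap rho x y a b : x != y -> upd (upd rho x a) y b = upd (upd rho y b) x a.
Proof.
move=> xy; apply: funext => z; rewrite /upd; case: (eqVneq z y) => // ->.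
by rewrite eq_sym (negbTE xy).
Qed.

Lemma map_urel (f : nat -> name) xs ns y :
  map f xs = map Urel ns -> y \in xs -> exists n, f y = Urel n.
Proof.
move=> e yxs; have := congr1 (nth (Urel 0) ^~ (index y xs)) e.
have := congr1 size e; rewrite !size_map => ss.
rewrite (nth_map 0) ?index_mem // nth_index // (nth_map 0) -?ss ?index_mem // => ->.
by eexists.
Qed.

Lemma leibniz_prog B x : {t | forall A rho a b e,
  PAnd (PEq Q A a b) (sem Q A B (upd rho x a)) e ->
  wp A t e (sem Q A B (upd rho x b))}.
Proof.
have var y : {t | forall A rho a b (P : prop) e, PAnd (PEq Q A a b) P e ->
    wp A t e (PEq Q A (upd rho x a y) (upd rho x b y))}.
  rewrite /upd; case: (y == x); first by eexists=> A rho a b P e h; apply: wp_fst; whyp h.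
  by eexists=> A rho a b P e h; apply: wp_refl.
elim: B => [f g xs|y|y|y z|y z|B [t ht] C [s hs]|B [t ht] C [s hs]|B [t ht]
  |B [t ht] C [s hs]|y B [t ht]|y B [t ht]] /=.
- eexists=> A rho a b e h; eapply wp_here.
  case: h => /PEq_kind[[sa sb]|[n -> ->//]] [ns e1 e2]; exists ns => //.
  rewrite -e1; apply/eq_in_map => y yxs; have [n] := map_urel e1 yxs.
  by rewrite /upd; case: eqP => // _ en; rewrite en in sa.
- eexists=> A rho a b e h; apply: (wp_fun cont_pr1); eapply wp_here.
  case: h; rewrite /upd; case: ifP => // _ /PEq_kind[[sa sb]|[n -> ->//]].
  by case=> m e1; rewrite e1 in sa.
- eexists=> A rho a b e h; eapply wp_here.
  by case: h; rewrite /upd /PSet; case: ifP => // _ /PEq_kind[[]|[n -> ->]].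
- eexists=> A rho a b e h.
  apply: wp_in_eql; first exact: (proj2_sig (var y)) h.
  apply: wp_in_eqr; first exact: (proj2_sig (var z)) h.
  by apply: wp_snd; whyp h.
- eexists=> A rho a b e h.
  apply: wp_trans; first by apply: wp_sym; exact: (proj2_sig (var y)) h.
  apply: wp_trans; last by exact: (proj2_sig (var z)) h.
  by apply: wp_snd; whyp h.
- eexists=> A rho a b e h; apply: wp_pair; (apply: wp_call; last by eauto).
    apply: wp_pair; first by apply: wp_fst; whyp h.
    by apply: wp_fst; apply: wp_snd; whyp h.
  apply: wp_pair; first by apply: wp_fst; whyp h.
  by apply: wp_snd; apply: wp_snd; whyp h.
- eexists=> A rho a b e h; apply: wp_orE; first by apply: wp_snd; whyp h.
  + move=> c hc; apply: wp_orI1; apply: wp_call; last by eauto.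
    by apply: wp_pair; [apply: wp_fst; whyp h|whyp hc].
  + move=> c hc; apply: wp_orI2; apply: wp_call; last by eauto.
    by apply: wp_pair; [apply: wp_fst; whyp h|whyp hc].
  + closed.
- eexists=> A rho a b e h; eapply wp_here => c hc.
  have [v _ hv] := wp_sym (wp_fst (wp_here A h)).
  have /ht[w _] : PAnd (PEq Q A b a) (sem Q A B (upd rho x b)) (bp v c).
    by split; rewrite ?pr0_bp ?pr1_bp.
  by case: h => _; apply.
- eexists=> A rho a b e h; apply: wp_lam => c hc; apply: wp_call; last by eauto.
  apply: wp_pair; first by apply: wp_fst; whyp h.
  apply: wp_app; first by apply: wp_snd; whyp h.
  apply: wp_call; last by eauto.
  apply: wp_pair; last by whyp hc.
  by apply: wp_sym; apply: wp_fst; whyp h.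
- case: (eqVneq x y) => [<-|xy].
    eexists=> A rho a b e h; apply: (wp_fun cont_pr1); eapply wp_here.
    by case: h => _ h c; move: (h c); rewrite !upd_upd.
  eexists=> A rho a b e h; apply: (wp_forall (Urel 0)) => c; rewrite upd_swap //.
  have {}h : PAnd (PEq Q A a b) (sem Q A B (upd (upd rho y c) x a)) e.
    by case: h => h1 h2; split=> //; rewrite -upd_swap //; apply: h2.
  by apply: wp_call; [whyp h|eauto].
- case: (eqVneq x y) => [<-|xy].
    eexists=> A rho a b e h; apply: (wp_fun cont_pr1); eapply wp_here; case: h => _.
    by apply: Jp_mono => d [c hc]; exists c; move: hc; rewrite !upd_upd.
  eexists=> A rho a b e h; apply: wp_exE; first by apply: wp_snd; whyp h.
    move=> c d hd; apply: (wp_exI (x := c)); rewrite upd_swap //.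
    rewrite upd_swap // in hd; apply: wp_call; last by eauto.
    by apply: wp_pair; [apply: wp_fst; whyp h|whyp hd].
  closed.
Qed.

End Equality.
Arguments wp_exI {Q A X} x {t env P}.

(** * Soundness of IZF *)

Ltac updE U := cbn [sem FIff]; rewrite /upd; repeat match goal with
  | |- context [@eq_op ?T ?a ?b] => first
      [ constr_eq a b; rewrite (eqxx a)
      | rewrite (_ : (@eq_op T a b) = false);
        last by (case: eqP U => // ->; rewrite /= ?inE ?eqxx ?orbT ?andbF) ]
  end.

Section IZFSoundness.

Variable Q : baire -> Prop.

(** The order of the quantifiers matters: one code for all advice, assignments and environments.
    This is what allows the advice to be chosen last. *)
Definition valid (phi : form) : Prop :=
  exists t, forall A rho env, wp A t env (sem Q A phi rho).

Lemma sem_ext A B rho rho' :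
  {in fv B, rho =1 rho'} -> sem Q A B rho = sem Q A B rho'.
Proof.
have updx C x (r r' : nat -> name) c : {in [seq y <- fv C | y != x], r =1 r'} ->
    {in fv C, upd r x c =1 upd r' x c}.
  move=> h y yC; rewrite /upd; case: (eqVneq y x) => // yx.
  by apply: h; rewrite mem_filter yx.
elim: B rho rho' => [f g xs|y|y|y z|y z|B IHB C IHC|B IHB C IHC|B IHB
  |B IHB C IHC|y B IHB|y B IHB] rho rho' /= h.
- by congr PRel; apply/eq_in_map.
- by rewrite h ?inE.
- by rewrite h ?inE.
- by rewrite !h ?inE ?eqxx ?orbT.
- by rewrite !h ?inE ?eqxx ?orbT.
- by rewrite (IHB _ rho') ?(IHC _ rho') // => x xB; apply: h; rewrite mem_cat xB ?orbT.
- by rewrite (IHB _ rho') ?(IHC _ rho') // => x xB; apply: h; rewrite mem_cat xB ?orbT.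
- by rewrite (IHB _ rho').
- by rewrite (IHB _ rho') ?(IHC _ rho') // => x xB; apply: h; rewrite mem_cat xB ?orbT.
- by congr PAll; apply: funext => c; apply: IHB; apply: updx.
- by congr PEx; apply: funext => c; apply: IHB; apply: updx.
Qed.

Lemma sem_upd_notin A B rho x c : x \notin fv B -> sem Q A B (upd rho x c) = sem Q A B rho.
Proof.
move=> xB; apply: sem_ext => y yB; rewrite /upd; case: eqP => // yx.
by rewrite -yx yB in xB.
Qed.

Lemma fv_allvars B : {subset fv B <= allvars B}.
Proof.
elim: B => [f g xs|x|x|x z|x z|B IHB C IHC|B IHB C IHC|B IHB|B IHB C IHC|x B IH|x B IH] y //=.
- by rewrite !mem_cat => /orP[/IHB|/IHC] ->; rewrite ?orbT.
- by rewrite !mem_cat => /orP[/IHB|/IHC] ->; rewrite ?orbT.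
- exact: IHB.
- by rewrite !mem_cat => /orP[/IHB|/IHC] ->; rewrite ?orbT.
- by rewrite mem_filter inE => /andP[_ /IH ->]; rewrite orbT.
- by rewrite mem_filter inE => /andP[_ /IH ->]; rewrite orbT.
Qed.

Lemma sem_rename A B x y rho : y \notin allvars B ->
  sem Q A (rename x y B) rho = sem Q A B (upd rho x (rho y)).
Proof.
have r z : rho (if z == x then y else z) = upd rho x (rho y) z.
  by rewrite /upd; case: ifP.
elim: B rho r => [f g xs|z|z|z w|z w|B IHB C IHC|B IHB C IHC|B IHB
  |B IHB C IHC|z B IHB|z B IHB] rho r /=.
- by move=> _; congr PRel; rewrite -map_comp; apply: eq_map => z /=; apply: r.
- by rewrite r.
- by rewrite r.
- by rewrite !r.
- by rewrite !r.
- by rewrite mem_cat negb_or => /andP[yB yC]; rewrite IHB ?IHC.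
- by rewrite mem_cat negb_or => /andP[yB yC]; rewrite IHB ?IHC.
- by move=> yB; rewrite IHB.
- by rewrite mem_cat negb_or => /andP[yB yC]; rewrite IHB ?IHC.
- rewrite inE negb_or => /andP[yz yB]; case: (eqVneq z x) => [->|zx] /=.
    by congr PAll; apply: funext => c; rewrite upd_upd.
  congr PAll; apply: funext => c; rewrite IHB // => [|w].
    by rewrite upd_swap // /upd (negbTE yz).
  by rewrite /upd (negbTE yz); case: (w == x); rewrite ?(negbTE yz).
- rewrite inE negb_or => /andP[yz yB]; case: (eqVneq z x) => [->|zx] /=.
    by congr PEx; apply: funext => c; rewrite upd_upd.
  congr PEx; apply: funext => c; rewrite IHB // => [|w].
    by rewrite upd_swap // /upd (negbTE yz).
  by rewrite /upd (negbTE yz); case: (w == x); rewrite ?(negbTE yz).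
Qed.

Lemma valid_close phi : valid phi -> valid (close phi).
Proof.
move=> [t ht]; exists t; rewrite /close; elim: (undup _) => //= x xs IH A rho env.
by apply: (wp_forall (Urel 0)) => c; apply: IH.
Qed.

Lemma valid_leibniz B x y : x != y -> y \notin allvars B ->
  valid (FAll x (FAll y (FImp (FEq x y) (FImp B (rename x y B))))).
Proof.
move=> xy yB; eexists=> A rho env /=.
apply: (wp_forall (Urel 0)) => a; apply: (wp_forall (Urel 0)) => b.
rewrite upd_swap // sem_rename // upd_upd.
have -> : upd (upd rho y b) x a x = a by rewrite /upd eqxx.
have -> : upd (upd rho y b) x a y = b by rewrite /upd eqxx eq_sym (negbTE xy).
apply: wp_lam => e he; apply: wp_lam => d hd.
apply: (wp_call (P := PAnd (PEq Q A a b) (sem Q A B (upd (upd rho y b) x a)))).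
  by apply: wp_pair; [whyp he|whyp hd].
exact: (proj2_sig (leibniz_prog Q B x)).
Qed.

Fixpoint upds (rho : nat -> name) (xs ns : seq nat) : nat -> name :=
  match xs, ns with
  | x :: xs', n :: ns' => upds (upd rho x (Urel n)) xs' ns'
  | _, _ => rho
  end.

Lemma upds_notin rho xs ns y : y \notin xs -> upds rho xs ns y = rho y.
Proof.
elim: xs ns rho => [|x xs IH] [|n ns] rho //=; rewrite inE negb_or => /andP[yx yxs].
by rewrite IH // /upd (negbTE yx).
Qed.

Lemma map_upds rho xs ns : uniq xs -> size ns = size xs ->
  map (upds rho xs ns) xs = map Urel ns.
Proof.
elim: xs ns rho => [|x xs IH] [|n ns] rho //= /andP[xxs uxs] [ss].
by rewrite IH // upds_notin // /upd eqxx.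
Qed.

(** [K] carries the assignments made so far through the induction; for each tuple of numbers a
    different program may be supplied. *)
Lemma FAllsN_wp xs B (K : (nat -> name) -> Prop) :
  (forall ns, size ns = size xs -> exists t, forall A rho env, K rho ->
     wp A t env (sem Q A B (upds rho xs ns))) ->
  exists t, forall A rho env, K rho -> wp A t env (sem Q A (FAllsN xs B) rho).
Proof.
elim: xs K => [|x xs IH] K h; first by have [t ht] := h [::] erefl; exists t.
have /choice[t ht] n : exists t, forall A rho env,
    (exists2 r, K r & rho = upd r x (Urel n)) -> wp A t env (sem Q A (FAllsN xs B) rho).
  apply: IH => ns ss; have [t ht] := h (n :: ns) (congr1 S ss).
  by exists t => A rho env [r Kr ->]; apply: ht.
eexists=> A rho env Kr /=; apply: (wp_forall (Urel 0)) => c.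
apply: wp_lam => a; rewrite {1}/upd eqxx => -[n -> ->].
apply: (wp_nat (n := n)); first by whyp (erefl (numeral n)).
by apply: ht; exists rho.
Qed.

Lemma valid_FAllsN xs B : uniq xs ->
  (forall ns, size ns = size xs -> exists t, forall A rho env,
     map rho xs = map Urel ns -> wp A t env (sem Q A B rho)) ->
  valid (FAllsN xs B).
Proof.
move=> uxs h; have [|t ht] := @FAllsN_wp xs B (fun=> True).
  move=> ns ss; have [t ht] := h ns ss; exists t => A rho env _.
  by apply: ht; apply: map_upds.
by exists t => A rho env; apply: ht.
Qed.

Lemma map_urel_inj : injective (map Urel).
Proof. by apply: inj_map => n m []. Qed.

Lemma sem_graph A rho f xs ns y m e : map rho xs = map Urel ns -> rho y = Urel m ->
  sem Q A (graph f xs y) rho e <-> eval f ns = m.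
Proof.
move=> exs ey; have ss := congr1 size exs; rewrite !size_map in ss.
have E : [seq eval h (m :: ns) | h <- [seq PProj i.+1 | i <- iota 0 (size xs)]] = ns.
  rewrite -map_comp ss; apply: (@eq_from_nth _ 0); rewrite size_map size_iota // => i ib.
  by rewrite (nth_map 0) ?size_iota // nth_iota.
rewrite /graph /= /PRel exs ey; split=> [[ns' e1 /=]|em].
  by have <- : m :: ns = ns' := map_urel_inj (x1 := m :: ns) e1; rewrite E.
by exists (m :: ns) => //=; rewrite E.
Qed.

Lemma sem_zero A rho y m e : rho y = Urel m -> sem Q A (is_zero y) rho e <-> m = 0.
Proof.
move=> ey; have H := @sem_graph A rho PZero [::] [::] y m e erefl ey.
by split=> [/H|m0]; last by apply/H; rewrite m0.
Qed.

Lemma sem_succ A rho x y n m e : rho x = Urel n -> rho y = Urel m ->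
  sem Q A (is_succ x y) rho e <-> n.+1 = m.
Proof.
by move=> ex ey; apply: (@sem_graph A rho PSucc [:: x] [:: n] y m e) => //=; rewrite ex.
Qed.

Lemma wp_true A env (P : prop) : (forall e, P e) -> wp A (fcode (fun=> numeral 0)) env P.
Proof. by move=> h; apply: wp_cst. Qed.

Lemma upd_map rho y c xs : y \notin xs -> map (upd rho y c) xs = map rho xs.
Proof.
move=> yxs; apply/eq_in_map => x xxs; rewrite /upd; case: eqP => // xy.
by rewrite -xy xxs in yxs.
Qed.

Lemma upd_x rho y c : upd rho y c y = c. Proof. by rewrite /upd eqxx. Qed.

Lemma valid_rel f g xs y : uniq (y :: xs) ->
  valid (FAllsN xs (FIff (FRel f g xs)
      (FExN y (FAnd (graph f xs y) (graph g xs y))))).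
Proof.
move=> /= /andP[yxs uxs]; apply: valid_FAllsN => // ns ss; eexists=> A rho env exs /=.
have ex m : map (upd rho y (Urel m)) xs = map Urel ns by rewrite upd_map.
have ey m : upd rho y (Urel m) y = Urel m by rewrite upd_x.
apply: wp_pair; apply: wp_lam => a h.
  have {}h : eval f ns = eval g ns.
    by case: h => ns' e1; have <- : ns = ns' by apply: map_urel_inj; rewrite -exs.
  apply: (wp_exI (Urel (eval f ns))); apply: wp_pair.
    by apply: wp_cst; exists (eval f ns); rewrite ?upd_x.
  by apply: wp_true => e; split; apply/(sem_graph _ _ _ (ex _) (ey _)).
apply: wp_true => e'; have [d [c []]] := Jp_ex h; rewrite {1}upd_x => -[m -> _].
case=> /(sem_graph _ _ _ (ex _) (ey _)) h1 /(sem_graph _ _ _ (ex _) (ey _)) h2.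
by exists ns; rewrite ?exs ?h1 ?h2.
Qed.

Lemma valid_total f xs y : uniq (y :: xs) -> valid (FAllsN xs (FExN y (graph f xs y))).
Proof.
move=> /= /andP[yxs uxs]; apply: valid_FAllsN => // ns ss; eexists=> A rho env exs /=.
apply: (wp_exI (Urel (eval f ns))); apply: wp_pair.
  by apply: wp_cst; exists (eval f ns); rewrite ?upd_x.
apply: wp_true => e; apply/(@sem_graph _ _ _ _ ns _ (eval f ns)) => //; last exact: upd_x.
by rewrite upd_map.
Qed.

Lemma valid_functional f xs y z : uniq [:: y, z & xs] ->
  valid (FAllsN [:: y, z & xs] (FImp (FAnd (graph f xs y) (graph f xs z)) (FEq y z))).
Proof.
move=> U; apply: valid_FAllsN => // -[|n [|m ns]] // _.
eexists=> A rho env /= [ey ez exs]; apply: wp_lam => a.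
case=> /(sem_graph _ _ _ exs ey) h1 /(sem_graph _ _ _ exs ez) h2.
by apply: wp_true => e; rewrite ey ez; apply/PEq_urel; rewrite -(h1 e) -(h2 e).
Qed.

Lemma valid_iff_true xs B C : uniq xs ->
  (forall A rho ns e e', map rho xs = map Urel ns -> size ns = size xs ->
     sem Q A B rho e <-> sem Q A C rho e') ->
  valid (FAllsN xs (FIff B C)).
Proof.
move=> U h; apply: valid_FAllsN => // ns ss; eexists=> A rho env exs /=.
by apply: wp_pair; apply: wp_lam => a ha; apply: wp_true => e;
  [apply: (proj1 (h _ _ ns a e exs ss))|apply: (proj2 (h _ _ ns e a exs ss))].
Qed.

Lemma valid_zero xs y : uniq (y :: xs) ->
  valid (FAllsN (y :: xs) (FIff (graph PZero xs y) (is_zero y))).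
Proof.
move=> U; apply: valid_iff_true => // A rho [|n ns] //= e e' [ey exs] _.
have H1 := @sem_graph A rho PZero xs ns y n e exs ey.
have H2 := @sem_zero A rho y n e' ey.
by split=> [/H1 h|/H2 h]; [apply/H2; rewrite -h|apply/H1; rewrite h].
Qed.

Lemma nth_map_urel (rho : nat -> name) xs ns i : map rho xs = map Urel ns -> i < size xs ->
  rho (nth 0 xs i) = Urel (nth 0 ns i).
Proof.
move=> exs ib; have := congr1 (nth (Urel 0) ^~ i) exs; have := congr1 size exs.
by rewrite !size_map => ss; rewrite !(nth_map 0) // -ss.
Qed.

Lemma valid_proj i xs y : uniq (y :: xs) ->
  valid (FAllsN (y :: xs) (FIff (graph (PProj i) xs y)
      (if i < size xs then FEq (nth 0 xs i) y else is_zero y))).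
Proof.
move=> U; apply: valid_iff_true => // A rho [|n ns] // e e' [ey exs] [ss].
apply: iff_trans (sem_graph _ _ e exs ey) _ => /=; case: ltnP => ib.
  by rewrite /= ey (nth_map_urel exs ib); split=> /PEq_urel.
have H := @sem_zero A rho y n e' ey; rewrite nth_default ?ss //.
by split=> [h|/H h]; [apply/H|].
Qed.

Lemma valid_succ xs y z : uniq [:: y, z & xs] ->
  valid (FAllsN (y :: xs) (FIff (graph PSucc xs y)
      (FExN z (FAnd (graph (PProj 0) xs z) (is_succ z y))))).
Proof.
move=> U; have [zy zxs yxs uxs] : [/\ z != y, z \notin xs, y \notin xs & uniq xs].
  by move: U => /= /andP[]; rewrite inE negb_or eq_sym => /andP[-> ->] /andP[-> ->].
apply: valid_FAllsN => [|[|m ns] //= _]; first by rewrite /= yxs.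
eexists=> A rho env /= [ey exs].
have ex c : map (upd rho z c) xs = map Urel ns by rewrite upd_map.
have ey' c : upd rho z c y = Urel m by rewrite /upd eq_sym (negbTE zy).
have ez n : upd rho z (Urel n) z = Urel n by rewrite upd_x.
apply: wp_pair; apply: wp_lam => a h.
  move/(sem_graph A PSucc a exs ey): h => h.
  apply: (wp_exI (Urel (nth 0 ns 0))); apply: wp_pair.
    by apply: wp_cst; exists (nth 0 ns 0); rewrite ?upd_x.
  apply: wp_true => e; split; first exact/(sem_graph _ _ _ (ex _) (ez _)).
  by apply/(sem_succ A _ (ez _) (ey' _)).
apply: wp_true => e'; have [d [c []]] := Jp_ex h; rewrite {1}upd_x => -[n -> _].
case=> /(sem_graph _ _ _ (ex _) (ez _)) h1 /(sem_succ _ _ (ez _) (ey' _)) h2.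
by apply/(sem_graph A PSucc e' exs ey); rewrite /= -(h2 e') -(h1 e').
Qed.

(** Only the truth of the premises matters, so their realizers are dropped and the final realizer is
    constant. *)
Lemma wp_imps A rho env C Bs :
  ((forall B, List.In B Bs -> exists e, sem Q A B rho e) -> forall e, sem Q A C rho e) ->
  wp A (iter (size Bs) plam (fcode (fun=> numeral 0))) env (sem Q A (foldr FImp C Bs) rho).
Proof.
elim: Bs env => [|B Bs IH] env h /=; first by apply: wp_true; apply: h.
apply: wp_lam => a Ba; apply: IH => hB; apply: h => D [<-|/hB//].
by exists a.
Qed.

Lemma valid_comp f gs xs ys z : uniq (z :: ys ++ xs) -> size ys = size gs ->
  valid (FAllsN (z :: ys ++ xs)
      (foldr FImp (graph (PComp f gs) xs z)
         (graph f ys z :: [seq graph p.1 xs p.2 | p <- zip gs ys]))).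
Proof.
move=> U sy; apply: valid_FAllsN => // -[|m nms] // [ss]; eexists=> A rho env [ez exs].
have {exs ss} [ns [ms [ey exs]]] : exists ns ms, map rho ys = map Urel ns /\ map rho xs = map Urel ms.
  exists (take (size ys) nms), (drop (size ys) nms).
  by rewrite !map_take !map_drop -exs map_cat take_size_cat ?drop_size_cat ?size_map.
apply: wp_imps => h e; apply/(sem_graph _ _ _ exs ez) => /=.
have [d] := h _ (or_introl erefl); move/(sem_graph _ _ _ ey ez) <-; congr eval.
have {}h i : i < size gs -> eval (nth PZero gs i) ms = nth 0 ns i.
  move=> ib; have yb : i < size ys by rewrite sy.
  have [|d' hd'] := h (graph (nth PZero gs i) xs (nth 0 ys i)).
    right; apply: List.in_map (fun p => graph p.1 xs p.2) _ (nth PZero gs i, nth 0 ys i) _.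
    rewrite -nth_zip //.
    suff : i < size (zip gs ys) by elim: (zip gs ys) i {ib yb} => //= p l IH [|i] ib; [left|right; apply: IH].
    by rewrite size_zip sy minnn.
  by move/(sem_graph _ _ _ exs (nth_map_urel ey yb)): hd'.
have sn : size ns = size gs by rewrite -sy; have := congr1 size ey; rewrite !size_map.
apply: (@eq_from_nth _ 0); rewrite size_map ?sn // => i ib.
by rewrite (nth_map PZero) // h.
Qed.

Lemma valid_rec_nil f g y :
  valid (FAllN y (FImp (graph f [::] y) (graph (PRec f g) [::] y))).
Proof.
apply: (@valid_FAllsN [:: y]) => // -[|m []] // _; eexists=> A rho env /= [ey].
apply: wp_lam => a /(@sem_graph A rho f [::] [::] y m a erefl ey) h.
by apply: wp_true => e; apply/(@sem_graph A rho _ [::] [::] y m e erefl ey).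
Qed.

Lemma valid_rec0 f g xs y n : uniq [:: y, n & xs] ->
  valid (FAllsN [:: y, n & xs]
      (FImp (FAnd (is_zero n) (graph f xs y)) (graph (PRec f g) (n :: xs) y))).
Proof.
move=> U; apply: valid_FAllsN => // -[|m [|k ns]] //= _; eexists=> A rho env [ey en exs].
have enx : map rho (n :: xs) = map Urel (k :: ns) by rewrite /= en exs.
apply: wp_lam => a [/(sem_zero A (pr0 a) en) k0 /(sem_graph A f (pr1 a) exs ey) h].
by apply: wp_true => e; apply/(sem_graph A (PRec f g) e enx ey) => /=; rewrite k0.
Qed.

Lemma valid_recS f g xs y z n m : uniq [:: y, z, n, m & xs] ->
  valid (FAllsN [:: y, z, n, m & xs]
      (FImp (FAnd (is_succ n m)
               (FAnd (graph (PRec f g) (n :: xs) y)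
                     (graph g [:: n, y & xs] z)))
            (graph (PRec f g) (m :: xs) z))).
Proof.
move=> U; apply: valid_FAllsN => // -[|y' [|z' [|n' [|m' ns]]]] //= _.
eexists=> A rho env [ey ez en em exs].
have enx : map rho (n :: xs) = map Urel (n' :: ns) by rewrite /= en exs.
have emx : map rho (m :: xs) = map Urel (m' :: ns) by rewrite /= em exs.
have enyx : map rho [:: n, y & xs] = map Urel [:: n', y' & ns] by rewrite /= en ey exs.
apply: wp_lam => a [/(sem_succ A (pr0 a) en em) h1 [/(sem_graph A _ (pr0 (pr1 a)) enx ey) h2]].
move/(sem_graph A _ (pr1 (pr1 a)) enyx ez) => h3.
apply: wp_true => e; apply/(sem_graph A (PRec f g) e emx ez).
by rewrite -h1 -h3 -h2.
Qed.

Lemma valid_succ_neq0 x y : x != y ->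
  valid (FAllsN [:: x; y] (FNot (FAnd (is_succ x y) (is_zero y)))).
Proof.
move=> xy; apply: valid_FAllsN => [|[|n [|m []]] // _]; first by rewrite /= inE xy.
eexists=> A rho env /= [ex ey]; apply: wp_true => e a.
by case=> /(sem_succ A (pr0 a) ex ey) h1 /(sem_zero A (pr1 a) ey) h2; rewrite h2 in h1.
Qed.

Lemma valid_succ_inj x y z : uniq [:: x; y; z] ->
  valid (FAllsN [:: x; y; z]
      (FImp (FAnd (is_succ x z) (is_succ y z)) (FEq x y))).
Proof.
move=> U; apply: valid_FAllsN => // -[|n [|m [|k []]]] // _.
eexists=> A rho env /= [ex ey ez]; apply: wp_lam => a.
case=> /(sem_succ A (pr0 a) ex ez) h1 /(sem_succ A (pr1 a) ey ez) h2.
by apply: wp_true => e; rewrite ex ey; apply/PEq_urel/succn_inj; rewrite h1 h2.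
Qed.

(** The induction takes place outside the algebra: a code is found for each numeral separately and
    these are collected by choice, since [pcasen] accepts any sequence of branches. *)
Lemma valid_nat_induction B x y : x != y -> y \notin allvars B ->
  valid (FImp (FAllN x (FImp (is_zero x) B))
      (FImp (FAllN x (FAllN y (FImp (FAnd (is_succ x y) B) (rename x y B))))
            (FAllN x B))).
Proof.
move=> xy yB; have yfB : y \notin fv B by apply: contra yB; apply: fv_allvars.
pose H0 := FAllN x (FImp (is_zero x) B).
pose H1 := FAllN x (FAllN y (FImp (FAnd (is_succ x y) B) (rename x y B))).
have /choice[t ht] n : exists t, forall A rho e,
    PAnd (sem Q A H0 rho) (sem Q A H1 rho) e ->
    wp A t e (sem Q A B (upd rho x (Urel n))).
  elim: n => [|n [t IH]]; eexists=> A rho e h.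
    have {}h : PAnd (PImp (PNat (Urel 0)) (PImp (sem Q A (is_zero x) (upd rho x (Urel 0)))
        (sem Q A B (upd rho x (Urel 0))))) (sem Q A H1 rho) e.
      by case: h => h0 h1; split=> //; have := h0 (Urel 0); rewrite /= {1}/upd eqxx.
    apply: wp_app.
      apply: wp_app; first by apply: wp_fst; whyp h.
      by apply: wp_cst; exists 0.
    by apply: wp_true => d; apply/(sem_zero A d (upd_x _ _ _)).
  pose r := upd (upd rho x (Urel n)) y (Urel n.+1).
  have rx : r x = Urel n by rewrite /r /upd (negbTE xy) eqxx.
  have ry : r y = Urel n.+1 by rewrite /r upd_x.
  have h' : PAnd (sem Q A H0 rho) (PImp (PNat (Urel n)) (PImp (PNat (Urel n.+1))
       (PImp (PAnd (sem Q A (is_succ x y) r) (sem Q A B r)) (sem Q A (rename x y B) r)))) e.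
    case: h => h0 h1; split=> //; have := h1 (Urel n) => /= {}h1 a ha.
    have {}ha : PNat (upd rho x (Urel n) x) a by rewrite upd_x.
    have [v v1 v2] := h1 a ha; exists v => // b hb.
    have {}hb : PNat (upd (upd rho x (Urel n)) y (Urel n.+1) y) b by rewrite upd_x.
    by have [w w1 w2] := v2 (Urel n.+1) b hb; exists w.
  have E : sem Q A (rename x y B) r = sem Q A B (upd rho x (Urel n.+1)).
    rewrite sem_rename // ry /r (@upd_swap rho x y _ _ xy) upd_upd.
    by rewrite -(@upd_swap rho x y _ _ xy) sem_upd_notin.
  have E' : sem Q A B r = sem Q A B (upd rho x (Urel n)) by rewrite /r sem_upd_notin.
  rewrite -E; apply: wp_app.
    apply: wp_app.
      apply: wp_app; first by apply: wp_snd; whyp h'.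
      by apply: wp_cst; exists n.
    by apply: wp_cst; exists n.+1.
  apply: wp_pair; first by apply: wp_true => d; apply/(sem_succ A d rx ry).
  by rewrite E'; apply: wp_call; [whyp h|apply: IH].
eexists=> A rho env; apply: wp_lam => a ha; apply: wp_lam => b hb.
apply: (wp_forall (Urel 0)) => c; apply: wp_lam => d; rewrite upd_x => -[n -> ->].
apply: (wp_nat (n := n)); first by whyp (erefl (numeral n)).
apply: (wp_call (P := PAnd (sem Q A H0 rho) (sem Q A H1 rho))); last exact: ht.
by apply: wp_pair; [whyp ha|whyp hb].
Qed.

End IZFSoundness.

Ltac wall := apply: (wp_forall (Urel 0)).

(** * Existence of sets and induction on membership *)

Section SetAxioms.

Variable Q : baire -> Prop.

Lemma valid_extensionality x y z : uniq [:: x; y; z] ->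
  valid Q (FAll x (FAll y (FImp (FAnd (FSet x) (FSet y))
      (FImp (FAll z (FIff (FIn z x) (FIn z y))) (FEq x y))))).
Proof.
move=> U; eexists=> A rho env; updE U.
wall=> a; wall=> b; apply: wp_lam => e0 [sa sb]; apply: wp_lam => e he.
have h c : PAnd (PImp (PIn Q A c a) (PIn Q A c b)) (PImp (PIn Q A c b) (PIn Q A c a)) e.
  exact: he.
apply: wp_eqI; first by left.
  move=> c p hp; apply: wp_app; first by apply: wp_fst; whyp (h c).
  by apply: wp_mem_in; whyp (hp : PMem c a p).
move=> c p hp; apply: wp_app; first by apply: wp_snd; whyp (h c).
by apply: wp_mem_in; whyp (hp : PMem c b p).
Qed.

(** The realizers 0 and 1 are the tags of disjunction, so that membership in the pair is the
    disjunction of the two equalities, as an identity of propositions. *)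
Definition upn (a b : name) : name :=
  Coll (fun i : bool => numeral i) (fun i => if i then b else a).

Lemma PIn_upn A a b c : PIn Q A c (upn a b) = POr Q A (PEq Q A c a) (PEq Q A c b).
Proof.
rewrite PInE; congr Jp; apply: funext => d; apply: propext; split.
  by case=> d' [[[] [<- <-]]]; [right|left].
by case=> -[d0 h]; [exists a; split=> //; exists false|exists b; split=> //; exists true].
Qed.

Lemma valid_pairing x y z u : uniq [:: x; y; z; u] ->
  valid Q (FAll x (FAll y (FEx u (FAnd (FSet u)
      (FAll z (FIff (FIn z u) (FOr (FEq z x) (FEq z y)))))))).
Proof.
move=> U; eexists=> A rho env; updE U.
wall=> a; wall=> b; apply: (wp_exI (upn a b)); apply: wp_pair; first exact: wp_true.
wall=> c; rewrite PIn_upn; apply: wp_pair; apply: wp_lam => e he; whyp he.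
Qed.

Definition index (a : name) : Type := if a is Coll J _ _ then J else Empty_set.
Definition elt_real (a : name) : index a -> baire :=
  match a with Urel _ => fun i => match i with end | Coll J p x => p end.
Definition elt (a : name) : index a -> name :=
  match a with Urel _ => fun i => match i with end | Coll J p x => x end.

Lemma pmem_elt a (i : index a) : pmem (elt_real i) (elt i) a.
Proof. by case: a i => [n []|J p x] i; exists i. Qed.

Lemma pmemP p c a : pmem p c a -> exists i : index a, elt_real i = p /\ elt i = c.
Proof. by case: a => // J q x. Qed.

Lemma valid_union x y z u : uniq [:: x; y; z; u] ->
  valid Q (FAll x (FImp (FSet x) (FEx u (FAnd (FSet u)
      (FAll z (FIff (FIn z u) (FEx y (FAnd (FIn y x) (FIn z y))))))))).
Proof.
move=> U; eexists=> A rho env; updE U.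
wall=> a; apply: wp_lam => e0 sa.
pose un := Coll (fun i : {i : index a & index (elt i)} => bp (elt_real (tag i)) (elt_real (tagged i)))
                (fun i => elt (tagged i)).
apply: (wp_exI un); apply: wp_pair; first exact: wp_true.
wall=> c; apply: wp_pair; apply: wp_lam => e he.
  apply: wp_inE; first by whyp he.
    move=> d f hf; case: (hf) => /pmemP[i [e1 e2]] _.
    apply: (wp_exI (elt (tag i))); apply: wp_pair.
      apply: wp_mem_in; apply: (wp_fun cont_pr0); apply: wp_fst; apply: wp_var0.
      split; last by case: hf => _ h; exact: h.
      by move: e1 => /= <-; rewrite /PMem pr0_bp; apply: pmem_elt.
    apply: wp_in_eql; first by apply: wp_sym; apply: wp_snd; whyp hf.
    apply: wp_mem_in; apply: (wp_fun cont_pr1); apply: wp_fst; apply: wp_var0.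
    split; last by case: hf => _ h; exact: h.
    by move: e1 e2 => /= <- <-; rewrite /PMem pr1_bp; apply: pmem_elt.
  closed.
apply: wp_exE; first by whyp he.
  move=> b d hd; apply: wp_inE; [by apply: wp_fst; whyp hd| |closed].
  move=> b' d' hd'.
  apply: wp_inE; last closed.
    apply: wp_in_eqr; first by apply: wp_snd; whyp hd'.
    by apply: wp_snd; whyp hd.
  move=> c' f hf; case: (hd') => hb' _; case: (hf) => hc' _.
  have [i [e1 e2]] := pmemP hb'; subst b'; have [k [e3 e4]] := pmemP hc'; subst c'.
  apply: (wp_inI (c := elt k)); last by apply: wp_snd; whyp hf.
  apply: (@wp_bp _ _ _ _ (eq (elt_real i)) (eq (elt_real k))).
  - by apply: (wp_fun cont_pr0); apply: wp_shift; apply: wp_var0.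
  - by apply: (wp_fun cont_pr0); apply: wp_var0.
  by move=> _ _ <- <-; exists (Tagged (fun i => index (elt i)) k).
closed.
Qed.

Definition omega : name := Coll numeral Urel.

Lemma valid_infinity z u : z != u ->
  valid Q (FEx u (FAnd (FSet u) (FAll z (FIff (FIn z u) (FNat z))))).
Proof.
move=> zu; have U : uniq [:: z; u] by rewrite /= inE zu.
eexists=> A rho env; updE U; apply: (wp_exI omega); apply: wp_pair; first exact: wp_true.
wall=> c; apply: wp_pair; apply: wp_lam => e he.
  apply: wp_inE; first by whyp he.
    move=> d f [[n [e1 <-]]]; case: c he => [m|J p x] he; last by move=> /PEq_kind[[]|[]].
    move=> /PEq_urel ->; apply: (wp_fun cont_pr0); apply: wp_var0; by exists n.
  by apply: closed_uniq => v w [n -> ->] [m [->] ->].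
case: he => n -> ->; apply: (wp_inI (c := Urel n)); last exact: wp_refl.
by apply: wp_var0; exists n.
Qed.

(** Up to equality, a subset of [a] is a predicate on indices and realizers, [S i p] saying that [p]
    puts element [i] into it. All such predicates form a type that can index a name, which yields
    the powerset; for separation, [p] realizes the formula. *)
Definition subn_ (a : name) (S : index a -> baire -> Prop) : name :=
  Coll (fun ip : {ip : index a * baire | S ip.1 ip.2} =>
          bp (elt_real (sval ip).1) (sval ip).2)
       (fun ip => elt (sval ip).1).

Lemma pmem_sub a S (i : index a) p : S i p -> pmem (bp (elt_real i) p) (elt i) (subn_ S).
Proof. by move=> Sp; exists (exist _ (i, p) Sp). Qed.

Lemma pmem_subP a (S : index a -> baire -> Prop) q c : pmem q c (subn_ S) ->
  exists i p, [/\ S i p, q = bp (elt_real i) p & c = elt i].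
Proof. by case=> [[[i p] Sp]] /= [<- <-]; exists i, p. Qed.

Lemma valid_powerset x y z u : uniq [:: x; y; z; u] ->
  valid Q (FAll x (FImp (FSet x) (FEx u (FAnd (FSet u)
      (FAll z (FIff (FIn z u)
        (FAnd (FSet z) (FAll y (FImp (FIn y z) (FIn y x)))))))))).
Proof.
move=> U; eexists=> A rho env; updE U.
wall=> a; apply: wp_lam => e0 sa.
pose pw := Coll (fun S : index a -> baire -> Prop => numeral 0) (fun S => subn_ S).
apply: (wp_exI pw); apply: wp_pair; first exact: wp_true.
wall=> c; apply: wp_pair; apply: wp_lam => e he.
  apply: wp_pair.
    apply: wp_true => e1; move: he; rewrite PInE => /Jp_ex[d [b [[S [_ <-]]]]].
    by move=> /PEq_kind[[]|[]].
  wall=> b; apply: wp_lam => f hf; apply: wp_inE; [by whyp he| |closed].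
  move=> s d hd; have [[S [_ Ss]] _] := hd; subst s.
  apply: wp_inE; last closed.
    by apply: wp_in_eqr; [apply: wp_snd; whyp hd|whyp hf].
  move=> b' d' hd'; have [hb' _] := hd'; have [i [p [_ e1 e2]]] := pmem_subP hb'; subst b'.
  apply: (wp_inI (c := elt i)); last by apply: wp_snd; whyp hd'.
  apply: (wp_fun cont_pr0); apply: (wp_fun cont_pr0); apply: wp_var0.
  by rewrite e1 pr0_bp; apply: pmem_elt.
have [sc hc] := he; pose S (i : index a) p := PIn Q A (elt i) c p.
apply: (wp_inI (c := subn_ S)); first by apply: wp_cst; exists S.
have he' b : PAnd (PSet c) (PImp (PIn Q A b c) (PIn Q A b a)) e by split=> //; apply: hc.
apply: wp_eqI; first by left.
  move=> b p hp; apply: wp_inE; last closed.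
    apply: wp_app; first by apply: wp_snd; whyp (he' b).
    by apply: wp_mem_in; whyp (hp : PMem b c p).
  move=> b' d hd; have [hb' _] := hd; have [i [e1 e2]] := pmemP hb'; subst b'.
  apply: (wp_inI (c := elt i)); last by apply: wp_snd; whyp hd.
  apply: (@wp_bp _ _ _ _ (eq (elt_real i)) (PIn Q A (elt i) c)).
  - by apply: (wp_fun cont_pr0); apply: wp_var0.
  - apply: wp_in_eql; first by apply: wp_snd; whyp hd.
    by apply: wp_mem_in; whyp (hp : PMem b c p).
  by move=> _ q <- hq; apply: (pmem_sub (hq : S i q)).
move=> b p /pmem_subP[i [q [Sq e1 ->]]]; apply: (wp_fun cont_pr1); apply: wp_var0.
by rewrite e1 pr1_bp.
Qed.

Lemma valid_separation B x a b : uniq [:: x; a; b] -> b \notin fv B ->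
  valid Q (FAll a (FImp (FSet a) (FEx b (FAnd (FSet b)
      (FAll x (FIff (FIn x b) (FAnd (FIn x a) B))))))).
Proof.
move=> U bB; have xa : x != a by move: U; rewrite /= !inE negb_or => /andP[/andP[]].
have bx : b != x by move: U; rewrite /= !inE negb_or [b == x]eq_sym => /andP[/andP[]].
have [T hT] := leibniz_prog Q B x.
eexists=> A rho env; cbn [sem]; wall=> s; apply: wp_lam => e0; rewrite /PSet upd_x => ss.
pose r := upd rho a s.
pose S (i : index s) p := sem Q A B (upd r x (elt i)) p.
apply: (wp_exI (subn_ S)); apply: wp_pair; first by apply: wp_true => e1; rewrite /PSet upd_x.
wall=> c; cbn [sem FIff]; rewrite -/r (upd_swap _ _ _ bx) sem_upd_notin //.
have -> : upd (upd r x c) b (subn_ S) x = c by rewrite /upd eq_sym (negbTE bx) eqxx.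
have -> : upd (upd r x c) b (subn_ S) b = subn_ S by rewrite upd_x.
have -> : upd (upd r x c) b (subn_ S) a = s.
  rewrite /r /upd; case: eqP U => [->|_]; first by rewrite /= !inE eqxx /= andbF.
  by rewrite eq_sym (negbTE xa) eqxx.
apply: wp_pair; apply: wp_lam => e he.
  have key t d : PAnd (PMem t (subn_ S)) (PEq Q A c t) d ->
      exists i q, [/\ t = elt i, pr0 d = bp (elt_real i) q & S i q].
    by case=> /pmem_subP[i [q [Sq e1 ->]]] _; exists i, q.
  apply: wp_inE; first by whyp he.
    move=> t d hd; have [i [q [e1 e2 Sq]]] := key t d hd; subst t; apply: wp_pair.
      apply: (wp_inI (c := elt i)); last by apply: wp_snd; whyp hd.
      apply: (wp_fun cont_pr0); apply: (wp_fun cont_pr0); apply: wp_var0.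
      by rewrite e2 pr0_bp; apply: pmem_elt.
    apply: (wp_call (P := PAnd (PEq Q A (elt i) c) (sem Q A B (upd r x (elt i))))); last exact: hT.
    apply: wp_pair; first by apply: wp_sym; apply: wp_snd; whyp hd.
    apply: (wp_fun cont_pr1); apply: (wp_fun cont_pr0); apply: wp_var0.
    by rewrite e2 pr1_bp.
  closed.
apply: wp_inE; [by apply: wp_fst; whyp he| |closed].
move=> t d hd; have [hs _] := hd; have [i [e1 e2]] := pmemP hs; subst t.
apply: (wp_inI (c := elt i)); last by apply: wp_snd; whyp hd.
apply: (@wp_bp _ _ _ _ (eq (elt_real i)) (S i)).
- by apply: (wp_fun cont_pr0); apply: wp_var0.
- apply: (wp_call (P := PAnd (PEq Q A c (elt i)) (sem Q A B (upd r x c)))); last exact: hT.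
  by apply: wp_pair; [apply: wp_snd; whyp hd|apply: wp_snd; whyp he].
by move=> _ q <- hq; apply: pmem_sub.
Qed.

(** A witness is chosen for each element together with each realizer of the existential statement.
    The bounding set consists of all of them, indexed by those pairs, and membership in it carries
    no information. *)
Lemma valid_collection B x y a b : uniq [:: x; y; a; b] -> b \notin fv B ->
  valid Q (FAll a (FImp (FSet a)
      (FImp (FAll x (FImp (FIn x a) (FEx y B)))
            (FEx b (FAnd (FSet b)
              (FAll x (FImp (FIn x a) (FEx y (FAnd (FIn y b) B))))))))).
Proof.
move=> U bB; have [T hT] := leibniz_prog Q B x.
have nq i j : i < 4 -> j < 4 -> i != j ->
    (nth 0 [:: x; y; a; b] i == nth 0 [:: x; y; a; b] j) = false.
  by move=> ib jb ij; rewrite nth_uniq // (negbTE ij).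
have xa := nq 0 2 isT isT isT; have ax := nq 2 0 isT isT isT.
have yx := nq 1 0 isT isT isT; have xy := nq 0 1 isT isT isT.
have bx := nq 3 0 isT isT isT; have bY := nq 3 1 isT isT isT.
have ay := nq 2 1 isT isT isT; have ab := nq 2 3 isT isT isT.
have yb := nq 1 3 isT isT isT; have xb := nq 0 3 isT isT isT.
rewrite /= in xa ax yx xy bx bY ay ab yb xb.
eexists=> A rho env; cbn [sem]; wall=> s; apply: wp_lam => e0; rewrite /PSet upd_x => ss.
set r := upd rho a s; apply: wp_lam => h hh.
have hr c : upd r x c x = c /\ upd r x c a = s by rewrite /r /upd !eqxx ax.
have {}hh c : PImp (PIn Q A c s) (PEx Q A (fun d => sem Q A B (upd (upd r x c) y d))) h.
  by have [e1 e2] := hr c; have := hh c; rewrite e1 e2.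
have /choice[f hf] (ie : index s * baire) : exists d,
    (exists d, sem Q A B (upd (upd r x (elt ie.1)) y d) ie.2) ->
    sem Q A B (upd (upd r x (elt ie.1)) y d) ie.2.
  case: (EM (exists d, sem Q A B (upd (upd r x (elt ie.1)) y d) ie.2)) => [[d hd]|no].
    by exists d.
  by exists (Urel 0) => /no.
pose w := Coll (fun ie : index s * baire => numeral 0) f.
apply: (wp_exI w); apply: wp_pair; first by apply: wp_true => e1; rewrite /PSet upd_x.
wall=> c; apply: wp_lam => e; cbn [sem].
have -> : upd (upd r b w) x c x = c by rewrite upd_x.
have -> : upd (upd r b w) x c a = s by rewrite /r /upd ax ab eqxx.
move=> he; apply: wp_inE; [by whyp he| |closed].
move=> t d hd; have [hs _] := hd; have [i [e1 e2]] := pmemP hs; subst t.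
apply: wp_exE; last closed.
  apply: wp_app; first by whyp (hh (elt i)).
  by apply: wp_mem_in; apply: wp_fst; whyp hd.
move=> v g hg; apply: (wp_exI (f (i, g))).
have E : sem Q A B (upd (upd (upd r b w) x c) y (f (i, g))) =
         sem Q A B (upd (upd r y (f (i, g))) x c).
  rewrite (@upd_swap _ b x) ?bx // (@upd_swap _ b y) ?bY // sem_upd_notin //.
  by rewrite upd_swap // xy.
rewrite E upd_x; have -> : upd (upd (upd r b w) x c) y (f (i, g)) b = w.
  by rewrite /upd bY bx eqxx.
apply: wp_pair; first by apply: wp_mem_in; apply: wp_cst; exists (i, g).
apply: (wp_call (P := PAnd (PEq Q A (elt i) c) (sem Q A B (upd (upd r y (f (i, g))) x (elt i))))); last exact: hT.
apply: wp_pair; first by apply: wp_sym; apply: wp_snd; whyp hd.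
apply: wp_var0; rewrite -upd_swap ?xy //; apply: (hf (i, g)); by exists v.
Qed.

(** Again a fixed point whose correctness follows by induction on the name; the realizer [h] of the
    premise is the environment of the recursive call. *)
Lemma valid_set_induction B x y : x != y -> y \notin allvars B ->
  valid Q (FImp (FAll x (FImp (FAll y (FImp (FIn y x) (rename x y B))) B)) (FAll x B)).
Proof.
move=> xy yB; have yfB : y \notin fv B by apply: contra yB; apply: fv_allvars.
have [L hL] := leibniz_prog Q B x.
pose H := FAll x (FImp (FAll y (FImp (FIn y x) (rename x y B))) B).
have E A rho c d : sem Q A (rename x y B) (upd (upd rho x c) y d) = sem Q A B (upd rho x d).
  rewrite sem_rename // upd_x (@upd_swap rho x y _ _ xy) upd_upd.
  by rewrite -(@upd_swap rho x y _ _ xy) sem_upd_notin.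
have [T hT] : {T | forall A rho f h c, sem Q A H rho h ->
    (forall d p, pmem p d c -> wp A f h (sem Q A B (upd rho x d))) ->
    wp A T (bp f h) (sem Q A B (upd rho x c))}.
  eexists=> A rho f h c hh IH.
  have {}hh : PImp (PAll (fun d => PImp (PIn Q A d c) (sem Q A B (upd rho x d))))
      (sem Q A B (upd rho x c)) h.
    move=> a ha; apply: (hh c a) => d e he.
    have {}he : PIn Q A d c e by move: he => /=; rewrite /upd eqxx (negbTE xy) eqxx.
    by have [v v1 v2] := ha d e he; exists v => //; move: v2; rewrite -(E A rho c d).
  apply: wp_app; first by whyp hh.
  wall=> d; apply: wp_lam => e he; apply: wp_inE; [by whyp he| |closed].
  move=> d' g hg.
  apply: (wp_call (P := PAnd (PEq Q A d' d) (sem Q A B (upd rho x d')))); last exact: hL.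
  apply: wp_pair; first by apply: wp_sym; apply: wp_snd; whyp hg.
  apply: wp_callf; first by whyp (erefl f).
  do 3 apply: wp_shift; eapply wp_here.
  by case: hg => hm _; apply: IH hm.
have [f hf] := wp_fix T.
eexists=> A rho env; apply: wp_lam => h hh; wall=> c; apply: (wp_call (P := eq h)).
  by whyp (erefl h).
move=> _ <-; elim: c => [n|J p z IH]; apply: hf; apply: hT => // d q [i [_ <-]].
exact: IH.
Qed.

Lemma valid_IZF phi : IZF phi -> valid Q phi.
Proof.
case=> {phi}.
- by move=> x; eexists=> A rho env /=; wall=> c; apply: wp_refl.
- by move=> B x y xy yB; apply: valid_close; apply: valid_leibniz.
- move=> x; eexists=> A rho env /=; wall=> c; apply: wp_true => e a.
  by case; rewrite /PSet upd_x => -[n ->].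
- move=> x y xy; eexists=> A rho env /=; wall=> c; wall=> d; apply: wp_lam => a h.
  by apply: wp_true => e; apply: PIn_set h.
- by move=> *; apply: valid_rel.
- by move=> *; apply: valid_total.
- by move=> *; apply: valid_functional.
- by move=> *; apply: valid_zero.
- by move=> *; apply: valid_succ.
- by move=> *; apply: valid_proj.
- by move=> *; apply: valid_comp.
- by move=> *; apply: valid_rec_nil.
- by move=> *; apply: valid_rec0.
- by move=> *; apply: valid_recS.
- by move=> *; apply: valid_succ_neq0.
- by move=> *; apply: valid_succ_inj.
- by move=> *; apply: valid_close; apply: valid_nat_induction.
- by move=> *; apply: valid_extensionality.
- by move=> *; apply: valid_pairing.
- by move=> *; apply: valid_union.
- by move=> *; apply: valid_infinity.
- by move=> *; apply: valid_powerset.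
- by move=> *; apply: valid_close; apply: valid_separation.
- by move=> *; apply: valid_close; apply: valid_collection.
- by move=> *; apply: valid_close; apply: valid_set_induction.
Qed.

End SetAxioms.

(** * Realizers as advice *)

Fixpoint prf_code (p : prf) : nat :=
  match p with
  | PZero => code [:: 0]
  | PSucc => code [:: 1]
  | PProj i => code [:: 2; i]
  | PComp g hs => code [:: 3, prf_code g & [seq prf_code h | h <- hs]]
  | PRec g h => code [:: 4; prf_code g; prf_code h]
  end.

Lemma code_inj : injective code. Proof. exact: can_inj CodeSeq.codeK. Qed.

Lemma prf_code_inj : injective prf_code.
Proof.
rewrite /injective; fix IH 1 => -[||i|g hs|g h] [||i'|g' hs'|g' h'] /code_inj // [].
- by move=> ->.
- move=> /IH ->; move: hs hs'.
  fix IHs 1 => -[|h hs] [|h' hs'] //= [/IH -> /IHs [->]] //.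
- by move=> /IH -> /IH ->.
Qed.

Fixpoint form_code (phi : form) : nat :=
  match phi with
  | FRel f g xs => code [:: 0, prf_code f, prf_code g & xs]
  | FNat x => code [:: 1; x]
  | FSet x => code [:: 2; x]
  | FIn x y => code [:: 3; x; y]
  | FEq x y => code [:: 4; x; y]
  | FAnd B C => code [:: 5; form_code B; form_code C]
  | FOr B C => code [:: 6; form_code B; form_code C]
  | FNot B => code [:: 7; form_code B]
  | FImp B C => code [:: 8; form_code B; form_code C]
  | FAll x B => code [:: 9; x; form_code B]
  | FEx x B => code [:: 10; x; form_code B]
  end.

Lemma form_code_inj : injective form_code.
Proof.
elim=> [f g xs|x|x|x y|x y|B IHB C IHC|B IHB C IHC|B IHB|B IHB C IHC|x B IHB|x B IHB]
  [f' g' xs'|x'|x'|x' y'|x' y'|B' C'|B' C'|B'|B' C'|x' B'|x' B'] /code_inj // [].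
- by move=> /prf_code_inj -> /prf_code_inj -> ->.
- by move=> ->.
- by move=> ->.
- by move=> -> ->.
- by move=> -> ->.
- by move=> /IHB -> /IHC ->.
- by move=> /IHB -> /IHC ->.
- by move=> /IHB ->.
- by move=> /IHB -> /IHC ->.
- by move=> -> /IHB ->.
- by move=> -> /IHB ->.
Qed.

(** For each formula number a code turning any advice into a realizer is chosen; then the advice is
    defined to have these codes as its columns. The query for column [n] is a computable program
    whose only outcome is the realizer. *)
Lemma valid_realizes (Q : baire -> Prop) (T : form -> Prop) :
  (forall phi, T phi -> valid Q phi) ->
  exists j, idempotent_jump KV j /\ j_realizes KV j T.
Proof.
move=> hT.
have /choice[s hs] n : exists s, forall phi, form_code phi = n -> T phi ->
    forall A, exists2 v, kapp s A v & forall rho, rlzj Q A phi rho v.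
  case: (EM (exists2 phi, form_code phi = n & T phi)) => [[phi <- Tphi]|no]; last first.
    by exists (numeral 0) => phi en Tphi; case: no; exists phi.
  have [t ht] := hT _ Tphi; have [_ [t' ht']] := rlz_sem Q phi.
  exists (ccomp (pcall t' t) (fcode (fun x => bp x (numeral 0)))) => _ /form_code_inj-> _ A.
  have h rho : wp A (pcall t' t) (numeral 0) (rlzj Q A phi rho).
    by apply: (wp_call (ht A rho (numeral 0))); apply: ht'.
  have [v tv _] := h (fun=> Urel 0); exists v.
    by apply: ccompP tv; apply: (@fcodeP (fun x => bp x (numeral 0))); solve_cont.
  by move=> rho; have [w tw hw] := h rho; rewrite (kapp_fun tv tw).
pose A : baire := fun k => if decode k is [:: n; m] then s n m else 0.
have colA n : col A n = s n by apply: funext => m; rewrite /col /A CodeSeq.codeK.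
exists (jop Q A); split; first exact: jop_idempotent.
move=> phi Tphi; have [v sv hv] := hs _ phi erefl Tphi A; exists v => //.
exists (scons 4 (numeral (form_code phi))); first exact: computable_advice.
move=> z; split=> [[_ /jv_inv[_ _ _ _ /(_ erefl)]]|->].
  by rewrite colA => /kapp_fun; apply.
split; last by apply: jv_adv => //; rewrite colA.
by apply: jdom_adv => //; exists v; rewrite colA.
Qed.

Lemma valid_not Q phi : (forall A rho e, ~ sem Q A phi rho e) -> valid Q (FNot phi).
Proof. by move=> h; eexists=> A rho env; apply: wp_true => e a; apply: h. Qed.

(** * Semantic versions of the formulas of analysis *)

(** Names stand in place of variables. The semantic versions of the sentences below are convertible
    with their [sem], so that no assignment has to be carried through the analysis. *)
Inductive nexp : Type :=
| NVar of name
| NCst of nat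
| NAdd of nexp & nexp
| NMul of nexp & nexp
| NPow2 of nexp.

Fixpoint nvars (t : nexp) : seq name :=
  match t with
  | NVar x => [:: x]
  | NCst _ => [::]
  | NAdd s r | NMul s r => nvars s ++ nvars r
  | NPow2 s => nvars s
  end.

Fixpoint ncode (t : nexp) (o : nat) : prf :=
  match t with
  | NVar _ => PProj o
  | NCst n => iter n (fun p => PComp PSucc [:: p]) PZero
  | NAdd s r => PComp padd [:: ncode s o; ncode r (o + size (nvars s))]
  | NMul s r => PComp pmul [:: ncode s o; ncode r (o + size (nvars s))]
  | NPow2 s => PComp ppow2 [:: ncode s o]
  end.

Definition nqexp : Type := (nexp * nexp * nexp)%type.
Definition nqadd (u v : nqexp) : nqexp :=
  let: (a, b, d) := u in let: (a', b', d') := v in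
  (NAdd (NMul a d') (NMul a' d), NAdd (NMul b d') (NMul b' d), NMul d d').
Definition nqmul (u v : nqexp) : nqexp :=
  let: (a, b, d) := u in let: (a', b', d') := v in
  (NAdd (NMul a a') (NMul b b'), NAdd (NMul a b') (NMul b a'), NMul d d').
Definition nq0 : nqexp := (NCst 0, NCst 0, NCst 1).
Definition nq1 : nqexp := (NCst 1, NCst 0, NCst 1).
Definition nqN1 : nqexp := (NCst 0, NCst 1, NCst 1).
Definition nq2N (k : name) : nqexp := (NCst 1, NCst 0, NPow2 (NVar k)).

Definition SAeq (s t : nexp) : prop :=
  PRel (ncode s 0) (ncode t (size (nvars s))) (nvars s ++ nvars t).
Definition SAle (s t : nexp) : prop :=
  PRel (PComp prsub [:: ncode t (size (nvars s)); ncode s 0]) PZero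
       (nvars s ++ nvars t).
Definition SAlt (s t : nexp) : prop := SAle (NAdd s (NCst 1)) t.

Definition SQlt (u v : nqexp) : prop :=
  let: (a, b, d) := u in let: (a', b', d') := v in
  SAlt (NAdd (NMul a d') (NMul b' d)) (NAdd (NMul a' d) (NMul b d')).
Definition SQdist (u v w : nqexp) : prop :=
  PAnd (SQlt u (nqadd v w)) (SQlt v (nqadd u w)).

Section Shallow.

Variables (Q : baire -> Prop) (A : baire).

Notation "'Ex' x .. y , p" := (PEx Q A (fun x => .. (PEx Q A (fun y => p)) ..))
  (at level 200, x binder, y binder, right associativity).
Notation "'All' x .. y , p" := (PAll (fun x => .. (PAll (fun y => p)) ..))
  (at level 200, x binder, y binder, right associativity).

Definition PIff (P R : prop) : prop := PAnd (PImp P R) (PImp R P).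
Definition PAllN (F : name -> prop) : prop := All n, PImp (PNat n) (F n).
Definition PExN (F : name -> prop) : prop := Ex n, PAnd (PNat n) (F n).

Definition SUpair (p x y : name) : prop := PAnd (PSet p)
  (All z, PIff (PIn Q A z p) (POr Q A (PEq Q A z x) (PEq Q A z y))).
Definition SOpair (p x y : name) : prop :=
  Ex s t, PAnd (SUpair s x x) (PAnd (SUpair t x y) (SUpair p s t)).
Definition SMaps (f x y : name) : prop := Ex p, PAnd (SOpair p x y) (PIn Q A p f).

Definition SNatseq (f : name) : prop :=
  PAnd (PSet f)
  (PAnd (All p, PImp (PIn Q A p f) (PExN (fun n => PExN (fun m => SOpair p n m))))
  (PAnd (PAllN (fun n => PExN (fun m => SMaps f n m)))
    (All n m m', PImp (PAnd (SMaps f n m) (SMaps f n m')) (PEq Q A m m')))).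

Definition STriple (v a b c : name) : prop :=
  Ex w, PAnd (SOpair w b c) (SOpair v a w).
Definition SRational (v : name) : prop :=
  PExN (fun a => PExN (fun b => PExN (fun c => STriple v a b c))).

Definition SRatseq (x : name) : prop :=
  PAnd (PSet x)
  (PAnd (All p, PImp (PIn Q A p x) (PExN (fun n =>
           Ex v, PAnd (SRational v) (SOpair p n v))))
  (PAnd (PAllN (fun n => Ex v, PAnd (SRational v) (SMaps x n v)))
    (All n v v', PImp (PAnd (SMaps x n v) (SMaps x n v')) (PEq Q A v v')))).

Definition soperand : Type := name -> (nqexp -> prop) -> prop.

Definition SRvar (x : name) : soperand := fun n F =>
  Ex v, PAnd (SMaps x n v) (PExN (fun a => PExN (fun b => PExN (fun c =>
    PAnd (STriple v a b c) (F (NVar a, NVar b, NAdd (NVar c) (NCst 1))))))).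
Definition SRcst (q : nqexp) : soperand := fun _ F => F q.
Definition SRadd (X Y : soperand) : soperand := fun n F =>
  X n (fun u => Y n (fun v => F (nqadd u v))).
Definition SRmul (X Y : soperand) : soperand := fun n F =>
  X n (fun u => Y n (fun v => F (nqmul u v))).
Definition SRdyadic (s : name) : soperand := fun n F =>
  PExN (fun m => PAnd (SMaps s n m) (F (NVar m, NCst 0, NPow2 (NVar n)))).

Definition SEventually (F : name -> prop) : prop :=
  PExN (fun i => PAllN (fun n => PImp (SAle (NVar i) (NVar n)) (F n))).

Definition SRlt (X Y : soperand) : prop :=
  PExN (fun k => SEventually (fun n =>
    X n (fun u => Y n (fun v => SQlt (nqadd u (nq2N k)) v)))).
Definition SRle (X Y : soperand) : prop :=
  PAllN (fun k => SEventually (fun n =>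
    X n (fun u => Y n (fun v => SQlt u (nqadd v (nq2N k)))))).
Definition SReq (X Y : soperand) : prop :=
  PAllN (fun k => SEventually (fun n =>
    X n (fun u => Y n (fun v => SQdist u v (nq2N k))))).
Definition SRclose (k : name) (X Y : soperand) : prop :=
  PAnd (SRlt X (SRadd Y (SRcst (nq2N k)))) (SRlt Y (SRadd X (SRcst (nq2N k)))).

Definition SReal (x : name) : prop :=
  PAnd (SRatseq x) (PAllN (fun n => PAllN (fun m => PImp (SAle (NVar n) (NVar m))
    (SRvar x n (fun u => SRvar x m (fun v => SQdist u v (nq2N n))))))).
Definition SReal_in (lo hi : nqexp) (x : name) : prop :=
  PAnd (SReal x) (PAnd (SRle (SRcst lo) (SRvar x)) (SRle (SRvar x) (SRcst hi))).

Definition SRealfun (f : name) : prop :=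
  PAnd (PSet f)
  (PAnd (All p, PImp (PIn Q A p f)
     (Ex x y, PAnd (SReal_in nq0 nq1 x) (PAnd (SReal_in nqN1 nq1 y) (SOpair p x y))))
  (PAnd (All x, PImp (SReal_in nq0 nq1 x)
     (Ex y, PAnd (SReal_in nqN1 nq1 y) (SMaps f x y)))
    (All x y x' y', PImp (PAnd (SMaps f x y) (PAnd (SMaps f x' y')
        (SReq (SRvar x) (SRvar x')))) (SReq (SRvar y) (SRvar y'))))).

Definition SContinuous (f : name) : prop :=
  All x y, PImp (SMaps f x y) (PAllN (fun k => PExN (fun m => All x' y',
    PImp (PAnd (SMaps f x' y') (SRclose m (SRvar x) (SRvar x')))
         (SRclose k (SRvar y) (SRvar y'))))).

Definition SValue_at (f : name) (q : nqexp) (y : name) : prop :=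
  Ex x, PAnd (SReq (SRvar x) (SRcst q)) (SMaps f x y).

Definition SBinary (i : nat) (b s : name) : prop :=
  PAnd (SNatseq b) (PAnd (SNatseq s)
  (PAnd (PAllN (fun n => PAllN (fun m =>
           PImp (SMaps b n m) (SAle (NVar m) (NCst 1)))))
  (PAnd (PAllN (fun n => PAllN (fun m =>
           PImp (PAnd (SMaps s n m) (SAeq (NVar n) (NCst 0))) (SAeq (NVar m) (NCst i)))))
    (PAllN (fun n => PAllN (fun n' => PAllN (fun m => PAllN (fun m' => PAllN (fun k =>
       PImp (PAnd (SMaps s n m) (PAnd (SMaps s n' m') (PAnd (SMaps b n k)
              (SAeq (NVar n') (NAdd (NVar n) (NCst 1))))))
            (SAeq (NVar m') (NAdd (NMul (NCst 2) (NVar m)) (NVar k)))))))))))).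

Definition SLLPO : prop := All x y, PImp (PAnd (SReal x) (SReal y))
  (POr Q A (SRle (SRvar x) (SRvar y)) (SRle (SRvar y) (SRvar x))).

Definition SRDIV : prop := All x y,
  PImp (PAnd (SReal_in nq0 nq1 x) (PAnd (SReal_in nq0 nq1 y) (SRle (SRvar x) (SRvar y))))
    (Ex z, PAnd (SReal_in nq0 nq1 z) (SReq (SRvar x) (SRmul (SRvar y) (SRvar z)))).

Definition SBE : prop := All x, PImp (SReal_in nq0 nq1 x)
  (Ex b s, PAnd (SBinary 0 b s) (SReq (SRvar x) (SRdyadic s))).

Definition SIVT : prop := All f, PImp
  (PAnd (SRealfun f) (PAnd (SContinuous f)
    (Ex y z, PAnd (SValue_at f nq0 y) (PAnd (SValue_at f nq1 z)
       (POr Q A (PAnd (SRlt (SRvar y) (SRcst nq0)) (SRlt (SRcst nq0) (SRvar z)))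
                (PAnd (SRlt (SRvar z) (SRcst nq0)) (SRlt (SRcst nq0) (SRvar y))))))))
  (Ex x y, PAnd (SReal_in nq0 nq1 x) (PAnd (SMaps f x y) (SReq (SRvar y) (SRcst nq0)))).

Definition STree (t : name) : prop :=
  PAnd (PSet t)
  (PAnd (All c, PImp (PIn Q A c t) (PAnd (PNat c) (SAlt (NCst 0) (NVar c))))
  (PAnd (PAllN (fun c => POr Q A (PIn Q A c t) (PNot (PIn Q A c t))))
    (PAllN (fun c => PAllN (fun c' => PImp (PAnd (SAlt (NCst 0) (NVar c)) (PAnd (PIn Q A c' t)
       (POr Q A (SAeq (NVar c') (NMul (NCst 2) (NVar c)))
                (SAeq (NVar c') (NAdd (NMul (NCst 2) (NVar c)) (NCst 1))))))
       (PIn Q A c t)))))).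

Definition SInfinite (t : name) : prop :=
  PAllN (fun n => PExN (fun c => PAnd (PIn Q A c t)
    (PAnd (SAle (NPow2 (NVar n)) (NVar c))
          (SAlt (NVar c) (NPow2 (NAdd (NVar n) (NCst 1))))))).

Definition SWKL : prop := All t, PImp (PAnd (STree t) (SInfinite t))
  (Ex b s, PAnd (SBinary 1 b s) (PAllN (fun n => PAllN (fun m =>
     PImp (SMaps s n m) (PIn Q A m t))))).

Lemma sem_LLPO rho : sem Q A LLPO rho = SLLPO. Proof. by []. Qed.
Lemma sem_RDIV rho : sem Q A RDIV rho = SRDIV. Proof. by []. Qed.
Lemma sem_BE rho : sem Q A BE rho = SBE. Proof. by []. Qed.
Lemma sem_IVT rho : sem Q A IVT rho = SIVT. Proof. by []. Qed.
Lemma sem_WKL rho : sem Q A WKL rho = SWKL. Proof. by []. Qed.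

End Shallow.

(** * Ordered pairs and functions on the natural numbers *)

(** Realizability with the realizer forgotten, used where only the truth of a statement matters,
    above all for facts about extracted sequences. *)
Definition inh (P : prop) : Prop := exists e, P e.

Section Pairs.

Variable Q : baire -> Prop.

Lemma inh_wp A t env P : wp A t env P -> inh P.
Proof. by case=> v _ Pv; exists v. Qed.

Lemma inh_prog A (P R : prop) (c : baire) :
  (forall e, P e -> wp A c e R) -> inh P -> inh R.
Proof. by move=> h [e /h/inh_wp]. Qed.

Lemma inh_and P R : inh (PAnd P R) <-> inh P /\ inh R.
Proof.
split=> [[e [h1 h2]]|[[a ha] [b hb]]]; first by split; [exists (pr0 e)|exists (pr1 e)].
by exists (bp a b); split; rewrite ?pr0_bp ?pr1_bp.
Qed.

Lemma inh_ex A X (P : X -> prop) : inh (PEx Q A P) <-> exists x, inh (P x).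
Proof.
split=> [[e /Jp_ex[d [x hd]]]|[x [d hd]]]; first by exists x, d.
by exists (scons 0 d); apply: Jp_ret; exists x.
Qed.

Lemma inh_imp P R : inh (PImp P R) -> inh P -> inh R.
Proof. by case=> e he [a /he[v _ hv]]; exists v. Qed.

Lemma inh_all X (P : X -> prop) x : inh (PAll P) -> inh (P x).
Proof. by case=> e he; exists e; apply: he. Qed.

Lemma inh_or A P R : inh (POr Q A P R) -> inh P \/ inh R.
Proof. by case=> e /Jp_ex[d [[_ h]|[_ h]]]; [left|right]; exists (pr1 d). Qed.

Lemma inh_allN F n : inh (PAllN F) -> inh (F (Urel n)).
Proof. by move=> /(inh_all (Urel n)) /inh_imp; apply; exists (numeral n), n. Qed.

Lemma inh_exN A F : inh (PExN Q A F) -> exists n, inh (F (Urel n)).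
Proof. by move=> /inh_ex[c /inh_and[[e [n -> _]] h]]; exists n. Qed.

Lemma upair_eq_prog : {t | forall A p x y e, SUpair Q A p x y e ->
  wp A t e (PEq Q A p (upn x y))}.
Proof.
eexists=> A p x y e h; have [sp h2] := h; apply: wp_eqI; first by left.
  move=> c q hq; rewrite PIn_upn; apply: wp_app.
    by apply: wp_fst; apply: (wp_fun cont_pr1); whyp (h2 c).
  by apply: wp_mem_in; whyp (hq : PMem c p q).
move=> c q hq; apply: wp_app.
  by apply: wp_snd; apply: (wp_fun cont_pr1); whyp (h2 c).
by rewrite -PIn_upn; apply: wp_mem_in; whyp (hq : PMem c (upn x y) q).
Qed.

Lemma eq_upair_prog : {t | forall A p x y e, PEq Q A p (upn x y) e ->
  wp A t e (SUpair Q A p x y)}.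
Proof.
eexists=> A p x y e h; apply: wp_pair.
  by apply: wp_true => e1; case: (PEq_kind h) => [[]|[]].
wall=> z; rewrite -PIn_upn; apply: wp_pair; apply: wp_lam => a ha.
  by apply: wp_in_eqr; [whyp h|whyp ha].
by apply: wp_in_eqr; [apply: wp_sym; whyp h|whyp ha].
Qed.

Lemma upn_cong_prog : {t | forall A a b a' b' e,
  PAnd (PEq Q A a a') (PEq Q A b b') e -> wp A t e (PEq Q A (upn a b) (upn a' b'))}.
Proof.
eexists=> A a b a' b' e h; apply: wp_eqI; first by left.
  move=> c p hp; rewrite PIn_upn.
  apply: (wp_orE (P1 := PEq Q A c a) (P2 := PEq Q A c b)); last closed.
  - by rewrite -PIn_upn; apply: wp_mem_in; whyp (hp : PMem c (upn a b) p).
  - by move=> f hf; apply: wp_orI1; apply: wp_trans; [whyp hf|apply: wp_fst; whyp h].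
  by move=> f hf; apply: wp_orI2; apply: wp_trans; [whyp hf|apply: wp_snd; whyp h].
move=> c p hp; rewrite PIn_upn.
apply: (wp_orE (P1 := PEq Q A c a') (P2 := PEq Q A c b')); last closed.
- by rewrite -PIn_upn; apply: wp_mem_in; whyp (hp : PMem c (upn a' b') p).
- move=> f hf; apply: wp_orI1; apply: wp_trans; first by whyp hf.
  by apply: wp_sym; apply: wp_fst; whyp h.
move=> f hf; apply: wp_orI2; apply: wp_trans; first by whyp hf.
by apply: wp_sym; apply: wp_snd; whyp h.
Qed.

Lemma wp_upn_cong A t s env a b a' b' :
  wp A t env (PEq Q A a a') -> wp A s env (PEq Q A b b') ->
  wp A (pcall (sval upn_cong_prog) (cpair t s)) env (PEq Q A (upn a b) (upn a' b')).
Proof.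
by move=> ht hs; apply: (wp_call (wp_pair ht hs)) => e; apply: (proj2_sig upn_cong_prog).
Qed.

Definition opn (a b : name) : name := upn (upn a a) (upn a b).

Lemma opn_cong_prog : {t | forall A a b a' b' e,
  PAnd (PEq Q A a a') (PEq Q A b b') e -> wp A t e (PEq Q A (opn a b) (opn a' b'))}.
Proof.
eexists=> A a b a' b' e h; apply: wp_upn_cong; apply: wp_upn_cong; try by apply: wp_fst; whyp h.
by apply: wp_snd; whyp h.
Qed.

Lemma wp_opn_cong A t s env a b a' b' :
  wp A t env (PEq Q A a a') -> wp A s env (PEq Q A b b') ->
  wp A (pcall (sval opn_cong_prog) (cpair t s)) env (PEq Q A (opn a b) (opn a' b')).
Proof.
by move=> ht hs; apply: (wp_call (wp_pair ht hs)) => e; apply: (proj2_sig opn_cong_prog).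
Qed.

Lemma opair_eq_prog : {t | forall A p x y e, SOpair Q A p x y e ->
  wp A t e (PEq Q A p (opn x y))}.
Proof.
eexists=> A p x y e h; apply: wp_exE; [by whyp h| |closed].
move=> s f hf; apply: wp_exE; [by whyp hf| |closed].
move=> t g hg; apply: (wp_trans (b := upn s t)).
  apply: (wp_call (P := SUpair Q A p s t)); last by apply: (proj2_sig upair_eq_prog).
  by apply: wp_snd; apply: wp_snd; whyp hg.
apply: wp_upn_cong.
  apply: (wp_call (P := SUpair Q A s x x)); last by apply: (proj2_sig upair_eq_prog).
  by apply: wp_fst; whyp hg.
apply: (wp_call (P := SUpair Q A t x y)); last by apply: (proj2_sig upair_eq_prog).
by apply: wp_fst; apply: wp_snd; whyp hg.
Qed.

Lemma wp_opairE A t env p x y : wp A t env (SOpair Q A p x y) ->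
  wp A (pcall (sval opair_eq_prog) t) env (PEq Q A p (opn x y)).
Proof. by move=> h; apply: (wp_call h) => e; apply: (proj2_sig opair_eq_prog). Qed.

Lemma eq_opair_prog : {t | forall A p x y e, PEq Q A p (opn x y) e ->
  wp A t e (SOpair Q A p x y)}.
Proof.
eexists=> A p x y e h; apply: (wp_exI (upn x x)); apply: (wp_exI (upn x y)).
have up a b c u env : wp A u env (PEq Q A a (upn b c)) ->
    wp A (pcall (sval eq_upair_prog) u) env (SUpair Q A a b c).
  by move=> hu; apply: (wp_call hu); apply: (proj2_sig eq_upair_prog).
apply: wp_pair; last apply: wp_pair; apply: up; [exact: wp_refl|exact: wp_refl|].
by whyp h.
Qed.

Lemma wp_opairI A t env p x y : wp A t env (PEq Q A p (opn x y)) ->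
  wp A (pcall (sval eq_opair_prog) t) env (SOpair Q A p x y).
Proof. by move=> h; apply: (wp_call h) => e; apply: (proj2_sig eq_opair_prog). Qed.

Lemma wp_in_upn1 A env a b :
  wp A (pret (cpair (fcode (fun=> numeral 0)) (sval (refl_prog Q)))) env (PIn Q A a (upn a b)).
Proof. by rewrite PIn_upn; apply: wp_orI1; apply: wp_refl. Qed.

Lemma wp_in_upn2 A env a b :
  wp A (pret (cpair (fcode (fun=> numeral 1)) (sval (refl_prog Q)))) env (PIn Q A b (upn a b)).
Proof. by rewrite PIn_upn; apply: wp_orI2; apply: wp_refl. Qed.

Lemma upn_single_prog : {t | forall A a b c e, PEq Q A (upn a a) (upn b c) e ->
  wp A t e (PEq Q A a b)}.
Proof.
eexists=> A a b c e h; apply: wp_sym.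
apply: (wp_orE (P1 := PEq Q A b a) (P2 := PEq Q A b a)); last closed.
- by rewrite -PIn_upn; apply: wp_in_eqr; [apply: wp_sym; whyp h|apply: wp_in_upn1].
- by move=> f hf; whyp hf.
by move=> f hf; whyp hf.
Qed.

(** The unordered pair [upn a b] equals [upn a' a'] or [upn a' b'], and [b] is a member of it. *)
Lemma opn_snd_prog : {t | forall A a b a' b' e, PEq Q A (opn a b) (opn a' b') e ->
  wp A t e (POr Q A (PEq Q A b a') (PEq Q A b b'))}.
Proof.
eexists=> A a b a' b' e h.
apply: (@wp_orE _ _ _ _ _ _ _ (PEq Q A (upn a b) (upn a' a')) (PEq Q A (upn a b) (upn a' b'))); last closed.
- by rewrite -PIn_upn; apply: wp_in_eqr; [whyp h|apply: wp_in_upn2].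
- move=> f hf; apply: (wp_orE (P1 := PEq Q A b a') (P2 := PEq Q A b a')); last closed.
  + by rewrite -PIn_upn; apply: wp_in_eqr; [whyp hf|apply: wp_in_upn2].
  + by move=> g hg; apply: wp_orI1; whyp hg.
  by move=> g hg; apply: wp_orI1; whyp hg.
move=> f hf; rewrite -PIn_upn.
by apply: wp_in_eqr; [whyp hf|apply: wp_in_upn2].
Qed.

Lemma opn_inj_prog : {t | forall A a b a' b' e, PEq Q A (opn a b) (opn a' b') e ->
  wp A t e (PAnd (PEq Q A a a') (PEq Q A b b'))}.
Proof.
have [T hT] : {t | forall A a b a' b' e, PEq Q A (opn a b) (opn a' b') e ->
    wp A t e (PEq Q A a a')}.
  eexists=> A a b a' b' e h.
  apply: (@wp_orE _ _ _ _ _ _ _ (PEq Q A (upn a a) (upn a' a')) (PEq Q A (upn a a) (upn a' b'))); last closed.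
  - by rewrite -PIn_upn; apply: wp_in_eqr; [whyp h|apply: wp_in_upn1].
  - by move=> f hf; apply: (wp_call (P := PEq Q A _ _)); [whyp hf|apply: (proj2_sig upn_single_prog)].
  by move=> f hf; apply: (wp_call (P := PEq Q A _ _)); [whyp hf|apply: (proj2_sig upn_single_prog)].
eexists=> A a b a' b' e h; apply: wp_pair.
  by apply: (wp_call (P := PEq Q A (opn a b) (opn a' b'))); [whyp h|apply: hT].
apply: (wp_orE (P1 := PEq Q A b a') (P2 := PEq Q A b b')); last closed.
- by apply: (wp_call (P := PEq Q A (opn a b) (opn a' b'))); [whyp h|apply: (proj2_sig opn_snd_prog)].
(* Here [b = a']. The same argument from the other side gives [b' = a] or [b' = b], and in the first
   case [b = a' = a = b']. *)
- move=> f hf; apply: (wp_orE (P1 := PEq Q A b' a) (P2 := PEq Q A b' b)); last closed.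
  + apply: (wp_call (P := PEq Q A (opn a' b') (opn a b))); last by apply: (proj2_sig opn_snd_prog).
    by apply: wp_sym; whyp h.
  + move=> g hg; apply: wp_trans; first by whyp hf.
    apply: wp_sym; apply: wp_trans; first by whyp hg.
    by apply: (wp_call (P := PEq Q A (opn a b) (opn a' b'))); [whyp h|apply: hT].
  by move=> g hg; apply: wp_sym; whyp hg.
by move=> f hf; whyp hf.
Qed.

Lemma wp_opn_inj A t env a b a' b' : wp A t env (PEq Q A (opn a b) (opn a' b')) ->
  wp A (pcall (sval opn_inj_prog) t) env (PAnd (PEq Q A a a') (PEq Q A b b')).
Proof. by move=> h; apply: (wp_call h) => e; apply: (proj2_sig opn_inj_prog). Qed.

Lemma maps_in_prog : {t | forall A f x y e, SMaps Q A f x y e ->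
  wp A t e (PIn Q A (opn x y) f)}.
Proof.
eexists=> A f x y e h; apply: wp_exE; [by whyp h| |closed].
move=> p d hd; apply: wp_in_eql; last by apply: wp_snd; whyp hd.
by apply: wp_opairE; apply: wp_fst; whyp hd.
Qed.

Lemma wp_mapsE A t env f x y : wp A t env (SMaps Q A f x y) ->
  wp A (pcall (sval maps_in_prog) t) env (PIn Q A (opn x y) f).
Proof. by move=> h; apply: (wp_call h) => e; apply: (proj2_sig maps_in_prog). Qed.

Lemma wp_mapsI A t env f x y : wp A t env (PIn Q A (opn x y) f) ->
  wp A (pret (cpair (pcall (sval eq_opair_prog) (sval (refl_prog Q))) t)) env (SMaps Q A f x y).
Proof.
move=> h; apply: (wp_exI (opn x y)); apply: wp_pair h.
by apply: wp_opairI; apply: wp_refl.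
Qed.

Definition trn (a b c : name) : name := opn a (opn b c).

Lemma triple_eq_prog : {t | forall A v a b c e, STriple Q A v a b c e ->
  wp A t e (PEq Q A v (trn a b c))}.
Proof.
eexists=> A v a b c e h; apply: wp_exE; [by whyp h| |closed].
move=> w d hd; apply: wp_trans; first by apply: wp_opairE; apply: wp_snd; whyp hd.
apply: wp_opn_cong; first exact: wp_refl.
by apply: wp_opairE; apply: wp_fst; whyp hd.
Qed.

Lemma wp_tripleE A t env v a b c : wp A t env (STriple Q A v a b c) ->
  wp A (pcall (sval triple_eq_prog) t) env (PEq Q A v (trn a b c)).
Proof. by move=> h; apply: (wp_call h) => e; apply: (proj2_sig triple_eq_prog). Qed.

Lemma wp_tripleI A t env v a b c : wp A t env (PEq Q A v (trn a b c)) ->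
  wp A (pret (cpair (pcall (sval eq_opair_prog) (sval (refl_prog Q)))
          (pcall (sval eq_opair_prog) t))) env (STriple Q A v a b c).
Proof.
move=> h; apply: (wp_exI (opn b c)); apply: wp_pair; apply: wp_opairI => //.
exact: wp_refl.
Qed.

Definition fn (g : nat -> name) : name := Coll numeral (fun n => opn (Urel n) (g n)).

Lemma wp_in_fn A s env g n : wp A s env (eq (numeral n)) ->
  wp A (pret (cpair s (sval (refl_prog Q)))) env (PIn Q A (opn (Urel n) (g n)) (fn g)).
Proof. by move=> h; apply: wp_mem_in; apply: wp_mono h => _ <-; exists n. Qed.

Lemma PEq_urelP A x n e : PEq Q A x (Urel n) e -> x = Urel n.
Proof. by move=> /PEq_kind[[]|[m -> [->]]]. Qed.

Lemma fn_dom A g x y : inh (PIn Q A (opn x y) (fn g)) -> exists n, x = Urel n.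
Proof.
case=> e; rewrite PInE => /Jp_ex[d [c [[n [_ <-]]]]] h.
have [v _ [/PEq_urelP -> _]] := wp_opn_inj (wp_here A h).
by exists n.
Qed.

Lemma fn_val_prog : {t | forall A g n y e, PIn Q A (opn (Urel n) y) (fn g) e ->
  wp A t e (PEq Q A y (g n))}.
Proof.
eexists=> A g n y e h; apply: wp_inE; [by whyp h| |closed].
move=> c d hd; have [[m [_ em]] h2] := hd; subst c.
have [v _ [/PEq_urel nm _]] := wp_opn_inj (wp_here A h2); subst m.
by apply: wp_snd; apply: wp_opn_inj; apply: wp_snd; whyp hd.
Qed.

Lemma wp_fn_val A t env g n y : wp A t env (PIn Q A (opn (Urel n) y) (fn g)) ->
  wp A (pcall (sval fn_val_prog) t) env (PEq Q A y (g n)).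
Proof. by move=> h; apply: (wp_call h) => e; apply: (proj2_sig fn_val_prog). Qed.

(** Sequences of naturals and sequences of rationals are both of this form, by conversion. *)
Definition SFun A (R : name -> prop) (f : name) : prop :=
  PAnd (PSet f)
  (PAnd (PAll (fun p => PImp (PIn Q A p f) (PExN Q A (fun n =>
           PEx Q A (fun v => PAnd (R v) (SOpair Q A p n v))))))
  (PAnd (PAllN (fun n => PEx Q A (fun v => PAnd (R v) (SMaps Q A f n v))))
    (PAll (fun n => PAll (fun v => PAll (fun v' =>
       PImp (PAnd (SMaps Q A f n v) (SMaps Q A f n v')) (PEq Q A v v'))))))).

Lemma fn_fun_prog (t : baire) : {c | forall A (R : name -> prop) g env,
  (forall n, wp A t (bp (numeral n) env) (R (g n))) ->
  wp A c env (SFun A R (fn g))}.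
Proof.
eexists=> A R g env h; apply: wp_pair; first exact: wp_true.
apply: wp_pair; last apply: wp_pair.
- wall=> p; apply: wp_lam => e he; apply: wp_inE; [by whyp he| |closed].
  move=> c d hd; have [[n [en ec]] _] := hd; subst c.
  apply: (wp_exI (Urel n)); apply: wp_pair.
    by apply: (wp_fun cont_pr0); apply: wp_var0; exists n.
  apply: (wp_exI (g n)); apply: wp_pair; last by apply: wp_opairI; apply: wp_snd; whyp hd.
  apply: (wp_call (c := t) (P := fun v => wp A t v (R (g n)))) => //.
  apply: (@wp_bp _ _ _ _ (eq (numeral n)) (eq env)) => [||_ _ <- <- //].
    by apply: (wp_fun cont_pr0); apply: wp_var0.
  by do 2 apply: wp_shift; apply: wp_here.
- wall=> c; apply: wp_lam => e [n -> ->]; apply: (wp_exI (g n)); apply: wp_pair.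
    by apply: (wp_call (c := t) (P := eq (bp (numeral n) env))); [apply: wp_here|move=> _ <-].
  by apply: wp_mapsI; apply: wp_in_fn; whyp (erefl (numeral n)).
wall=> x; wall=> v; wall=> v'; apply: wp_lam => e h'.
have [n en] : exists n, x = Urel n.
  by apply: (@fn_dom A g x v); apply: inh_wp (wp_mapsE (wp_fst (wp_here A h'))).
subst x; apply: wp_trans; first by apply: wp_fn_val; apply: wp_mapsE; apply: wp_fst; whyp h'.
by apply: wp_sym; apply: wp_fn_val; apply: wp_mapsE; apply: wp_snd; whyp h'.
Qed.

(** [r] normalises values to numbers, and [vn] is injective on the [ok] ones, so the number of the
    n-th value is unique. Uniqueness removes the modality, and the numbers are then assembled into a
    point of Baire space. *)
Lemma fn_extract (R : baire -> name -> prop) (vn : nat -> name) (ok : nat -> Prop) (r : baire) :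
  (forall A v e, R A v e -> wp A r e
     (PEx Q A (fun m => PAnd (fun a => a = numeral m /\ ok m) (PEq Q A v (vn m))))) ->
  (forall A m m', ok m -> ok m' -> inh (PEq Q A (vn m) (vn m')) -> m = m') ->
  {t | forall A f e, SFun A (R A) f e -> exists g : baire, (forall n, ok (g n)) /\
     wp A t e (PAnd (eq g) (PEq Q A f (fn (fun n => vn (g n)))))}.
Proof.
move=> hr vinj.
suff [t1 [t2 ht]] : {t1 & {t2 | forall A f e, SFun A (R A) f e ->
    exists g : baire, [/\ (forall n, ok (g n)), wp A t1 e (eq g)
      & wp A t2 e (PEq Q A f (fn (fun n => vn (g n))))]}}.
  exists (cpair t1 t2) => A f e /ht[g [okg h1 h2]]; exists g; split=> //.
  exact: wp_pair.
have graph A f e : SFun A (R A) f e -> exists g : baire, (forall n, ok (g n)) /\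
    forall n m, ok m -> inh (PIn Q A (opn (Urel n) (vn m)) f) -> m = g n.
  case=> _ [_ [tot fun_]].
  have /choice[g hg] n : exists m, ok m /\ inh (PIn Q A (opn (Urel n) (vn m)) f).
    have /inh_ex[v /inh_and[hv hm]] := inh_allN n (ex_intro _ _ tot).
    have /inh_ex[m /inh_and[[_ [_ okm]] hvm]] := inh_prog (@hr A v) hv.
    exists m; split=> //; case: hvm hm => a ha [b hb].
    have w : wp A (cpair (fcode (fun=> a)) (fcode (fun=> b))) e (PAnd (PEq Q A v (vn m)) (SMaps Q A f (Urel n) v)).
      by apply: wp_pair; apply: wp_cst.
    exact: (inh_wp (wp_in_eql (wp_opn_cong (@wp_refl Q A _ _) (wp_fst w)) (wp_mapsE (wp_snd w)))).
  exists g; split=> [n|n m okm hm]; first by case: (hg n).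
  have [okg hn] := hg n; apply: (vinj A) => //.
  have := inh_all (vn (g n)) (inh_all (vn m) (inh_all (Urel n) (ex_intro _ _ fun_))).
  move/inh_imp; apply; apply/inh_and; split.
    by case: hm => a ha; apply: inh_wp (wp_mapsI (wp_here A ha)).
  by case: hn => a ha; apply: inh_wp (wp_mapsI (wp_here A ha)).
have val A f e g n v m a b : SFun A (R A) f e ->
    (forall n m, ok m -> inh (PIn Q A (opn (Urel n) (vn m)) f) -> m = g n) ->
    SMaps Q A f (Urel n) v a -> PAnd (fun a => a = numeral m /\ ok m) (PEq Q A v (vn m)) b ->
    m = g n.
  move=> _ hg ha hb; have [[_ okm] _] := hb; apply: hg => //.
  have w : wp A (cpair (fcode (fun=> a)) (fcode (fun=> b))) e
      (PAnd (SMaps Q A f (Urel n) v) (PAnd (fun a => a = numeral m /\ ok m) (PEq Q A v (vn m)))).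
    by apply: wp_pair; apply: wp_cst.
  exact: (inh_wp (wp_in_eql (wp_opn_cong (@wp_refl Q A _ _) (wp_snd (wp_snd w))) (wp_mapsE (wp_fst w)))).
eexists; eexists=> A f e h; have [g [okg hg]] := graph A f e h.
exists g; split=> //; have [_ [rng [tot _]]] := h.
- apply: wp_collect => n; apply: (@wp_mono _ _ _ (eq (numeral (g n)))) => [_ <- //|].
  have cl : closedby Q A (pcall (cuniq Q) pself) (eq (numeral (g n))).
    by apply: closed_uniq => v w <- <-.
  apply: wp_exE; last exact: cl.
    apply: wp_app.
      apply: wp_shift; apply: (wp_fun cont_pr0); apply: (wp_fun cont_pr1); apply: (wp_fun cont_pr1).
      by whyp (tot (Urel n)).
    by apply: wp_var0; exists n.
  move=> v a ha; have [_ hm] := ha; apply: wp_exE; last exact: cl.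
    by apply: (wp_call (P := R A v)); [apply: wp_fst; whyp ha|apply: hr].
  move=> m b hb; apply: (wp_fun cont_pr0); apply: wp_var0.
  by have [[-> _] _] := hb; congr numeral; apply/esym; apply: (val A f e g n v m _ _ h hg hm hb).
apply: wp_eqI; first by left; split=> //; case: h.
  move=> c p hp; apply: wp_exE; last closed.
    apply: wp_app.
      by apply: wp_shift; apply: (wp_fun cont_pr0); apply: (wp_fun cont_pr1); whyp (rng c).
    by apply: wp_mem_in; whyp (hp : PMem c f p).
  move=> x a ha; have [[n nx na] _] := ha; subst x; apply: wp_exE; [by apply: wp_snd; whyp ha| |closed].
  move=> v b hb; apply: wp_exE; last closed.
    by apply: (wp_call (P := R A v)); [apply: wp_fst; whyp hb|apply: hr].
  move=> m d hd; have [_ hop] := hb; have mg : m = g n.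
    have [u _ hu] : wp A (pret (cpair (fcode (fun=> pr1 b)) (pret (cpair (fcode (fun=> p)) (sval (refl_prog Q))))))
        e (SMaps Q A f (Urel n) v).
      by apply: (wp_exI c); apply: wp_pair; [apply: wp_cst|apply: wp_mem_in; apply: wp_cst].
    exact: (val A f e g n v m _ _ h hg hu hd).
  subst m; apply: (wp_inI (c := opn (Urel n) (vn (g n)))).
    apply: (@wp_mono _ _ _ (eq (numeral n))) => [_ <-|]; first by exists n.
    by do 2 apply: wp_shift; apply: (wp_fun cont_pr0); apply: wp_var0.
  apply: wp_trans; first by apply: wp_opairE; apply: wp_snd; whyp hb.
  by apply: wp_opn_cong; [apply: wp_refl|apply: wp_snd; whyp hd].
move=> c p [n [np nc]]; subst c; apply: wp_exE; last closed.
  apply: wp_app.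
    apply: wp_shift; apply: (wp_fun cont_pr0); apply: (wp_fun cont_pr1); apply: (wp_fun cont_pr1).
    by whyp (tot (Urel n)).
  by apply: wp_var0; exists n.
move=> v a ha; have [_ hm] := ha; apply: wp_exE; last closed.
  by apply: (wp_call (P := R A v)); [apply: wp_fst; whyp ha|apply: hr].
move=> m b hb; have mg := val A f e g n v m _ _ h hg hm hb; subst m.
apply: wp_in_eql; last by apply: wp_mapsE; apply: wp_snd; whyp ha.
by apply: wp_opn_cong; [apply: wp_refl|apply: wp_snd; whyp hb].
Qed.

End Pairs.

(** * Rational values *)

Section Rationals.

Local Open Scope ring_scope.

Definition e2 (k : nat) : rat := (2%:R^-1) ^+ k.

Lemma e2_gt0 k : 0 < e2 k. Proof. by rewrite exprn_gt0 // invr_gt0 ltr0n. Qed.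

Lemma e2S k : e2 k = e2 k.+1 + e2 k.+1.
Proof. by rewrite /e2 exprS -mulrDl -[LHS]mul1r; congr (_ * _); lra. Qed.

Lemma e2_le k l : (k <= l)%N -> e2 l <= e2 k.
Proof.
move=> /subnK <-; elim: (l - k)%N => // n IH; rewrite addSn.
by apply: le_trans IH; rewrite (e2S (n + k)) lerDl ltW ?e2_gt0.
Qed.

Lemma e2_nat k : e2 k * (2 ^ k)%:R = 1.
Proof. by rewrite natrX /e2 -exprMn mulVf ?expr1n // pnatr_eq0. Qed.

Lemma e2_small (x : rat) : 0 < x -> exists k, e2 k < x.
Proof.
(* A positive rational is at least one over its denominator [n], and [n < 2 ^ n]. *)
move=> x0; pose n := `|denq x|%N; exists n.
have nx : 1 <= x * n%:R.
  rewrite -[x]divq_num_den /n -[X in _ * X]/(`|denq x|%N%:Z%:~R) absz_denq mulfVK ?intr_eq0 ?denq_eq0 //.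
  by rewrite ler1z -gtz0_ge1 numq_gt0.
have n2 : n%:R < (2 ^ n)%:R :> rat by rewrite ltr_nat ltn_expl.
have b0 : 0 < (2 ^ n)%:R :> rat by rewrite ltr0n expn_gt0.
rewrite -(ltr_pM2r b0) e2_nat; apply: le_lt_trans nx _.
by rewrite ltr_pM2l.
Qed.

Lemma le_e2 (x y : rat) : (forall k, x <= y + e2 k) -> x <= y.
Proof.
move=> h; case: (leP x y) => // yx; have xy : 0 < x - y by rewrite subr_gt0.
by have [k hk] := e2_small xy; have := h k; lra.
Qed.

(** Expressions now serve as data: under the valuation [id], [AVar n] denotes the number [n] itself,
    and [lift] turns it into the urelement [n]. *)
Definition qv (u : qexp) : rat :=
  let: (a, b, d) := u in ((aval id a)%:R - (aval id b)%:R) / (aval id d)%:R.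
Definition qpos (u : qexp) : bool := let: (a, b, d) := u in (0 < aval id d)%N.

Lemma qv_qadd u v : qpos u -> qpos v -> qv (qadd u v) = qv u + qv v.
Proof.
case: u v => [[a b] d] [[a' b'] d'] /= d0 d0'; rewrite !natrD !natrM.
have h : (aval id d)%:R != 0 :> rat by rewrite pnatr_eq0 -lt0n.
have h' : (aval id d')%:R != 0 :> rat by rewrite pnatr_eq0 -lt0n.
by field; rewrite h h'.
Qed.

Lemma qv_qmul u v : qpos u -> qpos v -> qv (qmul u v) = qv u * qv v.
Proof.
case: u v => [[a b] d] [[a' b'] d'] /= d0 d0'; rewrite !natrD !natrM.
have h : (aval id d)%:R != 0 :> rat by rewrite pnatr_eq0 -lt0n.
have h' : (aval id d')%:R != 0 :> rat by rewrite pnatr_eq0 -lt0n.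
by field; rewrite h h'.
Qed.

Lemma qpos_qadd u v : qpos (qadd u v) = qpos u && qpos v.
Proof. by case: u v => [[a b] d] [[a' b'] d'] /=; rewrite muln_gt0. Qed.

Lemma qpos_qmul u v : qpos (qmul u v) = qpos u && qpos v.
Proof. by case: u v => [[a b] d] [[a' b'] d'] /=; rewrite muln_gt0. Qed.

Lemma qv_q2N k : qv (q2N k) = e2 k.
Proof.
have nz : (2 ^ k)%:R != 0 :> rat by rewrite pnatr_eq0 expn_eq0.
by rewrite /qv /= subr0 mul1r; apply: (mulIf nz); rewrite mulVf // e2_nat.
Qed.

End Rationals.

Fixpoint lift (t : aexp) : nexp :=
  match t with
  | AVar n => NVar (Urel n)
  | ACst n => NCst n
  | AAdd s r => NAdd (lift s) (lift r)
  | AMul s r => NMul (lift s) (lift r)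
  | APow2 s => NPow2 (lift s)
  end.
Definition liftq (u : qexp) : nqexp :=
  let: (a, b, d) := u in (lift a, lift b, lift d).

Lemma nvars_lift t : nvars (lift t) = map Urel (avars t).
Proof. by elim: t => //= s -> r ->; rewrite map_cat. Qed.

Lemma ncode_lift t o : ncode (lift t) o = acode t o.
Proof.
by elim: t o => //= [s IHs r IHr|s IHs r IHr|s IHs] o;
  rewrite ?IHs ?IHr // nvars_lift size_map.
Qed.

Lemma SAle_lift s t e : SAle (lift s) (lift t) e <-> aval id s <= aval id t.
Proof.
rewrite /SAle /PRel !ncode_lift !nvars_lift size_map -map_cat.
have E : eval (PComp prsub [:: acode t (size (avars s)); acode s 0])
    (avars s ++ avars t) = aval id s - aval id t.
  rewrite -[LHS]/(eval prsub [:: eval (acode t _) _; eval (acode s _) _]) eval_prsub.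
  have := eval_acode id t (avars s) [::]; rewrite map_id cats0 => ->.
  by have := eval_acode id s [::] (avars t); rewrite map_id /= => ->.
split=> [[ns e1 e2]|st].
  by have ns1 := map_urel_inj e1; rewrite -ns1 E in e2; rewrite -subn_eq0 e2.
by exists (avars s ++ avars t) => //; rewrite E /=; apply/eqP; rewrite subn_eq0.
Qed.

Lemma SAeq_lift s t e : SAeq (lift s) (lift t) e <-> aval id s = aval id t.
Proof.
rewrite /SAeq /PRel !ncode_lift !nvars_lift size_map -map_cat.
have E1 : eval (acode s 0) (avars s ++ avars t) = aval id s.
  by have := eval_acode id s [::] (avars t); rewrite map_id.
have E2 : eval (acode t (size (avars s))) (avars s ++ avars t) = aval id t.
  by have := eval_acode id t (avars s) [::]; rewrite map_id cats0.
split=> [[ns e1]|st]; first by rewrite -(map_urel_inj e1) E1 E2.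
by exists (avars s ++ avars t) => //; rewrite E1 E2.
Qed.

Lemma SQlt_lift u v e : qpos u -> qpos v ->
  SQlt (liftq u) (liftq v) e <-> (qv u < qv v)%R.
Proof.
case: u v => [[a b] d] [[a' b'] d'] /= d0 d0'.
have := @SAle_lift (AAdd (AAdd (AMul a d') (AMul b' d)) (ACst 1)) (AAdd (AMul a' d) (AMul b d')) e.
rewrite /SAlt /= addn1 => ->.
rewrite ltr_pdivrMr ?ltr0n // mulrAC ltr_pdivlMr ?ltr0n //.
rewrite !mulrBl ltrBlDr addrAC ltrBrDr -!natrM -!natrD ltr_nat.
by [].
Qed.

Lemma nqadd_lift u v : nqadd (liftq u) (liftq v) = liftq (qadd u v).
Proof. by case: u v => [[a b] d] [[a' b'] d']. Qed.

Lemma nqmul_lift u v : nqmul (liftq u) (liftq v) = liftq (qmul u v).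
Proof. by case: u v => [[a b] d] [[a' b'] d']. Qed.

(** * Canonical names of sequences *)

(* The number code [:: a; b; c] stands for the rational (a - b) / (c + 1). *)
Definition qc (m : nat) : qexp :=
  (AVar (nth 0 (decode m) 0), AVar (nth 0 (decode m) 1),
   AAdd (AVar (nth 0 (decode m) 2)) (ACst 1)).
Definition rq (m : nat) : rat := qv (qc m).
Definition trc (m : nat) : name :=
  trn (Urel (nth 0 (decode m) 0)) (Urel (nth 0 (decode m) 1)) (Urel (nth 0 (decode m) 2)).

Definition sn (s : baire) : name := fn (fun n => Urel (s n)).
Definition rn (a : baire) : name := fn (fun n => trc (a n)).

Definition reg (a : baire) : Prop :=
  forall n m, n <= m -> (`|rq (a n) - rq (a m)| < e2 n)%R.

Lemma cont_numeral (h : baire -> nat) :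
  (forall x, exists k, forall x', agree k x x' -> h x' = h x) ->
  cont (fun x => numeral (h x)).
Proof. by move=> H x n; have [k hk] := H x; exists k => x' /hk e; rewrite /numeral e. Qed.

Lemma cont_at n : cont (fun x => numeral (x n)).
Proof. by apply: cont_numeral => x; exists n.+1 => x' ->. Qed.

Section Canonical.

Variable Q : baire -> Prop.

Lemma trn_inj A a b c a' b' c' :
  inh (PEq Q A (trn (Urel a) (Urel b) (Urel c)) (trn (Urel a') (Urel b') (Urel c'))) ->
  [/\ a = a', b = b' & c = c'].
Proof.
case=> e h; have [v _ [/PEq_urel -> h2]] := wp_opn_inj (wp_here A h).
by have [w _ [/PEq_urel -> /PEq_urel ->]] := wp_opn_inj (wp_here A h2).
Qed.

Lemma trc_inj A m m' : size (decode m) = 3 -> size (decode m') = 3 ->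
  inh (PEq Q A (trc m) (trc m')) -> m = m'.
Proof.
move=> s3 s3' /trn_inj[e0 e1 e2]; rewrite -[m]CodeSeq.decodeK -[m']CodeSeq.decodeK.
congr code; move: s3 s3' e0 e1 e2.
by case: (decode m) (decode m') => [|? [|? [|? []]]] // [|? [|? [|? []]]] //= _ _ -> -> ->.
Qed.

Lemma rational_prog : {r | forall A v e, SRational Q A v e -> wp A r e
  (PEx Q A (fun m => PAnd (fun a => a = numeral m /\ size (decode m) = 3)
                          (PEq Q A v (trc m))))}.
Proof.
eexists=> A v e h; apply: wp_exE; [by whyp h| |closed].
move=> x d hd; have [[a xa da] _] := hd; subst x; apply: wp_exE; [by apply: wp_snd; whyp hd| |closed].
move=> x f hf; have [[b xb fb] _] := hf; subst x; apply: wp_exE; [by apply: wp_snd; whyp hf| |closed].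
move=> x g hg; have [[c xc gc] _] := hg; subst x.
apply: (wp_exI (code [:: a; b; c])); apply: wp_pair.
  apply: (wp_nat (n := a)); first by apply: wp_shift; apply: wp_shift; apply: (wp_fun cont_pr0); apply: wp_var0.
  apply: (wp_nat (n := b)); first by apply: wp_shift; apply: (wp_fun cont_pr0); apply: wp_var0.
  apply: (wp_nat (n := c)); first by apply: (wp_fun cont_pr0); apply: wp_var0.
  apply: wp_cst; split; first reflexivity. by rewrite CodeSeq.codeK.
by rewrite /trc CodeSeq.codeK /=; apply: wp_tripleE; apply: wp_snd; whyp hg.
Qed.

Lemma ratseq_extract : {t | forall A x e, SRatseq Q A x e ->
  exists a : baire, (forall n, size (decode (a n)) = 3) /\
    wp A t e (PAnd (eq a) (PEq Q A x (rn a)))}.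
Proof.
have [r hr] := rational_prog.
have [t ht] := @fn_extract Q (SRational Q) trc (fun m => size (decode m) = 3) r hr trc_inj.
by exists t.
Qed.

Lemma natseq_extract : {t | forall A f e, SNatseq Q A f e ->
  exists a : baire, wp A t e (PAnd (eq a) (PEq Q A f (sn a)))}.
Proof.
have [r hr] : {r | forall A v e, PNat v e -> wp A r e
    (PEx Q A (fun m => PAnd (fun a => a = numeral m /\ True) (PEq Q A v (Urel m))))}.
  eexists=> A v e [n -> en]; apply: (wp_exI n); apply: wp_pair; last exact: wp_refl.
  by whyp (conj en I).
have [|t ht] := @fn_extract Q (fun=> PNat) Urel (fun=> True) r hr.
  by move=> A m m' _ _ [e /PEq_urel].
by exists t => A f e /ht[g [_ h]]; exists g.
Qed.

Lemma natseq_prog : {t | forall A s, wp A t s (SNatseq Q A (sn s))}.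
Proof.
have [T hT] : {T | forall A s n, wp A T (bp (numeral n) s) (PNat (Urel (s n)))}.
  eexists=> A s n; apply: (wp_nat (n := n)); first by whyp (erefl (numeral n)).
  by apply: (wp_fun (cont_at n)); apply: wp_shift; apply: wp_here; exists (s n).
by exists (sval (fn_fun_prog Q T)) => A s; apply: (proj2_sig (fn_fun_prog Q T)).
Qed.

Lemma ratseq_prog : {t | forall A a, wp A t a (SRatseq Q A (rn a))}.
Proof.
have [T hT] : {T | forall A a n, wp A T (bp (numeral n) a) (SRational Q A (trc (a n)))}.
  eexists=> A a n; apply: (wp_nat (n := n)); first by whyp (erefl (numeral n)).
  apply: (wp_nat (n := a n)).
    by apply: (wp_fun (cont_at n)); apply: wp_shift; apply: wp_here.
  move: (a n) => m.
  apply: (wp_exI (Urel (nth 0 (decode m) 0))); apply: wp_pair; first by apply: wp_cst; eexists.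
  apply: (wp_exI (Urel (nth 0 (decode m) 1))); apply: wp_pair; first by apply: wp_cst; eexists.
  apply: (wp_exI (Urel (nth 0 (decode m) 2))); apply: wp_pair; first by apply: wp_cst; eexists.
  by apply: wp_tripleI; apply: wp_refl.
by exists (sval (fn_fun_prog Q T)) => A a; apply: (proj2_sig (fn_fun_prog Q T)).
Qed.

(** * Operands on canonical names *)

(** An operand hands its n-th term to a continuation. On canonical names this term is
    [val n (info x n)], where the number [info x n] is continuous in the data [x]. The program
    [op_prog] may depend on both numbers, because [pcasen] branches over them. *)
Record okop (X : baire -> baire -> soperand) (info : baire -> nat -> nat)
    (val : nat -> nat -> qexp) : Type := Okop {
  op_cont : forall n, cont (fun x => numeral (info x n));
  op_pos : forall n i, qpos (val n i);
  op_prog : nat -> nat -> baire -> baire;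
  op_intro : forall A x n env t F, wp A t env (F (liftq (val n (info x n)))) ->
    wp A (op_prog n (info x n) t) env (X A x (Urel n) F);
  op_elim : forall A x n F, inh (X A x (Urel n) F) -> inh (F (liftq (val n (info x n))))
}.

Definition oq X info val (o : okop X info val) (x : baire) (n : nat) : rat :=
  qv (val n (info x n)).

Definition ok_rvar h (ch : cont h) :
  okop (fun A x => SRvar Q A (rn (h x))) (fun x n => h x n) (fun _ m => qc m).
Proof.
pose T n m t := pret (cpair (pret (cpair (pcall (sval (eq_opair_prog Q)) (sval (refl_prog Q)))
   (pret (cpair (fcode (fun=> numeral n)) (sval (refl_prog Q))))))
  (pret (cpair (fcode (fun=> numeral (nth 0 (decode m) 0)))
  (pret (cpair (fcode (fun=> numeral (nth 0 (decode m) 1)))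
  (pret (cpair (fcode (fun=> numeral (nth 0 (decode m) 2)))
    (cpair (pret (cpair (pcall (sval (eq_opair_prog Q)) (sval (refl_prog Q)))
          (pcall (sval (eq_opair_prog Q)) (sval (refl_prog Q))))) t)))))))).
apply: (@Okop _ _ _ _ _ T).
- by move=> n; apply: (cont_comp (cont_at n) ch).
- by move=> n m; rewrite /qc /= addn1.
- move=> A x n env t F ht; apply: (wp_exI (trc (h x n))); apply: wp_pair.
    by apply: wp_mapsI; apply: (@wp_in_fn Q A _ _ (fun n => trc (h x n))); apply: wp_cst.
  apply: (wp_exI (Urel (nth 0 (decode (h x n)) 0))); apply: wp_pair; first by apply: wp_cst; eexists.
  apply: (wp_exI (Urel (nth 0 (decode (h x n)) 1))); apply: wp_pair; first by apply: wp_cst; eexists.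
  apply: (wp_exI (Urel (nth 0 (decode (h x n)) 2))); apply: wp_pair; first by apply: wp_cst; eexists.
  by apply: wp_pair ht; apply: wp_tripleI; apply: wp_refl.
move=> A x n F /inh_ex[v /inh_and[[d hd]]] /inh_exN[a] /inh_exN[b] /inh_exN[c].
case/inh_and=> -[d' hd'] hF.
have E : inh (PEq Q A (trn (Urel a) (Urel b) (Urel c)) (trc (h x n))).
  have w : wp A (cpair (fcode (fun=> d)) (fcode (fun=> d'))) d
      (PAnd (SMaps Q A (rn (h x)) (Urel n) v) (STriple Q A v (Urel a) (Urel b) (Urel c))).
    by apply: wp_pair; apply: wp_cst.
  exact: (inh_wp (wp_trans (wp_sym (wp_tripleE (wp_snd w)))
    (wp_fn_val (wp_mapsE (wp_fst w))))).
by have [e0 e1 e2] := trn_inj E; move: hF; rewrite /qc /liftq /= -e0 -e1 -e2.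
Qed.

Definition ok_rcst (q : qexp) (hq : qpos q) :
  okop (fun A x => SRcst (liftq q)) (fun x n => 0) (fun _ _ => q).
Proof.
apply: (@Okop _ _ _ _ _ (fun _ _ t => t)) => //.
by move=> n; apply: (@cont_cst (numeral 0)).
Qed.

Lemma cont_code2 (f g : baire -> nat) :
  cont (fun x => numeral (f x)) -> cont (fun x => numeral (g x)) ->
  cont (fun x => numeral (code [:: f x; g x])).
Proof.
move=> cf cg; apply: cont_numeral => x; have [k hk] := cf x 0; have [l hl] := cg x 0.
exists (maxn k l) => x' ag; congr code.
have -> : f x' = f x by apply: hk; apply: agree_le ag; rewrite leq_maxl.
by have -> : g x' = g x by apply: hl; apply: agree_le ag; rewrite leq_maxr.
Qed.

Definition ok_bin (op : qexp -> qexp -> qexp) (nop : nqexp -> nqexp -> nqexp)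
  (hop : forall u v, nop (liftq u) (liftq v) = liftq (op u v))
  (hpos : forall u v, qpos u -> qpos v -> qpos (op u v))
  X i v (o : okop X i v) Y i' v' (o' : okop Y i' v') :
  okop (fun A x n F => X A x n (fun u => Y A x n (fun w => F (nop u w))))
    (fun x n => code [:: i x n; i' x n])
    (fun n m => op (v n (nth 0 (decode m) 0)) (v' n (nth 0 (decode m) 1))).
Proof.
apply: (@Okop _ _ _ _ _ (fun n m t =>
  op_prog o n (nth 0 (decode m) 0) (op_prog o' n (nth 0 (decode m) 1) t))).
- by move=> n; apply: cont_code2; [exact: (op_cont o)|exact: (op_cont o')].
- by move=> n m; apply: hpos; [exact: (op_pos o)|exact: (op_pos o')].
- move=> A x n env t F; rewrite CodeSeq.codeK /= -hop => ht.
  by apply: op_intro; apply: op_intro.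
move=> A x n F /(op_elim o)/(op_elim o').
by rewrite CodeSeq.codeK /= hop.
Qed.

Lemma qpos_add u v : qpos u -> qpos v -> qpos (qadd u v).
Proof. by rewrite qpos_qadd => -> ->. Qed.

Lemma qpos_mul u v : qpos u -> qpos v -> qpos (qmul u v).
Proof. by rewrite qpos_qmul => -> ->. Qed.

Definition ok_radd X i v (o : okop X i v) Y i' v' (o' : okop Y i' v') :
  okop (fun A x => SRadd (X A x) (Y A x)) _ _ := ok_bin nqadd_lift qpos_add o o'.
Definition ok_rmul X i v (o : okop X i v) Y i' v' (o' : okop Y i' v') :
  okop (fun A x => SRmul (X A x) (Y A x)) _ _ := ok_bin nqmul_lift qpos_mul o o'.

Lemma oq_radd X i v (o : okop X i v) Y i' v' (o' : okop Y i' v') x n :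
  oq (ok_radd o o') x n = (oq o x n + oq o' x n)%R.
Proof. by rewrite /oq CodeSeq.codeK /= qv_qadd ?(op_pos o) ?(op_pos o'). Qed.

Lemma oq_rmul X i v (o : okop X i v) Y i' v' (o' : okop Y i' v') x n :
  oq (ok_rmul o o') x n = (oq o x n * oq o' x n)%R.
Proof. by rewrite /oq CodeSeq.codeK /= qv_qmul ?(op_pos o) ?(op_pos o'). Qed.

Definition ok_rdyadic h (ch : cont h) :
  okop (fun A x => SRdyadic Q A (sn (h x))) (fun x n => h x n)
       (fun n m => (AVar m, ACst 0, APow2 (AVar n))).
Proof.
apply: (@Okop _ _ _ _ _ (fun n m t => pret (cpair (fcode (fun=> numeral m))
  (cpair (pret (cpair (pcall (sval (eq_opair_prog Q)) (sval (refl_prog Q)))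
   (pret (cpair (fcode (fun=> numeral n)) (sval (refl_prog Q)))))) t)))).
- by move=> n; apply: (cont_comp (cont_at n) ch).
- by move=> n m; rewrite /= expn_gt0.
- move=> A x n env t F ht; apply: (wp_exI (Urel (h x n))); apply: wp_pair.
    by apply: wp_cst; exists (h x n).
  apply: wp_pair ht; apply: wp_mapsI.
  by apply: (@wp_in_fn Q A _ _ (fun n => Urel (h x n))); apply: wp_cst.
move=> A x n F /inh_exN[m /inh_and[[d hd] hF]].
have [u _ /PEq_urel E] := wp_fn_val (wp_mapsE (wp_here A hd)).
by rewrite -E.
Qed.

(** * Comparison of operands *)

Section Relations.

Variables (X : baire -> baire -> soperand) (i : baire -> nat -> nat)
  (v : nat -> nat -> qexp) (o : okop X i v).
Variables (Y : baire -> baire -> soperand) (i' : baire -> nat -> nat)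
  (v' : nat -> nat -> qexp) (o' : okop Y i' v').

Lemma q2N_lift k : nq2N (Urel k) = liftq (q2N k). Proof. by []. Qed.

Lemma qpos_q2N k : qpos (q2N k). Proof. by rewrite /= expn_gt0. Qed.

Lemma wp_op A x n env (F : nqexp -> nqexp -> prop) :
  (forall e, F (liftq (v n (i x n))) (liftq (v' n (i' x n))) e) ->
  wp A (op_prog o n (i x n) (op_prog o' n (i' x n) (fcode (fun=> numeral 0)))) env
    (X A x (Urel n) (fun u => Y A x (Urel n) (fun w => F u w))).
Proof. by move=> h; do 2 apply: op_intro; apply: wp_true. Qed.

Lemma eventually_prog (c : nat) (F : name -> nqexp -> nqexp -> prop) : {t | forall A x,
  (forall n, c <= n -> forall e, F (Urel n) (liftq (v n (i x n))) (liftq (v' n (i' x n))) e) ->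
  wp A t x (SEventually Q A (fun n => X A x n (fun u => Y A x n (fun w => F n u w))))}.
Proof.
eexists=> A x h; apply: (wp_exI (Urel c)); apply: wp_pair; first by apply: wp_cst; exists c.
wall=> z; apply: wp_lam => e [n -> ->]; apply: wp_lam => e'.
move=> /(@SAle_lift (AVar c) (AVar n)) /= cn.
apply: (wp_nat (n := n)); first by whyp (erefl (numeral n)).
apply: (wp_nat (n := i x n) (t := fun a => pcasen
    (pfun (fun x => numeral (i' x n)) (pshift (pshift pself)))
    (fun b => op_prog o n a (op_prog o' n b (fcode (fun=> numeral 0)))))).
  by apply: (wp_fun (op_cont o n)); do 2 apply: wp_shift; apply: wp_here.
apply: (wp_nat (n := i' x n) (t := fun b =>
    op_prog o n (i x n) (op_prog o' n b (fcode (fun=> numeral 0))))).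
  by apply: (wp_fun (op_cont o' n)); do 2 apply: wp_shift; apply: wp_here.
apply: (@wp_op A x n _ (F (Urel n))); exact: h.
Qed.

Lemma eventually_inh A x (F : name -> nqexp -> nqexp -> prop) :
  inh (SEventually Q A (fun n => X A x n (fun u => Y A x n (fun w => F n u w)))) ->
  exists c, forall n, c <= n -> inh (F (Urel n) (liftq (v n (i x n))) (liftq (v' n (i' x n)))).
Proof.
move=> /inh_exN[c h]; exists c => n cn; have := inh_allN n h => /inh_imp.
move=> {h} /(_ _)/(op_elim o)/(op_elim o'); apply.
by exists (numeral 0); apply/(@SAle_lift (AVar c) (AVar n)).
Qed.

Lemma allN_prog (F : baire -> baire -> name -> prop) (t : nat -> baire) (D : baire -> Prop) :
  (forall A x n, D x -> wp A (t n) x (F A x (Urel n))) ->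
  {c | forall A x, D x -> wp A c x (PAllN (F A x))}.
Proof.
move=> h; eexists=> A x Dx; wall=> z; apply: wp_lam => e [n -> ->].
apply: (wp_nat (n := n)); first by whyp (erefl (numeral n)).
by apply: wp_shift; apply: h.
Qed.

(** For precision [k] the program announces the stage [k + c]. The delay [c] is fixed before the
    data; each use picks it large enough for its own error bound. *)
Lemma rle_prog c : {t | forall A x,
  (forall k n, k + c <= n -> (oq o x n < oq o' x n + e2 k)%R) ->
  wp A t x (SRle Q A (X A x) (Y A x))}.
Proof.
have T k := eventually_prog (k + c) (fun n u w => SQlt u (nqadd w (nq2N (Urel k)))).
apply: (allN_prog (t := fun k => sval (T k))) => A x k h; apply: (proj2_sig (T k)) => n kn e.
rewrite q2N_lift nqadd_lift; apply/SQlt_lift; rewrite ?qpos_qadd ?(op_pos o) ?(op_pos o') ?qpos_q2N //.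
by rewrite qv_qadd ?(op_pos o) ?(op_pos o') ?qpos_q2N // qv_q2N; apply: h.
Qed.

Lemma rle_inh A x : inh (SRle Q A (X A x) (Y A x)) ->
  forall k, exists c, forall n, c <= n -> (oq o x n < oq o' x n + e2 k)%R.
Proof.
move=> h k; have [c hc] := @eventually_inh A x _ (inh_allN k h).
exists c => n /hc[e]; rewrite q2N_lift nqadd_lift.
move/SQlt_lift; rewrite ?qpos_qadd ?(op_pos o) ?(op_pos o') ?qpos_q2N qv_qadd ?(op_pos o) ?(op_pos o') ?qpos_q2N //.
by rewrite qv_q2N; apply.
Qed.

Lemma req_prog c : {t | forall A x,
  (forall k n, k + c <= n -> (`|oq o x n - oq o' x n| < e2 k)%R) ->
  wp A t x (SReq Q A (X A x) (Y A x))}.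
Proof.
have T k := eventually_prog (k + c) (fun n u w => SQdist u w (nq2N (Urel k))).
apply: (allN_prog (t := fun k => sval (T k))) => A x k h; apply: (proj2_sig (T k)) => n kn e.
have := h _ _ kn; rewrite ltr_norml /SQdist q2N_lift !nqadd_lift => /andP[h1 h2].
by split; apply/SQlt_lift; rewrite ?qpos_qadd ?(op_pos o) ?(op_pos o') ?qpos_q2N // qv_qadd ?(op_pos o) ?(op_pos o') ?qpos_q2N //
  qv_q2N -/(oq o x n) -/(oq o' x n); lra.
Qed.

Lemma req_inh A x : inh (SReq Q A (X A x) (Y A x)) ->
  forall k, exists c, forall n, c <= n -> (`|oq o x n - oq o' x n| < e2 k)%R.
Proof.
move=> h k; have [c hc] := @eventually_inh A x _ (inh_allN k h).
exists c => n /hc[e]; rewrite /SQdist q2N_lift !nqadd_lift => -[].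
move=> /SQlt_lift + /SQlt_lift; rewrite !qpos_qadd !(op_pos o) !(op_pos o') qpos_q2N !qv_qadd ?(op_pos o) ?(op_pos o') ?qpos_q2N //.
by rewrite qv_q2N -/(oq o x n) -/(oq o' x n) ltr_norml => /(_ isT isT) h1 /(_ isT isT) h2; lra.
Qed.

Lemma rlt_prog k c : {t | forall A x,
  (forall n, c <= n -> (oq o x n + e2 k < oq o' x n)%R) ->
  wp A t x (SRlt Q A (X A x) (Y A x))}.
Proof.
have T := eventually_prog c (fun n u w => SQlt (nqadd u (nq2N (Urel k))) w).
eexists=> A x h; apply: (wp_exI (Urel k)); apply: wp_pair; first by apply: wp_cst; exists k.
apply: (proj2_sig T) => n kn e; rewrite q2N_lift nqadd_lift.
apply/SQlt_lift; rewrite ?qpos_qadd ?(op_pos o) ?(op_pos o') ?qpos_q2N // qv_qadd ?(op_pos o) ?(op_pos o') ?qpos_q2N //.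
by rewrite qv_q2N; apply: h.
Qed.

Lemma rlt_inh A x : inh (SRlt Q A (X A x) (Y A x)) ->
  exists k c, forall n, c <= n -> (oq o x n + e2 k < oq o' x n)%R.
Proof.
move=> /inh_exN[k h]; exists k; have [c hc] := @eventually_inh A x _ h.
exists c => n /hc[e]; rewrite q2N_lift nqadd_lift.
move/SQlt_lift; rewrite ?qpos_qadd ?(op_pos o) ?(op_pos o') ?qpos_q2N qv_qadd ?(op_pos o) ?(op_pos o') ?qpos_q2N //.
by rewrite qv_q2N; apply.
Qed.

End Relations.

End Canonical.

(** * Real numbers *)

Section Reals.

Variable Q : baire -> Prop.

Lemma real_prog : {t | forall A a, reg a -> wp A t a (SReal Q A (rn a))}.
Proof.
pose o := ok_rvar Q cont_id.
eexists=> A a ra; apply: wp_pair; first exact: (proj2_sig (ratseq_prog Q)).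
wall=> z; apply: wp_lam => e [n -> ->]; wall=> z'; apply: wp_lam => e' [m -> ->].
apply: wp_lam => d /(@SAle_lift (AVar n) (AVar m)) /= nm.
apply: (wp_nat (n := n)); first by whyp (erefl (numeral n)).
apply: (wp_nat (n := m)); first by whyp (erefl (numeral m)).
apply: (wp_nat (n := a n) (t := fun k => pcasen
    (pfun (fun x => numeral (x m)) (pshift (pshift (pshift pself))))
    (fun l => op_prog o n k (op_prog o m l (fcode (fun=> numeral 0)))))).
  by apply: (wp_fun (cont_at n)); do 3 apply: wp_shift; apply: wp_here.
apply: (wp_nat (n := a m) (t := fun l =>
    op_prog o n (a n) (op_prog o m l (fcode (fun=> numeral 0))))).
  by apply: (wp_fun (cont_at m)); do 3 apply: wp_shift; apply: wp_here.
apply: (op_intro o (x := a)); apply: (op_intro o (x := a)); apply: wp_true => f.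
have := ra _ _ nm; rewrite ltr_norml /SQdist q2N_lift !nqadd_lift => /andP[h1 h2].
have p1 k : qpos (qc k) := op_pos o 0 k.
by split; apply/SQlt_lift; rewrite ?qpos_qadd ?p1 ?qpos_q2N // qv_qadd ?p1 ?qpos_q2N //
  qv_q2N -/(rq _) -/(rq _); lra.
Qed.

Lemma real_inh A a : inh (SReal Q A (rn a)) -> reg a.
Proof.
pose o := ok_rvar Q cont_id; have p1 k : qpos (qc k) := op_pos o 0 k.
move=> /inh_and[_ h] n m nm; have := inh_allN m (inh_allN n h) => /inh_imp.
move=> {h} /(_ _)/(@op_elim _ _ _ o A a n)/(@op_elim _ _ _ o A a m) [].
  by exists (numeral 0); apply/(@SAle_lift (AVar n) (AVar m)).
move=> e; rewrite /SQdist q2N_lift !nqadd_lift => -[].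
move=> /SQlt_lift + /SQlt_lift; rewrite !qpos_qadd !p1 qpos_q2N !qv_qadd ?p1 ?qpos_q2N //.
by rewrite qv_q2N -/(rq _) -/(rq _) ltr_norml => /(_ isT isT) h1 /(_ isT isT) h2; lra.
Qed.

Lemma real_extract : {t | forall A x e, SReal Q A x e ->
  exists a, reg a /\ wp A t e (PAnd (eq a) (PEq Q A x (rn a)))}.
Proof.
have [t ht] := ratseq_extract Q; have [l hl] := leibniz_prog Q (real 0 1) 0.
eexists=> A x e h.
have [a [_ ha]] := ht A x (pr0 e) (proj1 h); exists a; split; last first.
  by apply: (wp_call (P := eq (pr0 e))); [apply: (wp_fun cont_pr0); apply: wp_here|move=> _ <-; exact: ha].
have [v _ [_ hv]] := ha.
have : PAnd (PEq Q A x (rn a)) (SReal Q A x) (bp (pr1 v) e).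
  by split; rewrite ?pr0_bp ?pr1_bp // -bp_pr.
by move=> /(hl A (fun=> Urel 0) x (rn a))/inh_wp/real_inh.
Qed.

(** The bounds are stated termwise with slack; for regular sequences [realin_prog] and [realin_inh]
    show this to be equivalent to the realized inequalities. *)
Definition within (lo hi : qexp) (a : baire) : Prop :=
  forall n, (qv lo - e2 n <= rq (a n) <= qv hi + e2 n)%R.

Lemma realin_prog lo hi : qpos lo -> qpos hi -> {t | forall A a, reg a -> within lo hi a ->
  wp A t a (SReal_in Q A (liftq lo) (liftq hi) (rn a))}.
Proof.
move=> plo phi; pose o := ok_rvar Q cont_id.
have [t1 h1] := rle_prog Q (ok_rcst plo) o 1; have [t2 h2] := rle_prog Q o (ok_rcst phi) 1.
have lt k n : k + 1 <= n -> (e2 n < e2 k)%R.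
  by move=> kn; have := e2_le kn; rewrite addn1 [e2 k]e2S; have := e2_gt0 k.+1; lra.
eexists=> A a ra wa; apply: wp_pair; first exact: (proj2_sig real_prog).
apply: wp_pair.
  apply: h1 => k n kn; have /andP[w1 w2] := wa n; have := lt _ _ kn.
  by rewrite /oq -/(rq _); lra.
apply: h2 => k n kn; have /andP[w1 w2] := wa n; have := lt _ _ kn.
by rewrite /oq -/(rq _); lra.
Qed.

Lemma realin_inh A lo hi a : qpos lo -> qpos hi ->
  inh (SReal_in Q A (liftq lo) (liftq hi) (rn a)) -> reg a /\ within lo hi a.
Proof.
move=> plo phi; pose o := ok_rvar Q cont_id.
move=> /inh_and[/real_inh ra /inh_and[h1 h2]]; split=> // n.
have {}h1 := rle_inh (ok_rcst plo) o h1; have {}h2 := rle_inh o (ok_rcst phi) h2.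
apply/andP; split; apply: le_e2 => k.
  have [c hc] := h1 k; have := hc (maxn c n) (leq_maxl _ _).
  by have := ra _ _ (leq_maxr c n); rewrite ltr_norml /oq -/(rq _) => /andP[]; lra.
have [c hc] := h2 k; have := hc (maxn c n) (leq_maxl _ _).
by have := ra _ _ (leq_maxr c n); rewrite ltr_norml /oq -/(rq _) => /andP[]; lra.
Qed.

Lemma realin_extract lo hi : qpos lo -> qpos hi ->
  (forall A x rho, sem Q A (real_in lo hi 0 1) (upd rho 0 x) =
     SReal_in Q A (liftq lo) (liftq hi) x) ->
  {t | forall A x e, SReal_in Q A (liftq lo) (liftq hi) x e ->
  exists a, [/\ reg a, within lo hi a & wp A t e (PAnd (eq a) (PEq Q A x (rn a)))]}.
Proof.
move=> plo phi E; have [t ht] := real_extract; have [l hl] := leibniz_prog Q (real_in lo hi 0 1) 0.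
eexists=> A x e h.
have [a [ra ha]] := ht A x (pr0 e) (proj1 h); exists a.
have [v _ [_ hv]] := ha.
have : PAnd (PEq Q A x (rn a)) (SReal_in Q A (liftq lo) (liftq hi) x) (bp (pr1 v) e).
  by split; rewrite ?pr0_bp ?pr1_bp.
have := hl A (fun=> Urel 0) x (rn a) (bp (pr1 v) e); rewrite !E => hl' /hl'/inh_wp/realin_inh.
case=> // _ wa; split=> //.
by apply: (wp_call (P := eq (pr0 e))); [apply: (wp_fun cont_pr0); apply: wp_here|move=> _ <-; exact: ha].
Qed.

Lemma real01_extract : {t | forall A x e, SReal_in Q A nq0 nq1 x e ->
  exists a, [/\ reg a, within q0 q1 a & wp A t e (PAnd (eq a) (PEq Q A x (rn a)))]}.
Proof. by apply: (@realin_extract q0 q1). Qed.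

Lemma real11_extract : {t | forall A x e, SReal_in Q A nqN1 nq1 x e ->
  exists a, [/\ reg a, within qN1 q1 a & wp A t e (PAnd (eq a) (PEq Q A x (rn a)))]}.
Proof. by apply: (@realin_extract qN1 q1). Qed.

Lemma wp_bit A t s0 s1 env z (P : prop) : z = numeral 0 \/ z = numeral 1 ->
  wp A t env (eq z) -> (z = numeral 0 -> wp A s0 env P) -> (z = numeral 1 -> wp A s1 env P) ->
  wp A (pcasen t (fun n => if n is 0 then s0 else s1)) env P.
Proof.
by case=> [|] z01 ht h0 h1; move: (ht); rewrite z01 => ht'; apply: (wp_nat ht'); [apply: h0|apply: h1].
Qed.

Lemma wp_oracle A s f env x : wp A s env (eq x) -> cont f -> Q (f x) ->
  (exists z, kset (f x) z) -> wp A (pfun (scons 3) (pfun f s)) env (Jp Q A (kset (f x))).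
Proof.
move=> hs cf Qf ex; apply: (wp_fun (cont_scons 3)); apply: (wp_fun cf).
apply: wp_mono hs => _ <-; split; first exact: jdom_base.
by move=> d /jv_inv[_ _ _ /(_ erefl)].
Qed.

End Reals.

(** * LLPO *)

Definition QLLPO (p : baire) : Prop :=
  forall z, kset p z -> z = numeral 0 \/ z = numeral 1.

(** The string of [n] zeros survives while the n-th terms are compatible with [x <= y], that of [n]
    ones while they are compatible with [y <= x]. The slack is the sum of the errors of the two
    terms. *)
Definition llpo_inst (x : baire) : baire := fun c =>
  let s := decode c in let n := size s in
  if (all (pred1 0) s && (rq (pr0 x n) <= rq (pr1 x n) + e2 n + e2 n)%R) ||
     (all (pred1 1) s && (rq (pr1 x n) <= rq (pr0 x n) + e2 n + e2 n)%R) then 0 else 1.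

Lemma cont_llpo_inst : cont llpo_inst.
Proof.
apply: (@cont_modulus _ (fun c => (size (decode c)).*2.+2)) => c x x' xx.
by rewrite /llpo_inst /pr0 /pr1 !xx //; lia.
Qed.

Lemma llpo_inst_const x : QLLPO (llpo_inst x).
Proof.
move=> z zk; have [z1|z0] : all (pred1 1) (mkseq z 1) \/ all (pred1 0) (mkseq z 1).
- have [_] := zk 1; rewrite /llpo_inst CodeSeq.codeK; case: ifP => // /orP[] /andP[h _] _.
    by right.
  by left.
- right; apply: funext => n; have [_] := zk n.+1; rewrite /llpo_inst CodeSeq.codeK.
  case: ifP => // /orP[] /andP[/allP h _] _.
    have := h (z 0); rewrite (map_f z) ?mem_iota // => /(_ isT) /eqP e0.
    by move: z1; rewrite /= e0.
  by apply/eqP; apply: h; apply: map_f; rewrite mem_iota /=.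
left; apply: funext => n; have [_] := zk n.+1; rewrite /llpo_inst CodeSeq.codeK.
case: ifP => // /orP[] /andP[/allP h _] _.
  by apply/eqP; apply: h; apply: map_f; rewrite mem_iota /=.
have := h (z 0); rewrite (map_f z) ?mem_iota // => /(_ isT) /eqP e0.
by move: z0; rewrite /= e0.
Qed.

Lemma all_const n k : all (pred1 n) (mkseq (numeral n) k).
Proof. by apply/allP => x /mapP[i _ ->] /=. Qed.

(** If [x <= y] is refuted at some stage, regularity keeps [y <= x] unrefuted at all stages. *)
Lemma llpo_inst_ex x : reg (pr0 x) -> reg (pr1 x) -> exists z, kset (llpo_inst x) z.
Proof.
move=> r0 r1.
case: (EM (forall n, (rq (pr0 x n) <= rq (pr1 x n) + e2 n + e2 n)%R)) => [h|/existsNP[n /negP]].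
  exists (numeral 0) => n; split=> //; rewrite /llpo_inst CodeSeq.codeK size_mkseq.
  by rewrite all_const h.
rewrite -ltNge => hn; exists (numeral 1) => m; split=> //.
rewrite /llpo_inst CodeSeq.codeK size_mkseq all_const /= orbC; case: leP => //= hm; exfalso.
case: (leqP n m) => nm.
  have := r0 _ _ nm; have := r1 _ _ nm; have := e2_gt0 m; clear nm.
  by rewrite !ltr_norml => ? /andP[? ?] /andP[? ?]; lra.
have := r0 _ _ (ltnW nm); have := r1 _ _ (ltnW nm); have := e2_gt0 n; clear nm.
by rewrite !ltr_norml => ? /andP[? ?] /andP[? ?]; lra.
Qed.

(** At length 0 both alternatives share the empty string, which decides nothing. *)
Lemma llpo_inst0 x : kset (llpo_inst x) (numeral 0) ->
  forall n, 0 < n -> (rq (pr0 x n) <= rq (pr1 x n) + e2 n + e2 n)%R.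
Proof.
move=> zk [|n] // _; have [_] := zk n.+1; rewrite /llpo_inst CodeSeq.codeK size_mkseq.
by case: ifP => // /orP[/andP[]//|/andP[]].
Qed.

Lemma llpo_inst1 x : kset (llpo_inst x) (numeral 1) ->
  forall n, 0 < n -> (rq (pr1 x n) <= rq (pr0 x n) + e2 n + e2 n)%R.
Proof.
move=> zk [|n] // _; have [_] := zk n.+1; rewrite /llpo_inst CodeSeq.codeK size_mkseq.
by case: ifP => // /orP[/andP[]|/andP[]//].
Qed.

(** The scheme of the positive results on reals: the given names are replaced by canonical names of
    sequences extracted from their realizers, a set of the class is computed from these sequences,
    and the conclusion is carried back by [leibniz_prog]. *)
Lemma valid_LLPO : valid QLLPO LLPO.
Proof.
pose Q := QLLPO; have [tr hr] := real_extract Q.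
have [t0 h0] := rle_prog Q (ok_rvar Q cont_pr0) (ok_rvar Q cont_pr1) 2.
have [t1 h1] := rle_prog Q (ok_rvar Q cont_pr1) (ok_rvar Q cont_pr0) 2.
pose G := (rle (rvar 0) (rvar 1) ∨ rle (rvar 1) (rvar 0))%S 2.
have [l0 hl0] := leibniz_prog Q G 0; have [l1 hl1] := leibniz_prog Q G 1.
have bound k n : k + 2 <= n -> (e2 n + e2 n < e2 k)%R.
  rewrite addn2 => kn; have := e2_le kn.
  by rewrite [e2 k]e2S [e2 k.+1]e2S; have := e2_gt0 k.+2; lra.
eexists=> A rho env; rewrite sem_LLPO; wall=> x; wall=> y; apply: wp_lam => e he.
have [[a [ra ha]] [b [rb hb]]] := (hr A x (pr0 e) (proj1 he), hr A y (pr1 e) (proj2 he)).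
apply: (wp_let (P := PAnd (eq a) (PEq Q A x (rn a)))).
  apply: (wp_call (P := eq (pr0 e))); first by apply: (wp_fun cont_pr0); apply: wp_var0.
  by move=> _ <-; exact: ha.
move=> u hu; apply: (wp_let (P := PAnd (eq b) (PEq Q A y (rn b)))).
  apply: (wp_call (P := eq (pr1 e))); first by apply: wp_shift; apply: (wp_fun cont_pr1); apply: wp_var0.
  by move=> _ <-; exact: hb.
move=> w hw.
have E c d : sem Q A G (upd (upd rho 0 c) 1 d) = POr Q A
    (SRle Q A (SRvar Q A c) (SRvar Q A d)) (SRle Q A (SRvar Q A d) (SRvar Q A c)) by [].
have S c d : upd (upd rho 1 d) 0 c = upd (upd rho 0 c) 1 d by apply: upd_swap.
rewrite -E -S; apply: (wp_call (c := l0) (P := PAnd (PEq Q A (rn a) x)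
    (sem Q A G (upd (upd rho 1 y) 0 (rn a))))); last exact: hl0.
apply: wp_pair; first by apply: wp_sym; apply: wp_snd; whyp hu.
rewrite S; apply: (wp_call (c := l1) (P := PAnd (PEq Q A (rn b) y)
    (sem Q A G (upd (upd rho 0 (rn a)) 1 (rn b))))); last exact: hl1.
apply: wp_pair; first by apply: wp_sym; apply: wp_snd; whyp hw.
rewrite E.
have hab (c : baire) : wp A (cpair (pfun pr0 (pshift pvar0)) (pfun pr0 pvar0)) (bp w (bp u c)) (eq (bp a b)).
  case: hu hw => ea _ [eb _]; apply: (wp_bp (P := eq a) (Q := eq b)) => [||v1 v2 <- <- //].
    by apply: (wp_fun cont_pr0); apply: wp_shift; apply: wp_var0.
  by apply: (wp_fun cont_pr0); apply: wp_var0.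
apply: (wp_let (P := eq (bp a b))); first exact: hab.
move=> _ <-; apply: wp_mapj.
  apply: (wp_oracle (x := bp a b)) cont_llpo_inst _ _; first by apply: wp_var0.
    exact: llpo_inst_const.
  by apply: llpo_inst_ex; rewrite ?pr0_bp ?pr1_bp.
move=> z zk; apply: (wp_bit (llpo_inst_const zk)); first by apply: wp_var0.
  move=> z0; apply: (wp_bp (P := eq (numeral 0)) (Q := SRle Q A (SRvar Q A (rn a)) (SRvar Q A (rn b)))).
  - by apply: wp_cst.
  - apply: (wp_call (P := eq (bp a b))); first by apply: wp_shift; apply: wp_var0.
    move=> _ <-; have := h0 A (bp a b); rewrite pr0_bp pr1_bp; apply=> k n kn.
    rewrite z0 in zk; have n0 : 0 < n by lia.
    by have := llpo_inst0 zk n0; have := bound _ _ kn; rewrite /oq pr0_bp pr1_bp -!/(rq _); lra.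
  by move=> v1 v2 <- hv; left; rewrite pr0_bp pr1_bp.
move=> z1; apply: (wp_bp (P := eq (numeral 1)) (Q := SRle Q A (SRvar Q A (rn b)) (SRvar Q A (rn a)))).
- by apply: wp_cst.
- apply: (wp_call (P := eq (bp a b))); first by apply: wp_shift; apply: wp_var0.
  move=> _ <-; have := h1 A (bp a b); rewrite pr0_bp pr1_bp; apply=> k n kn.
  rewrite z1 in zk; have n0 : 0 < n by lia.
  by have := llpo_inst1 zk n0; have := bound _ _ kn; rewrite /oq pr0_bp pr1_bp -!/(rq _); lra.
by move=> v1 v2 <- hv; right; rewrite pr0_bp pr1_bp.
Qed.

(** * Values of the jump operators *)

Lemma jop_finite Q A : (forall p, Q p -> exists L : list baire, forall z, kset p z -> List.In z L) ->
  forall e, jdom Q A e -> exists L : list baire, forall z, jv A e z -> List.In z L.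
Proof.
move=> hQ e; elim=> {}e e0.
- by exists [:: stail e] => z /jv_inv[/(_ e0) -> _ _ _ _]; left.
- move=> _ [L hL] tot.
  have /choice[f hf] y : exists z, (exists z, kapp (pr0 (stail e)) y z) -> kapp (pr0 (stail e)) y z.
    by case: (EM (exists z, kapp (pr0 (stail e)) y z)) => [[z hz]|no]; [exists z|exists y => /no].
  exists (List.map f L) => z /jv_inv[_ /(_ e0)[y jy yz] _ _ _].
  apply/List.in_map_iff; exists y; split; last exact: hL.
  exact: (kapp_fun (hf y (ex_intro _ z yz)) yz).
- move=> _ [L hL] _ IH.
  have /choice[g hg] y : exists L : list baire, jv A (stail e) y -> forall z, jv A y z -> List.In z L.
    case: (EM (jv A (stail e) y)) => [/IH[M hM]|no]; first by exists M.
    by exists [::] => /no.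
  exists (List.flat_map g L) => z /jv_inv[_ _ /(_ e0)[y jy yz] _ _].
  by apply/List.in_flat_map; exists y; split; [exact: hL|exact: hg yz].
- by move=> /hQ[L hL] _; exists L => z /jv_inv[_ _ _ /(_ e0)/hL].
- move=> [z az]; exists [:: z] => z' /jv_inv[_ _ _ _ /(_ e0) az'].
  by left; exact: (kapp_fun az az').
Qed.

(** * Continuous selectors of outcomes *)

Section Selectors.

Variables (Q : baire -> Prop) (A : baire) (small : (baire -> Prop) -> Prop).

Hypothesis small1 : forall c, small (eq c).
Hypothesis small2 : forall G H (f : baire -> baire -> baire), small G -> small H ->
  small (fun c => exists g h, [/\ G g, H h & c = f g h]).
Hypothesis small_list : forall (L : seq (seq nat)) (H : seq nat -> baire -> Prop),
  (forall s, s \in L -> small (H s)) -> small (fun c => exists2 s, s \in L & H s c).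

Hypothesis base : forall p, Q p -> exists G k, small G /\ forall p', agree k p p' -> Q p' ->
  (exists z, kset p' z) -> exists c v, [/\ G c, kapp c p' v & kset p' v].

Lemma cont_stail : cont stail.
Proof. by apply: (@cont_modulus _ (fun n => n.+2)) => n x x' h; rewrite /stail h. Qed.

(** [small] will mean finite or countable. For a composition, compactness splits the outcomes of the
    first program over finitely many strings, each with its own small family for the second program,
    and the composites form a small family again. *)
Lemma jop_selectors e : jdom Q A e -> exists G k, small G /\ forall e', agree k e e' ->
  jdom Q A e' -> exists c v, [/\ G c, kapp c e' v & jv A e' v].
Proof.
elim=> {}e e0.
- exists (eq (fcode stail)), 1; split=> // e' ee _; exists (fcode stail), (stail e').
  by split=> //; [apply: fcodeP; apply: cont_stail|apply: jv_ret; rewrite -ee].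
- move=> _ [G [k [sG hG]]] _.
  pose g1 := fcode (fun x => pr1 (stail x)); pose g0 := fcode (fun x => pr0 (stail x)).
  have c1 : cont (fun x => pr1 (stail x)) := cont_comp cont_pr1 cont_stail.
  have c0 : cont (fun x => pr0 (stail x)) := cont_comp cont_pr0 cont_stail.
  have [l hl] := cont_agree c1 e k.
  exists (fun c => exists g h, [/\ G g, eq g0 h & c = capp h (ccomp g g1)]), (maxn l 1).
  split=> [|e' ee de']; first exact: small2.
  have x0 : e' 0 = 1 by rewrite -ee // leq_max orbT.
  have [/(_ x0)[d' tot] _ _] := jdom_inv de'.
  have [|g [y [Gg gy jy]]] := hG (pr1 (stail e')) _ d'.
    by apply: hl; apply: agree_le ee; rewrite leq_maxl.
  have [z yz] := tot _ jy; exists (capp g0 (ccomp g g1)), z; split; first by exists g, g0.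
    apply: cappP yz; first exact: fcodeP c0.
    by apply: ccompP gy; apply: fcodeP c1.
  exact: jv_map jy yz.
- move=> dx [G [k [sG hG]]] dy IH.
  pose S s := exists H, small H /\ forall y, mkseq y (size s) = s -> jdom Q A y ->
    exists c v, [/\ H c, kapp c y v & jv A y v].
  have [y jy|L [l [LS hL]]] := @jop_usco Q A _ dx S.
    have [H [m [sH hH]]] := IH y jy; exists m, H; split=> // y'.
    by rewrite size_mkseq => /agree_mkseq/agree_sym; apply: hH.
  have /choice[H hH] s : exists H, s \in L -> small H /\ forall y, mkseq y (size s) = s -> jdom Q A y ->
      exists c v, [/\ H c, kapp c y v & jv A y v].
    by case: (boolP (s \in L)) => [/LS[H hH]|_]; [exists H|exists (eq (numeral 0))].
  exists (fun c => exists g h, [/\ G g, exists2 s, s \in L & H s h & c = ccomp h (ccomp g (fcode stail))]),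
    (maxn k l).+1.
  split=> [|e' ee de'].
    by apply: small2 => //; apply: small_list => s /hH[].
  have x0 : e' 0 = 2 by rewrite -ee.
  have [_ /(_ x0)[d' dy'] _] := jdom_inv de'.
  have ag i : i <= maxn k l -> agree i (stail e) (stail e').
    by move=> il j ji; rewrite /stail ee // ltnS; apply: leq_trans il.
  have [|g [y [Gg gy jy]]] := hG (stail e') _ d'; first by apply: ag; rewrite leq_maxl.
  have [||m mL] := hL A (stail e') _ _ d' y jy => //; first by apply: ag; rewrite leq_maxr.
  have [_ hm] := hH _ mL; have [||c [v [Hc cv jv_]]] := hm y; first by rewrite size_mkseq.
    exact: dy'.
  exists (ccomp c (ccomp g (fcode stail))), v; split.
  + by exists g, c; split=> //; exists (mkseq y m).
  + apply: ccompP cv; apply: ccompP gy; apply: fcodeP; exact: cont_stail.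
  exact: jv_bind jy jv_.
- move=> Qe ex; have [G [k [sG hG]]] := base Qe.
  exists (fun c => exists g h, [/\ G g, eq (fcode stail) h & c = ccomp g h]), k.+1.
  split=> [|e' ee de']; first exact: small2.
  have x0 : e' 0 = 3 by rewrite -ee.
  have [_ _ /(_ x0) Qe'] := jdom_inv de'; have [z jz] := jdom_ex de'.
  have [|||c [v [Gc cv kv]]] := hG (stail e').
  + by move=> i ik; apply: ee.
  + by [].
  + by exists z; have [_ _ _ /(_ x0)] := jv_inv jz.
  exists (ccomp c (fcode stail)), v; split; first by exists c, (fcode stail).
    by apply: ccompP cv; apply: fcodeP; apply: cont_stail.
  exact: jv_base.
- move=> [z az]; exists (eq (fcode (fun=> z))), 2; split=> // e' ee _.
  exists (fcode (fun=> z)), z; split=> //; first by apply: fcodeP; apply: cont_cst.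
  by apply: jv_adv; rewrite -!ee.
Qed.

End Selectors.

Definition finite_codes (G : baire -> Prop) : Prop :=
  exists L : list baire, forall g, G g -> List.In g L.
Definition countable_codes (G : baire -> Prop) : Prop :=
  exists f : nat -> baire, forall g, G g -> exists n, f n = g.

Lemma finite_codes2 G H (f : baire -> baire -> baire) : finite_codes G -> finite_codes H ->
  finite_codes (fun c => exists g h, [/\ G g, H h & c = f g h]).
Proof.
move=> [L hL] [M hM]; exists (List.flat_map (fun g => List.map (f g) M) L) => c [g [h [Gg Hh ->]]].
by apply/List.in_flat_map; exists g; split; [exact: hL|apply: List.in_map; exact: hM].
Qed.

Lemma finite_codes_list (L : seq (seq nat)) (H : seq nat -> baire -> Prop) :
  (forall s, s \in L -> finite_codes (H s)) -> finite_codes (fun c => exists2 s, s \in L & H s c).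
Proof.
elim: L => [|s L IH] h; first by exists [::] => g [s].
have [M hM] := IH (fun s' h' => h s' (mem_behead (s := s :: L) h')).
have [N hN] := h s (mem_head _ _); exists (N ++ M) => g [s']; rewrite inE => /predU1P[->|s'L] hg.
  by apply/List.in_app_iff; left; apply: hN.
by apply/List.in_app_iff; right; apply: hM; exists s'.
Qed.

Lemma countable_codes2 G H (f : baire -> baire -> baire) : countable_codes G -> countable_codes H ->
  countable_codes (fun c => exists g h, [/\ G g, H h & c = f g h]).
Proof.
move=> [L hL] [M hM]; exists (fun n => f (L (nth 0 (decode n) 0)) (M (nth 0 (decode n) 1))).
move=> c [g [h [/hL[n <-] /hM[m <-] ->]]]; exists (code [:: n; m]).
by rewrite CodeSeq.codeK.
Qed.

Lemma countable_codes_list (L : seq (seq nat)) (H : seq nat -> baire -> Prop) :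
  (forall s, s \in L -> countable_codes (H s)) -> countable_codes (fun c => exists2 s, s \in L & H s c).
Proof.
move=> h; have /choice[f hf] s : exists f : nat -> baire, s \in L -> forall g, H s g -> exists n, f n = g.
  by case: (boolP (s \in L)) => [/h[f hf]|_]; [exists f|exists (fun=> numeral 0)].
exists (fun n => f (nth [::] L (nth 0 (decode n) 0)) (nth 0 (decode n) 1)) => g [s sL hg].
have [n nE] := hf s sL g hg; exists (code [:: seq.index s L; n]).
by rewrite CodeSeq.codeK /= nth_index.
Qed.

Definition kuniq : baire := code_of (fun p z => forall z', kset p z' <-> z' = z).

Lemma kuniqP p z : (forall z', kset p z' <-> z' = z) -> kapp kuniq p z.
Proof.
move=> h; apply: code_ofP => // {h z} {}p z h n.
have [z' /h ->|L [k [LS hL]]] := @kset_fan p (fun s => s = mkseq z n.+1); first by exists n.+1.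
exists k => p' z' pp h'; have [m /LS e] : exists m, mkseq z' m \in L.
  by apply: (hL p') => //; apply/h'.
have m1 : m = n.+1 by have := congr1 size e; rewrite !size_mkseq.
by move: e; rewrite m1 => /agree_mkseq; apply.
Qed.

Lemma outcomes_near Q A F x f (S : seq nat -> Prop) :
  kapp F (bp A x) f -> jdom Q A f -> (forall z, jv A f z -> exists k, S (mkseq z k)) ->
  exists (L : seq (seq nat)) k, (forall s, s \in L -> S s) /\ forall x' f',
    agree k x x' -> kapp F (bp A x') f' -> jdom Q A f' ->
    forall z, jv A f' z -> exists m, mkseq z m \in L.
Proof.
move=> Ff df cov; have [L [k [LS hL]]] := jop_usco df cov.
have [l hl] := kapp_agree Ff k; exists L, l; split=> // x' f' xx Ff' df' z jz.
apply: (hL A f') => //; apply: (hl F (bp A x')) => //.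
exact: bp_agree.
Qed.

(** * The failure of robust division *)

Definition ratc (a d : nat) : nat := code [:: a; 0; d.-1].

Lemma rq_ratc a d : 0 < d -> rq (ratc a d) = (a%:R / d%:R)%R.
Proof. by move=> d0; rewrite /rq /qv /qc CodeSeq.codeK /= subr0 addn1 prednK. Qed.

Lemma qv_q0 : qv q0 = 0%R. Proof. by rewrite /qv /= subrr mul0r. Qed.
Lemma qv_q1 : qv q1 = 1%R. Proof. by rewrite /qv /= subr0 divr1. Qed.
Lemma qv_qN1 : qv qN1 = (-1)%R. Proof. by rewrite /qv /= sub0r divr1. Qed.

Definition rdiv_good (w : baire) : Prop :=
  [/\ reg (pr0 w), reg (pr1 w), within q0 q1 (pr0 w), within q0 q1 (pr1 w)
    & forall n, (rq (pr0 w n) <= rq (pr1 w n))%R].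

Definition rdiv_sol (w z : baire) : Prop :=
  reg z /\ forall k, exists c, forall n, c <= n ->
    (`|rq (pr0 w n) - rq (pr1 w n) * rq (z n)| < e2 k)%R.

Section RdivProgram.

Variables (Q : baire -> Prop).

Let cxx : cont (fun w => pr0 (pr0 w)) := cont_comp cont_pr0 cont_pr0.
Let cyy : cont (fun w => pr1 (pr0 w)) := cont_comp cont_pr1 cont_pr0.

Lemma rdiv_inh A x y z :
  inh (SReq Q A (SRvar Q A (rn x)) (SRmul (SRvar Q A (rn y)) (SRvar Q A (rn z)))) ->
  forall k, exists c, forall n, c <= n -> (`|rq (x n) - rq (y n) * rq (z n)| < e2 k)%R.
Proof.
move=> h k; pose w := bp (bp x y) z.
have := @req_inh Q _ _ _ (ok_rvar Q cxx) _ _ _ (ok_rmul (ok_rvar Q cyy) (ok_rvar Q cont_pr1)) A w.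
rewrite /w pr0_bp pr1_bp pr0_bp pr1_bp => /(_ h k)[c hc]; exists c => n /hc.
by rewrite oq_rmul /oq !(pr0_bp, pr1_bp).
Qed.

Lemma rdiv_program A a : SRDIV Q A a -> exists F, forall w, rdiv_good w ->
  wp A F w (Jp Q A (rdiv_sol w)).
Proof.
move=> ha; have [t1 h1] := @realin_prog Q q0 q1 isT isT.
have [t3 h3] := rle_prog Q (ok_rvar Q cont_pr0) (ok_rvar Q cont_pr1) 0.
have [te he] := real01_extract Q.
pose G := req (rvar 0) (rmul (rvar 1) (rvar 2)) 3.
have [l hl] := leibniz_prog Q G 2.
eexists=> w [rx ry wx wy xy]; set x := pr0 w in rx wx; set y := pr1 w in ry wy.
have hxy := ha (rn x) (rn y); apply: wp_mapj.
  apply: wp_app; first by apply: wp_cst; exact: hxy.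
  apply: wp_pair; last apply: wp_pair.
  - apply: (wp_call (P := eq x)); first by apply: (wp_fun cont_pr0); apply: wp_here.
    by move=> _ <-; apply: h1.
  - apply: (wp_call (P := eq y)); first by apply: (wp_fun cont_pr1); apply: wp_here.
    by move=> _ <-; apply: h1.
  apply: h3 => k n _; rewrite /oq -!/(rq _); have := xy n; have := e2_gt0 k; lra.
move=> d [z [hz1 hz2]]; have [ze [rz _ wz]] := he A z (pr0 d) hz1.
apply: (@wp_mono _ _ _ (eq ze)) => [_ <-|]; last first.
  apply: (wp_fst (R := PEq Q A z (rn ze))).
  apply: (wp_call (P := eq (pr0 d))); first by apply: (wp_fun cont_pr0); apply: wp_var0.
  by move=> _ <-; exact: wz.
split=> //; apply: (@rdiv_inh A).
have E c : sem Q A G (upd (upd (upd (fun=> Urel 0) 0 (rn x)) 1 (rn y)) 2 c) =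
    SReq Q A (SRvar Q A (rn x)) (SRmul (SRvar Q A (rn y)) (SRvar Q A c)) by [].
rewrite -E; have [v _ [_ hv]] := wz.
apply: inh_wp (hl A _ z (rn ze) (bp (pr1 v) (pr1 d)) _).
by split; rewrite ?pr0_bp ?pr1_bp ?E.
Qed.

End RdivProgram.

Section Ratios.

Local Open Scope ring_scope.

(** The multiples [i * M] are more than [2 * d] apart, so each [r] spoils at most one of them. *)
Lemma avoid_points (d M : rat) (L : seq rat) (I : seq nat) : d + d < M ->
  uniq I -> (size L < size I)%N ->
  exists2 i, i \in I & forall r, r \in L -> d < `|r - i%:R * M|.
Proof.
move=> dM; elim: L I => [|r L IH] I uI sI.
  by case: I uI sI => // i I _ _; exists i => //; rewrite inE eqxx.
case: (EM (exists2 i, i \in I & `|r - i%:R * M| <= d)) => [[i iI hi]|no].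
  have [||k kI hk] := IH (rem i I); first exact: rem_uniq.
    by move: sI; rewrite size_rem //= => ?; lia.
  move: kI; rewrite mem_rem_uniq // inE => /andP[ki kI]; exists k => // r'.
  rewrite inE => /predU1P[->|/hk//]; case: (ltP d `|r - k%:R * M|) => // hk'.
  move: hi hk'; rewrite !ler_norml => /andP[a1 a2] /andP[b1 b2]; exfalso.
  have M0 : 0 < M by lra.
  move: ki; rewrite neq_ltn => /orP[] lt.
    have : (k.+1)%:R * M <= i%:R * M by rewrite ler_pM2r // ler_nat.
    by rewrite -natr1 mulrDl; lra.
  have : (i.+1)%:R * M <= k%:R * M by rewrite ler_pM2r // ler_nat.
  by rewrite -natr1 mulrDl; lra.
have [|k kI hk] := IH I uI; first exact: ltn_trans sI.
by exists k => // r'; rewrite inE => /predU1P[->|/hk//]; case: ltP => // h; case: no; exists k.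
Qed.

(** Zero before stage [m] and [(i / M) * 2^-m] from then on. Over the denominator given by
    [i = M = 1] the quotient is [i / M], while the first [m] terms do not reveal it. *)
Definition ratio_seq (i M m : nat) : baire := fun n =>
  if (n < m)%N then ratc 0 1 else ratc i (M * 2 ^ m).

Lemma rq_ratio_seq i M m n : (0 < M)%N -> (i <= M)%N ->
  rq (ratio_seq i M m n) = if (n < m)%N then 0 else (i%:R / M%:R) * e2 m.
Proof.
move=> M0 iM; rewrite /ratio_seq; case: ifP => _; first by rewrite rq_ratc // mul0r.
rewrite rq_ratc ?muln_gt0 ?M0 ?expn_gt0 // natrM invfM mulrA; congr (_ * _).
have nz : (2 ^ m)%:R != 0 :> rat by rewrite pnatr_eq0 expn_eq0.
by apply: (mulIf nz); rewrite mulVf // e2_nat.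
Qed.

Lemma ratio_bounds (i M : nat) : (0 < M)%N -> (i <= M)%N -> (0 <= (i%:R / M%:R : rat) <= 1).
Proof.
move=> M0 iM; rewrite divr_ge0 ?ler0n //= ler_pdivrMr ?ltr0n // mul1r ler_nat //.
Qed.

Lemma reg_ratio_seq i M m : (0 < M)%N -> (i <= M)%N -> reg (ratio_seq i M m).
Proof.
move=> M0 iM n k nk; rewrite !rq_ratio_seq //; have /andP[r0 r1] := ratio_bounds M0 iM.
set r := i%:R / M%:R in r0 r1 *; have := e2_gt0 n; have := e2_gt0 m => em en.
case: ltnP => nm; case: ltnP => km; rewrite ?subrr ?normr0 //.
  have lt : e2 m < e2 n by have := e2_le nm; rewrite [e2 n]e2S; have := e2_gt0 n.+1; lra.
  have re0 : 0 <= r * e2 m by rewrite mulr_ge0 ?(ltW em).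
  have re1 : r * e2 m <= e2 m by rewrite ler_piMl ?(ltW em).
  by rewrite sub0r normrN (ger0_norm re0); exact: le_lt_trans lt.
by move: (leq_ltn_trans nk km); rewrite ltnNge nm.
Qed.

Lemma within_ratio_seq i M m : (0 < M)%N -> (i <= M)%N -> within q0 q1 (ratio_seq i M m).
Proof.
move=> M0 iM n; rewrite !rq_ratio_seq //; have /andP[r0 r1] := ratio_bounds M0 iM.
set r := i%:R / M%:R in r0 r1 *; have := e2_gt0 n; have := e2_gt0 m => em en.
have : e2 m <= 1 := e2_le (leq0n m); rewrite qv_q0 qv_q1 => e1.
have re0 : 0 <= r * e2 m by rewrite mulr_ge0 ?(ltW em).
have re1 : r * e2 m <= e2 m by rewrite ler_piMl ?(ltW em).
by case: (n < m)%N; apply/andP; split; lra.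
Qed.

(** With numerator and denominator 0 the program has finitely many outcomes. There are more
    candidate ratios [i / M] than outcomes, so one ratio is far from all of them, and by upper
    semicontinuity the outcomes still miss it when [ratio_seq] starts late enough. *)
Lemma not_RDIV Q : (forall p, Q p -> exists L : list baire, forall z, kset p z -> List.In z L) ->
  valid Q (FNot RDIV).
Proof.
move=> fin; apply: valid_not => A rho a; rewrite sem_RDIV => /rdiv_program[F hF].
pose w i M m := bp (ratio_seq i M m) (ratio_seq 1 1 m).
have good i M m : (0 < M)%N -> (i <= M)%N -> rdiv_good (w i M m).
  move=> M0 iM; rewrite /rdiv_good /w pr0_bp pr1_bp.
  split; [exact: reg_ratio_seq|exact: reg_ratio_seq|exact: within_ratio_seq|exact: within_ratio_seq|].
  move=> n; rewrite !rq_ratio_seq //; case: ifP => // _; have /andP[r0 r1] := ratio_bounds M0 iM.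
  by rewrite divr1 ler_pM2r ?e2_gt0.
pose z0 := bp (fun=> ratc 0 1) (fun=> ratc 0 1).
have agw i M m : agree m z0 (w i M m).
  by apply: bp_agree => k km; rewrite /ratio_seq km.
have gz : rdiv_good z0.
  have rz : rq (ratc 0 1) = 0 by rewrite rq_ratc // mul0r.
  have r0 : reg (fun=> ratc 0 1) by move=> n m _; rewrite subrr normr0 e2_gt0.
  have w0 : within q0 q1 (fun=> ratc 0 1).
    by move=> n; rewrite rz qv_q0 qv_q1; have := e2_gt0 n; lra.
  by rewrite /rdiv_good /z0 pr0_bp pr1_bp; split.
have [f0 F0 [d0 s0]] := hF _ gz.
have [L hL] := jop_finite fin d0.
pose M := (size L).+1; have M0 : (0 < M)%N by [].
have Mr : 0 < M%:R^-1 :> rat by rewrite invr_gt0 ltr0n.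
have [n hn] : exists n, e2 n + e2 n < M%:R^-1.
  by have [n hn] := e2_small Mr; exists n.+1; rewrite -e2S.
have [||i iI hi] := @avoid_points (e2 n) M%:R^-1 [seq rq (z n) | z <- L] (iota 0 M) hn.
- exact: iota_uniq.
- by rewrite size_map size_iota.
rewrite mem_iota /= add0n in iI.
pose S (s : seq nat) := size s = n.+1 /\ e2 n < `|rq (nth 0%N s n) - i%:R * M%:R^-1|.
have [z /hL zL|K [k [KS hK]]] := @outcomes_near Q A F z0 f0 S F0 d0.
  exists n.+1; split; first by rewrite size_mkseq.
  rewrite nth_mkseq //; apply: hi.
  by elim: (L) zL => //= y l IH [->|/IH h]; rewrite inE ?eqxx // h orbT.
have iM : (i <= M)%N by exact: ltnW.
have [f Ff [df sf]] := hF _ (good i M k M0 iM); have [z jz] := jdom_ex df.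
have [m /KS[sm]] := hK (w i M k) f (@agw i M k) Ff df z jz.
rewrite size_mkseq in sm; rewrite sm nth_mkseq //; apply/negP; rewrite -leNgt.
have [rz hz] := sf z jz; apply: le_e2 => l.
(* Division by the denominator [2^-k] costs [k] bits of precision. *)
have [c hc] := hz (l + k)%N.
pose N := maxn (maxn c k) n; have := hc N; rewrite /w pr0_bp pr1_bp !rq_ratio_seq //.
have cN : (c <= N)%N by rewrite !leq_max leqnn.
have kN : (k <= N)%N by rewrite !leq_max leqnn orbT.
have nN : (n <= N)%N by rewrite leq_max leqnn orbT.
rewrite ltnNge kN /= divr1 mul1r cN => /(_ isT); have := rz _ _ nN.
rewrite !ltr_norml ler_norml -/(rq _) => /andP[a1 a2].
have -> : e2 (l + k) = e2 l * e2 k by rewrite /e2 exprD.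
move=> /andP[b1 b2].
have c1 : (i%:R / M%:R - rq (z N)) * e2 k < e2 l * e2 k by lra.
have c2 : (rq (z N) - i%:R / M%:R) * e2 k < e2 l * e2 k by lra.
by move: c1 c2; rewrite !ltr_pM2r ?e2_gt0 // => c1 c2; lra.
Qed.

End Ratios.

(** * The failure of binary expansions *)

Definition bsteps (s : baire) : Prop := forall n, s n.+1 = (s n).*2 \/ s n.+1 = (s n).*2.+1.

Definition bval (x s : baire) : Prop := forall k, exists c, forall n, c <= n ->
  (`|rq (x n) - (s n)%:R * e2 n| < e2 k)%R.

Section BinaryProgram.

Variable Q : baire -> Prop.

Lemma sn_maps A f s n : inh (PEq Q A f (sn s)) -> inh (SMaps Q A f (Urel n) (Urel (s n))).
Proof.
case=> e he; have w := wp_here A he.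
have hn : wp A (fcode (fun=> numeral n)) e (eq (numeral n)) by apply: wp_cst.
exact: inh_wp (wp_mapsI (wp_in_eqr (wp_sym w) (wp_in_fn Q (fun n => Urel (s n)) hn))).
Qed.

Lemma binary_extract : {t | forall A i b f e, SBinary Q A i b f e -> exists s : baire,
  [/\ s 0 = i, bsteps s & wp A t e (PAnd (eq s) (PEq Q A f (sn s)))]}.
Proof.
have [t ht] := natseq_extract Q; eexists=> A i b f e [hb [hs [h1 [h2 h3]]]].
have [s ws] := ht A f _ hs; have [d wd] := ht A b _ hb; exists s.
have ms n : inh (SMaps Q A f (Urel n) (Urel (s n))).
  by apply: sn_maps; have [v _ [_ hv]] := ws; exists (pr1 v).
have mb n : inh (SMaps Q A b (Urel n) (Urel (d n))).
  by apply: sn_maps; have [v _ [_ hv]] := wd; exists (pr1 v).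
have inhI (P : prop) v : P v -> inh P by exists v.
split.
- have := inh_allN (s 0) (inh_allN 0 (inhI _ _ h2)) => /inh_imp[].
    by apply/inh_and; split=> //; exists (numeral 0); apply/(@SAeq_lift (AVar 0) (ACst 0)).
  by move=> v /(@SAeq_lift (AVar (s 0)) (ACst i)).
- move=> n; have dn : d n <= 1.
    by have [v /(@SAle_lift (AVar (d n)) (ACst 1))] := inh_imp (inh_allN (d n) (inh_allN n (inhI _ _ h1))) (mb n).
  have := inh_allN (d n) (inh_allN (s n.+1) (inh_allN (s n) (inh_allN n.+1 (inh_allN n (inhI _ _ h3))))).
  move=> /inh_imp[].
    do 3 (apply/inh_and; split=> //); exists (numeral 0).
    by apply/(@SAeq_lift (AVar n.+1) (AAdd (AVar n) (ACst 1))); rewrite /= addn1.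
  move=> v /(@SAeq_lift (AVar (s n.+1)) (AAdd (AMul (ACst 2) (AVar (s n))) (AVar (d n)))) /= ->.
  by case: (d n) dn => [|[|]] // _; [left|right]; lia.
apply: (wp_call (P := eq (pr0 (pr1 e)))); last by move=> _ <-; exact: ws.
by apply: (wp_fun cont_pr0); apply: (wp_fun cont_pr1); apply: wp_here.
Qed.

Lemma bval_inh A x f s : inh (PEq Q A f (sn s)) ->
  inh (SReq Q A (SRvar Q A (rn x)) (SRdyadic Q A f)) -> bval x s.
Proof.
pose G := req (rvar 0) (rdyadic 1) 2; have [l hl] := leibniz_prog Q G 1.
have E c : sem Q A G (upd (upd (fun=> Urel 0) 0 (rn x)) 1 c) =
    SReq Q A (SRvar Q A (rn x)) (SRdyadic Q A c) by [].
case=> e he [d hd] k.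
have {hd he} h : inh (SReq Q A (SRvar Q A (rn x)) (SRdyadic Q A (sn s))).
  rewrite -E; apply: inh_wp (hl A _ f (sn s) (bp e d) _).
  by split; rewrite ?pr0_bp ?pr1_bp ?E.
have := @req_inh Q _ _ _ (ok_rvar Q cont_pr0) _ _ _ (ok_rdyadic Q cont_pr1) A (bp x s).
rewrite pr0_bp pr1_bp => /(_ h k)[c hc]; exists c => n /hc.
rewrite /oq pr0_bp pr1_bp -/(rq _) /qv /= subr0.
have -> : ((2 ^ n)%:R^-1 = e2 n)%R by rewrite -qv_q2N /qv /= subr0 mul1r.
by [].
Qed.

Lemma be_program A a : SBE Q A a -> exists F, forall x, reg x -> within q0 q1 x ->
  wp A F x (Jp Q A (fun s => [/\ s 0 = 0, bsteps s & bval x s])).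
Proof.
move=> ha; have [t1 h1] := @realin_prog Q q0 q1 isT isT; have [te he] := binary_extract.
eexists=> x rx wx; apply: wp_exE; last exact: closed_Jp.
  apply: wp_app; first by apply: wp_cst; exact: (ha (rn x)).
  by apply: h1.
move=> b d hd; apply: wp_mapj; first by whyp hd.
move=> d' [f [hb hr]]; have [s [s0 ss ws]] := he A 0 b f (pr0 d') hb.
apply: (@wp_mono _ _ _ (eq s)) => [_ <-|]; last first.
  apply: (wp_fst (R := PEq Q A f (sn s))).
  apply: (wp_call (P := eq (pr0 d'))); first by apply: (wp_fun cont_pr0); apply: wp_var0.
  by move=> _ <-; exact: ws.
split=> //; apply: (@bval_inh A x f); first by have [v _ [_ hv]] := ws; exists (pr1 v).
by exists (pr1 d').
Qed.

End BinaryProgram.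

Lemma bsteps_bound s : bsteps s -> forall n j,
  s n * 2 ^ j <= s (n + j) /\ s (n + j) + 1 <= (s n + 1) * 2 ^ j.
Proof.
move=> ss n; elim=> [|j [h1 h2]]; first by rewrite addn0; lia.
by rewrite addnS expnS; case: (ss (n + j)) => ->; lia.
Qed.

Section Perturbation.

Local Open Scope ring_scope.

Lemma e2D n j : e2 (n + j) = e2 n * e2 j. Proof. by rewrite /e2 exprD. Qed.

Lemma e2_scale (a b n j : nat) : (a%:R * e2 n <= b%:R * e2 (n + j)) = (a * 2 ^ j <= b)%N.
Proof.
have h : a%:R * e2 n = (a * 2 ^ j)%:R * e2 (n + j).
  by rewrite e2D natrM -!mulrA [(2 ^ j)%:R * _]mulrCA [_ * e2 j]mulrC e2_nat mulr1.
by rewrite h ler_pM2r ?e2_gt0 // ler_nat.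
Qed.

Lemma e2_scale' (a b n j : nat) : (b%:R * e2 (n + j) <= a%:R * e2 n) = (b <= a * 2 ^ j)%N.
Proof.
have h : a%:R * e2 n = (a * 2 ^ j)%:R * e2 (n + j).
  by rewrite e2D natrM -!mulrA [(2 ^ j)%:R * _]mulrCA [_ * e2 j]mulrC e2_nat mulr1.
by rewrite h ler_pM2r ?e2_gt0 // ler_nat.
Qed.

(* x = 1/2 + sum_i (+-1 or 0) 2^-(i+2); the digit 1 adds, the digit 2 subtracts *)
Fixpoint pnum (p : baire) (n : nat) : nat :=
  if n is m.+1 then ((pnum p m).*2 + (p m == 1) - (p m == 2))%N else 1%N.
Definition pseq (p : baire) : baire := fun n => ratc (pnum p n) (2 ^ n.+1).

Lemma pnum_gt0 p n : (0 < pnum p n)%N.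
Proof. by elim: n => //= n IH; case: (p n == 2); case: (p n == 1); lia. Qed.

Lemma pnum_step p n : (pnum p n.+1 <= (pnum p n).*2.+1)%N /\ ((pnum p n).*2 <= (pnum p n.+1).+1)%N.
Proof. by rewrite /=; case: (p n == 1); case: (p n == 2); lia. Qed.

Lemma pnum_bound p n j : (pnum p (n + j) + 1 <= (pnum p n + 1) * 2 ^ j)%N /\
  (pnum p n * 2 ^ j <= pnum p (n + j) + 2 ^ j - 1)%N.
Proof.
elim: j => [|j [h1 h2]]; first by rewrite addn0; lia.
have [s1 s2] := pnum_step p (n + j); rewrite (addnS n j) expnS; set k := (2 ^ j)%N in h1 h2 *.
have k0 : (0 < k)%N by rewrite expn_gt0.
move: s1 s2 h1 h2; move: (pnum p (n + j).+1) (pnum p (n + j)) (pnum p n) => a b c s1 s2 h1 h2.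
have e1 : ((c + 1) * (2 * k) = ((c + 1) * k).*2)%N by lia.
have e2 : (c * (2 * k) = (c * k).*2)%N by lia.
by split; rewrite ?e1 ?e2; lia.
Qed.

Lemma rq_pseq p n : rq (pseq p n) = (pnum p n)%:R * e2 n.+1.
Proof.
rewrite rq_ratc ?expn_gt0 //; congr (_ * _).
by rewrite -qv_q2N /qv /= subr0 mul1r.
Qed.

Lemma reg_pseq p : reg (pseq p).
Proof.
move=> n m /subnKC <-; set j := (m - n)%N; rewrite !rq_pseq -addSn e2D.
have [h1 h2] := pnum_bound p n j; have := e2_nat j; have := e2_gt0 j; have := e2_gt0 n.+1.
have -> : e2 n = e2 n.+1 + e2 n.+1 by rewrite -e2S.
have {}h1 : (pnum p (n + j))%:R + 1 <= ((pnum p n)%:R + 1) * (2 ^ j)%:R :> rat.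
  by move: h1; rewrite -(ler_nat rat) natrM !natrD.
have {}h2 : (pnum p n)%:R * (2 ^ j)%:R + 1 <= (pnum p (n + j))%:R + (2 ^ j)%:R :> rat.
  have : (pnum p n * 2 ^ j + 1 <= pnum p (n + j) + 2 ^ j)%N by move: (expn_gt0 2 j); lia.
  by rewrite -(ler_nat rat) !natrD natrM.
move: h1 h2; set a := (pnum p n)%:R; set b := (pnum p (n + j))%:R.
set u := e2 n.+1; set v := e2 j; set k := (2 ^ j)%:R => h1 h2 u0 v0 vk.
have b1 : b * v + v <= a + 1.
  have : (b + 1) * v <= (a + 1) * k * v by rewrite ler_pM2r.
  by rewrite -mulrA [k * v]mulrC vk mulr1; lra.
have b2 : a + v <= b * v + 1.
  have : (a * k + 1) * v <= (b + k) * v by rewrite ler_pM2r.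
  by rewrite !mulrDl -mulrA [k * v]mulrC vk mulr1 mul1r.
have -> : a * u - b * (u * v) = (a - b * v) * u by ring.
rewrite normrM (gtr0_norm u0) -{2 3}[u]mul1r -mulrDl ltr_pM2r // ltr_norml.
by apply/andP; split; lra.
Qed.

Lemma within_pseq p : within q0 q1 (pseq p).
Proof.
move=> n; rewrite rq_pseq qv_q0 qv_q1; have := e2_gt0 n.
have : (pnum p n)%:R * e2 n.+1 <= (1%:R : rat) * e2 0.
  have := e2_scale' 1 (pnum p n) 0 n.+1; rewrite add0n mul1n => ->.
  have [h _] := pnum_bound p 0 n; rewrite add0n /= in h; rewrite expnS; lia.
rewrite mul1r [e2 0]expr0 => h1 h2; have : 0 <= (pnum p n)%:R * e2 n.+1.
  by rewrite mulr_ge0 ?ler0n ?ltW ?e2_gt0.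
by lra.
Qed.

Definition evz (p : baire) (n : nat) : Prop := forall i, (n <= i)%N -> p i = 0%N.

Lemma pnum_evz p n j : evz p n -> pnum p (n + j) = (pnum p n * 2 ^ j)%N.
Proof.
move=> pz; elim: j => [|j IH]; first by rewrite addn0 muln1.
by rewrite addnS /= IH pz ?leq_addr // expnS; lia.
Qed.

(** The number is the dyadic rational [pnum p n0 / 2^(n0+1)] and lies between [s n / 2^n] and
    [(s n + 1) / 2^n]; a common denominator turns this into inequalities of naturals. *)
Lemma bval_bounds p s n0 n j : bsteps s -> bval (pseq p) s -> evz p n0 -> (n + j = n0.+1)%N ->
  (s n * 2 ^ j <= pnum p n0)%N /\ (pnum p n0 <= (s n + 1) * 2 ^ j)%N.
Proof.
move=> ss sv pz nj.
have key : (s n)%:R * e2 n <= (pnum p n0)%:R * e2 n0.+1 /\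
    (pnum p n0)%:R * e2 n0.+1 <= (s n + 1)%:R * e2 n.
  have fact k : exists m, [/\ (n <= m)%N, rq (pseq p m) = (pnum p n0)%:R * e2 n0.+1
      & `|rq (pseq p m) - (s m)%:R * e2 m| < e2 k].
    have [c hc] := sv k; exists (maxn c n0.+1); split; last by apply: hc; rewrite leq_maxl.
      by rewrite leq_max; apply/orP; right; lia.
    have : (n0 <= maxn c n0.+1)%N by lia.
    move=> /subnKC <-; rewrite rq_pseq pnum_evz // -addSn e2D natrM -!mulrA; congr (_ * _).
    by rewrite mulrCA [_ * e2 _]mulrC e2_nat mulr1.
  have bb m : (n <= m)%N -> (s n)%:R * e2 n <= (s m)%:R * e2 m <= (s n + 1)%:R * e2 n.
    move=> /subnKC <-; have [h1 h2] := bsteps_bound ss n (m - n).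
    by rewrite e2_scale e2_scale' h1 /=; lia.
  split; apply: le_e2 => k; have [m [nm <- hm]] := fact k; have /andP[b1 b2] := bb m nm;
    move: hm; rewrite ltr_norml => /andP[? ?]; lra.
by case: key; rewrite -nj e2_scale e2_scale'.
Qed.

(** For the number [M / 2^(n0+1)] the partial sum of an expansion at [n0+1] is [M] or [M - 1]. A
    code settles this choice after reading finitely many digits of [p]; a later digit moves the
    number to the side that the choice excludes. The codes of the list are treated one after
    another. *)
Lemma avoid_codes (L : list baire) (s0 : seq nat) : exists s1 : seq nat,
  prefix s0 s1 /\ forall p n0 G s, evz p n0 -> mkseq p (size s1) = s1 -> List.In G L ->
    kapp G p s -> bsteps s -> bval (pseq p) s -> False.
Proof.
elim: L s0 => [|G L IH] s0; first by exists s0; split=> //; apply: prefix_refl.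
have [s1 [p01 h1]] := IH s0.
case: (EM (exists p n0 s, [/\ evz p n0, mkseq p (size s1) = s1, kapp G p s, bsteps s & bval (pseq p) s]));
  last first.
  move=> no; exists s1; split=> // p n0 G' s pz ps [<-|GL] Gs ss sv; last exact: (h1 p n0 G' s pz ps GL Gs ss sv).
  by apply: no; exists p, n0, s.
move=> [p [n0 [s [pz ps Gs ss sv]]]].
have [k hk] := kapp_agree Gs n0.+2.
have [lo hi] := bval_bounds ss sv pz (addn0 n0.+1); rewrite expn0 !muln1 in lo hi.
(* The digit 2 pushes the number below [M / 2^(n0+1)] if the partial sum is [M], the digit 1 above
   it otherwise. *)
pose K := maxn (maxn k n0) (size s1); pose dig := if s n0.+1 == pnum p n0 then 2%N else 1%N.
have Kn0 : (n0 <= K)%N by rewrite /K; lia.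
have Kk : (k <= K)%N by rewrite /K; lia.
have Ks : (size s1 <= K)%N by rewrite /K; lia.
exists (rcons (mkseq p K) dig); split.
  apply: prefix_trans p01 _; rewrite -[in X in prefix X]ps prefixE size_mkseq.
  rewrite -cats1 take_cat size_mkseq; case: ltnP => h.
    by rewrite /mkseq -map_take take_iota (minn_idPl (ltnW h)).
  have -> : size s1 = K by apply/eqP; rewrite eqn_leq Ks h.
  by rewrite subnn take0 cats0.
move=> p' n1 G' s' pz' ps' inG Gs' ss' sv'.
rewrite size_rcons size_mkseq mkseqS in ps'; have [ps1 ps2] := rcons_inj ps'.
have ag : agree K p' p by apply/agree_mkseq.
case: inG => [GG|GL]; last first.
  apply: (h1 p' n1 G' s') => //; rewrite -[RHS]ps; apply/agree_mkseq; exact: agree_le ag.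
subst G'; have st : s' n0.+1 = s n0.+1.
  by apply/esym; apply: (hk G p') => //; apply: agree_sym; apply: agree_le ag.
have pK : pnum p' K = (pnum p n0 * 2 ^ (K - n0))%N.
  have -> : pnum p' K = pnum p K by elim: (K) ag => //= m IHm ag; rewrite IHm ?ag //; apply: agree_le ag.
  by rewrite -{1}(subnKC Kn0) pnum_evz.
pose n2 := maxn n1 K.+1; have pz2 : evz p' n2 by move=> i hi'; apply: pz'; rewrite /n2 in hi'; lia.
have Kn2 : (K.+1 <= n2)%N by rewrite leq_maxr.
have [|lo' hi'] := @bval_bounds p' s' n2 n0.+1 (n2 - n0) ss' sv' pz2; first by lia.
rewrite st in lo' hi'; have [u1 u2] := pnum_bound p' K.+1 (n2 - K.+1).
rewrite subnKC // in u1 u2.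
have e1 : (2 ^ (n2 - n0) = 2 ^ (K - n0) * 2 * 2 ^ (n2 - K.+1))%N.
  by rewrite -expnSr -expnD; congr (2 ^ _)%N; lia.
move: u1 u2; rewrite /= pK ps2 /dig; move: lo' hi'; rewrite e1.
set a := (2 ^ (K - n0))%N; set b := (2 ^ (n2 - K.+1))%N; set N := pnum p' n2; set M := pnum p n0 in lo hi *.
have a0 : (0 < a)%N by rewrite expn_gt0.
have b0 : (0 < b)%N by rewrite expn_gt0.
have M0 : (0 < M)%N by apply: pnum_gt0.
have Ma : (0 < M * a)%N by rewrite muln_gt0 M0.
have p1 : (M * (a * 2 * b) = (M * a).*2 * b)%N by rewrite -mul2n; lia.
case: (eqVneq (s n0.+1) M) => [->|ne]; rewrite ?p1 => lo' hi' u1 u2.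
  have : (N + 1 <= (M * a).*2 * b)%N.
    by apply: leq_trans u1 _; rewrite leq_mul2r; apply/orP; right; rewrite /= -mul2n; lia.
  by lia.
have sM : (s n0.+1 + 1 = M)%N by move: ne lo hi => /eqP; rewrite /M; lia.
rewrite sM p1 in hi'; have : ((M * a).*2 * b + b <= N + b - 1)%N.
  by apply: leq_trans _ u2; rewrite -[X in (_ + X)%N]mul1n -mulnDl leq_mul2r; apply/orP; right; rewrite /= -mul2n; lia.
by lia.
Qed.

(** Composed with the program that expands [pseq p], finitely many selectors would give expansions
    for all perturbations starting with enough zeros, contrary to [avoid_codes]. *)
Lemma not_BE Q : (forall p, Q p -> exists G k, finite_codes G /\ forall p', agree k p p' -> Q p' ->
    (exists z, kset p' z) -> exists c v, [/\ G c, kapp c p' v & kset p' v]) ->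
  valid Q (FNot BE).
Proof.
move=> base; apply: valid_not => A rho a; rewrite sem_BE => /be_program[F hF].
pose F' := ccomp F (fcode (fun p => bp A (pseq p))).
have cF : cont (fun p => bp A (pseq p)).
  apply: cont_bp; first exact: cont_cst.
  apply: (@cont_modulus _ id) => n p p' pp; rewrite /pseq; congr ratc.
  by elim: n pp => //= n IH pp; rewrite IH ?pp //; apply: agree_le pp.
have run p : exists f, [/\ kapp F' p f, jdom Q A f
    & forall z, jv A f z -> [/\ z 0 = 0%N, bsteps z & bval (pseq p) z]].
  have [f Ff [df sf]] := hF _ (reg_pseq p) (@within_pseq p); exists f; split=> //.
  by apply: ccompP Ff; apply: fcodeP.
have [f0 [F0 d0 _]] := run (numeral 0).
have [|G [k [[L hL] hG]]] := @jop_selectors Q A finite_codes _ (@finite_codes2) (@finite_codes_list) base _ d0.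
  by move=> c; exists [:: c] => g <-; left.
have [l hl] := kapp_agree F0 k.
have [s1 [pre h1]] := avoid_codes (List.map (ccomp^~ F') L) (nseq l 0%N).
pose p : baire := fun i => nth 0%N s1 i.
have pz : evz p (size s1) by move=> i hi; rewrite /p nth_default.
have ps : mkseq p (size s1) = s1 by apply: mkseq_nth.
have [f [Ff df sf]] := run p.
have [|c [v [Gc cv jv_]]] := hG f _ df.
  apply: (hl F' p) => // i il; rewrite /p; have /prefixP[s2 ->] := pre.
  by rewrite nth_cat size_nseq il nth_nseq il.
have [_ vs vv] := sf v jv_.
apply: (h1 p (size s1) (ccomp c F') v pz ps _ _ vs vv); last exact: ccompP Ff cv.
by apply: (List.in_map (ccomp^~ F')); apply: hL.
Qed.

End Perturbation.

(** * Robust division from all-or-unique choice *)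

Definition QRDIV (p : baire) : Prop :=
  kset p (numeral 0) \/ exists z, forall z', kset p z' <-> z' = z.

(** * Digits of a quotient found by search *)

Section Division.

Local Open Scope ring_scope.

Variables x y : baire.
Hypotheses (rx : reg x) (ry : reg y).

(** For positive [y] the sign of [a x - b y] compares [x / y] with [b / a]; it is certain once the
    approximation exceeds the error [lerr]. *)
Definition lform (a b m : nat) : rat := a%:R * rq (x m) - b%:R * rq (y m).
Definition lerr (a b m : nat) : rat := (a + b)%:R * e2 m.

Lemma lform_close a b m l : (m <= l)%N ->
  lform a b m - lform a b l <= lerr a b m /\ lform a b l - lform a b m <= lerr a b m.
Proof.
move=> ml; have := rx ml; have := ry ml; rewrite !ltr_norml => /andP[y1 y2] /andP[x1 x2].
have a0 : 0 <= a%:R :> rat by rewrite ler0n.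
have b0 : 0 <= b%:R :> rat by rewrite ler0n.
have h1 := ler_wpM2l a0 (ltW x1); have h2 := ler_wpM2l a0 (ltW x2).
have h3 := ler_wpM2l b0 (ltW y1); have h4 := ler_wpM2l b0 (ltW y2).
by rewrite /lform /lerr natrD; split; lra.
Qed.

Lemma lform_pos a b m : lerr a b m < lform a b m -> forall l, - lerr a b l <= lform a b l.
Proof.
move=> h l; have e0 k : 0 <= lerr a b k by rewrite mulr_ge0 ?ler0n // ltW ?e2_gt0.
have := e0 m; have := e0 l; case: (leqP m l) => [ml|/ltnW lm].
  by have [] := lform_close a b ml; lra.
by have [] := lform_close a b lm; lra.
Qed.

Lemma lform_neg a b m : lform a b m < - lerr a b m -> forall l, lform a b l <= lerr a b l.
Proof.
move=> h l; have e0 k : 0 <= lerr a b k by rewrite mulr_ge0 ?ler0n // ltW ?e2_gt0.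
have := e0 m; have := e0 l; case: (leqP m l) => [ml|/ltnW lm].
  by have [] := lform_close a b ml; lra.
by have [] := lform_close a b lm; lra.
Qed.

(* One search step: the outcome is the successor of the chosen digit, or 0. *)
Definition dtest (n s m : nat) : nat :=
  if lform (2 ^ n.+1) s.+1 m < - lerr (2 ^ n.+1) s.+1 m then 1%N
  else if lerr (2 ^ n.+1) s.+1 m < lform (2 ^ n.+1) s.+1 m then 3%N
  else if (lerr (2 ^ n.+2) s.*2.+1 m < lform (2 ^ n.+2) s.*2.+1 m)
          && (lform (2 ^ n.+2) s.*2.+3 m < - lerr (2 ^ n.+2) s.*2.+3 m) then 2%N
  else 0%N.

(** By [dtest_ex] the search succeeds when [y] is regular and certified positive; the last 0 is a
    default. *)
Definition dnext (n s : nat) : nat :=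
  if pselect (exists m, dtest n s m != 0%N) is left h then (dtest n s (ex_minn h)).-1 else 0%N.

Fixpoint dstate (n : nat) : nat :=
  if n is m.+1 then ((dstate m).*2 + dnext m (dstate m))%N else 0%N.
Definition dseq : baire := fun n => dnext n (dstate n).

Lemma dnext_le2 n s : (dnext n s <= 2)%N.
Proof.
rewrite /dnext; case: pselect => // h; rewrite /dtest.
by case: ifP => // _; case: ifP => // _; case: ifP.
Qed.

(** The quotient lies between [s / 2^(n+1)] and [(s + 2) / 2^(n+1)]. The subintervals for the digits
    0, 1 and 2 overlap, so that one of them can be confirmed by a finite search, as would be
    impossible with bits. *)
Definition dinv (n s : nat) : Prop :=
  (forall l, - lerr (2 ^ n.+1) s l <= lform (2 ^ n.+1) s l) /\
  (forall l, lform (2 ^ n.+1) s.+2 l <= lerr (2 ^ n.+1) s.+2 l).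

Lemma lform2 a b l : lform (2 * a) b.*2 l = 2 * lform a b l.
Proof. by rewrite /lform -mul2n !natrM; ring. Qed.

Lemma lerr2 a b l : lerr (2 * a) b.*2 l = 2 * lerr a b l.
Proof. by rewrite /lerr -mul2n -mulnDr natrM mulrA. Qed.

Lemma dinv_next n s : dinv n s -> (exists m, dtest n s m != 0%N) -> dinv n.+1 (s.*2 + dnext n s).
Proof.
move=> [hP hN] ex; rewrite /dnext; case: pselect => // h.
case: ex_minnP => m; rewrite /dtest /dinv [(2 ^ n.+2)%N]expnS.
case: ifP => [c0 _ _|_].
  rewrite addn0; split=> l; first by rewrite lform2 lerr2; have := hP l; lra.
  by rewrite -[s.*2.+2]/(s.+1.*2) lform2 lerr2; have := lform_neg c0 l; lra.
case: ifP => [c2 _ _|_].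
  rewrite addn2; split=> l; first by rewrite -[s.*2.+2]/(s.+1.*2) lform2 lerr2; have := lform_pos c2 l; lra.
  by rewrite -[s.*2.+4]/(s.+2.*2) lform2 lerr2; have := hN l; lra.
by case: ifP => // /andP[c1 c1'] _ _; rewrite addn1; split; [apply: lform_pos c1|apply: lform_neg c1'].
Qed.

Hypothesis ypos : exists n, e2 n + e2 n < rq (y n).

Lemma y_lower : exists2 d, 0 < d & exists n, forall l, (n <= l)%N -> d <= rq (y l).
Proof.
have [n hn] := ypos; exists (e2 n); first exact: e2_gt0.
by exists n => l nl; have := ry nl; rewrite ltr_norml => /andP[? ?]; lra.
Qed.

(** If both outer tests fail, [2^(n+1) x] is within the error of [(s + 1) y]. As [y] is bounded
    below by [d], the middle test succeeds at a stage where the error is under [d / 8]. *)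
Lemma dtest_ex n s : exists m, dtest n s m != 0%N.
Proof.
apply: contrapT => /forallNP no; have [d d0 [n0 hd]] := y_lower.
have nz m : dtest n s m = 0%N by have /negP := no m; rewrite negbK => /eqP.
pose C : rat := (2 ^ n.+1 + s.+1)%:R.
have C1 : 0 < C by rewrite ltr0n addnS.
have [k hk] : exists k, e2 k < d / (8 * C) by apply: e2_small; rewrite divr_gt0 // mulr_gt0.
have {}hk : 8 * C * e2 k < d by rewrite mulrC -ltr_pdivlMr // mulr_gt0.
pose m := maxn n0 k; have dm : d <= rq (y m) by apply: hd; rewrite leq_maxl.
have em : C * e2 m <= C * e2 k by rewrite ler_pM2l // e2_le // leq_maxr.
have := nz m; rewrite /dtest; case: ifP => // c0; case: ifP => // c2; case: ifP => // c1 _.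
move/negbT: c0; rewrite -leNgt => c0; move/negbT: c2; rewrite -leNgt => c2.
have e1 : lerr (2 ^ n.+1) s.+1 m = C * e2 m by [].
have e3 : lerr (2 ^ n.+2) s.*2.+1 m <= 2 * C * e2 m.
  rewrite /lerr ler_pM2r ?e2_gt0 // /C -natrM ler_nat expnS; lia.
have e4 : lerr (2 ^ n.+2) s.*2.+3 m <= 3 * C * e2 m.
  rewrite /lerr ler_pM2r ?e2_gt0 // /C -natrM ler_nat expnS; lia.
have f1 : lform (2 ^ n.+2) s.*2.+1 m = 2 * lform (2 ^ n.+1) s.+1 m + rq (y m).
  rewrite /lform expnS natrM -[s.*2.+1]addn1 -[s.+1]addn1 !natrD -mul2n natrM; ring.
have f3 : lform (2 ^ n.+2) s.*2.+3 m = 2 * lform (2 ^ n.+1) s.+1 m - rq (y m).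
  rewrite /lform expnS natrM -[s.*2.+3]addn3 -[s.+1]addn1 !natrD -mul2n natrM; ring.
have p0 : 0 < C * e2 m by rewrite mulr_gt0 ?e2_gt0.
move/negP: c1; apply; rewrite f1 f3; rewrite e1 in c0 c2; apply/andP; split.
  by apply: le_lt_trans e3 _; lra.
by have := e4; lra.
Qed.

Hypotheses (x0 : forall m, - e2 m <= rq (x m)) (xy : forall m, rq (x m) - rq (y m) <= e2 m + e2 m).

Lemma dinv_state n : dinv n (dstate n).
Proof.
elim: n => [|n IH]; last by apply: dinv_next => //; apply: dtest_ex.
by split=> l; rewrite /lform /lerr; [have := x0 l|have := xy l]; rewrite /=; lra.
Qed.

End Division.

Section DivisionInstance.

Local Open Scope ring_scope.

Definition ycert (y : baire) (n : nat) : bool := e2 n + e2 n < rq (y n).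

(** Strings are excluded only after [y] has been certified positive, and then only the digits of the
    quotient remain. Otherwise all of [{0,1,2}^omega] is left. *)
Definition rdiv_inst (w : baire) : baire := fun c =>
  let s := decode c in
  if has (ycert (pr1 w)) (iota 0 (size s).+1) && (s != mkseq (dseq (pr0 w) (pr1 w)) (size s))
  then 1%N else 0%N.

Definition rdiv_dom (w : baire) : Prop :=
  [/\ reg (pr0 w), reg (pr1 w), within q0 q1 (pr0 w), within q0 q1 (pr1 w)
    & forall m, rq (pr0 w m) - rq (pr1 w m) <= e2 m + e2 m].

Lemma lform_agree k a b m x y x' y' : agree k x x' -> agree k y y' -> (m < k)%N ->
  lform x' y' a b m = lform x y a b m.
Proof. by move=> xx yy mk; rewrite /lform xx // yy. Qed.

Lemma dnext_agree x y n s : (exists m, dtest x y n s m != 0%N) -> exists k, forall x' y',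
  agree k x x' -> agree k y y' -> dnext x' y' n s = dnext x y n s.
Proof.
move=> ex; rewrite /dnext; case: pselect => // h.
exists (ex_minn h).+1 => x' y' xx yy.
have E m : (m <= ex_minn h)%N -> dtest x' y' n s m = dtest x y n s m.
  by move=> mh; rewrite /dtest !(lform_agree _ _ xx yy).
case: pselect => h'; last by case: h'; exists (ex_minn h); rewrite E //; case: ex_minnP.
suff -> : ex_minn h' = ex_minn h by rewrite E.
move: E; case: (ex_minnP h) => m hm mmin E; case: ex_minnP => m' hm' mmin'.
have le : (m' <= m)%N by apply: mmin'; rewrite E.
by apply/eqP; rewrite eqn_leq le mmin // -E.
Qed.

Local Opaque dnext.

Lemma dstate_agree x y : (forall n s, exists m, dtest x y n s m != 0%N) ->
  forall n, exists k, forall x' y', agree k x x' -> agree k y y' ->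
    dstate x' y' n = dstate x y n.
Proof.
move=> ex; elim=> [|n [k hk]]; first by exists 0%N.
have [l hl] := dnext_agree (ex n (dstate x y n)).
exists (maxn k l) => x' y' xx yy /=.
rewrite hk ?hl //; by [apply: agree_le xx; rewrite ?leq_maxr ?leq_maxl|apply: agree_le yy; rewrite ?leq_maxr ?leq_maxl].
Qed.

Lemma dseq_agree x y : (forall n s, exists m, dtest x y n s m != 0%N) ->
  forall n, exists k, forall x' y', agree k x x' -> agree k y y' ->
    mkseq (dseq x' y') n = mkseq (dseq x y) n.
Proof.
move=> ex; elim=> [|n [k hk]]; first by exists 0%N => x' y' _ _; exact: (erefl [::]).
have [l hl] := dstate_agree ex n; have [j hj] := dnext_agree (ex n (dstate x y n)).
exists (maxn k (maxn l j)) => x' y' xx yy; rewrite (mkseqS (dseq x' y')) (mkseqS (dseq x y)).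
have kx : agree k x x' by apply: agree_le xx; rewrite leq_maxl.
have ky : agree k y y' by apply: agree_le yy; rewrite leq_maxl.
have lx : agree l x x' by apply: agree_le xx; rewrite !leq_max leqnn orbT.
have ly : agree l y y' by apply: agree_le yy; rewrite !leq_max leqnn orbT.
have jx : agree j x x' by apply: agree_le xx; rewrite !leq_max leqnn !orbT.
have jy : agree j y y' by apply: agree_le yy; rewrite !leq_max leqnn !orbT.
rewrite (hk _ _ kx ky) /dseq (hl _ _ lx ly) (hj _ _ jx jy).
reflexivity.
Qed.

Lemma ycert_ex w n : has (ycert (pr1 w)) (iota 0 n) -> exists n, e2 n + e2 n < rq (pr1 w n).
Proof. by case/hasP => m _ h; exists m. Qed.

(** The search behind [dseq] needs a regular, certified [y] to halt, so the instance is shown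
    continuous on [rdiv_dom] only, and its code comes from [code_of] instead of [fcode]. *)
Lemma rdiv_inst_pcont : pcont (fun w p => rdiv_dom w /\ p = rdiv_inst w).
Proof.
move=> w p [gw ->] c; rewrite /rdiv_inst; set s := decode c; set n := size s.
have yc w' : agree n.*2.+2 w w' ->
    has (ycert (pr1 w')) (iota 0 n.+1) = has (ycert (pr1 w)) (iota 0 n.+1).
  move=> ww; apply: eq_in_has => m; rewrite mem_iota => /andP[_ mn].
  by rewrite /ycert /pr1 ww //; lia.
case hc: (has (ycert (pr1 w)) (iota 0 n.+1)); last first.
  by exists n.*2.+2 => w' p' ww [_ ->]; cbv beta; rewrite -/s -/n (yc _ ww) hc !andFb.
have [k hk] : exists k, forall x' y', agree k (pr0 w) x' -> agree k (pr1 w) y' ->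
    mkseq (dseq x' y') n = mkseq (dseq (pr0 w) (pr1 w)) n.
  by case: gw => *; apply: dseq_agree => m t; apply: dtest_ex => //; apply: ycert_ex hc.
exists (maxn n.*2.+2 k.*2) => w' p' ww [_ ->]; cbv beta; rewrite -/s -/n.
have w1 : agree n.*2.+2 w w' by apply: agree_le ww; rewrite leq_maxl.
have w2 : agree k.*2 w w' by apply: agree_le ww; rewrite leq_maxr.
have e0 : agree k (pr0 w) (pr0 w') by move=> i ik; apply: w2; lia.
have e1 : agree k (pr1 w) (pr1 w') by move=> i ik; apply: w2; lia.
by rewrite (yc _ w1) hc (hk _ _ e0 e1).
Qed.

Lemma rdiv_inst_cert w z : (exists n, e2 n + e2 n < rq (pr1 w n)) ->
  kset (rdiv_inst w) z <-> z = dseq (pr0 w) (pr1 w).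
Proof.
move=> [n hn]; split=> [zk|->].
  apply: funext => i; pose m := maxn n i.+1; have [_] := zk m.
  rewrite /rdiv_inst CodeSeq.codeK size_mkseq; case: ifP => //.
  have -> : has (ycert (pr1 w)) (iota 0 m.+1).
    by apply/hasP; exists n => //; rewrite mem_iota /m; lia.
  move=> /negbFE/eqP/agree_mkseq h _; apply: h; rewrite /m; lia.
by move=> i; split; [exact: dnext_le2|rewrite /rdiv_inst CodeSeq.codeK size_mkseq eqxx andbF].
Qed.

Lemma rdiv_inst_zero w z : ~ (exists n, e2 n + e2 n < rq (pr1 w n)) -> (forall n, (z n <= 2)%N) ->
  kset (rdiv_inst w) z.
Proof.
move=> no zb n; split=> //; rewrite /rdiv_inst; case: ifP => // /andP[/ycert_ex h].
by case: no.
Qed.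

Lemma rdiv_inst_QRDIV w : QRDIV (rdiv_inst w).
Proof.
case: (EM (exists n, e2 n + e2 n < rq (pr1 w n))) => [h|no]; last by left; apply: rdiv_inst_zero.
by right; exists (dseq (pr0 w) (pr1 w)) => z; apply: rdiv_inst_cert.
Qed.

Lemma rdiv_inst_ex w : exists z, kset (rdiv_inst w) z.
Proof. by case: (rdiv_inst_QRDIV w) => [h|[z h]]; [exists (numeral 0)|exists z; apply/h]. Qed.

(** In [dreal] digit [i] has weight [2^-(i+2)], so digits up to 2 stay within [0,1]. The same sums
    serve binary expansions later, with twice the weight. *)
Fixpoint dsum (z : baire) (n : nat) : nat := if n is m.+1 then ((dsum z m).*2 + z m)%N else 0%N.
Definition dreal (z : baire) : baire := fun n => ratc (dsum z n) (2 ^ n.+1).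

Lemma rq_dreal z n : rq (dreal z n) = (dsum z n)%:R * e2 n.+1.
Proof.
by rewrite rq_ratc ?expn_gt0 //; congr (_ * _); rewrite -qv_q2N /qv /= subr0 mul1r.
Qed.

Lemma cont_dreal : cont dreal.
Proof.
apply: (@cont_modulus _ id) => n z z' zz; rewrite /dreal; congr ratc.
by elim: n zz => //= n IH zz; rewrite IH ?zz //; apply: agree_le zz.
Qed.

Lemma dsum_bound z n j : (forall n, (z n <= 2)%N) ->
  (dsum z n * 2 ^ j <= dsum z (n + j) /\ dsum z (n + j) + 2 <= (dsum z n + 2) * 2 ^ j)%N.
Proof.
move=> zb; elim: j => [|j [h1 h2]]; first by rewrite addn0 muln1 muln1.
rewrite (addnS n j) expnS /=; have := zb (n + j)%N; set k := (2 ^ j)%N in h1 h2 *.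
move: (dsum z (n + j)) (dsum z n) h1 h2 => a b h1 h2 zj.
have e1 : (b * (2 * k) = (b * k).*2)%N by lia.
have e2 : ((b + 2) * (2 * k) = ((b + 2) * k).*2)%N by lia.
by rewrite e1 e2; lia.
Qed.

Lemma dreal_bounds z n j : (forall n, (z n <= 2)%N) ->
  rq (dreal z n) <= rq (dreal z (n + j)%N) /\ rq (dreal z (n + j)%N) + e2 (n + j) <= rq (dreal z n) + e2 n.
Proof.
move=> /(dsum_bound n j)[h1 h2]; rewrite !rq_dreal; split; first by rewrite -addSn e2_scale.
have dbl m a : a%:R * e2 m.+1 + e2 m = (a + 2)%:R * e2 m.+1 :> rat.
  by rewrite [e2 m]e2S natrD; ring.
by rewrite !dbl -addSn e2_scale'.
Qed.

Lemma reg_dreal z : (forall n, (z n <= 2)%N) -> reg (dreal z).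
Proof.
move=> zb n m /subnKC <-; have [h1 h2] := dreal_bounds n (m - n)%N zb.
by have := e2_gt0 (n + (m - n)); rewrite ltr_norml => ?; apply/andP; split; lra.
Qed.

Lemma within_dreal z : (forall n, (z n <= 2)%N) -> within q0 q1 (dreal z).
Proof.
move=> zb n; rewrite qv_q0 qv_q1; have := dreal_bounds 0 n zb.
rewrite add0n rq_dreal [dsum z 0]/= mul0r [e2 0]expr0 => -[h1 h2].
by  have := e2_gt0 n; lra.
Qed.

Lemma dstateE x y n : dstate x y n = dsum (dseq x y) n.
Proof. by elim: n => [//|n IH] /=; rewrite -IH. Qed.

(** If [y] is never certified, then [y], and with it [x], vanishes up to a few [2^-n], and every
    quotient in [0,1] serves. Otherwise [z] consists of the digits of the quotient, and [dinv]
    scaled by [2^-(n+1)] gives the estimate. *)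
Lemma rdiv_inst_sol w z : rdiv_dom w -> kset (rdiv_inst w) z -> forall n,
  `|rq (pr0 w n) - rq (pr1 w n) * rq (dreal z n)| <= 8 * e2 n.
Proof.
move=> [rx ry wx wy xy] zk n; have zb m : (z m <= 2)%N by have [] := zk m.
have := within_dreal zb n; have := wx n; have := wy n; rewrite qv_q0 qv_q1.
have en1 : e2 n <= 1 := e2_le (leq0n n); have e0 := e2_gt0 n.
have := dreal_bounds 0 n zb; rewrite add0n rq_dreal /= mul0r [e2 0]expr0 => -[d1 d2].
move=> /andP[y1 y2] /andP[x1 x2] _; set v := rq (dreal z n) in d1 d2 *.
have v0 : 0 <= v by []. have v1 : v <= 1 by lra.
case: (EM (exists n, e2 n + e2 n < rq (pr1 w n))) => [h|no].
  have zE := proj1 (rdiv_inst_cert z h) zk.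
  have x0 m : - e2 m <= rq (pr0 w m) by have := wx m; rewrite qv_q0 => /andP[]; lra.
  have [hP hN] := dinv_state rx ry h x0 xy n.
  move: (hP n) (hN n); rewrite dstateE -zE /lform /lerr; set s := dsum z n.
  have vE : v = s%:R * e2 n.+1 by rewrite /v rq_dreal.
  have eE := e2_nat n.+1; set E := (2 ^ n.+1)%:R in eE *; set u := e2 n.+1 in vE eE.
  have e1 : e2 n = u + u by rewrite -e2S.
  rewrite -[s.+2]addn2 !natrD -/E; set X := rq (pr0 w n) in x1 x2 *; set Y := rq (pr1 w n) in y1 y2 *.
  set S : rat := s%:R in vE *; move=> g1 g2; have u0 : 0 < u by apply: e2_gt0.
  have k1 : - (1 + v) * e2 n <= X - v * Y.
    have := ler_wpM2l (ltW u0) g1; rewrite vE.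
    have -> : u * (- ((E + S) * e2 n)) = - ((u * E + S * u) * e2 n) by ring.
    have -> : u * (E * X - S * Y) = (u * E) * X - S * u * Y by ring.
    by rewrite eE !mul1r mulNr.
  have k2 : X - v * Y - (u + u) * Y <= (1 + v + (u + u)) * e2 n.
    have := ler_wpM2l (ltW u0) g2; rewrite vE.
    have -> : u * ((E + (S + 2)) * e2 n) = (u * E + S * u + (u + u)) * e2 n by ring.
    have -> : u * (E * X - (S + 2) * Y) = (u * E) * X - S * u * Y - (u + u) * Y by ring.
    by rewrite eE !mul1r.
  rewrite -e1 in k2; move: k1 k2; clear -v0 v1 en1 e0 y1 y2; set e := e2 n in v0 v1 en1 e0 y1 y2 *.
  have p1 : 0 <= v * e by rewrite mulr_ge0 // ltW.
  have p2 : v * e <= e by rewrite ler_piMl // ltW.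
  have p3 : e * e <= e by rewrite ler_piMl // ltW.
  have p4 : e * Y <= 2 * e by rewrite mulrC ler_pM2r //; lra.
  by rewrite [Y * v]mulrC ler_norml => k1 k2; apply/andP; split; lra.
have yn : rq (pr1 w n) <= e2 n + e2 n by rewrite leNgt; apply/negP => h; apply: no; exists n.
have := xy n; set X := rq (pr0 w n) in x1 x2 *; set Y := rq (pr1 w n) in y1 y2 yn *; move=> xyn.
have q1_ : Y * v <= 2 * e2 n.
  apply: (@le_trans _ _ ((e2 n + e2 n) * v)); first by rewrite ler_wpM2r.
  have h : (e2 n + e2 n) * v <= e2 n + e2 n by rewrite ler_piMr //; lra.
  by lra.
have q2_ : - e2 n <= Y * v.
  apply: (@le_trans _ _ (- e2 n * v)); last by rewrite ler_wpM2r //; lra.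
  by rewrite mulNr lerN2 ler_piMr // ltW.
by rewrite ler_norml; apply/andP; split; lra.
Qed.

Lemma valid_RDIV Q : (forall p, QRDIV p -> Q p) -> valid Q RDIV.
Proof.
move=> hQ; have [te he] := real01_extract Q.
have [t1 h1] := @realin_prog Q q0 q1 isT isT.
have cxx : cont (fun w => pr0 (pr0 w)) := cont_comp cont_pr0 cont_pr0.
have cyy : cont (fun w => pr1 (pr0 w)) := cont_comp cont_pr1 cont_pr0.
(* The delay 4 makes up for the error [8 * e2 n] of [rdiv_inst_sol]. *)
have [t2 h2] := req_prog Q (ok_rvar Q cxx) (ok_rmul (ok_rvar Q cyy) (ok_rvar Q cont_pr1)) 4.
pose K := rle (rvar 0) (rvar 1) 2; have [k0 hk0] := leibniz_prog Q K 0; have [k1 hk1] := leibniz_prog Q K 1.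
pose G := (∃ z, real_in q0 q1 z ∧ req (rvar 0) (rmul (rvar 1) (rvar z)))%S 2.
have [l0 hl0] := leibniz_prog Q G 0; have [l1 hl1] := leibniz_prog Q G 1.
pose inst := code_of (fun w p => rdiv_dom w /\ p = rdiv_inst w).
eexists=> A rho env; rewrite sem_RDIV; wall=> x; wall=> y; apply: wp_lam => e [hx [hy hxy]].
have [[a [ra wa xa]] [b [rb wb yb]]] := (he A x _ hx, he A y _ hy).
have EK c d : sem Q A K (upd (upd rho 0 c) 1 d) = SRle Q A (SRvar Q A c) (SRvar Q A d) by [].
have EG c d : sem Q A G (upd (upd rho 0 c) 1 d) = PEx Q A (fun z => PAnd (SReal_in Q A nq0 nq1 z)
    (SReq Q A (SRvar Q A c) (SRmul (SRvar Q A d) (SRvar Q A z)))) by [].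
have S c d : upd (upd rho 1 d) 0 c = upd (upd rho 0 c) 1 d by apply: upd_swap.
have good : rdiv_dom (bp a b).
  rewrite /rdiv_dom pr0_bp pr1_bp; split=> //.
  have [v _ [_ hv]] := xa; have [u _ [_ hu]] := yb.
  have i1 : inh (sem Q A K (upd (upd rho 0 (rn a)) 1 y)).
    rewrite -S; apply: inh_wp (hk0 A (upd rho 1 y) x (rn a) (bp (pr1 v) (pr1 (pr1 e))) _).
    by split; rewrite ?pr0_bp ?pr1_bp // S EK.
  case: i1 => q hq.
  have i2 : inh (SRle Q A (SRvar Q A (rn a)) (SRvar Q A (rn b))).
    rewrite -EK; apply: inh_wp (hk1 A (upd rho 0 (rn a)) y (rn b) (bp (pr1 u) q) _).
    by split; rewrite ?pr0_bp ?pr1_bp.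
  have := @rle_inh Q _ _ _ (ok_rvar Q cont_pr0) _ _ _ (ok_rvar Q cont_pr1) A (bp a b).
  rewrite pr0_bp pr1_bp => /(_ i2) hle m; apply: le_e2 => k; have [c hc] := hle k.
  have := hc (maxn c m) (leq_maxl _ _); rewrite /oq pr0_bp pr1_bp -!/(rq _).
  have := ra _ _ (leq_maxr c m); have := rb _ _ (leq_maxr c m).
  by rewrite !ltr_norml => /andP[? ?] /andP[? ?]; lra.
apply: (wp_let (P := PAnd (eq a) (PEq Q A x (rn a)))).
  apply: (wp_call (P := eq (pr0 e))); first by apply: (wp_fun cont_pr0); apply: wp_var0.
  by move=> _ <-; exact: xa.
move=> u hu; apply: (wp_let (P := PAnd (eq b) (PEq Q A y (rn b)))).
  apply: (wp_call (P := eq (pr0 (pr1 e)))).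
    by apply: wp_shift; apply: (wp_fun cont_pr0); apply: (wp_fun cont_pr1); apply: wp_var0.
  by move=> _ <-; exact: yb.
move=> w hw; rewrite -EG -S; apply: (wp_call (c := l0) (P := PAnd (PEq Q A (rn a) x)
    (sem Q A G (upd (upd rho 1 y) 0 (rn a))))); last exact: hl0.
apply: wp_pair; first by apply: wp_sym; apply: wp_snd; whyp hu.
rewrite S; apply: (wp_call (c := l1) (P := PAnd (PEq Q A (rn b) y)
    (sem Q A G (upd (upd rho 0 (rn a)) 1 (rn b))))); last exact: hl1.
apply: wp_pair; first by apply: wp_sym; apply: wp_snd; whyp hw.
rewrite EG; apply: (wp_let (P := eq (bp a b))).
  case: hu hw => ea _ [eb _]; apply: (wp_bp (P := eq a) (Q := eq b)) => [||v1 v2 <- <- //].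
    by apply: (wp_fun cont_pr0); apply: wp_shift; apply: wp_var0.
  by apply: (wp_fun cont_pr0); apply: wp_var0.
move=> _ <-; apply: (wp_mapj (P := kset (rdiv_inst (bp a b)))).
  apply: (wp_fun (cont_scons 3)); apply: (@wp_mono _ _ _ (eq (rdiv_inst (bp a b)))) => [_ <-|].
    split; last by move=> d /jv_inv[_ _ _ /(_ erefl)].
    by apply: jdom_base => //; [apply: hQ; apply: rdiv_inst_QRDIV|apply: rdiv_inst_ex].
  have hi : kapp inst (bp a b) (rdiv_inst (bp a b)) by apply: code_ofP => //; apply: rdiv_inst_pcont.
  apply: (wp_app (P := eq (bp a b))); last by apply: wp_var0.
  by apply: wp_cst => _ <-; exists (rdiv_inst (bp a b)).
move=> z zk; have zb m : (z m <= 2)%N by have [] := zk m.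
apply: (@wp_mono _ _ _ (PAnd (SReal_in Q A nq0 nq1 (rn (dreal z)))
    (SReq Q A (SRvar Q A (rn a)) (SRmul (SRvar Q A (rn b)) (SRvar Q A (rn (dreal z))))))).
  by move=> v hv; exists (rn (dreal z)).
apply: wp_pair.
  apply: (wp_call (P := eq (dreal z))); first by apply: (wp_fun cont_dreal); apply: wp_var0.
  by move=> _ <-; apply: h1; [apply: reg_dreal|apply: within_dreal].
apply: (wp_call (P := eq (bp (bp a b) (dreal z)))).
  apply: (wp_bp (P := eq (bp a b)) (Q := eq (dreal z))) => [||_ _ <- <- //].
    by apply: wp_shift; apply: wp_var0.
  by apply: (wp_fun cont_dreal); apply: wp_var0.
move=> _ <-; have := h2 A (bp (bp a b) (dreal z)); rewrite !(pr0_bp, pr1_bp); apply=> k n kn.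
have := rdiv_inst_sol good zk n; rewrite oq_rmul /oq !(pr0_bp, pr1_bp) -!/(rq _) => hz.
apply: le_lt_trans hz _; have := e2_le kn; rewrite addn4.
have := e2_gt0 k.+4; rewrite [e2 k]e2S [e2 k.+1]e2S [e2 k.+2]e2S [e2 k.+3]e2S; lra.
Qed.

End DivisionInstance.

(** * Binary expansions from choice between two points *)

Definition QBE (p : baire) : Prop :=
  forall z1 z2 z3, kset p z1 -> kset p z2 -> kset p z3 -> [\/ z1 = z2, z1 = z3 | z2 = z3].

Lemma dsum_agree n z z' : agree n z z' -> dsum z' n = dsum z n.
Proof. by elim: n => //= n IH zz; rewrite zz // IH //; apply: agree_le zz. Qed.

(** A difference of 2 is at least [2 * 8 - 7 = 9] after three more bits, beyond the tolerance 4 of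
    [be_inst_close]. *)
Lemma dsum_apart z z' n : (forall m, z m <= 1) -> (forall m, z' m <= 1) ->
  dsum z n + 2 <= dsum z' n -> dsum z n.+3 + 9 <= dsum z' n.+3.
Proof.
move=> b b'; have := b n; have := b n.+1; have := b n.+2.
have := b' n; have := b' n.+1; have := b' n.+2; rewrite /=; lia.
Qed.

(** After the first difference the partial sums differ by one. A larger difference would grow past
    4, so it stays one, which forces a tail of ones against a tail of zeros. *)
Lemma dsum_near_lt z z' m : (forall n, z n <= 1) -> (forall n, z' n <= 1) ->
  (forall n, dsum z' n <= dsum z n + 4) -> agree m z z' -> z m < z' m ->
  forall n, m < n -> z n = 1 /\ z' n = 0.
Proof.
move=> b b' d ag lt.
have one n : dsum z' n = (dsum z n).+1 -> [/\ z n = 1, z' n = 0 & dsum z' n.+1 = (dsum z n.+1).+1].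
  move=> e; have := d n.+4; case: (leqP (dsum z n.+1 + 2) (dsum z' n.+1)) => [h|h].
    by have := dsum_apart b b' h; lia.
  by move=> _; move: h; rewrite /= e; have := b n; have := b' n => ? ? ?; split; lia.
have base j : dsum z' (m.+1 + j) = (dsum z (m.+1 + j)).+1.
  elim: j => [|j IH]; last by rewrite addnS; have [] := one _ IH.
  by rewrite addn0 /= (dsum_agree ag); have := b m; have := b' m; lia.
by move=> n mn; have := base (n - m.+1); rewrite subnKC // => /one[].
Qed.

Lemma dsum_near z z' : (forall n, z n <= 1) -> (forall n, z' n <= 1) ->
  (forall n, dsum z' n <= dsum z n + 4) -> (forall n, dsum z n <= dsum z' n + 4) -> z <> z' ->
  exists N, forall n, N < n -> z n + z' n = 1 /\ z n = z N.+1 /\ z' n = z' N.+1.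
Proof.
move=> b b' d d' ne.
have ex : exists m, z m != z' m.
  apply: contrapT => /forallNP h; apply: ne; apply: funext => m.
  by have /negP := h m; rewrite negbK => /eqP.
case: (ex_minnP ex) => m hm mmin.
have ag : agree m z z'.
  by move=> i im; apply/eqP; apply: contraTT im => /mmin; rewrite -leqNgt.
exists m => n mn; case: (ltngtP (z m) (z' m)) => h; last by rewrite h eqxx in hm.
  have H := dsum_near_lt b b' d ag h; have [-> ->] := H n mn.
  by have [-> ->] := H m.+1 (leqnn _).
have H := dsum_near_lt b' b d' (agree_sym ag) h; have [-> ->] := H n mn.
by have [-> ->] := H m.+1 (leqnn _).
Qed.

Section Expansion.

Local Open Scope ring_scope.

(** The tolerance is [2^-n] for the term [a n] plus [2^-n] for the rest of the expansion. *)
Definition be_inst (a : baire) : baire := fun c =>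
  let s := decode c in let n := size s in
  if all (leq^~ 1%N) s && (`|rq (a n) - (dsum (nth 0%N s) n)%:R * e2 n| <= 2 * e2 n)
  then 0%N else 1%N.

Lemma cont_be_inst : cont be_inst.
Proof.
apply: (@cont_modulus _ (fun c => (size (decode c)).+1)) => c a a' aa.
by rewrite /be_inst aa.
Qed.

Lemma kset_be_inst a z : kset (be_inst a) z <->
  forall n, (z n <= 1)%N /\ `|rq (a n) - (dsum z n)%:R * e2 n| <= 2 * e2 n.
Proof.
have E n : dsum (nth 0%N (mkseq z n)) n = dsum z n.
  by apply: dsum_agree => i hi; rewrite nth_mkseq.
split=> [zk n|h n].
  have [_] := zk n.+1; rewrite /be_inst CodeSeq.codeK size_mkseq; case: ifP => // /andP[/allP b _] _.
  have [_] := zk n; rewrite /be_inst CodeSeq.codeK size_mkseq; case: ifP => // /andP[_].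
  by rewrite E => -> _; split=> //; apply: b; apply: map_f; rewrite mem_iota /=.
have [zn hn] := h n; split; first by apply: leq_trans zn _.
rewrite /be_inst CodeSeq.codeK size_mkseq E hn andbT; case: ifP => // /negP[].
by apply/allP => x /mapP[i _ ->]; have [] := h i.
Qed.

Lemma be_inst_close a z z' : kset (be_inst a) z -> kset (be_inst a) z' ->
  forall n, (dsum z' n <= dsum z n + 4)%N.
Proof.
move=> /kset_be_inst h /kset_be_inst h' n; have [_ hn] := h n; have [_ hn'] := h' n.
rewrite -(ler_nat rat) natrD -(ler_pM2r (e2_gt0 n)) mulrDl.
by move: hn hn'; rewrite !ler_norml => /andP[? ?] /andP[? ?]; lra.
Qed.

(** Two different members have complementary tails. Three different ones would have bits at a late
    place that add up to one in pairs, which parity excludes. *)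
Lemma be_inst_QBE a : QBE (be_inst a).
Proof.
move=> z1 z2 z3 k1 k2 k3; apply: contrapT => no.
have b z : kset (be_inst a) z -> forall n, (z n <= 1)%N by move=> /kset_be_inst h n; have [] := h n.
have near z z' : kset (be_inst a) z -> kset (be_inst a) z' -> z <> z' ->
    exists N, forall n, (N < n)%N -> (z n + z' n = 1)%N.
  move=> k k' ne.
  have [N hN] := dsum_near (b _ k) (b _ k') (be_inst_close k k') (be_inst_close k' k) ne.
  by exists N => n /hN[].
have [|N1 h1] := near z1 z2 k1 k2; first by move=> e; apply: no; constructor 1.
have [|N2 h2] := near z1 z3 k1 k3; first by move=> e; apply: no; constructor 2.
have [|N3 h3] := near z2 z3 k2 k3; first by move=> e; apply: no; constructor 3.
pose n := (maxn N1 (maxn N2 N3)).+1.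
have l1 : (N1 < n)%N by rewrite /n; lia.
have l2 : (N2 < n)%N by rewrite /n; lia.
have l3 : (N3 < n)%N by rewrite /n; lia.
by have := h1 n l1; have := h2 n l2; have := h3 n l3; lia.
Qed.

Section Greedy.

Variable below : rat -> Prop.

(** Bits of the supremum of a lower cut, found greedily by a classical test. The predicate [below]
    is the cut of a real here and that of the right ends of a bisection later. *)
Fixpoint gstate (n : nat) : nat :=
  if n is m.+1 then ((gstate m).*2 + `[< below ((gstate m).*2.+1%:R * e2 m.+1) >])%N else 0%N.
Definition greedy : baire := fun n => nat_of_bool `[< below ((gstate n).*2.+1%:R * e2 n.+1) >].

Lemma dsum_greedy n : dsum greedy n = gstate n.
Proof. by elim: n => //= n ->. Qed.

Lemma greedy_bit n : (greedy n <= 1)%N. Proof. by rewrite /greedy; case: asbool. Qed.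

Hypothesis below0 : below 0.

Lemma dbl_e2 s n : (s.*2)%:R * e2 n.+1 = s%:R * e2 n.
Proof. by rewrite [e2 n]e2S -mul2n natrM; ring. Qed.

(* The exceptional case is that of an expansion ending in ones. *)
Lemma gstateP n : below ((gstate n)%:R * e2 n) /\
  (~ below ((gstate n).+1%:R * e2 n) \/ (gstate n).+1%:R * e2 n = 1).
Proof.
elim: n => [|n [IH1 IH2]]; first by rewrite /= mul0r mul1r [e2 0]expr0; split=> //; right.
rewrite /=; case: (asboolP (below _)) => [h|h].
  rewrite addn1; split=> //; rewrite -[(gstate n).*2.+2]/((gstate n).+1.*2) dbl_e2.
  exact: IH2.
by rewrite addn0 dbl_e2; split=> //; left.
Qed.

End Greedy.

Lemma be_inst_ex a : reg a -> within q0 q1 a -> exists z, kset (be_inst a) z.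
Proof.
move=> ra wa; pose below q := forall m, q <= rq (a m) + e2 m.
have b0 : below 0 by move=> m; have := wa m; rewrite qv_q0 => /andP[]; lra.
exists (greedy below); apply/kset_be_inst => n; split; first exact: greedy_bit.
rewrite dsum_greedy; have [h1 h2] := gstateP b0 n; set s := gstate below n in h1 h2 *.
have e0 := e2_gt0 n; have S : s.+1%:R * e2 n = s%:R * e2 n + e2 n by rewrite -addn1 natrD; ring.
have up : rq (a n) - e2 n <= s%:R * e2 n + e2 n.
  rewrite -S; case: h2 => [/existsNP[m /negP]|->]; last by have := wa n; rewrite qv_q1 => /andP[]; lra.
  rewrite -ltNge => h; case: (leqP n m) => nm.
    by have := ra _ _ nm; rewrite ltr_norml => /andP[]; have := e2_gt0 m; lra.
  by have := ra _ _ (ltnW nm); rewrite ltr_norml => /andP[]; lra.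
by have := h1 n; rewrite ler_norml => ?; apply/andP; split; lra.
Qed.

End Expansion.

Lemma cont_dsum : cont dsum.
Proof. by apply: (@cont_modulus _ id) => n z z' /dsum_agree. Qed.

Lemma sn_val Q A s n m : inh (SMaps Q A (sn s) (Urel n) (Urel m)) -> m = s n.
Proof. by case=> e he; have [v _ /PEq_urel] := wp_fn_val (wp_mapsE (wp_here A he)). Qed.

Lemma binary_prog Q : {t | forall A z, (forall n, z n <= 1) ->
  wp A t z (SBinary Q A 0 (sn z) (sn (dsum z)))}.
Proof.
have [t ht] := natseq_prog Q.
eexists=> A z zb; apply: wp_pair; first exact: ht.
apply: wp_pair.
  apply: (wp_call (P := eq (dsum z))); first by apply: (wp_fun cont_dsum); apply: wp_here.
  by move=> _ <-.
apply: wp_pair.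
  wall=> c; apply: wp_lam => e [n -> _]; wall=> c'; apply: wp_lam => e' [m -> _].
  apply: wp_lam => d hd; have mz : m = z n by apply: (@sn_val Q A); exists d.
  by apply: wp_true => e1; apply/(@SAle_lift (AVar m) (ACst 1)); rewrite mz; exact: zb.
apply: wp_pair.
  wall=> c; apply: wp_lam => e [n -> _]; wall=> c'; apply: wp_lam => e' [m -> _].
  apply: wp_lam => d [hd /(@SAeq_lift (AVar n) (ACst 0)) /= n0].
  have mz : m = dsum z n by apply: (@sn_val Q A); exists (pr0 d).
  by apply: wp_true => e1; apply/(@SAeq_lift (AVar m) (ACst 0)); rewrite /= mz n0.
wall=> c; apply: wp_lam => e [n -> _]; wall=> c'; apply: wp_lam => e' [n' -> _].
wall=> c2; apply: wp_lam => e2 [m -> _]; wall=> c3; apply: wp_lam => e3 [m' -> _].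
wall=> c4; apply: wp_lam => e4 [k -> _]; apply: wp_lam => d [d1 [d2 [d3]]].
move=> /(@SAeq_lift (AVar n') (AAdd (AVar n) (ACst 1))) /= nn.
have m1 : m = dsum z n by apply: (@sn_val Q A); exists (pr0 d).
have m2 : m' = dsum z n' by apply: (@sn_val Q A); exists (pr0 (pr1 d)).
have m3 : k = z n by apply: (@sn_val Q A); exists (pr0 (pr1 (pr1 d))).
apply: wp_true => e1; apply/(@SAeq_lift (AVar m') (AAdd (AMul (ACst 2) (AVar m)) (AVar k))).
by rewrite /= m1 m2 m3 nn addn1 /= mul2n.
Qed.

Lemma valid_BE Q : (forall p, QBE p -> Q p) -> valid Q BE.
Proof.
move=> hQ; have [te he] := real01_extract Q; have [tb hb] := binary_prog Q.
have [t2 h2] := req_prog Q (ok_rvar Q cont_pr0) (ok_rdyadic Q cont_pr1) 2.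
pose G := (∃ b s, binary 0 b s ∧ req (rvar 0) (rdyadic s))%S 1.
have [l0 hl0] := leibniz_prog Q G 0.
eexists=> A rho env; rewrite sem_BE; wall=> x; apply: wp_lam => e hx.
have [a [ra wa xa]] := he A x _ hx.
have EG c : sem Q A G (upd rho 0 c) = PEx Q A (fun b => PEx Q A (fun s =>
    PAnd (SBinary Q A 0 b s) (SReq Q A (SRvar Q A c) (SRdyadic Q A s)))) by [].
apply: (wp_let (P := PAnd (eq a) (PEq Q A x (rn a)))).
  by apply: (wp_call (P := eq e)); [apply: wp_var0|move=> _ <-; exact: xa].
move=> u hu; rewrite -EG; apply: (wp_call (c := l0) (P := PAnd (PEq Q A (rn a) x)
    (sem Q A G (upd rho 0 (rn a))))); last exact: hl0.
apply: wp_pair; first by apply: wp_sym; apply: wp_snd; whyp hu.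
rewrite EG; apply: (wp_let (P := eq a)).
  by case: hu => ea _; apply: (wp_fun cont_pr0); apply: wp_var0.
move=> _ <-; apply: wp_mapj.
  apply: (wp_oracle (x := a)) cont_be_inst _ _; first by apply: wp_var0.
    by apply: hQ; apply: be_inst_QBE.
  exact: be_inst_ex.
move=> z zk; have h := proj1 (kset_be_inst a z) zk.
apply: (@wp_mono _ _ _ (PEx Q A (fun s => PAnd (SBinary Q A 0 (sn z) s)
    (SReq Q A (SRvar Q A (rn a)) (SRdyadic Q A s))))) => [v hv|]; first by exists (sn z).
apply: (wp_exI (sn (dsum z))); apply: wp_pair.
  apply: (wp_call (P := eq z)); first by apply: wp_var0.
  by move=> _ <-; apply: hb => n; have [] := h n.
apply: (wp_call (P := eq (bp a (dsum z)))).
  apply: (wp_bp (P := eq a) (Q := eq (dsum z))) => [||_ _ <- <- //].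
    by apply: wp_shift; apply: wp_var0.
  by apply: (wp_fun cont_dsum); apply: wp_var0.
move=> _ <-; have := h2 A (bp a (dsum z)); rewrite !(pr0_bp, pr1_bp); apply=> k n kn.
have [_ hz] := h n; rewrite /oq pr0_bp pr1_bp -/(rq _) /qv /= subr0.
have -> : ((2 ^ n)%:R^-1 = e2 n :> rat)%R by rewrite -qv_q2N /qv /= subr0 mul1r.
apply: le_lt_trans hz _; have := e2_le kn; rewrite addn2.
by have := e2_gt0 k.+2; rewrite [e2 k]e2S [e2 k.+1]e2S; lra.
Qed.

(** * Local rank of the outcomes *)

Lemma list_bound (T : Type) (L : list T) (P : T -> nat -> Prop) :
  (forall v l l', P v l -> l <= l' -> P v l') ->
  (forall v, List.In v L -> exists l, P v l) -> exists l, forall v, List.In v L -> P v l.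
Proof.
move=> mono; elim: L => [|v L IH] h; first by exists 0.
have [l hl] := IH (fun w hw => h w (or_intror hw)); have [k hk] := h v (or_introl erefl).
exists (maxn k l) => w [<-|/hl hw]; first by apply: mono hk _; rewrite leq_maxl.
by apply: mono hw _; rewrite leq_maxr.
Qed.

Lemma list_choice (T U : Type) (L : list T) (R : T -> U -> Prop) :
  (forall v, List.In v L -> exists w, R v w) -> exists M : list U,
  (forall v, List.In v L -> exists2 w, List.In w M & R v w) /\
  (forall w, List.In w M -> exists2 v, List.In v L & R v w).
Proof.
elim: L => [|v L IH] h; first by exists [::].
have [M [h1 h2]] := IH (fun w hw => h w (or_intror hw)); have [w hw] := h v (or_introl erefl).
exists (w :: M); split=> [v' [<-|/h1[w' i r]]|w' [<-|/h2[v' i r]]].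
- by exists w => //; left.
- by exists w' => //; right.
- by exists v => //; left.
by exists v' => //; right.
Qed.

Lemma list_filter (T : Type) (L : list T) (P : T -> Prop) :
  exists M : list T, forall v, List.In v M <-> List.In v L /\ P v.
Proof.
elim: L => [|v L [M hM]]; first by exists [::] => v; split=> [|[]].
case: (EM (P v)) => [Pv|nP]; [exists (v :: M) => w|exists M => w]; split.
- by case=> [<-|/hM[]]; split=> //; [left|right].
- by case=> -[->|i] Pw; [left|right; apply/hM].
- by move=> /hM[i Pw]; split=> //; right.
by case=> -[e|i] Pw; [case: nP; rewrite e|apply/hM].
Qed.

Section Rank.

Variables (Q : baire -> Prop) (A : baire).

(** [D e r L] records a rank and a list of some outcomes of [e]. A selection is made because a set
    containing [0^omega] may be infinite: there [0^omega] alone is selected, at rank 0, while the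
    finite sets without it are listed in full at rank 1. *)
Definition ranking : Type := baire -> nat -> list baire -> Prop.

Definition rank_sound (N : nat) (D : ranking) : Prop := forall e r L, D e r L ->
  [/\ r <= N, exists v, List.In v L & forall v, List.In v L -> jv A e v].

(* The rank is lower semicontinuous, and the selected outcomes are upper
   semicontinuous along arguments of the same rank. *)
Definition rank_cont (D : ranking) : Prop := forall e r L, D e r L -> forall m, exists l,
  forall e' r' L', agree l e e' -> D e' r' L' -> r <= r' /\ (r' = r ->
    forall v', List.In v' L' -> exists2 v, List.In v L & agree m v v').

Definition ranked (e : baire) : Prop := exists k N D,
  [/\ forall e', agree k e e' -> jdom Q A e' -> exists r L, D e' r L, rank_sound N D & rank_cont D].

Lemma agree0 k e e' : agree k.+1 e e' -> e' 0 = e 0.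
Proof. by move=> h; rewrite h. Qed.

Lemma ranked_ret e : e 0 = 0 -> ranked e.
Proof.
move=> e0; exists 1, 0, (fun e r L => [/\ e 0 = 0, r = 0 & L = [:: stail e]]); split.
- by move=> e' /agree0; rewrite e0 => e1 _; exists 0, [:: stail e'].
- move=> e' r L [e1 -> ->]; split=> //; first by exists (stail e'); left.
  by move=> v [<-|//]; apply: jv_ret.
move=> e1 r L [_ -> ->] m; have [l hl] := cont_agree cont_stail e1 m.
exists l => e' r' L' /hl ag [_ -> ->]; split=> // _ v [<-|//].
by exists (stail e1) => //; left.
Qed.

Lemma ranked_adv e : e 0 = 4 -> ranked e.
Proof.
move=> e0; exists 1, 0, (fun e r L => exists z,
  [/\ e 0 = 4, r = 0, L = [:: z] & kapp (col A (e 1)) A z]); split.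
- move=> e' /agree0; rewrite e0 => e1 d; exists 0.
  have [z zj] := jdom_ex d; exists [:: z], z; split=> //.
  by have [_ _ _ _] := jv_inv zj; apply.
- move=> e' r L [z [e1 -> -> hz]]; split=> //; first by exists z; left.
  by move=> v [<-|//]; apply: jv_adv.
move=> e1 r L [z [_ -> -> hz]] m; exists 2 => e' r' L' ag [z' [_ -> -> hz']].
split=> // _ v [<-|//]; exists z; first by left.
by rewrite -(ag 1) // in hz'; rewrite (kapp_fun hz hz').
Qed.

Lemma ranked_map e : e 0 = 1 -> ranked (pr1 (stail e)) -> ranked e.
Proof.
move=> e0 [k [N [D [h1 h2 h3]]]].
have c0 : cont (fun e => pr0 (stail e)) := cont_comp cont_pr0 cont_stail.
have c1 : cont (fun e => pr1 (stail e)) := cont_comp cont_pr1 cont_stail.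
have [k' hk'] := cont_agree c1 e k.
exists k'.+1, N, (fun e r L => e 0 = 1 /\ exists L0, [/\ D (pr1 (stail e)) r L0,
  forall v, List.In v L0 -> exists2 w, List.In w L & kapp (pr0 (stail e)) v w
  & forall w, List.In w L -> exists2 v, List.In v L0 & kapp (pr0 (stail e)) v w]); split.
- move=> e' ag d; have e1 : e' 0 = 1 by rewrite (agree0 ag).
  have [/(_ e1)[d' tot] _ _] := jdom_inv d.
  have [r [L0 D0]] := h1 _ (hk' _ (agree_le (leqnSn _) ag)) d'.
  have [_ _ L0v] := h2 _ _ _ D0.
  have [L [L1 L2]] := list_choice (fun v i => tot v (L0v v i)).
  by exists r, L; split=> //; exists L0.
- move=> e' r L [e1 [L0 [D0 L1 L2]]]; have [rN [v vL] L0v] := h2 _ _ _ D0; split=> //.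
    by have [w wL _] := L1 v vL; exists w.
  by move=> w /L2[v' v'L vw]; apply: (jv_map e1 (L0v _ v'L)).
move=> e1 r L [_ [L0 [D0 L1 L2]]] m.
have [j hj] : exists j, forall v, List.In v L0 -> exists2 w, List.In w L &
    forall a' b' c', agree j (pr0 (stail e1)) a' -> agree j v b' -> kapp a' b' c' -> agree m w c'.
  apply: list_bound => [v l l' [w wL hw] ll|v /L1[w wL vw]].
    by exists w => // a' b' c' aa bb; apply: hw; [apply: agree_le aa|apply: agree_le bb].
  by have [j hj] := kapp_agree vw m; exists j, w.
have [l hl] := h3 _ _ _ D0 j.
have [l0 hl0] := cont_agree c0 e1 j; have [l1 hl1] := cont_agree c1 e1 l.
exists (maxn l0 l1) => e' r' L' ag [_ [L0' [D0' _ L2']]].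
have a0 : agree l0 e1 e' by apply: agree_le ag; rewrite leq_maxl.
have a1 : agree l1 e1 e' by apply: agree_le ag; rewrite leq_maxr.
have [rr hr] := hl _ _ _ (hl1 _ a1) D0'; split=> // /hr hv w' /L2'[v' /hv[v vL vv] vw].
by have [w wL hw] := hj v vL; exists w => //; apply: hw vw => //; apply: hl0.
Qed.

(** Compactness leaves finitely many strings, each with a local ranking. The first string of the
    list that matches [y] decides which ranking applies; this choice is locally constant, so
    semicontinuity survives. *)
Lemma ranked_patch x : jdom Q A x -> (forall y, jv A x y -> ranked y) -> exists k N D,
  [/\ forall x' y, agree k x x' -> jdom Q A x' -> jv A x' y -> jdom Q A y -> exists r L, D y r L,
      rank_sound N D & rank_cont D].
Proof.
move=> dx hx.
pose good s (ND : nat * ranking) := [/\ forall e, mkseq e (size s) = s -> jdom Q A e ->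
  exists r L, ND.2 e r L, rank_sound ND.1 ND.2 & rank_cont ND.2].
have [|Ls [k [LS hk]]] := jop_usco dx (S := fun s => exists ND, good s ND).
  move=> z /hx[j [N [D [h1 h2 h3]]]]; exists j, (N, D); split=> // e; rewrite size_mkseq => ez.
  by apply: h1; apply/agree_mkseq.
have /choice[f hf] s : exists ND, s \in Ls -> good s ND.
  by case: (boolP (s \in Ls)) => [/LS[ND h]|_]; [exists ND|exists (0, fun _ _ _ => False)].
pose fm (y : baire) := find (fun s => mkseq y (size s) == s) Ls.
have fmE y : fm y < size Ls -> mkseq y (size (nth [::] Ls (fm y))) = nth [::] Ls (fm y).
  by rewrite -has_find => h; apply/eqP; apply: (nth_find [::] h).
exists k, (\max_(s <- Ls) (f s).1), (fun y r L => fm y < size Ls /\ (f (nth [::] Ls (fm y))).2 y r L); split.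
- move=> x' y ag dx' xy dy; have [m mL] := hk _ _ (fun _ _ => erefl) ag dx' y xy.
  have lt : fm y < size Ls.
    by rewrite -has_find; apply/hasP; exists (mkseq y m) => //; rewrite size_mkseq.
  have [h1 _ _] := hf _ (mem_nth [::] lt); have [r [L D]] := h1 y (fmE y lt) dy.
  by exists r, L.
- move=> e r L [lt D]; have [_ h2 _] := hf _ (mem_nth [::] lt); have [rN ne jL] := h2 _ _ _ D.
  split=> //; apply: leq_trans rN _.
  by apply: (@leq_bigmax_seq _ Ls xpredT (fun s => (f s).1)) => //; apply: mem_nth.
move=> e r L [lt D] m; have [_ _ h3] := hf _ (mem_nth [::] lt); have [l hl] := h3 _ _ _ D m.
exists (maxn l (\max_(s <- Ls) size s)) => e' r' L' ag [lt' D'].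
have E : fm e' = fm e.
  apply: eq_in_find => s sL; congr (_ == s); apply/agree_mkseq; apply: agree_sym.
  apply: agree_le ag; rewrite leq_max; apply/orP; right.
  by apply: (@leq_bigmax_seq _ Ls xpredT size).
by rewrite E in D'; apply: hl D'; apply: agree_le ag; rewrite leq_maxl.
Qed.

(** The rank is lexicographic: that of the first program, then the least rank [r2] among its
    selected outcomes, and only outcomes attaining [r2] are pursued. Nearby selected outcomes stem
    from old ones, so the minimum cannot drop; if it is unchanged, the final outcomes stay close as
    well. *)
Lemma ranked_bind e : e 0 = 2 -> jdom Q A (stail e) -> ranked (stail e) ->
  (forall y, jv A (stail e) y -> ranked y) -> ranked e.
Proof.
move=> e0 dx [k1 [N1 [D1 [h1 s1 c1]]]] /(ranked_patch dx)[k2 [N2 [D2 [h2 s2 c2]]]].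
have [k hk] := cont_agree cont_stail e (maxn k1 k2).
exists k.+1, (N1 * N2.+1 + N2), (fun e r O => e 0 = 2 /\ exists r1 r2 L1
  (W : list (baire * nat * list baire)), [/\ D1 (stail e) r1 L1, r = r1 * N2.+1 + r2,
    forall y, List.In y L1 -> exists q T, List.In (y, q, T) W,
    forall y q T, List.In (y, q, T) W -> [/\ List.In y L1, D2 y q T & r2 <= q]
    & (exists y T, List.In (y, r2, T) W) /\
      forall v, List.In v O <-> exists y T, List.In (y, r2, T) W /\ List.In v T]); split.
- move=> e' ag d; have e1 : e' 0 = 2 by rewrite (agree0 ag).
  have [_ /(_ e1)[d' dy] _] := jdom_inv d.
  have ag' := hk _ (agree_le (leqnSn _) ag).
  have [r1 [L1 DL]] := h1 _ (agree_le (leq_maxl _ _) ag') d'.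
  have [_ [y0 y0L] L1v] := s1 _ _ _ DL.
  have [y yL|W [W1 W2]] := @list_choice _ (baire * nat * list baire) L1
      (fun y w => w.1.1 = y /\ D2 y w.1.2 w.2).
    have yj := L1v y yL.
    have [q [T DT]] := h2 _ y (agree_le (leq_maxr _ _) ag') d' yj (dy y yj).
    by exists (y, q, T).
  have ex : exists q, `[< exists y T, List.In (y, q, T) W >].
    have [[[y q] T] wW _] := W1 _ y0L; exists q; apply/asboolP; by exists y, T.
  case: (ex_minnP ex) => r2 /asboolP[y [T yT]] rmin.
  exists (r1 * N2.+1 + r2), (List.flat_map (fun w => if w.1.2 == r2 then w.2 else [::]) W).
  split=> //; exists r1, r2, L1, W; split=> //.
  + by move=> y' /W1[[[y2 q] T'] wW [/= ee _]]; exists q, T'; rewrite -ee.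
  + move=> y' q T' wW; have [y2 y2L [/= ee DD]] := W2 _ wW; rewrite ee; split=> //.
    by apply: rmin; apply/asboolP; exists y', T'.
  split; first by exists y, T.
  move=> v; rewrite List.in_flat_map; split=> [[[[y' q] T'] [wW]]|[y' [T' [wW vT]]]].
    by rewrite /=; case: eqP => // <- vT; exists y', T'.
  by exists (y', r2, T'); split=> //=; rewrite eqxx.
- move=> e' r L [e1 [r1 [r2 [L1 [W [DL -> W1 W2 [[y [T yT]] hO]]]]]]].
  have [r1N _ L1v] := s1 _ _ _ DL; have [yL DT _] := W2 _ _ _ yT.
  have [r2N [v vT] _] := s2 _ _ _ DT; split.
  + by rewrite leq_add // leq_mul2r r1N orbT.
  + by exists v; apply/hO; exists y, T.
  move=> w /hO[y' [T' [yT' wT]]]; have [yL' DT' _] := W2 _ _ _ yT'.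
  by have [_ _ jT] := s2 _ _ _ DT'; apply: (jv_bind e1 (L1v _ yL')); apply: jT.
move=> e1 r O [_ [r1 [r2 [L1 [W [DL -> W1 W2 [_ hO]]]]]]] m.
have [j hj] : exists j, forall y, List.In y L1 -> exists q T, List.In (y, q, T) W /\
    forall y' q' T', agree j y y' -> D2 y' q' T' -> q <= q' /\ (q' = q ->
      forall v', List.In v' T' -> exists2 v, List.In v T & agree m v v').
  apply: list_bound => [y l l' [q [T [i h]]] ll|y /W1[q [T i]]].
    by exists q, T; split=> // y' q' T' ag; apply: h; apply: agree_le ag.
  by have [_ DT _] := W2 _ _ _ i; have [l hl] := c2 _ _ _ DT m; exists l, q, T.
have [l hl] := c1 _ _ _ DL j; have [l' hl'] := cont_agree cont_stail e1 l.
exists l' => e' r' O' /hl' ag [_ [r1' [r2' [L1' [W' [DL' -> W1' W2' [[y [T yT]] hO']]]]]]].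
have [r11 hr1] := hl _ _ _ ag DL'.
have near y' q' T' : r1' = r1 -> List.In (y', q', T') W' -> exists y q T,
    [/\ List.In (y, q, T) W, r2 <= q, q <= q' & (q' = q -> forall v', List.In v' T' ->
      exists2 v, List.In v T & agree m v v')].
  move=> rr i'; have [yL' DT' _] := W2' _ _ _ i'; have [y2 y2L yy] := hr1 rr y' yL'.
  have [q [T2 [i h]]] := hj _ y2L; have [_ _ r2q] := W2 _ _ _ i; have [qq hq] := h _ _ _ yy DT'.
  by exists y2, q, T2.
have [_ DT' _] := W2' _ _ _ yT; have [r2N' _ _] := s2 _ _ _ DT'.
(* If the first rank jumps up, the factor [N2.+1] outweighs any drop of the second. *)
case: (ltngtP r1 r1') => [lt|gt|rr]; last 1 first.
- have [y2 [q [T2 [i r2q qr _]]]] := near _ _ _ (esym rr) yT; rewrite -rr; split.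
    by rewrite leq_add2l; apply: leq_trans qr.
  move=> /eqP; rewrite eqn_add2l => /eqP r2E v' /hO'[y3 [T3 [i3 vT3]]].
  have [y4 [q4 [T4 [i4 r24 q42 h4]]]] := near _ _ _ (esym rr) i3.
  have q4E : q4 = r2 by lia.
  have [|v vT4 vv] := h4 _ v' vT3; first by lia.
  by exists v => //; apply/hO; exists y4, T4; rewrite -q4E.
- have r2N : r2 <= N2.
    have [_ [y2 y2L] _] := s1 _ _ _ DL; have [q [T2 i]] := W1 _ y2L.
    have [_ D22 r2q] := W2 _ _ _ i; have [qN _ _] := s2 _ _ _ D22; exact: leq_trans qN.
  have lt' : r1 * N2.+1 + r2 < r1' * N2.+1 + r2'.
    have : r1.+1 * N2.+1 <= r1' * N2.+1 by rewrite leq_mul2r lt orbT.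
    by rewrite mulSn; lia.
  by split; [exact: ltnW|move=> E; rewrite E ltnn in lt'].
by rewrite ltnNge r11 in gt.
Qed.

Hypothesis base : forall p, Q p -> kset p (numeral 0) \/
  exists L : list baire, forall z, kset p z -> List.In z L.

(** Not containing [0^omega] is witnessed by one excluded string, hence open, so that the rank can
    only jump up nearby. At rank 1 the set is finite and [kset_fan] gives upper semicontinuity. *)
Lemma ranked_base e : e 0 = 3 -> ranked e.
Proof.
move=> e0; exists 1, 1, (fun e r L => e 0 = 3 /\ (exists v, List.In v L) /\
  ([/\ kset (stail e) (numeral 0), r = 0 & L = [:: numeral 0]] \/
   [/\ ~ kset (stail e) (numeral 0), r = 1 & forall z, List.In z L <-> kset (stail e) z])); split.
- move=> e' /agree0; rewrite e0 => e1 d; have [_ _ /(_ e1)/base Qb] := jdom_inv d.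
  case: (EM (kset (stail e') (numeral 0))) => [k0|nk0].
    by exists 0, [:: numeral 0]; split=> //; split; [exists (numeral 0); left|left].
  case: Qb => // -[L hL]; have [M hM] := list_filter L (kset (stail e')).
  exists 1, M; split=> //; split; last first.
    by right; split=> // z; split=> [/hM[]//|kz]; apply/hM; split=> //; apply: hL.
  have [z /jv_inv[_ _ _ /(_ e1) kz _]] := jdom_ex d; exists z; apply/hM; split=> //.
  exact: hL.
- move=> e' r L [e1 [ne [[k0 rE LE]|[_ rE hL]]]]; subst r; try subst L; split=> //.
    by move=> v [<-|//]; apply: jv_base.
  by move=> v /hL kv; apply: jv_base.
move=> e1 r L [_ [ne [[k0 -> ->]|[nk0 -> hL]]]] m.
  exists 0 => e' r' L' _ [_ [_ [[_ -> ->]|[_ -> _]]]]; split=> // _ v [<-|//].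
  by exists (numeral 0) => //; left.
have [n hn] : exists n, stail e1 (code (mkseq (numeral 0) n)) != 0.
  apply: contrapT => /forallNP h; apply: nk0 => n; split=> //.
  by have /negP := h n; rewrite negbK => /eqP.
have [z /hL zL|Ls [k [LS hk]]] := @kset_fan (stail e1) (fun s => exists2 v, List.In v L & s = mkseq v m).
  by exists m, z.
have [l hl] := cont_agree cont_stail e1 (maxn k (code (mkseq (numeral 0) n)).+1).
exists l => e' r' L' /hl ag [_ [_ [[k0' -> ->]|[_ -> hL']]]].
  have [_] := k0' n; rewrite -(ag (code (mkseq (numeral 0) n))); last by rewrite leq_max leqnn orbT.
  by move=> h; rewrite h in hn.
split=> // _ v' /hL' kv; have [j /LS[v vL e2]] := hk _ v' (agree_le (leq_maxl _ _) ag) kv.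
exists v => //; have jm : j = m by have := congr1 size e2; rewrite !size_mkseq.
by apply/agree_mkseq; rewrite -e2 jm.
Qed.

Lemma jop_ranked e : jdom Q A e -> ranked e.
Proof.
elim=> {}e e0.
- exact: ranked_ret.
- by move=> _ h _; apply: ranked_map.
- by move=> d h _ h2; apply: ranked_bind.
- by move=> _ _; apply: ranked_base.
by move=> _; apply: ranked_adv.
Qed.

Lemma stable_outcomes F (E : baire -> Prop) (p0 : baire) : E p0 ->
  (forall p, exists2 f, kapp F p f & jdom Q A f) ->
  exists p (L : list baire), E p /\ forall m, exists l, forall p' f, E p' -> agree l p p' ->
    kapp F p' f -> exists v v', [/\ List.In v L, jv A f v' & agree m v v'].
Proof.
move=> E0 run; have [f0 F0 d0] := run p0.
have [k [N [D [h1 h2 h3]]]] := jop_ranked d0; have [l0 hl0] := kapp_agree F0 k.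
pose P r := `[< exists p f L, [/\ E p, agree l0 p0 p, kapp F p f & D f r L] >].
have exP : exists r, P r.
  have [r [L DL]] := h1 f0 (fun _ _ => erefl) d0.
  by exists r; apply/asboolP; exists p0, f0, L.
have bP r : P r -> r <= N by move=> /asboolP[p [f [L [_ _ _ /h2[]]]]].
case: (ex_maxnP exP bP) => r /asboolP[p [f [L [Ep ag Fp DL]]]] rmax.
exists p, L; split=> // m; have [j hj] := h3 _ _ _ DL m; have [i hi] := kapp_agree Fp j.
exists (maxn i l0) => p' f' Ep' ag' Fp'; have [f2 F2 d2] := run p'.
rewrite (kapp_fun F2 Fp') in d2.
have a0 : agree l0 p0 p' by apply: agree_trans ag _; apply: agree_le ag'; rewrite leq_maxr.
have [r' [L' DL']] := h1 f' (hl0 _ _ _ (fun _ _ => erefl) a0 Fp') d2.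
have [_ [v' v'L] jL] := h2 _ _ _ DL'.
have [|rr hr] := hj _ _ _ _ DL'.
  by apply: hi Fp' => //; apply: agree_le ag'; rewrite leq_maxl.
have r'r : r' <= r by apply: rmax; apply/asboolP; exists p', f', L'.
have [|v vL vv] := hr _ v' v'L; first by apply/eqP; rewrite eqn_leq r'r.
by exists v, v'; split=> //; apply: jL.
Qed.

End Rank.

(** * The failure of weak Koenig's lemma under convex choice *)

Definition bits (z : baire) : Prop := forall n, z n <= 1.

(* For 0-1 sequences the pointwise order of the partial sums is the
   lexicographic order. *)
Definition QIVT (p : baire) : Prop := (forall z, kset p z -> bits z) /\
  forall z w z', kset p z -> kset p z' -> bits w ->
    (forall n, dsum z n <= dsum w n <= dsum z' n) -> kset p w.

Lemma first_diff (z z' : baire) : z <> z' -> exists2 m, agree m z z' & z m <> z' m.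
Proof.
move=> ne; have ex : exists m, z m != z' m.
  apply: contrapT => /forallNP h; apply: ne; apply: funext => m.
  by have /negP := h m; rewrite negbK => /eqP.
case: (ex_minnP ex) => m hm mmin; exists m; last by apply/eqP.
by move=> i im; apply/eqP; apply: contraTT im => /mmin; rewrite -leqNgt.
Qed.

(** [z] up to [m], then 0 and ones for ever: lexicographically between [z] and any 0-1 sequence that
    first exceeds it at [m]. Over all [z] and [m] these are only countably many points. *)
Definition gap (z : baire) (m : nat) : baire := nth 1 (rcons (mkseq z m) 0).

Lemma gap_between z z' m : bits z -> bits z' -> agree m z z' -> z m < z' m ->
  forall n, dsum z n <= dsum (gap z m) n <= dsum z' n.
Proof.
move=> b b' ag lt.
have gl i : i < m -> gap z m i = z i.
  by move=> im; rewrite /gap nth_rcons size_mkseq im nth_mkseq.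
have gm : gap z m m = 0 by rewrite /gap nth_rcons size_mkseq ltnn eqxx.
have gg i : m < i -> gap z m i = 1.
  by move=> im; rewrite /gap nth_default // size_rcons size_mkseq.
have lo n : n <= m -> dsum (gap z m) n = dsum z n /\ dsum z' n = dsum z n.
  elim: n => //= n IH nm; have [-> ->] := IH (ltnW nm); rewrite gl // -(ag n) //.
have hi j : dsum z (m.+1 + j) <= dsum (gap z m) (m.+1 + j) < dsum z' (m.+1 + j).
  elim: j => [|j IH].
    rewrite addn0 /=; have [-> ->] := lo m (leqnn m); rewrite gm.
    by have := b m; have := b' m; lia.
  rewrite addnS; move: (leq_addr j m.+1) IH; move: (m.+1 + j) => n mn IH /=.
  by rewrite gg //; have := b n; lia.
move=> n; case: (leqP n m) => [/lo[-> ->]|mn]; first by rewrite leqnn.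
by have := hi (n - m.+1); rewrite subnKC // => /andP[-> /ltnW].
Qed.

Definition convex_codes (c : baire) : Prop :=
  c = kuniq \/ exists b s, c = fcode (fun=> nth b s).

Lemma convex_codes_countable : countable_codes convex_codes.
Proof.
exists (fun n => if decode n is b :: s then fcode (fun=> nth b s) else kuniq) => g [->|[b [s ->]]].
  by exists (code [::]); rewrite CodeSeq.codeK.
by exists (code (b :: s)); rewrite CodeSeq.codeK.
Qed.

(** A convex set with two members contains a [gap], which a constant code provides; a singleton is
    read off by [kuniq]. *)
Lemma convex_selector p : QIVT p -> (exists z, kset p z) ->
  exists c v, [/\ convex_codes c, kapp c p v & kset p v].
Proof.
move=> [qb qc] [z kz]; case: (EM (exists2 z', kset p z' & z <> z')) => [[z' kz' ne]|no]; last first.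
  exists kuniq, z; split=> //; first by left.
  apply: kuniqP => z'; split=> [kz'|-> //]; apply/esym; apply: contrapT => ne.
  by apply: no; exists z'.
have main y y' m : kset p y -> kset p y' -> agree m y y' -> y m < y' m ->
    exists c v, [/\ convex_codes c, kapp c p v & kset p v].
  move=> ky ky' ag lt; exists (fcode (fun=> gap y m)), (gap y m); split.
  - by right; exists 1, (rcons (mkseq y m) 0).
  - by apply: (@fcodeP (fun=> gap y m)); apply: cont_cst.
  apply: (qc y _ y') => //; last by apply: gap_between => //; apply: qb.
  move=> i; rewrite /gap nth_rcons size_mkseq; case: ltnP => [im|_]; last by case: eqP.
  by rewrite nth_mkseq //; apply: qb.
have [m ag mne] := first_diff ne; case: (ltngtP (z m) (z' m)) => // lt.
  exact: (main z z' m).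
by apply: (main z' z m) => //; apply: agree_sym.
Qed.

Fixpoint bst (z : baire) (n : nat) : nat := if n is m.+1 then (bst z m).*2 + z m else 1.

Lemma bst_bounds z n : (forall m, m < n -> z m <= 1) -> 2 ^ n <= bst z n < 2 ^ n.+1.
Proof.
elim: n => // n IH zb; have := IH (fun m h => zb m (ltnW h)); have := zb n (leqnn _).
by rewrite [2 ^ n.+2]expnS [2 ^ n.+1]expnS /=; lia.
Qed.

Lemma bst_inj z z' n n' : (forall m, m < n -> z m <= 1) -> (forall m, m < n' -> z' m <= 1) ->
  bst z n = bst z' n' -> n = n' /\ agree n z z'.
Proof.
have pos w k : 0 < bst w k by elim: k => //= k; lia.
elim: n n' => [|n IH] [|n'] zb zb' //=.
- by move=> e; have := pos z' n'; lia.
- by move=> e; have := pos z n; lia.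
have := zb n (leqnn _); have := zb' n' (leqnn _) => a b e.
have [|||nn ag] := IH n'.
- by move=> m h; apply: zb; apply: ltnW.
- by move=> m h; apply: zb'; apply: ltnW.
- by lia.
subst n'; split=> // i; rewrite ltnS leq_eqVlt => /orP[/eqP ->|/ag //]; lia.
Qed.

(** The entry [p s = 2 m + b + 1] forbids the bit [b] at place [m], for strings longer than [s] and
    [m]; the entry 0 forbids nothing. As in Kleene's tree, a path separates the places where 0 is
    forbidden from those where 1 is. *)
Definition alive (p z : baire) (n : nat) : Prop := (forall m, m < n -> z m <= 1) /\
  forall m s, m < n -> s < n -> p s <> (m.*2 + z m).+1.
Definition inT (p : baire) (c : nat) : Prop := exists z n, c = bst z n /\ alive p z n.

(** A node of length [n] has a code of at least [2 ^ n > n], so the first [c] entries of [p] decide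
    whether [c] is a node. *)
Lemma inT_agree p p' c : agree c p p' -> inT p c -> inT p' c.
Proof.
move=> pp [z [n [e [zb zk]]]]; exists z, n; split=> //; split=> // m s mn sn.
rewrite -pp; first exact: zk.
by have := bst_bounds zb; rewrite -e; have := ltn_expl n (isT : 1 < 2); lia.
Qed.

Lemma cont_inT c : cont (fun p => numeral (nat_of_bool `[< inT p c >])).
Proof.
apply: cont_numeral => p; exists c => p' pp; congr nat_of_bool; apply: asbool_equiv_eq.
by split; apply: inT_agree => //; apply: agree_sym.
Qed.

Lemma inT_gt0 p c : inT p c -> 0 < c.
Proof. by case=> z [n [-> [zb _]]]; have := bst_bounds zb; have := expn_gt0 2 n; lia. Qed.

Lemma inT_parent p c b : b <= 1 -> 0 < c -> inT p (c.*2 + b) -> inT p c.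
Proof.
move=> b1 c0 [z [[|n] [/= e [zb zk]]]]; first by lia.
have zn := zb n (leqnn _); exists z, n; split; first by lia.
by split=> [m h|m s h h']; [apply: zb; apply: ltnW|apply: zk; apply: ltnW].
Qed.

Definition good (p : baire) : Prop := forall m s t, ~ (p s = m.*2.+1 /\ p t = m.*2.+2).

Definition lft (p : baire) (n : nat) : baire := fun m => has (fun s => p s == m.*2.+1) (iota 0 n).

(** The bit is 1 just where 0 has been forbidden before stage [n]; by [good] it is then not
    forbidden itself. *)
Lemma lft_alive p n : good p -> alive p (lft p n) n.
Proof.
move=> gp; split=> [m _|m s mn sn]; first by rewrite /lft; case: has.
rewrite /lft; case: hasP => [[t _ /eqP pt]|no] /=.
  by rewrite addn1 => ps; apply: (gp m t s).
by rewrite addn0 => ps; apply: no; exists s; rewrite ?mem_iota //=; apply/eqP.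
Qed.

Lemma bst_agree n z z' : agree n z z' -> bst z' n = bst z n.
Proof. by elim: n => //= n IH zz; rewrite zz // IH //; apply: agree_le zz. Qed.

Lemma cont_lft n : cont (fun p => numeral (bst (lft p n) n)).
Proof.
apply: cont_numeral => p; exists n => p' pp; apply: bst_agree => m mn; rewrite /lft.
congr nat_of_bool; apply: eq_in_has => s; rewrite mem_iota => /andP[_ sn]; rewrite pp //.
Qed.

Definition tn (p : baire) : name :=
  Coll (fun c : {c | inT p c} => numeral (sval c)) (fun c => Urel (sval c)).

Section TreeProgram.

Variable Q : baire -> Prop.

Lemma pmem_tn p c : inT p c -> pmem (numeral c) (Urel c) (tn p).
Proof. by move=> h; exists (exist _ c h). Qed.

Lemma in_tn A p c : inh (PIn Q A (Urel c) (tn p)) -> inT p c.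
Proof.
case=> e; rewrite PInE => /Jp_ex[d [x [[[c' h] [_ /= <-]]]]] /PEq_urel -> //.
Qed.

Lemma tree_prog : {t | forall A p, wp A t p (STree Q A (tn p))}.
Proof.
eexists=> A p; apply: wp_pair; first exact: wp_true.
apply: wp_pair; last apply: wp_pair.
- wall=> c; apply: wp_lam => e he; apply: wp_inE; [by whyp he| |].
    move=> c' d hd; have [[[n h] [en /= ec]] hq] := hd; subst c'.
    have cE := PEq_urelP hq; subst c.
    apply: wp_pair; first by apply: (wp_fun cont_pr0); apply: wp_var0; exists n.
    by apply: wp_true => e1; apply/(@SAle_lift (AAdd (ACst 0) (ACst 1)) (AVar n)); apply: inT_gt0 h.
  apply: closed_and; first by apply: closed_uniq => v w [n -> ->] [m [->] ->].
  exact: closed_const.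
- wall=> c; apply: wp_lam => e [n -> ->].
  apply: (wp_nat (n := n)); first by whyp (erefl (numeral n)).
  apply: (@wp_bit _ _ _ _ _ (numeral (nat_of_bool `[< inT p n >]))).
  + by case: asbool; [right|left].
  + by apply: wp_shift; apply: (wp_fun (cont_inT n)); apply: wp_here.
  + move=> h0; apply: wp_orI2; apply: wp_true => e1 a ha.
    have h : inT p n by apply: (@in_tn A); exists a.
    by have := congr1 (@^~ 0) h0; rewrite /numeral asboolT.
  move=> h1; apply: wp_orI1; apply: wp_mem_in.
  apply: wp_cst; apply: pmem_tn; apply: contrapT => no.
  by have := congr1 (@^~ 0) h1; rewrite /numeral asboolF.
wall=> c; apply: wp_lam => e [n -> ->]; wall=> c'; apply: wp_lam => e' [n' -> ->].
apply: wp_lam => d [/(@SAle_lift (AAdd (ACst 0) (ACst 1)) (AVar n)) /= n0 [h1 h2]].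
have {}n0 : 0 < n by have := n0 (numeral 0); lia.
have h : inT p n.
  have {}h1 : inT p n' by apply: (@in_tn A); exists (pr0 (pr1 d)).
  case: (inh_or (ex_intro _ _ h2)) => -[q].
    move=> /(@SAeq_lift (AVar n') (AMul (ACst 2) (AVar n))) /= e1.
    by apply: (@inT_parent p n 0) => //; rewrite addn0 -mul2n -e1.
  move=> /(@SAeq_lift (AVar n') (AAdd (AMul (ACst 2) (AVar n)) (ACst 1))) /= e1.
  by apply: (@inT_parent p n 1) => //; rewrite -mul2n -e1.
apply: wp_mem_in; apply: wp_shift; apply: wp_shift; apply: wp_var0; exact: pmem_tn.
Qed.

Lemma infinite_prog : {t | forall A p, good p -> wp A t p (SInfinite Q A (tn p))}.
Proof.
eexists=> A p gp; wall=> c; apply: wp_lam => e [n -> ->].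
apply: (wp_nat (n := n)); first by whyp (erefl (numeral n)).
have al := lft_alive n gp; have bb := bst_bounds (proj1 al).
have wc (P : prop) : P (numeral (bst (lft p n) n)) ->
    wp A (pshift (pfun (fun p => numeral (bst (lft p n) n)) pself)) (bp (numeral n) p) P.
  by move=> hP; apply: wp_shift; apply: (wp_fun (cont_lft n)); apply: wp_here.
apply: (wp_exI (Urel (bst (lft p n) n))); apply: wp_pair; first by apply: wc; eexists.
apply: wp_pair; first by apply: wp_mem_in; apply: wc; apply: pmem_tn; exists (lft p n), n.
move: (bst _ _) bb => b bb; apply: wp_pair; apply: wp_true => e1.
  by apply/(@SAle_lift (APow2 (AVar n)) (AVar b)) => /=; lia.
by apply/(@SAle_lift (AAdd (AVar b) (ACst 1)) (APow2 (AAdd (AVar n) (ACst 1)))) => /=; rewrite !addn1; lia.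
Qed.

Lemma wkl_program A a : SWKL Q A a -> exists F, forall p, good p ->
  wp A F p (Jp Q A (fun s => [/\ s 0 = 1, bsteps s & forall n, inT p (s n)])).
Proof.
move=> ha; have [t1 h1] := tree_prog; have [t2 h2] := infinite_prog.
have [te he] := binary_extract Q.
eexists=> p gp; apply: wp_exE; last exact: closed_Jp.
  apply: wp_app; first by apply: wp_cst; exact: (ha (tn p)).
  by apply: wp_pair; [apply: h1|apply: h2].
move=> b d hd; apply: wp_mapj; first by whyp hd.
move=> d' [f [hb hr]]; have [s [s0 ss ws]] := he A 1 b f (pr0 d') hb.
apply: (@wp_mono _ _ _ (eq s)) => [_ <-|]; last first.
  apply: (wp_fst (R := PEq Q A f (sn s))).
  apply: (wp_call (P := eq (pr0 d'))); first by apply: (wp_fun cont_pr0); apply: wp_var0.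
  by move=> _ <-; exact: ws.
split=> // n; apply: (@in_tn A).
have hs : inh (SMaps Q A f (Urel n) (Urel (s n))).
  by apply: sn_maps; have [v _ [_ hv]] := ws; exists (pr1 v).
exact: inh_imp (inh_allN (s n) (inh_allN n (ex_intro _ _ hr))) hs.
Qed.

End TreeProgram.

Lemma path_avoids p s : s 0 = 1 -> bsteps s -> (forall n, inT p (s n)) ->
  forall m t, p t <> (m.*2 + odd (s m.+1)).+1.
Proof.
move=> s0 ss sT m t; pose z : baire := fun m => odd (s m.+1).
have zb k : z k <= 1 by rewrite /z; case: odd.
have sE n : s n = bst z n.
  by elim: n => //= n <-; rewrite /z; case: (ss n) => ->; rewrite /= odd_double /=; lia.
have [z' [n [e [zb' zk]]]] := sT (maxn m t).+1; rewrite sE in e.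
have [nE ag] := bst_inj (fun k _ => zb k) zb' e; subst n.
by have := zk m t; rewrite -ag -/(z m); [apply; rewrite ltnS ?leq_maxl ?leq_maxr|rewrite ltnS leq_maxl].
Qed.

Definition untouched (p : baire) (i : nat) : Prop := forall t, p t <> i.*2.+1 /\ p t <> i.*2.+2.

(** A condition of the diagonal construction: a finite segment and a list of places promised to stay
    untouched. *)
Definition extends (p : baire) (st : seq nat * seq nat) : Prop :=
  [/\ good p, mkseq p (size st.1) = st.1 & forall i, i \in st.2 -> untouched p i].

Definition fin (s : seq nat) : baire := nth 0 s.

Definition defeats (c p : baire) : Prop := forall v, kapp c p v -> v 0 = 1 -> bsteps v ->
  ~ forall n, inT p (v n).

(** If [c] answers on some sequence in which a fresh place [n] stays untouched, the answer fixes a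
    bit at [n] after finitely many entries, and a new entry forbids that bit. If there is no such
    sequence, [n] is promised to stay untouched and [c] is undefined on all extensions. *)
Lemma diagonal_step c st : extends (fin st.1) st -> exists st',
  [/\ extends (fin st'.1) st', prefix st.1 st'.1, size st.1 < size st'.1, {subset st.2 <= st'.2}
    & forall p, extends p st' -> defeats c p].
Proof.
case: st => s Pr /= ex0; pose n := (\max_(i <- s) i + \max_(i <- Pr) i).+1.
have nPr : n \notin Pr.
  apply/negP => h; have := @leq_bigmax_seq _ Pr xpredT id n h isT; rewrite /n /=; lia.
have ns : untouched (fin s) n.
  move=> t; have : fin s t <= \max_(i <- s) i.
    rewrite /fin; case: (ltnP t (size s)) => h; last by rewrite nth_default.
    by apply: (@leq_bigmax_seq _ s xpredT id) => //; apply: mem_nth.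
  by rewrite /n; lia.
case: (EM (exists p v, extends p (s, n :: Pr) /\ kapp c p v)) => [[p [v [[gp /= ps pu] cv]]]|no]; last first.
  (* The entry 0 forbids nothing and only lengthens the segment. *)
  exists (rcons s 0, n :: Pr); split=> /=.
  - have E : fin (rcons s 0) = fin s.
      apply: funext => t; rewrite /fin nth_rcons; case: ltnP => // h.
      by rewrite nth_default //; case: eqP.
    rewrite E; case: ex0 => g _ u; split=> //=; last by move=> i; rewrite inE => /orP[/eqP ->|/u].
    by rewrite -E; apply: mkseq_nth.
  - exact: prefix_rcons.
  - by rewrite size_rcons.
  - by move=> i iP; rewrite inE iP orbT.
  move=> p [gp /= ps pu] v cv; case: no; exists p, v; split=> //; split=> //=.
  by move: ps; rewrite size_rcons mkseqS => /rcons_inj[].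
(* The bit at [n] is the parity of [v n.+1], so [n.+2] entries of the answer must be fixed. *)
have [k hk] := kapp_agree cv n.+2; pose K := maxn k (size s).
have pn : untouched p n by apply: pu; rewrite inE eqxx.
pose s' := rcons (mkseq p K) (n.*2 + odd (v n.+1)).+1.
have fs t : fin s' t = if t < K then p t else if t == K then (n.*2 + odd (v n.+1)).+1 else 0.
  by rewrite /fin /s' nth_rcons size_mkseq; case: ltnP => // h; rewrite nth_mkseq.
have b1 : odd (v n.+1) <= 1 by case: odd.
exists (s', Pr); split=> /=.
- split=> /=; last 1 first.
  + move=> i iP; have [p1 p2] : untouched p i /\ i != n.
      by split; [apply: pu; rewrite inE iP orbT|apply: contraNneq nPr => <-].
    move=> t; rewrite fs; case: ifP => _; first exact: p1.
    by case: ifP => _; move/eqP: p2; lia.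
  + move=> m a b; rewrite !fs; case: ifP => _ [].
      move=> e1; case: ifP => _; first by move=> e2; apply: (gp m a b).
      case: ifP => _ // e2; have mn : m = n by move: b1 e2; lia.
      by have [] := pn a; rewrite -mn.
    case: ifP => _ // e1; have mn : m = n by move: b1 e1; lia.
    case: ifP => _; first by move=> e2; have [_] := pn b; rewrite -mn.
    by case: ifP => _ // e2; lia.
  by apply: mkseq_nth.
- rewrite /s' -ps prefixE size_mkseq -cats1 takel_cat ?size_mkseq ?leq_maxr //.
  by rewrite /mkseq -map_take take_iota (minn_idPl (leq_maxr _ _)).
- by rewrite size_rcons size_mkseq ltnS leq_maxr.
- by [].
move=> p' [gp' /= ps' pu'] v' cv' v0 vs vT.
move: ps'; rewrite /s' size_rcons size_mkseq mkseqS => /rcons_inj[ag eK].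
have vv : v' n.+1 = v n.+1.
  apply/esym; apply: (hk c p') => //; apply: agree_sym; apply: (agree_le (leq_maxl k (size s))).
  by apply/agree_mkseq.
by apply: (@path_avoids p' v' v0 vs vT n K); rewrite vv eK.
Qed.

Lemma diagonal (C : nat -> baire) (s0 : seq nat) : extends (fin s0) (s0, [::]) ->
  exists p, [/\ good p, mkseq p (size s0) = s0 & forall i, defeats (C i) p].
Proof.
move=> ex0; pose S := {st : seq nat * seq nat | extends (fin st.1) st}.
have /choice[g hg] (x : nat * S) : exists st' : S, [/\ prefix (sval x.2).1 (sval st').1,
    size (sval x.2).1 < size (sval st').1, {subset (sval x.2).2 <= (sval st').2}
    & forall p, extends p (sval st') -> defeats (C x.1) p].
  have [st' [h1 h2 h3 h4 h5]] := diagonal_step (C x.1) (proj2_sig x.2).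
  by exists (exist (fun st => extends (fin st.1) st) st' h1).
pose st := fix st n : S := if n is m.+1 then g (m, st m) else exist (fun st => extends (fin st.1) st) (s0, [::]) ex0.
pose s n := (sval (st n)).1.
have sS n : [/\ prefix (s n) (s n.+1), size (s n) < size (s n.+1),
    {subset (sval (st n)).2 <= (sval (st n.+1)).2}
    & forall p, extends p (sval (st n.+1)) -> defeats (C n) p] by apply: (hg (n, st n)).
have pre n j : prefix (s n) (s (n + j)) /\ {subset (sval (st n)).2 <= (sval (st (n + j))).2}.
  elim: j => [|j [h1 h2]]; first by rewrite addn0; split=> //; apply: prefix_refl.
  rewrite addnS; have [h3 _ h4 _] := sS (n + j); split; first exact: prefix_trans h3.
  by move=> i /h2 /h4.
have sz n : n <= size (s n) by elim: n => // n IH; have [_ h _ _] := sS n; apply: leq_ltn_trans h.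
pose p : baire := fun i => fin (s i.+1) i.
have pE n i : i < size (s n) -> p i = fin (s n) i.
  have both a b : a <= b -> i < size (s a) -> fin (s b) i = fin (s a) i.
    move=> ab ia; have [/prefixP[u e] _] := pre a (b - a); rewrite subnKC // in e.
    by rewrite e /fin nth_cat ia.
  move=> iz; rewrite /p; case: (leqP n i.+1) => h; first exact: both.
  by apply/esym; apply: both; [apply: ltnW|apply: sz].
have pfin N : exists n, agree N p (fin (s n)) by exists N => i iN; apply: pE; apply: leq_trans (sz N).
have gp : good p.
  move=> m a b [e1 e2]; have [n hn] := pfin (maxn a b).+1.
  have [gn _ _] := proj2_sig (st n); apply: (gn m a b).
  by rewrite -!hn // ltnS ?leq_maxl ?leq_maxr.
have ext n : extends p (sval (st n)).
  split=> //; first by rewrite -/(s n) -[RHS](mkseq_nth 0); apply/agree_mkseq => i /pE.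
  move=> i iP t; have [_ _ u] := proj2_sig (st (maxn n t.+1)).
  have tN : t < size (s (maxn n t.+1)) by apply: leq_trans (sz _); rewrite leq_maxr.
  rewrite (pE _ _ tN); apply: u; have [_ h] := pre n (maxn n t.+1 - n).
  by rewrite subnKC ?leq_maxl // in h; apply: h.
exists p; split=> //; first by have [_] := ext 0.
by move=> i; have [_ _ _ h] := sS i; apply: h.
Qed.

(** Near the sequence 0, whose tree is full, one of countably many codes would find a path for each
    good sequence; the diagonal sequence defeats all of them. *)
Lemma not_WKL : valid QIVT (FNot WKL).
Proof.
pose Q := QIVT; apply: valid_not => A rho a; rewrite sem_WKL => /wkl_program[F hF].
pose F' := ccomp F (fcode (fun p => bp A p)).
have cF : cont (fun p => bp A p) by apply: cont_bp; [exact: cont_cst|exact: cont_id].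
have run p : good p -> exists f, [/\ kapp F' p f, jdom Q A f
    & forall z, jv A f z -> [/\ z 0 = 1, bsteps z & forall n, inT p (z n)]].
  by move=> /hF[f Ff [df sf]]; exists f; split=> //; apply: ccompP Ff; apply: fcodeP.
have g0 : good (numeral 0) by move=> m s t [].
have [f0 [F0 d0 _]] := run _ g0.
have base p : Q p -> exists G k, countable_codes G /\ forall p', agree k p p' -> Q p' ->
    (exists z, kset p' z) -> exists c v, [/\ G c, kapp c p' v & kset p' v].
  move=> _; exists convex_codes, 0; split; first exact: convex_codes_countable.
  by move=> p' _; apply: convex_selector.
have [|G [k [[C hC] hG]]] := @jop_selectors Q A countable_codes _ (@countable_codes2) (@countable_codes_list) base _ d0.
  by move=> c; exists (fun=> c) => g <-; exists 0.
have [l hl] := kapp_agree F0 k.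
have [|p [gp ps dp]] := @diagonal (fun i => ccomp (C i) F') (nseq l 0).
  have E : fin (nseq l 0) = numeral 0 by apply: funext => i; rewrite /fin nth_nseq if_same.
  split=> //=; first by rewrite E.
  by rewrite /fin; apply: mkseq_nth.
have [f [Ff df sf]] := run p gp.
have [|c [v [Gc cv vj]]] := hG f _ df.
  apply: (hl F' p) => // i il; have := congr1 (nth 0 ^~ i) ps.
  by rewrite size_nseq nth_mkseq // nth_nseq il.
have [i ci] := hC c Gc; have [v0 vs vT] := sf v vj.
by apply: (dp i v _ v0 vs vT); rewrite ci; apply: ccompP Ff cv.
Qed.

(** * The failure of the intermediate value theorem *)

Section Plateau.

Local Open Scope ring_scope.

Lemma rq_surj (q : rat) : exists m, rq m = q.
Proof.
have dE : (denq q)%:~R = (`|denq q|.-1.+1)%:R :> rat.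
  by rewrite prednK ?absz_gt0 ?denq_eq0 // -[RHS]/(`|denq q|%N%:Z%:~R) absz_denq.
have := divq_num_den q; case: (numq q) => k qE.
  exists (code [:: k; 0; `|denq q|.-1]%N).
  by rewrite /rq /qc CodeSeq.codeK /qv /= addn1 -dE subr0; exact: qE.
exists (code [:: 0; k.+1; `|denq q|.-1]%N).
by rewrite /rq /qc CodeSeq.codeK /qv /= addn1 -dE sub0r; rewrite NegzE mulrNz in qE; exact: qE.
Qed.

Definition rc (q : rat) : nat := sval (cid (rq_surj q)).
Lemma rcK q : rq (rc q) = q. Proof. exact: (proj2_sig (cid (rq_surj q))). Qed.

(** An interval is a left end and a width. The digit 0 keeps it, so after any number of zeros the
    passage to the left or the right quarter is still open. *)
Definition zstep (aw : rat * rat) (c : nat) : rat * rat :=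
  if c == 0%N then aw else
  if c == 1%N then (aw.1, aw.2 / 4) else (aw.1 + 3 * aw.2 / 4, aw.2 / 4).

Fixpoint ziv (p : baire) (n : nat) : rat * rat :=
  if n is m.+1 then zstep (ziv p m) (p m) else (1 / 4, 1 / 2).
Definition lo p n := (ziv p n).1.
Definition hi p n := (ziv p n).1 + (ziv p n).2.

Lemma zstep_gt0 aw c : 0 < aw.2 -> 0 < (zstep aw c).2.
Proof. by rewrite /zstep; case: ifP => // _; case: ifP => _ /= ?; lra. Qed.

Lemma zstep_sub aw c : 0 < aw.2 ->
  aw.1 <= (zstep aw c).1 /\ (zstep aw c).1 + (zstep aw c).2 <= aw.1 + aw.2.
Proof. by rewrite /zstep; case: ifP => _; [|case: ifP => _]; move=> /= ?; split; lra. Qed.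

Lemma ziv_gt0 p n : 0 < (ziv p n).2.
Proof. by elim: n => //= n IH; apply: zstep_gt0. Qed.

Lemma ziv_nest p n j : lo p n <= lo p (n + j)%N /\ hi p (n + j)%N <= hi p n.
Proof.
elim: j => [|j [h1 h2]]; first by rewrite addn0.
rewrite addnS; have [h3 h4] := zstep_sub (p (n + j)%N) (ziv_gt0 p (n + j)%N).
by move: h1 h2; rewrite /lo /hi /=; lra.
Qed.

Lemma lo_le_hi p n m : lo p n <= hi p m.
Proof.
have pos k : lo p k <= hi p k by rewrite /lo /hi; have := ziv_gt0 p k; lra.
case: (leqP n m) => h; [|have {}h := ltnW h]; have := subnKC h => <-.
  by have [h1 _] := ziv_nest p n (m - n)%N; apply: le_trans h1 (pos _).
by have [_ h1] := ziv_nest p m (n - m)%N; apply: le_trans (pos _) h1.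
Qed.

Lemma ziv_in p n : 1 / 4 <= lo p n /\ hi p n <= 3 / 4.
Proof. by have [] := ziv_nest p 0 n; rewrite add0n /lo /hi /=; lra. Qed.

Definition ramp (a b q : rat) : rat := if q < a then q - a else if b < q then q - b else 0.

Lemma ramp_lip (a b q q' : rat) : a <= b -> q <= q' -> 0 <= ramp a b q' - ramp a b q <= q' - q.
Proof.
by move=> ab qq; rewrite /ramp; case: ltP => ?; [|case: ltP => ?]; case: ltP => ?;
  try (case: ltP => ?); lra.
Qed.

(** A weighted sum of signed distances from nested intervals: non-decreasing and 1-Lipschitz, with a
    limit that vanishes exactly on the intersection of the intervals. *)
Fixpoint plat (p : baire) (N : nat) (q : rat) : rat :=
  if N is n.+1 then plat p n q + e2 n.+1 * ramp (lo p n) (hi p n) q else 0.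

Lemma plat_mono p N (q q' : rat) : q <= q' -> 0 <= plat p N q' - plat p N q <= (1 - e2 N) * (q' - q).
Proof.
move=> qq; elim: N => [|n IH]; first by rewrite /= [e2 0]expr0; lra.
have := ramp_lip (lo_le_hi p n n) qq; move: IH; rewrite /= [e2 n]e2S.
have u0 := e2_gt0 n.+1; set u := e2 n.+1 in u0 *; set r := ramp _ _ q; set r' := ramp _ _ q'.
set d := q' - q => /andP[h1 h2] /andP[h3 h4].
have k1 : 0 <= u * (r' - r) by rewrite mulr_ge0 // ltW.
have k2 : u * (r' - r) <= u * d by rewrite ler_pM2l.
have e1 : (1 - (u + u)) * d = d - u * d - u * d by ring.
have e3 : (1 - u) * d = d - u * d by ring.
rewrite e1 in h2; rewrite e3; rewrite mulrBr in k1 k2; apply/andP; split; lra.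
Qed.

Lemma plat_lip p N (q q' e : rat) : `|q - q'| <= e -> `|plat p N q - plat p N q'| <= e.
Proof.
have key (a b : rat) : a <= b -> `|a - b| <= e -> `|plat p N a - plat p N b| <= e.
  move=> ab; have /andP[h1 h2] := plat_mono p N ab; have e0 := e2_gt0 N.
  have h3 : (1 - e2 N) * (b - a) <= b - a by rewrite ler_piMl //; lra.
  by rewrite !ler_norml => /andP[h4 h5]; apply/andP; split; lra.
case: (leP q q') => [/key //|/ltW/key h].
by rewrite distrC => /h; rewrite distrC.
Qed.

Lemma plat_tail p N j (q : rat) : 0 <= q <= 1 -> `|plat p (N + j)%N q - plat p N q| <= e2 N - e2 (N + j).
Proof.
move=> q01; elim: j => [|j IH]; first by rewrite addn0 !subrr normr0.
rewrite addnS /=; move: IH; rewrite [X in _ <= _ - X -> _]e2S.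
have [b1 b2] := ziv_in p (N + j)%N; have bb := lo_le_hi p (N + j)%N (N + j)%N.
have : `|ramp (lo p (N + j)%N) (hi p (N + j)%N) q| <= 1.
  by rewrite /ramp ler_norml; case: ltP => ?; [|case: ltP => ?]; apply/andP; split; lra.
have u0 := e2_gt0 (N + j).+1; set u := e2 (N + j).+1 in u0 *; set r := ramp _ _ _.
rewrite !ler_norml => /andP[r1 r2] /andP[h1 h2].
have k1 : u * r <= u by rewrite ler_piMr // ltW.
have k2 : - u <= u * r by rewrite -mulrN1 ler_pM2l.
apply/andP; split; lra.
Qed.

(** Left of [lo p n] no term is positive, because [lo p n <= hi p k] for all [k]; the n-th term
    alone gives the bound. *)
Lemma plat_neg p n (c d : rat) N : (n < N)%N -> 0 <= d -> c <= lo p n - d -> plat p N c <= - (e2 n.+1 * d).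
Proof.
move=> nN d0 cl; have np k : ramp (lo p k) (hi p k) c <= 0.
  have := lo_le_hi p n k; rewrite /ramp => ?; case: ltP => ?; first lra.
  by case: ltP => ?; lra.
have tn k : e2 k.+1 * ramp (lo p k) (hi p k) c <= 0 by apply: mulr_ge0_le0 => //; apply: ltW; apply: e2_gt0.
have le0 k : plat p k c <= 0 by elim: k => //= k IH; have := tn k; lra.
elim: N nN => // N IH; rewrite ltnS leq_eqVlt => /orP[/eqP <-|/IH h] /=; last by have := tn N; lra.
have : e2 n.+1 * ramp (lo p n) (hi p n) c <= e2 n.+1 * (- d).
  rewrite ler_pM2l ?e2_gt0 // /ramp; case: ltP => ?; first lra.
  by have := lo_le_hi p n n; case: ltP => ? ?; lra.
by rewrite mulrN; have := le0 n; lra.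
Qed.

Lemma plat_pos p n (c d : rat) N : (n < N)%N -> 0 <= d -> hi p n + d <= c -> e2 n.+1 * d <= plat p N c.
Proof.
move=> nN d0 cl; have np k : 0 <= ramp (lo p k) (hi p k) c.
  have := lo_le_hi p k n; rewrite /ramp => ?; case: ltP => ?; first lra.
  by case: ltP => ?; lra.
have tn k : 0 <= e2 k.+1 * ramp (lo p k) (hi p k) c by rewrite mulr_ge0 // ltW ?e2_gt0.
have le0 k : 0 <= plat p k c by elim: k => //= k IH; have := tn k; lra.
elim: N nN => // N IH; rewrite ltnS leq_eqVlt => /orP[/eqP <-|/IH h] /=; last by have := tn N; lra.
have : e2 n.+1 * d <= e2 n.+1 * ramp (lo p n) (hi p n) c.
  rewrite ler_pM2l ?e2_gt0 // /ramp; have := lo_le_hi p n n; case: ltP => ? ?; first lra.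
  by case: ltP => ?; lra.
by have := le0 n; lra.
Qed.

Definition clip (q : rat) : rat := if q < 0 then 0 else if 1 < q then 1 else q.

Lemma clip01 q : 0 <= clip q <= 1.
Proof. by rewrite /clip; case: ltP => ?; [|case: ltP => ?]; lra. Qed.

Lemma clip_le (q b : rat) : 0 <= b -> q <= b -> clip q <= b.
Proof. by rewrite /clip => ? ?; case: ltP => ?; [|case: ltP => ?]; lra. Qed.

Lemma clip_ge (q b : rat) : b <= 1 -> b <= q -> b <= clip q.
Proof. by rewrite /clip => ? ?; case: ltP => ?; [|case: ltP => ?]; lra. Qed.

Lemma clip_lip (q q' e : rat) : `|q - q'| <= e -> `|clip q - clip q'| <= e.
Proof.
rewrite /clip !ler_norml => /andP[? ?].
by case: ltP => ?; [|case: ltP => ?]; case: ltP => ?; try (case: ltP => ?); apply/andP; split; lra.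
Qed.

(** Truncating at [n.+2] and reading [a] at [n.+2] cost at most [2^-(n+2)] each, which keeps the
    sequence regular. Terms of [a] may lie slightly outside [0,1], hence [clip]. *)
Definition bet (p a : baire) : baire := fun n => rc (plat p n.+2 (clip (rq (a n.+2)))).

Lemma rq_bet p a n : rq (bet p a n) = plat p n.+2 (clip (rq (a n.+2))).
Proof. exact: rcK. Qed.

Lemma bet_lip p a a' n (e : rat) : `|rq (a n.+2) - rq (a' n.+2)| <= e -> `|rq (bet p a n) - rq (bet p a' n)| <= e.
Proof. by move=> h; rewrite !rq_bet; apply: plat_lip; apply: clip_lip. Qed.

Lemma reg_bet p a : reg a -> reg (bet p a).
Proof.
move=> ra n m nm; rewrite !rq_bet; have nm2 : (n.+2 <= m.+2)%N by [].
have := plat_lip p n.+2 (clip_lip (ltW (ra _ _ nm2))).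
have := plat_tail p n.+2 (m - n)%N (clip01 (rq (a m.+2))); rewrite addSn addSn subnKC //.
set x := plat p n.+2 _; set y := plat p n.+2 _; set z := plat p m.+2 _.
have := e2_gt0 m.+2; rewrite [e2 n]e2S [e2 n.+1]e2S; have := e2_gt0 n.+2.
rewrite !ler_norml ltr_norml => ? ? /andP[? ?] /andP[? ?]; apply/andP; split; lra.
Qed.

Lemma within_bet p a : within qN1 q1 (bet p a).
Proof.
move=> n; rewrite rq_bet qv_qN1 qv_q1.
have := plat_tail p 0 n.+2 (clip01 (rq (a n.+2))); rewrite add0n subr0 [e2 0]expr0 ler_norml.
by have := e2_gt0 n.+2; have := e2_gt0 n => ? ? /andP[? ?]; lra.
Qed.

Definition inI (aw : rat * rat) (v : baire) : Prop :=
  forall i, aw.1 - e2 i <= rq (v i) <= aw.1 + aw.2 + e2 i.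

Lemma bet_zero p a : reg a ->
  (forall k, exists c, forall n, (c <= n)%N -> `|rq (bet p a n)| < e2 k) -> forall n, inI (ziv p n) a.
Proof.
move=> ra hz n m; have [l1 h1] := ziv_in p n; have lh := lo_le_hi p n n.
have far (d : rat) : 0 < d -> ~ (forall i, (n <= i)%N -> (m <= i)%N -> e2 n.+1 * d <= `|rq (bet p a i)|).
  move=> d0 h; have [k hk] : exists k, e2 k < e2 n.+1 * d by apply: e2_small; rewrite mulr_gt0 ?e2_gt0.
  have [c hc] := hz k; pose i := maxn c (maxn n m).
  have ci : (c <= i)%N by rewrite /i leq_maxl.
  have ni : (n <= i)%N by rewrite /i !leq_max leqnn orbT.
  have mi : (m <= i)%N by rewrite /i !leq_max leqnn !orbT.
  by have := h i ni mi; have := hc i ci; lra.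
have near i : (m <= i)%N -> `|rq (a m) - rq (a i.+2)| < e2 m by move=> mi; apply: ra; lia.
rewrite -/(lo p n) -/(hi p n); apply/andP; split; rewrite leNgt; apply/negP => h.
  pose d := Num.min (1 / 4) (lo p n - e2 m - rq (a m)).
  have d0 : 0 < d by rewrite lt_min; apply/andP; split; lra.
  have /andP[d1 d2] : (d <= 1 / 4) && (d <= lo p n - e2 m - rq (a m)) by rewrite !ge_min !lexx orbT.
  apply: (far d d0) => i ni mi; have := near i mi; rewrite ltr_norml => /andP[? ?].
  rewrite rq_bet; set c := clip _; have hc : c <= lo p n - d by apply: clip_le; lra.
  have nN : (n < i.+2)%N by apply: leq_trans (leqnSn _).
  have hp := plat_neg nN (ltW d0) hc.
  by rewrite -normrN; apply: le_trans (ler_norm _); lra.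
pose d := Num.min (1 / 4) (rq (a m) - e2 m - hi p n).
have d0 : 0 < d by rewrite lt_min; apply/andP; split; lra.
have /andP[d1 d2] : (d <= 1 / 4) && (d <= rq (a m) - e2 m - hi p n) by rewrite !ge_min !lexx orbT.
apply: (far d d0) => i ni mi; have := near i mi; rewrite ltr_norml => /andP[? ?].
rewrite rq_bet; set c := clip _; have hc : hi p n + d <= c by apply: clip_ge; lra.
have nN : (n < i.+2)%N by apply: leq_trans (leqnSn _).
by have hp := plat_pos nN (ltW d0) hc; apply: le_trans hp (ler_norm _).
Qed.

Lemma plat_agree p p' N q : agree N p p' -> plat p' N q = plat p N q.
Proof.
move=> pp; have E n : (n <= N)%N -> ziv p' n = ziv p n.
  by elim: n => //= n IH nN; rewrite IH ?(ltnW nN) // pp.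
have : forall n, (n <= N)%N -> plat p' n q = plat p n q.
  elim=> //= n IH nN; rewrite IH ?(ltnW nN) // /lo /hi E // ltnW //.
by apply.
Qed.

Lemma cont_bet f g : cont f -> cont g -> cont (fun w => bet (f w) (g w)).
Proof.
move=> cf cg w n; have [k hk] := cont_agree cf w n.+2; have [l hl] := cont_agree cg w n.+3.
exists (maxn k l) => w' ww; rewrite /bet (plat_agree _ (hk w' _)); last by apply: agree_le ww; rewrite leq_maxl.
by rewrite -(hl w' _ n.+2) //; apply: agree_le ww; rewrite leq_maxr.
Qed.

Lemma inI_shrink aw cs v : 0 < aw.2 -> inI (foldl zstep aw cs) v -> inI aw v.
Proof.
elim: cs aw => //= c cs IH aw aw0 /(IH _ (zstep_gt0 c aw0)) h i.
by have := h i; have [] := zstep_sub c aw0; lra.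
Qed.

(** Each outcome is avoided by passing to the quarter on the other side of the midpoint. The
    quarters are a fourth of the width away from it, so a precision below an eighth is enough. *)
Lemma avoid_outcomes (L : list baire) aw : 0 < aw.2 -> exists cs m, forall v v',
  List.In v L -> agree m v v' -> ~ inI (foldl zstep aw cs) v'.
Proof.
elim: L aw => [|v L IH] aw aw0; first by exists [::], 0%N.
have [i hi] : exists i, e2 i < aw.2 / 8 by apply: e2_small; lra.
pose c := if aw.1 + aw.2 / 2 < rq (v i) then 1%N else 2%N.
have [cs [m h]] := IH _ (zstep_gt0 c aw0); exists (c :: cs), (maxn m i.+1) => w w' [<-|wL] ag /=.
  move=> /(inI_shrink (zstep_gt0 c aw0))/(_ i); have -> : w' i = v i by rewrite ag // leq_max leqnn orbT.
  by rewrite /zstep /c; case: ltP => ? /=; lra.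
by apply: h wL _; apply: agree_le ag; rewrite leq_maxl.
Qed.

End Plateau.

(** * Passing from names of reals to their canonical names *)

Section Transport.

Variable Q : baire -> Prop.

Lemma leibniz2_prog G : {t | forall A rho x y a b e,
  PAnd (PAnd (PEq Q A x a) (PEq Q A y b)) (sem Q A G (upd (upd rho 0 x) 1 y)) e ->
  wp A t e (sem Q A G (upd (upd rho 0 a) 1 b))}.
Proof.
have [l0 h0] := leibniz_prog Q G 0; have [l1 h1] := leibniz_prog Q G 1.
eexists=> A rho x y a b e h.
have S c d : upd (upd rho 1 d) 0 c = upd (upd rho 0 c) 1 d by apply: upd_swap.
apply: (wp_call (c := l1) (P := PAnd (PEq Q A y b) (sem Q A G (upd (upd rho 0 a) 1 y))));
  last by move=> v; apply: h1.
apply: wp_pair; first by apply: wp_snd; apply: wp_fst; whyp h.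
rewrite -S; apply: (wp_call (c := l0) (P := PAnd (PEq Q A x a) (sem Q A G (upd (upd rho 1 y) 0 x))));
  last by move=> v; apply: h0.
apply: wp_pair; first by apply: wp_fst; apply: wp_fst; whyp h.
by rewrite S; apply: wp_snd; whyp h.
Qed.

Lemma leibniz2_inh G A rho x y a b : inh (PEq Q A x a) -> inh (PEq Q A y b) ->
  inh (sem Q A G (upd (upd rho 0 x) 1 y)) -> inh (sem Q A G (upd (upd rho 0 a) 1 b)).
Proof.
move=> [e1 h1] [e3 h3] [e h]; have [t ht] := leibniz2_prog G.
apply: inh_wp (ht A rho x y a b (bp (bp e1 e3) e) _).
by split; rewrite ?pr0_bp ?pr1_bp //; split; rewrite ?pr0_bp ?pr1_bp.
Qed.

Definition FReq := req (rvar 0) (rvar 1) 2.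
Definition FRclose := rclose 2 (rvar 0) (rvar 1) 3.

Lemma sem_FReq A rho x y : sem Q A FReq (upd (upd rho 0 x) 1 y) =
  SReq Q A (SRvar Q A x) (SRvar Q A y).
Proof. by []. Qed.

Lemma sem_FRclose A k x y : sem Q A FRclose (upd (upd (fun=> Urel k) 0 x) 1 y) =
  SRclose Q A (Urel k) (SRvar Q A x) (SRvar Q A y).
Proof. by []. Qed.

Lemma req_rn A x y a b : reg a -> reg b -> inh (PEq Q A x (rn a)) -> inh (PEq Q A y (rn b)) ->
  inh (SReq Q A (SRvar Q A x) (SRvar Q A y)) -> forall n, (`|rq (a n) - rq (b n)| <= e2 n + e2 n)%R.
Proof.
move=> ra rb xa yb; rewrite -(sem_FReq A (fun=> Urel 0)) => /(leibniz2_inh xa yb).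
rewrite sem_FReq => h n.
have := @req_inh Q _ _ _ (ok_rvar Q cont_pr0) _ _ _ (ok_rvar Q cont_pr1) A (bp a b).
rewrite pr0_bp pr1_bp => /(_ h) hk; rewrite ler_norml.
have : forall k, (rq (a n) - rq (b n) <= e2 n + e2 n + e2 k /\ - (e2 n + e2 n) <= rq (a n) - rq (b n) + e2 k)%R.
  move=> k; have [c hc] := hk k; have := hc (maxn c n) (leq_maxl _ _).
  rewrite /oq pr0_bp pr1_bp -!/(rq _); have := ra _ _ (leq_maxr c n); have := rb _ _ (leq_maxr c n).
  by rewrite !ltr_norml => /andP[? ?] /andP[? ?] /andP[? ?]; split; lra.
by move=> H; apply/andP; split; apply: le_e2 => k; have [] := H k.
Qed.

Lemma rclose_rn A k x y a b : reg a -> reg b -> inh (PEq Q A x (rn a)) -> inh (PEq Q A y (rn b)) ->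
  inh (SRclose Q A (Urel k) (SRvar Q A x) (SRvar Q A y)) ->
  forall n, (`|rq (a n) - rq (b n)| <= e2 k + e2 n + e2 n)%R.
Proof.
move=> ra rb xa yb; rewrite -sem_FRclose => /(leibniz2_inh xa yb).
rewrite sem_FRclose => /inh_and[h1 h2] n.
have := @rlt_inh Q _ _ _ (ok_rvar Q cont_pr0) _ _ _ (ok_radd (ok_rvar Q cont_pr1) (ok_rcst (qpos_q2N k))) A (bp a b).
have := @rlt_inh Q _ _ _ (ok_rvar Q cont_pr1) _ _ _ (ok_radd (ok_rvar Q cont_pr0) (ok_rcst (qpos_q2N k))) A (bp a b).
rewrite !pr0_bp !pr1_bp => /(_ h2)[k2 [c2 H2]] /(_ h1)[k1 [c1 H1]].
pose m := maxn n (maxn c1 c2).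
have := H1 m; have := H2 m; rewrite !oq_radd /oq !pr0_bp !pr1_bp -!/(rq _) qv_q2N.
move=> /(_ _)-g2 /(_ _)-g1; have {}g1 := g1 ltac:(rewrite /m; lia); have {}g2 := g2 ltac:(rewrite /m; lia).
have := ra n m (leq_maxl _ _); have := rb n m (leq_maxl _ _); have := e2_gt0 k1; have := e2_gt0 k2.
rewrite !ltr_norml ler_norml => ? ? /andP[? ?] /andP[? ?]; apply/andP; split; lra.
Qed.

End Transport.

Definition fnm (p : baire) : name :=
  Coll (fun a : {a | reg a /\ within q0 q1 a} => sval a)
       (fun a => opn (rn (sval a)) (rn (bet p (sval a)))).

Section PlateauProgram.

Variable Q : baire -> Prop.

Definition PGraph A p x y : prop := fun d => [/\ reg (pr0 d), within q0 q1 (pr0 d)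
  & PAnd (PEq Q A x (rn (pr0 d))) (PEq Q A y (rn (bet p (pr0 d)))) (pr1 d)].

Lemma graph_elim : {t | forall A p x y e, SMaps Q A (fnm p) x y e ->
  wp A t e (Jp Q A (PGraph A p x y))}.
Proof.
eexists=> A p x y e h.
apply: (wp_mapj (P := fun d => exists c, PAnd (PMem c (fnm p)) (PEq Q A (opn x y) c) d)).
  by rewrite -PInE; apply: wp_mapsE; whyp h.
move=> d [c hd]; have [[[a [ra wa]] [/= ea ec]] hq] := hd; subst c.
apply: (wp_bp (P := eq a) (Q := PAnd (PEq Q A x (rn a)) (PEq Q A y (rn (bet p a))))).
- by apply: (wp_fun cont_pr0); apply: wp_var0.
- by apply: wp_opn_inj; apply: wp_snd; whyp hd.
by move=> v w <- hw; split; rewrite ?pr0_bp ?pr1_bp.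
Qed.

Lemma realfun_prog : {t | forall A p, wp A t p (SRealfun Q A (fnm p))}.
Proof.
have [g hg] := graph_elim; have [te he] := real01_extract Q.
have [t1 h1] := @realin_prog Q q0 q1 isT isT; have [t2 h2] := @realin_prog Q qN1 q1 isT isT.
have c1 : cont (fun w => bet (pr0 w) (pr0 (pr1 w))) by apply: cont_bet cont_pr0 (cont_comp cont_pr0 cont_pr1).
have c2 : cont (fun w => bet (pr0 w) (pr1 (pr1 w))) by apply: cont_bet cont_pr0 (cont_comp cont_pr1 cont_pr1).
have [tq hq] := req_prog Q (ok_rvar Q c1) (ok_rvar Q c2) 1.
have [tl hl] := leibniz2_prog Q FReq.
have cb : cont (fun w => bet (pr0 w) (pr1 w)) := cont_bet cont_pr0 cont_pr1.
eexists=> A p; apply: wp_pair; first exact: wp_true.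
apply: wp_pair; last apply: wp_pair.
- wall=> c; apply: wp_lam => e hce; apply: wp_inE; [by whyp hce| |closed].
  move=> c' d hd; have [[[a [ra wa]] [/= ea ec]] _] := hd; subst c'.
  apply: (wp_exI (rn a)); apply: (wp_exI (rn (bet p a))); apply: wp_pair.
    apply: (wp_call (c := t1) (P := eq a)); first by apply: (wp_fun cont_pr0); apply: wp_var0.
    by move=> _ <-; apply: h1.
  apply: wp_pair; last by apply: wp_opairI; apply: wp_snd; whyp hd.
  apply: (wp_call (c := t2) (P := eq (bet p a))).
    apply: (wp_fun cb); apply: (wp_bp (P := eq p) (Q := eq a)) => [||_ _ <- <-].
    + by apply: wp_shift; apply: wp_shift; apply: wp_here.
    + by apply: (wp_fun cont_pr0); apply: wp_var0.
    by rewrite pr0_bp pr1_bp.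
  by move=> _ <-; apply: h2; [apply: reg_bet|apply: within_bet].
- wall=> x; apply: wp_lam => e hx; have [a [ra wa xa]] := he A x _ hx.
  apply: (wp_let (P := PAnd (eq a) (PEq Q A x (rn a)))).
    by apply: (wp_call (c := te) (P := eq e)); [apply: wp_var0|move=> _ <-; exact: xa].
  move=> u hu; apply: (wp_exI (rn (bet p a))); apply: wp_pair.
    apply: (wp_call (c := t2) (P := eq (bet p a))).
      apply: (wp_fun cb); apply: (wp_bp (P := eq p) (Q := eq a)) => [||_ _ <- <-].
      + by apply: wp_shift; apply: wp_shift; apply: wp_here.
      + by apply: (wp_fun cont_pr0); apply: wp_var0; case: hu.
      by rewrite pr0_bp pr1_bp.
    by move=> _ <-; apply: h2; [apply: reg_bet|apply: within_bet].
  apply: wp_mapsI; apply: wp_in_eql.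
    apply: (wp_opn_cong (a := rn a) (b := rn (bet p a))); last exact: wp_refl.
    by apply: wp_sym; apply: wp_snd; whyp hu.
  apply: wp_mem_in; apply: (wp_fun cont_pr0); apply: wp_var0; case: hu => ea _.
  by exists (exist (fun a => reg a /\ within q0 q1 a) a (conj ra wa)).
wall=> x; wall=> y; wall=> x'; wall=> y'; apply: wp_lam => e [e1 [e3 e4]].
apply: (wp_bind (P := PGraph A p x y)); [|move=> d1 [r1 w1 g1]|by apply: (closed_all (Urel 0)) => c; apply: closed_imp; exact: closed_Jp].
  by apply: (wp_call (c := g) (P := eq (pr0 e))); [apply: (wp_fun cont_pr0); apply: wp_var0|move=> _ <-; apply: hg].
apply: (wp_bind (P := PGraph A p x' y')); [|move=> d2 [r2 w2 g2]|by apply: (closed_all (Urel 0)) => c; apply: closed_imp; exact: closed_Jp].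
  apply: (wp_call (c := g) (P := eq (pr0 (pr1 e)))); last by move=> _ <-; apply: hg.
  by apply: wp_shift; apply: (wp_fun cont_pr0); apply: (wp_fun cont_pr1); apply: wp_var0.
have close : forall n, (`|rq (pr0 d1 n) - rq (pr0 d2 n)| <= e2 n + e2 n)%R.
  by apply: (@req_rn Q A x x') => //; [exists (pr0 (pr1 d1)); case: g1|exists (pr0 (pr1 d2)); case: g2|exists (pr1 (pr1 e))].
set a := pr0 d1 in r1 w1 g1 close *; set a' := pr0 d2 in r2 w2 g2 close *.
rewrite -(sem_FReq Q A (fun=> Urel 0)); apply: (wp_call (c := tl) (P := PAnd (PAnd
    (PEq Q A (rn (bet p a)) y) (PEq Q A (rn (bet p a')) y'))
    (sem Q A FReq (upd (upd (fun=> Urel 0) 0 (rn (bet p a))) 1 (rn (bet p a')))))); last by move=> v; apply: hl.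
apply: wp_pair; first apply: wp_pair.
- by apply: wp_sym; apply: wp_shift; apply: wp_snd; apply: (wp_fun cont_pr1); apply: wp_var0; exact: g1.
- by apply: wp_sym; apply: wp_snd; apply: (wp_fun cont_pr1); apply: wp_var0; exact: g2.
rewrite sem_FReq; apply: (wp_call (c := tq) (P := eq (bp p (bp a a')))).
  apply: (wp_bp (P := eq p) (Q := eq (bp a a'))) => [||_ _ <- <- //].
    by do 3 apply: wp_shift; apply: wp_here.
  apply: (wp_bp (P := eq a) (Q := eq a')) => [||_ _ <- <- //].
    by apply: wp_shift; apply: (wp_fun cont_pr0); apply: wp_var0.
  by apply: (wp_fun cont_pr0); apply: wp_var0.
move=> _ <-; have := hq A (bp p (bp a a')); rewrite !(pr0_bp, pr1_bp); apply=> k n kn.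
rewrite /oq !(pr0_bp, pr1_bp) -!/(rq _); apply: le_lt_trans (bet_lip p (close n.+2)) _.
have := e2_le kn; rewrite addn1 [e2 k]e2S [e2 n]e2S [e2 n.+1]e2S.
by have := e2_gt0 n.+2; lra.
Qed.

Lemma continuous_prog : {t | forall A p, wp A t p (SContinuous Q A (fnm p))}.
Proof.
have [g hg] := graph_elim; have [tl hl] := leibniz2_prog Q FRclose.
have c1 : cont (fun w => bet (pr0 w) (pr0 (pr1 w))) by apply: cont_bet cont_pr0 (cont_comp cont_pr0 cont_pr1).
have c2 : cont (fun w => bet (pr0 w) (pr1 (pr1 w))) by apply: cont_bet cont_pr0 (cont_comp cont_pr1 cont_pr1).
pose o1 := ok_rvar Q c1; pose o2 := ok_rvar Q c2.
pose T1 k := rlt_prog Q o1 (ok_radd o2 (ok_rcst (qpos_q2N k))) k.+3 k.+2.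
pose T2 k := rlt_prog Q o2 (ok_radd o1 (ok_rcst (qpos_q2N k))) k.+3 k.+2.
eexists=> A p; wall=> x; wall=> y; apply: wp_lam => e h; wall=> c; apply: wp_lam => e' [k -> ->].
apply: (wp_nat (n := k)); first by whyp (erefl (numeral k)).
apply: (wp_bind (P := PGraph A p x y)); [|move=> d1 [r1 w1 g1]|exact: closed_Jp].
  by apply: wp_shift; apply: (wp_call (c := g) (P := eq e)); [apply: wp_var0|move=> _ <-; apply: hg].
(* [bet] is 1-Lipschitz; the extra bit absorbs the regularity errors. *)
apply: (wp_exI (Urel k.+1)); apply: wp_pair; first by apply: wp_cst; exists k.+1.
wall=> x'; wall=> y'; apply: wp_lam => e3 [e4 e5].
apply: (wp_bind (P := PGraph A p x' y')); [|move=> d2 [r2 w2 g2]|by apply: closed_and; exact: closed_Jp].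
  by apply: (wp_call (c := g) (P := eq (pr0 e3))); [apply: (wp_fun cont_pr0); apply: wp_var0|move=> _ <-; apply: hg].
have close : forall n, (`|rq (pr0 d1 n) - rq (pr0 d2 n)| <= e2 k.+1 + e2 n + e2 n)%R.
  by apply: (@rclose_rn Q A k.+1 x x') => //; [exists (pr0 (pr1 d1)); case: g1|exists (pr0 (pr1 d2)); case: g2|exists (pr1 e3)].
set a := pr0 d1 in r1 w1 g1 close *; set a' := pr0 d2 in r2 w2 g2 close *.
have bnd n : k.+2 <= n -> (`|rq (bet p a n) - rq (bet p a' n)| + e2 k.+3 < e2 k)%R.
  move=> kn; have := bet_lip p (close n.+2); have := e2_le kn.
  rewrite [e2 n]e2S [e2 n.+1]e2S [e2 k]e2S [e2 k.+1]e2S [e2 k.+2]e2S.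
  by have := e2_gt0 k.+3; have := e2_gt0 n.+2; lra.
rewrite -sem_FRclose; apply: (wp_call (c := tl) (P := PAnd (PAnd
    (PEq Q A (rn (bet p a)) y) (PEq Q A (rn (bet p a')) y'))
    (sem Q A FRclose (upd (upd (fun=> Urel k) 0 (rn (bet p a))) 1 (rn (bet p a')))))); last by move=> v; apply: hl.
apply: wp_pair; first apply: wp_pair.
- by apply: wp_sym; do 2 apply: wp_shift; apply: wp_snd; apply: (wp_fun cont_pr1); apply: wp_var0; exact: g1.
- by apply: wp_sym; apply: wp_snd; apply: (wp_fun cont_pr1); apply: wp_var0; exact: g2.
rewrite sem_FRclose; apply: (wp_let (P := eq (bp p (bp a a')))).
  apply: (wp_bp (P := eq p) (Q := eq (bp a a'))) => [||_ _ <- <- //].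
    by do 5 apply: wp_shift; apply: wp_here.
  apply: (wp_bp (P := eq a) (Q := eq a')) => [||_ _ <- <- //].
    by do 2 apply: wp_shift; apply: (wp_fun cont_pr0); apply: wp_var0.
  by apply: (wp_fun cont_pr0); apply: wp_var0.
move=> _ <-; apply: wp_pair.
  apply: (wp_call (c := sval (T1 k)) (P := eq (bp p (bp a a')))); first by apply: wp_var0.
  move=> _ <-; have := proj2_sig (T1 k) A (bp p (bp a a')); rewrite !(pr0_bp, pr1_bp); apply=> n kn.
  rewrite oq_radd /oq !(pr0_bp, pr1_bp) -!/(rq _) qv_q2N; have := bnd n kn.
  by have := ler_norm (rq (bet p a n) - rq (bet p a' n))%R; lra.
apply: (wp_call (c := sval (T2 k)) (P := eq (bp p (bp a a')))); first by apply: wp_var0.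
move=> _ <-; have := proj2_sig (T2 k) A (bp p (bp a a')); rewrite !(pr0_bp, pr1_bp); apply=> n kn.
rewrite oq_radd /oq !(pr0_bp, pr1_bp) -!/(rq _) qv_q2N; have := bnd n kn; rewrite distrC.
by have := ler_norm (rq (bet p a' n) - rq (bet p a n))%R; lra.
Qed.

Definition rconst (q : rat) : baire := fun=> rc q.

Lemma reg_rconst (q : rat) : reg (rconst q).
Proof. by move=> n m _; rewrite subrr normr0 e2_gt0. Qed.

Lemma within_rconst (q : rat) : (0 <= q <= 1)%R -> within q0 q1 (rconst q).
Proof. by move=> q01 n; rewrite rcK qv_q0 qv_q1; have := e2_gt0 n; lra. Qed.

Lemma signs_prog : {t | forall A p, wp A t p (PEx Q A (fun y => PEx Q A (fun z =>
  PAnd (SValue_at Q A (fnm p) nq0 y) (PAnd (SValue_at Q A (fnm p) nq1 z)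
    (POr Q A (PAnd (SRlt Q A (SRvar Q A y) (SRcst nq0)) (SRlt Q A (SRcst nq0) (SRvar Q A z)))
             (PAnd (SRlt Q A (SRvar Q A z) (SRcst nq0)) (SRlt Q A (SRcst nq0) (SRvar Q A y))))))))}.
Proof.
have w0 : within q0 q1 (rconst 0) by apply: within_rconst; lra.
have w1 : within q0 q1 (rconst 1) by apply: within_rconst; lra.
have [t1 h1] := req_prog Q (ok_rvar Q (cont_cst (rconst 0))) (@ok_rcst q0 isT) 0.
have [t2 h2] := req_prog Q (ok_rvar Q (cont_cst (rconst 1))) (@ok_rcst q1 isT) 0.
have c0 : cont (fun p => bet p (rconst 0)) := cont_bet cont_id (cont_cst _).
have c1 : cont (fun p => bet p (rconst 1)) := cont_bet cont_id (cont_cst _).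
(* The points 0 and 1 are 1/4 away from the first interval, whose term has weight 1/2; the values
   are thus at least 1/8 in size, more than [2^-4]. *)
have [t3 h3] := rlt_prog Q (ok_rvar Q c0) (@ok_rcst q0 isT) 4 0.
have [t4 h4] := rlt_prog Q (@ok_rcst q0 isT) (ok_rvar Q c1) 4 0.
eexists=> A p; apply: (wp_exI (rn (bet p (rconst 0)))); apply: (wp_exI (rn (bet p (rconst 1)))).
apply: wp_pair.
  apply: (wp_exI (rn (rconst 0))); apply: wp_pair.
    by apply: h1 => k n _; rewrite /oq -/(rq _) rcK qv_q0 subrr normr0 e2_gt0.
  apply: wp_mapsI; apply: wp_mem_in; apply: (@wp_cst _ (rconst 0)).
  by exists (exist (fun a => reg a /\ within q0 q1 a) (rconst 0) (conj (@reg_rconst 0%R) w0)).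
apply: wp_pair.
  apply: (wp_exI (rn (rconst 1))); apply: wp_pair.
    by apply: h2 => k n _; rewrite /oq -/(rq _) rcK qv_q1 subrr normr0 e2_gt0.
  apply: wp_mapsI; apply: wp_mem_in; apply: (@wp_cst _ (rconst 1)).
  by exists (exist (fun a => reg a /\ within q0 q1 a) (rconst 1) (conj (@reg_rconst 1%R) w1)).
have e1 : (e2 1 = 1 / 2)%R by rewrite /e2 expr1; lra.
have e4 : (e2 4 = 1 / 16)%R by rewrite /e2; lra.
apply: wp_orI1; apply: wp_pair.
  apply: h3 => n _; rewrite /oq -/(rq _) rq_bet rcK qv_q0.
  have := @plat_neg p 0 (clip 0) (1 / 4) n.+2 isT; rewrite /clip ltxx /lo /= e1 e4; lra.
apply: h4 => n _; rewrite /oq -/(rq _) rq_bet rcK qv_q0.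
have := @plat_pos p 0 (clip 1) (1 / 4) n.+2 isT; rewrite /clip /hi /= e1 e4.
by case: ltP => ?; [lra|case: ltP => ?; lra].
Qed.

Lemma ivt_program A a : SIVT Q A a -> exists F, forall p,
  wp A F p (Jp Q A (fun v => reg v /\ forall n, inI (ziv p n) v)).
Proof.
move=> ha; have [t1 h1] := realfun_prog; have [t2 h2] := continuous_prog.
have [t3 h3] := signs_prog; have [g hg] := graph_elim.
pose G := req (rvar 0) (rcst q0) 1.
eexists=> p; apply: wp_exE; last exact: closed_Jp.
  apply: wp_app; first by apply: wp_cst; exact: (ha (fnm p)).
  by apply: wp_pair; [apply: h1|apply: wp_pair; [apply: h2|apply: h3]].
move=> x d hd; apply: wp_exE; [by whyp hd| |exact: closed_Jp].
move=> y d' [_ [hm hr]]; apply: (wp_mapj (P := PGraph A p x y)).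
  apply: (wp_call (c := g) (P := eq (pr0 (pr1 d')))); last by move=> _ <-; apply: hg.
  by apply: (wp_fun cont_pr0); apply: (wp_fun cont_pr1); apply: wp_var0.
move=> d2 [r2 w2 [_ g2]]; apply: (wp_fun cont_pr0); apply: wp_var0; split=> //.
apply: bet_zero => //.
have E c : sem Q A G (upd (fun=> Urel 0) 0 c) = SReq Q A (SRvar Q A c) (SRcst nq0) by [].
have [l hl] := leibniz_prog Q G 0.
have h : inh (SReq Q A (SRvar Q A (rn (bet p (pr0 d2)))) (SRcst nq0)).
  rewrite -E; apply: inh_wp (hl A _ y _ (bp (pr1 (pr1 d2)) (pr1 (pr1 d'))) _).
  by split; rewrite ?pr0_bp ?pr1_bp ?E.
have := @req_inh Q _ _ _ (ok_rvar Q cont_id) _ _ _ (@ok_rcst q0 isT) A (bet p (pr0 d2)) h.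
by move=> H k; have [c hc] := H k; exists c => n /hc; rewrite /oq -/(rq _) qv_q0 subr0.
Qed.

End PlateauProgram.

(** At an eventually zero [p] with stable outcomes the zeros form a whole interval. Digits appended
    later shrink it away from each of the finitely many listed outcomes, although the new sequence
    still has an outcome close to one of them. *)
Lemma not_IVT Q : (forall p, Q p -> kset p (numeral 0) \/
    exists L : list baire, forall z, kset p z -> List.In z L) ->
  valid Q (FNot IVT).
Proof.
move=> base; apply: valid_not => A rho a; rewrite sem_IVT => /ivt_program[F hF].
pose F' := ccomp F (fcode (fun p => bp A p)).
have cF : cont (fun p => bp A p) by apply: cont_bp; [exact: cont_cst|exact: cont_id].
have run p : exists f, [/\ kapp F' p f, jdom Q A f
    & forall z, jv A f z -> reg z /\ forall n, inI (ziv p n) z].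
  by have [f Ff [df sf]] := hF p; exists f; split=> //; apply: ccompP Ff; apply: fcodeP.
have [||p [L [[n0 pz] hL]]] := @stable_outcomes Q A base F' (fun p => exists n, evz p n) (numeral 0).
- by exists 0.
- by move=> p; have [f [Ff df _]] := run p; exists f.
have [cs [m hm]] := avoid_outcomes L (ziv_gt0 p n0); have [l hl] := hL m.
pose K := maxn n0 l; pose p' : baire := fun i => if i < K then p i else nth 0 cs (i - K).
have [f [Ff df sf]] := run p'.
have [||v [v' [vL v'j ag]]] := hl p' f _ _ Ff.
- exists (K + size cs) => i Ki; rewrite /p' ltnNge (leq_trans (leq_addr _ _) Ki) /=.
  by rewrite nth_default //; lia.
- by move=> i il; rewrite /p' (leq_trans il) // leq_maxr.
have [_ hv] := sf v' v'j; apply: (hm v v' vL ag).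
have zK : ziv p' K = ziv p n0.
  have e1 n : n <= K -> ziv p' n = ziv p n.
    by elim: n => //= n IH nK; rewrite IH ?(ltnW nK) // /p' nK.
  rewrite (e1 K (leqnn K)) /K -(subnKC (leq_maxl n0 l)); elim: (maxn n0 l - n0) => [|j IH]; first by rewrite addn0.
  by rewrite addnS /= pz ?leq_addr.
have zE j : j <= size cs -> ziv p' (K + j) = foldl zstep (ziv p n0) (take j cs).
  elim: j => [|j IH] js; first by rewrite addn0 take0.
  rewrite addnS /= IH ?(ltnW js) // (take_nth 0) // foldl_rcons; congr zstep.
  by rewrite /p' ltnNge leq_addr /= addKn.
by have := hv (K + size cs); rewrite zE // take_size.
Qed.

(** * The intermediate value theorem from convex choice *)

Section ValueProgram.

Variable Q : baire -> Prop.

Lemma wp_advice A env : wp A (fcode pr0) env (eq A).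
Proof. by exists A => //; have := @fcodeP pr0 (bp A env) cont_pr0; rewrite pr0_bp. Qed.

Lemma inhI (P : prop) v : P v -> inh P. Proof. by exists v. Qed.

Lemma inh_refl A x : inh (PEq Q A x x).
Proof. exact: inh_wp (wp_refl Q A x (numeral 0)). Qed.

Lemma value_prog : {V | forall A f e a, SRealfun Q A f e -> reg a -> within q0 q1 a ->
  wp A V (bp a e) (Jp Q A (fun b => reg b /\ inh (SMaps Q A f (rn a) (rn b))))}.
Proof.
have [t1 h1] := @realin_prog Q q0 q1 isT isT; have [te he] := real11_extract Q.
eexists=> A f e a [_ [_ [h3 _]]] ra wa.
apply: (wp_mapj (P := fun d => exists y, PAnd (SReal_in Q A nqN1 nq1 y) (SMaps Q A f (rn a) y) d)).
  apply: (wp_app (P := SReal_in Q A nq0 nq1 (rn a))).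
    apply: wp_shift; apply: (wp_fun cont_pr0); apply: (wp_fun cont_pr1); apply: (wp_fun cont_pr1).
    by apply: wp_here; exact: (h3 (rn a)).
  by apply: (wp_call (c := t1) (P := eq a)); [apply: wp_var0|move=> _ <-; apply: h1].
move=> d [y [hy hm]]; have [b [rb wb yb]] := he A y (pr0 d) hy.
apply: (@wp_mono _ _ _ (eq b)) => [_ <-|]; last first.
  apply: (wp_fst (R := PEq Q A y (rn b))).
  apply: (wp_call (c := te) (P := eq (pr0 d))); first by apply: (wp_fun cont_pr0); apply: wp_var0.
  by move=> _ <-; exact: yb.
split=> //; have [v _ [_ hv]] := yb.
have w : wp A (cpair (fcode (fun=> pr1 v)) (fcode (fun=> pr1 d))) d
    (PAnd (PEq Q A y (rn b)) (SMaps Q A f (rn a) y)) by apply: wp_pair; apply: wp_cst.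
exact: inh_wp (wp_mapsI (wp_in_eql (wp_opn_cong (wp_refl Q A (rn a) d) (wp_fst w))
  (wp_mapsE (wp_snd w)))).
Qed.

Lemma maps_real A f x y : inh (SRealfun Q A f) -> inh (SMaps Q A f x y) -> exists a b,
  [/\ reg a, reg b, inh (PEq Q A x (rn a)), inh (PEq Q A y (rn b)) & inh (SMaps Q A f (rn a) (rn b))].
Proof.
move=> [e [_ [h2 _]]] [d hd]; have [i hi] := inh_wp (wp_mapsE (wp_here A hd)).
have [v _ hv] := h2 (opn x y) i hi.
have /inh_ex[x' /inh_ex[y' /inh_and[[r1 hr1] /inh_and[[r2 hr2] [o ho]]]]] := inhI hv.
have [t1 h1] := real01_extract Q; have [t2 h2'] := real11_extract Q.
have [a [ra _ [u _ [_ hu]]]] := h1 A x' r1 hr1; have [b [rb _ [w _ [_ hw]]]] := h2' A y' r2 hr2.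
have [q _ [q1 q2]] := wp_opn_inj (wp_opairE (wp_here A ho)).
have W : wp A (cpair (cpair (fcode (fun=> pr0 q)) (fcode (fun=> pr1 u)))
    (cpair (fcode (fun=> pr1 q)) (fcode (fun=> pr1 w)))) d
    (PAnd (PAnd (PEq Q A x x') (PEq Q A x' (rn a))) (PAnd (PEq Q A y y') (PEq Q A y' (rn b)))).
  by apply: wp_pair; apply: wp_pair; apply: wp_cst.
have xa := wp_trans (wp_fst (wp_fst W)) (wp_snd (wp_fst W)).
have yb := wp_trans (wp_fst (wp_snd W)) (wp_snd (wp_snd W)).
exists a, b; split=> //; [exact: inh_wp xa|exact: inh_wp yb|].
exact: inh_wp (wp_mapsI (wp_in_eql (wp_opn_cong xa yb) (wp_mapsE (wp_here A hd)))).
Qed.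

Lemma rclose_intro A m a a' : (exists c, forall i, c <= i -> (`|rq (a i) - rq (a' i)| <= e2 m.+1)%R) ->
  inh (SRclose Q A (Urel m) (SRvar Q A (rn a)) (SRvar Q A (rn a'))).
Proof.
move=> [c hc]; have lt i : c <= i -> (`|rq (a i) - rq (a' i)| + e2 m.+2 < e2 m)%R.
  by move=> /hc; rewrite [e2 m]e2S [e2 m.+1]e2S; have := e2_gt0 m.+2; lra.
apply/inh_and; split.
  have [t ht] := rlt_prog Q (ok_rvar Q cont_pr0) (ok_radd (ok_rvar Q cont_pr1) (ok_rcst (qpos_q2N m))) m.+2 c.
  have := ht A (bp a a'); rewrite !(pr0_bp, pr1_bp) => H; apply: inh_wp (H _) => i ci.
  rewrite oq_radd /oq !(pr0_bp, pr1_bp) -!/(rq _) qv_q2N; have := lt i ci.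
  by have := ler_norm (rq (a i) - rq (a' i))%R; lra.
have [t ht] := rlt_prog Q (ok_rvar Q cont_pr1) (ok_radd (ok_rvar Q cont_pr0) (ok_rcst (qpos_q2N m))) m.+2 c.
have := ht A (bp a a'); rewrite !(pr0_bp, pr1_bp) => H; apply: inh_wp (H _) => i ci.
rewrite oq_radd /oq !(pr0_bp, pr1_bp) -!/(rq _) qv_q2N; have := lt i ci; rewrite distrC.
by have := ler_norm (rq (a' i) - rq (a i))%R; lra.
Qed.

Definition sg (s : bool) (b : baire) : Prop :=
  exists k, (if s then e2 k < rq (b k) else rq (b k) < - e2 k)%R.

Lemma sg_excl b s : reg b -> sg s b -> ~ sg (~~ s) b.
Proof.
have key k l : reg b -> (e2 k < rq (b k))%R -> (rq (b l) < - e2 l)%R -> False.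
  move=> rb h1 h2; case: (leqP k l) => kl; [have := rb _ _ kl|have := rb _ _ (ltnW kl)];
    have := e2_gt0 k; have := e2_gt0 l; rewrite ltr_norml => ? ? /andP[? ?]; lra.
by move=> rb; case: s => -[k hk] [l hl]; [apply: (key k l)|apply: (key l k)].
Qed.

Lemma sg_bound s b : reg b -> sg s b -> exists d k, (0 < d)%R /\ forall i, k <= i ->
  (if s then d <= rq (b i) else rq (b i) <= - d)%R.
Proof.
move=> rb [k]; case: s => hk.
  exists (rq (b k) - e2 k)%R, k; split; first lra.
  by move=> i ki; have := rb _ _ ki; rewrite ltr_norml => /andP[? ?]; lra.
exists (- rq (b k) - e2 k)%R, k; split; first lra.
by move=> i ki; have := rb _ _ ki; rewrite ltr_norml => /andP[? ?]; lra.
Qed.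

(** Continuity is at hand only as a realized statement about names; it is used at a precision below
    [d / 8], where [d] bounds the value away from 0. *)
Lemma sg_near A f a b s : inh (SContinuous Q A f) -> reg b -> inh (SMaps Q A f (rn a) (rn b)) ->
  sg s b -> exists m, forall a' b', reg b' -> inh (SMaps Q A f (rn a') (rn b')) ->
    (exists c, forall i, c <= i -> (`|rq (a i) - rq (a' i)| <= e2 m.+1)%R) -> sg s b'.
Proof.
move=> hc rb hm /(sg_bound rb)[d [k0 [d0 hd]]].
have [k hk] : exists k, (e2 k < d / 8)%R by apply: e2_small; lra.
have /inh_exN[m hM] := inh_allN k (inh_imp (inh_all (rn b) (inh_all (rn a) hc)) hm).
exists m => a' b' rb' hm' cl.
have h : inh (SRclose Q A (Urel k) (SRvar Q A (rn b)) (SRvar Q A (rn b'))).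
  apply: inh_imp (inh_all (rn b') (inh_all (rn a') hM)) _.
  by apply/inh_and; split=> //; apply: rclose_intro.
pose i := maxn k0 k; have := rclose_rn rb rb' (inh_refl A (rn b)) (inh_refl A (rn b')) h i.
have := hd i (leq_maxl _ _); have := e2_le (leq_maxr k0 k); rewrite -/i ler_norml.
by case: s hd => _ ? ? /andP[? ?]; exists i; lra.
Qed.

Lemma req_q A x a (u : qexp) : qpos u -> reg a -> inh (PEq Q A x (rn a)) ->
  (forall c, sem Q A (req (rvar 0) (rcst u) 1) (upd (fun=> Urel 0) 0 c) =
     SReq Q A (SRvar Q A c) (SRcst (liftq u))) ->
  inh (SReq Q A (SRvar Q A x) (SRcst (liftq u))) -> forall n, (`|rq (a n) - qv u| <= e2 n)%R.
Proof.
move=> pu ra [e he] E [e' he'] n; have [l hl] := leibniz_prog Q (req (rvar 0) (rcst u) 1) 0.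
have h : inh (SReq Q A (SRvar Q A (rn a)) (SRcst (liftq u))).
  rewrite -E; apply: inh_wp (hl A _ x _ (bp e e') _).
  by split; rewrite ?pr0_bp ?pr1_bp ?E.
have H := @req_inh Q _ _ _ (ok_rvar Q cont_id) _ _ _ (ok_rcst pu) A a h.
have : forall k, (rq (a n) - qv u <= e2 n + e2 k /\ - e2 n <= rq (a n) - qv u + e2 k)%R.
  move=> k; have [c hc] := H k; have := hc (maxn c n) (leq_maxl _ _).
  rewrite /oq -/(rq _); have := ra _ _ (leq_maxr c n).
  by rewrite !ltr_norml => /andP[? ?] /andP[? ?]; split; lra.
by move=> K; rewrite ler_norml; apply/andP; split; apply: le_e2 => k; have [] := K k.
Qed.

Lemma value_at_real A f (u : qexp) y b : qpos u ->
  (forall c, sem Q A (req (rvar 0) (rcst u) 1) (upd (fun=> Urel 0) 0 c) =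
     SReq Q A (SRvar Q A c) (SRcst (liftq u))) ->
  inh (SRealfun Q A f) -> inh (SValue_at Q A f (liftq u) y) -> reg b ->
  inh (SMaps Q A f (rn (rconst (qv u))) (rn b)) ->
  exists b', [/\ reg b', inh (PEq Q A y (rn b')) & forall n, (`|rq (b n) - rq (b' n)| <= e2 n + e2 n)%R].
Proof.
move=> pu E hf /inh_ex[x /inh_and[hx hm]] rb hb.
have [a [b' [ra rb' xa yb ab]]] := maps_real hf hm; exists b'; split=> //.
have near := req_q pu ra xa E hx.
have [t ht] := req_prog Q (ok_rvar Q (cont_cst (rconst (qv u)))) (ok_rvar Q cont_id) 1.
have hq : inh (SReq Q A (SRvar Q A (rn (rconst (qv u)))) (SRvar Q A (rn a))).
  apply: inh_wp (ht A a _) => k n kn; rewrite /oq -!/(rq _) rcK distrC.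
  apply: le_lt_trans (near n) _; have := e2_le kn; rewrite addn1 [e2 k]e2S.
  by have := e2_gt0 k.+1; lra.
apply: (req_rn rb rb' (inh_refl A (rn b)) (inh_refl A (rn b'))).
case: hf => e [_ [_ [_ h4]]]; have h4' := inhI h4.
apply: inh_imp (inh_all (rn b') (inh_all (rn a) (inh_all (rn b) (inh_all (rn (rconst (qv u))) h4')))) _.
by do 2 (apply/inh_and; split=> //).
Qed.

Lemma rlt0_sg A y b b' : reg b -> inh (PEq Q A y (rn b')) ->
  (forall n, (`|rq (b n) - rq (b' n)| <= e2 n + e2 n)%R) ->
  (inh (SRlt Q A (SRvar Q A y) (SRcst nq0)) -> sg false b) /\
  (inh (SRlt Q A (SRcst nq0) (SRvar Q A y)) -> sg true b).
Proof.
move=> rb [e he] near; split=> -[e' he'].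
  pose G := rlt (rvar 0) (rcst q0) 1; have [l hl] := leibniz_prog Q G 0.
  have E c : sem Q A G (upd (fun=> Urel 0) 0 c) = SRlt Q A (SRvar Q A c) (SRcst nq0) by [].
  have h : inh (SRlt Q A (SRvar Q A (rn b')) (SRcst nq0)).
    rewrite -E; apply: inh_wp (hl A _ y _ (bp e e') _).
    by split; rewrite ?pr0_bp ?pr1_bp ?E.
  have [k [c H]] := @rlt_inh Q _ _ _ (ok_rvar Q cont_id) _ _ _ (@ok_rcst q0 isT) A b' h.
  pose i := maxn c k.+2; exists i; have := H i (leq_maxl _ _); rewrite /oq -/(rq _) qv_q0.
  have := near i; have := e2_le (leq_maxr c k.+2); rewrite -/i ler_norml [e2 k]e2S [e2 k.+1]e2S.
  by have := e2_gt0 i => ? ? /andP[? ?] ?; lra.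
pose G := rlt (rcst q0) (rvar 0) 1; have [l hl] := leibniz_prog Q G 0.
have E c : sem Q A G (upd (fun=> Urel 0) 0 c) = SRlt Q A (SRcst nq0) (SRvar Q A c) by [].
have h : inh (SRlt Q A (SRcst nq0) (SRvar Q A (rn b'))).
  rewrite -E; apply: inh_wp (hl A _ y _ (bp e e') _).
  by split; rewrite ?pr0_bp ?pr1_bp ?E.
have [k [c H]] := @rlt_inh Q _ _ _ (@ok_rcst q0 isT) _ _ _ (ok_rvar Q cont_id) A b' h.
pose i := maxn c k.+2; exists i; have := H i (leq_maxl _ _); rewrite /oq -/(rq _) qv_q0.
have := near i; have := e2_le (leq_maxr c k.+2); rewrite -/i ler_norml [e2 k]e2S [e2 k.+1]e2S.
by have := e2_gt0 i => ? ? /andP[? ?] ?; lra.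
Qed.

Definition vcode : baire := sval value_prog.

(** [w] pairs the advice with a realizer of the function. Running that realizer at a rational may
    produce several sequences, all of them values at [q]. *)
Definition outcome (w : baire) (q : rat) (b : baire) : Prop := exists2 u,
  kapp vcode (bp (pr0 w) (bp (rconst q) (pr1 w))) u & jv (pr0 w) u b.

Definition realizes_fun (w : baire) : Prop := exists f, SRealfun Q (pr0 w) f (pr1 w).

Lemma outcome_dom w f (q : rat) : SRealfun Q (pr0 w) f (pr1 w) -> (0 <= q <= 1)%R ->
  exists u, [/\ kapp vcode (bp (pr0 w) (bp (rconst q) (pr1 w))) u, jdom Q (pr0 w) u
    & forall b, jv (pr0 w) u b -> reg b /\ inh (SMaps Q (pr0 w) f (rn (rconst q)) (rn b))].
Proof.
move=> hf q01; have [u vu [du hu]] := proj2_sig value_prog _ _ _ _ hf (@reg_rconst q) (within_rconst q01).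
by exists u.
Qed.

(* A sign of the value at q that is already forced by the first l entries of w. *)
Definition cert (s : bool) (w : baire) (q : rat) (l : nat) : Prop := forall w' b,
  agree l w w' -> realizes_fun w' -> outcome w' q b -> sg s b.

Lemma cert_agree s w w' q l : agree l w w' -> cert s w q l -> cert s w' q l.
Proof. by move=> ww h w2 b ww2; apply: h; apply: agree_trans ww2. Qed.

Lemma cert_le s w q l l' : l <= l' -> cert s w q l -> cert s w q l'.
Proof. by move=> ll h w' b ww; apply: h; apply: agree_le ww. Qed.

(** [outcomes] of the given sign are covered by the strings that already show it, and upper
    semicontinuity reduces this to finitely many entries of [w]. *)
Lemma cert_ex s w (q : rat) : (0 <= q <= 1)%R -> realizes_fun w ->
  (forall b, outcome w q b -> sg s b) -> exists l, cert s w q l.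
Proof.
move=> q01 [f hf] hs; have [u [vu du _]] := outcome_dom hf q01.
pose S (t : seq nat) := exists2 k, k < size t &
  (if s then e2 k < rq (nth 0 t k) else rq (nth 0 t k) < - e2 k)%R.
have [z zj|L [k [LS hk]]] := jop_usco du (S := S).
  have [k hk] := hs z (ex_intro2 _ _ u vu zj).
  by exists k.+1, k; rewrite ?size_mkseq // nth_mkseq.
have [l hl] := kapp_agree vu k; exists (maxn k l).*2 => w' b ww [f' hf'] [u' vu' bj].
have ag j : j <= maxn k l -> agree j (pr0 w) (pr0 w') /\ agree j (pr1 w) (pr1 w').
  by move=> jm; split=> i ij; rewrite /pr0 /pr1 ww //; lia.
have [ak _] := ag k (leq_maxl _ _); have [a0 a1] := ag l (leq_maxr _ _).
have uu : agree k u u'.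
  by apply: (hl vcode) vu' => //; apply: bp_agree => //; apply: bp_agree.
have [u2 [vu2 du2 _]] := outcome_dom hf' q01; rewrite (kapp_fun vu2 vu') in du2.
have [m mL] := hk _ _ ak uu du2 b bj; have [j] := LS _ mL.
by rewrite size_mkseq => jm; rewrite nth_mkseq // => h; exists j.
Qed.

End ValueProgram.

(** * Bisection by certified signs *)

Section Bisection.

Local Open Scope ring_scope.

Definition raise (P : rat -> bool) (r l : rat) (s : seq rat) : rat :=
  foldl (fun l q => if [&& l < q, q < r & P q] then q else l) l s.
Definition lower (P : rat -> bool) (l r : rat) (s : seq rat) : rat :=
  foldl (fun r q => if [&& l < q, q < r & P q] then q else r) r s.

Lemma raiseP P r s l : l < r -> [/\ l <= raise P r l s, raise P r l s < r,
  raise P r l s = l \/ P (raise P r l s)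
  & forall q, q \in s -> raise P r l s < q -> q < r -> ~~ P q].
Proof.
elim: s l => [|q s IH] l lr; first by split=> //; left.
rewrite /raise /= -/(raise P r _ s); case: ifP => [/and3P[lq qr Pq]|no].
  have [h1 h2 h3 h4] := IH q qr; split=> //; first by apply: le_trans h1; apply: ltW.
    by case: h3 => [->|]; right.
  by move=> q'; rewrite inE => /orP[/eqP ->|/h4 //]; rewrite ltNge h1.
have [h1 h2 h3 h4] := IH l lr; split=> // q'; rewrite inE => /orP[/eqP ->|/h4 //] g1 g2.
by apply/negP => Pq; move/negP: no; apply; rewrite (le_lt_trans h1 g1) g2.
Qed.

Lemma lowerP P l s r : l < r -> [/\ lower P l r s <= r, l < lower P l r s,
  lower P l r s = r \/ P (lower P l r s)
  & forall q, q \in s -> l < q -> q < lower P l r s -> ~~ P q].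
Proof.
elim: s r => [|q s IH] r lr; first by split=> //; left.
rewrite /lower /= -/(lower P l _ s); case: ifP => [/and3P[lq qr Pq]|no].
  have [h1 h2 h3 h4] := IH q lq; split=> //; first by apply: le_trans h1 _; apply: ltW.
    by case: h3 => [->|]; right.
  by move=> q'; rewrite inE => /orP[/eqP ->|/h4 //]; rewrite [q < _]ltNge h1.
have [h1 h2 h3 h4] := IH r lr; split=> // q'; rewrite inE => /orP[/eqP ->|/h4 //] g1 g2.
by apply/negP => Pq; move/negP: no; apply; rewrite g1 (lt_le_trans g2 h1).
Qed.

Definition dy (n : nat) : seq rat := [seq i%:R * e2 n | i <- iota 0 (2 ^ n)].

Lemma dy_mem j N n : (N <= n)%N -> j%:R * e2 N < 1 -> j%:R * e2 N \in dy n.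
Proof.
move=> Nn; have -> : j%:R * e2 N = (j * 2 ^ (n - N))%:R * e2 n.
  by rewrite -{2}(subnKC Nn) e2D natrM -!mulrA [(2 ^ _)%:R * _]mulrCA [_ * e2 (n - N)]mulrC e2_nat mulr1.
move=> lt; apply: map_f; rewrite mem_iota /= add0n ltnNge; apply/negP => h.
have : (2 ^ n)%:R * e2 n <= (j * 2 ^ (n - N))%:R * e2 n by rewrite ler_pM2r ?e2_gt0 // ler_nat.
by rewrite mulrC e2_nat leNgt lt.
Qed.

Variable Q : baire -> Prop.
Variable o : bool.

(** The left end moves to dyadics with the sign [o], the sign at 0, and the right end to those with
    the opposite sign. Stage [m] consults the first [m] entries of [w] only, so the ends are
    continuous in [w]. The limit may be an interval instead of a point. *)
Fixpoint lr (w : baire) (n : nat) : rat * rat :=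
  if n is m.+1 then
    let l := raise (fun q => `[< cert Q o w q m >]) (lr w m).2 (lr w m).1 (dy m) in
    (l, lower (fun q => `[< cert Q (~~ o) w q m >]) l (lr w m).2 (dy m))
  else (0, 1).

Lemma lr_step w n : (lr w n).1 < (lr w n).2 ->
  [/\ (lr w n).1 <= (lr w n.+1).1, (lr w n.+1).1 < (lr w n.+1).2 & (lr w n.+1).2 <= (lr w n).2].
Proof.
move=> h /=; have [h1 h2 _ _] := raiseP (fun q => `[< cert Q o w q n >]) (dy n) h.
by have [h3 h4 _ _] := lowerP (fun q => `[< cert Q (~~ o) w q n >]) (dy n) h2.
Qed.

Lemma lr_lt w n : (lr w n).1 < (lr w n).2.
Proof. by elim: n => // n IH; have [] := lr_step IH. Qed.

Lemma lr_nest w n j : (lr w n).1 <= (lr w (n + j)%N).1 /\ (lr w (n + j)%N).2 <= (lr w n).2.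
Proof.
elim: j => [|j [h1 h2]]; first by rewrite addn0.
by rewrite addnS; have [h3 _ h4] := lr_step (lr_lt w (n + j)); split; [apply: le_trans h3|apply: le_trans h2].
Qed.

Lemma lr_le w n m : (n <= m)%N -> (lr w n).1 <= (lr w m).1 /\ (lr w m).2 <= (lr w n).2.
Proof. by move=> /subnKC <-; apply: lr_nest. Qed.

Lemma lr_cross w n m : (lr w n).1 < (lr w m).2.
Proof.
case: (leqP n m) => h; first by have [h1 _] := lr_le w h; apply: le_lt_trans h1 (lr_lt w m).
by have [_ h1] := lr_le w (ltnW h); apply: lt_le_trans (lr_lt w n) h1.
Qed.

Lemma lr01 w n : 0 <= (lr w n).1 /\ (lr w n).2 <= 1.
Proof. by have := lr_le w (leq0n n). Qed.

Lemma lr_left w n : (lr w n).1 = 0 \/ exists m, cert Q o w (lr w n).1 m.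
Proof.
elim: n => [|n IH]; first by left.
have [_ _ + _] := raiseP (fun q => `[< cert Q o w q n >]) (dy n) (lr_lt w n).
by rewrite -[raise _ _ _ _]/((lr w n.+1).1) => -[->|/asboolP h] //; right; exists n.
Qed.

Lemma lr_right w n : (lr w n).2 = 1 \/ exists m, cert Q (~~ o) w (lr w n).2 m.
Proof.
elim: n => [|n IH]; first by left.
have [_ h2 _ _] := raiseP (fun q => `[< cert Q o w q n >]) (dy n) (lr_lt w n).
have [_ _ + _] := lowerP (fun q => `[< cert Q (~~ o) w q n >]) (dy n) h2.
by rewrite -[lower _ _ _ _]/((lr w n.+1).2) => -[->|/asboolP h] //; right; exists n.
Qed.

Lemma lr_gap s w n q : q \in dy n -> (lr w n.+1).1 < q -> q < (lr w n.+1).2 -> ~ cert Q s w q n.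
Proof.
move=> qd lq qr; have [_ _ rr] := lr_step (lr_lt w n).
have [_ h2 _ h4] := raiseP (fun q => `[< cert Q o w q n >]) (dy n) (lr_lt w n).
have [_ _ _ h4'] := lowerP (fun q => `[< cert Q (~~ o) w q n >]) (dy n) h2.
have n1 : ~ cert Q o w q n.
  by have := h4 q qd lq (lt_le_trans qr rr); move=> /asboolP.
have n2 : ~ cert Q (~~ o) w q n by have := h4' q qd lq qr; move=> /asboolP.
by case: s o n1 n2 => -[].
Qed.

Lemma lr_agree w w' n : agree n w w' -> lr w' n = lr w n.
Proof.
elim: n => // n IH ww; have wn : agree n w w' by apply: agree_le ww.
have E s : (fun q => `[< cert Q s w' q n >]) = (fun q => `[< cert Q s w q n >]).
  apply: funext => q; apply: asbool_equiv_eq; split; apply: cert_agree => //; exact: agree_sym.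
by rewrite /= IH // !E.
Qed.

(** A string of bits survives if its dyadic interval meets the interval of the bisection at the same
    stage. Both inequalities are monotone in the partial sum, whence convexity. *)
Definition ivt_inst (w : baire) : baire := fun c =>
  let s := decode c in let n := size s in
  if [&& all (leq^~ 1%N) s, (dsum (nth 0%N s) n)%:R * e2 n <= (lr w n).2
       & (lr w n).1 <= (dsum (nth 0%N s) n).+1%:R * e2 n] then 0%N else 1%N.

Lemma cont_ivt_inst : cont ivt_inst.
Proof.
apply: (@cont_modulus _ (fun c => size (decode c))) => c w w' ww.
by rewrite /ivt_inst (lr_agree ww).
Qed.

Lemma kset_ivt_inst w z : kset (ivt_inst w) z <-> bits z /\
  forall n, (dsum z n)%:R * e2 n <= (lr w n).2 /\ (lr w n).1 <= (dsum z n).+1%:R * e2 n.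
Proof.
have E n : dsum (nth 0%N (mkseq z n)) n = dsum z n.
  by apply: dsum_agree => i hi; rewrite nth_mkseq.
split=> [zk|[zb h] n].
  split=> n.
    have [_] := zk n.+1; rewrite /ivt_inst CodeSeq.codeK; case: ifP => // /and3P[/allP b _ _] _.
    by apply: b; apply: map_f; rewrite mem_iota /=.
  have [_] := zk n; rewrite /ivt_inst CodeSeq.codeK size_mkseq E.
  by case: ifP => // /and3P[_ h1 h2].
have [h1 h2] := h n; split; first by apply: leq_trans (zb n) _.
rewrite /ivt_inst CodeSeq.codeK size_mkseq E h1 h2 !andbT; case: ifP => // /negP[].
by apply/allP => x /mapP[i _ ->]; apply: zb.
Qed.

Lemma ivt_inst_QIVT w : QIVT (ivt_inst w).
Proof.
split=> [z /kset_ivt_inst[]//|z v z' /kset_ivt_inst[_ h] /kset_ivt_inst[_ h'] vb le].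
apply/kset_ivt_inst; split=> // n; have /andP[l1 l2] := le n.
have [_ g1] := h n; have [g2 _] := h' n; split.
  by apply: le_trans g2; rewrite ler_pM2r ?e2_gt0 // ler_nat.
by apply: le_trans g1 _; rewrite ler_pM2r ?e2_gt0 // ler_nat.
Qed.

(** The member is the greedy expansion of the infimum of the right ends. *)
Lemma ivt_inst_ex w : exists z, kset (ivt_inst w) z.
Proof.
pose below q := forall m, q <= (lr w m).2.
have b0 : below 0 by move=> m; have [h _] := lr01 w m; apply: le_trans h (ltW (lr_lt w m)).
exists (greedy below); apply/kset_ivt_inst; split; first exact: greedy_bit.
move=> n; rewrite dsum_greedy; have [h1 h2] := gstateP b0 n; split; first exact: h1.
case: h2 => [/existsNP[m /negP]|->].
  by rewrite -ltNge => h; apply: le_trans (ltW (lr_cross w n m)) (ltW h).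
by apply: le_trans (ltW (lr_lt w n)) _; have [] := lr01 w n.
Qed.

Definition breal (z : baire) : baire := fun n => rc ((dsum z n)%:R * e2 n).

Lemma bits_dsum z n j : bits z -> (dsum z n)%:R * e2 n <= (dsum z (n + j)%N)%:R * e2 (n + j)%N /\
  (dsum z (n + j)%N).+1%:R * e2 (n + j)%N <= (dsum z n).+1%:R * e2 n.
Proof.
move=> zb; rewrite e2_scale e2_scale'; elim: j => [|j [h1 h2]]; first by rewrite addn0 !muln1.
rewrite (addnS n j) expnS /=; have := zb (n + j)%N; move: h1 h2.
set k := (2 ^ j)%N; move: (dsum z (n + j)) (dsum z n) => a b h1 h2 zj.
have e1 : (b * (2 * k) = (b * k).*2)%N by lia.
have e3 : (b.+1 * (2 * k) = (b.+1 * k).*2)%N by lia.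
by rewrite e1 e3; lia.
Qed.

Lemma breal_bounds z n m : bits z -> (n <= m)%N ->
  (dsum z n)%:R * e2 n <= rq (breal z m) /\ rq (breal z m) + e2 m <= (dsum z n)%:R * e2 n + e2 n.
Proof.
move=> zb /subnKC <-; rewrite rcK; have [h1 h2] := bits_dsum n (m - n)%N zb; split=> //.
have S (s k : nat) : s.+1%:R * e2 k = s%:R * e2 k + e2 k by rewrite -addn1 natrD; ring.
by rewrite !S in h2.
Qed.

Lemma reg_breal z : bits z -> reg (breal z).
Proof.
move=> zb n m nm; have [h1 h2] := breal_bounds zb nm; rewrite {1}/breal rcK ltr_norml.
by have := e2_gt0 m; have := e2_gt0 n => ? ?; apply/andP; split; lra.
Qed.

Lemma within_breal z : bits z -> within q0 q1 (breal z).
Proof.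
move=> zb n; rewrite qv_q0 qv_q1; have := breal_bounds zb (leq0n n).
by rewrite /= mul0r [e2 0]expr0; have := e2_gt0 n => ? [? ?]; lra.
Qed.

Lemma cont_breal : cont breal.
Proof. by apply: (@cont_modulus _ id) => n z z' /dsum_agree e; rewrite /breal e. Qed.

(** If the value at the chosen point had a sign, so would all values within [2^-(m+1)]. Consider the
    side of the end that carries the opposite sign. Either that end comes this close, a
    contradiction; or a dyadic point this close lies inside all intervals, and its sign gets
    certified, which [lr_gap] forbids. *)
Lemma ivt_solution w f z b : SRealfun Q (pr0 w) f (pr1 w) -> inh (SContinuous Q (pr0 w) f) ->
  (forall c, reg c -> inh (SMaps Q (pr0 w) f (rn (rconst 0)) (rn c)) -> sg o c) ->
  (forall c, reg c -> inh (SMaps Q (pr0 w) f (rn (rconst 1)) (rn c)) -> sg (~~ o) c) ->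
  kset (ivt_inst w) z -> reg b -> inh (SMaps Q (pr0 w) f (rn (breal z)) (rn b)) ->
  forall n, `|rq (b n)| <= e2 n.
Proof.
move=> hf hc end0 end1 /kset_ivt_inst[zb zk] rb hb.
suff no s : ~ sg s b.
  move=> n; rewrite leNgt; apply/negP; rewrite ltr_normr => /orP[h|h].
    by apply: (no true); exists n.
  by apply: (no false); exists n; rewrite ltrNr.
move=> /(sg_near hc rb hb)[m near]; pose N := m.+2.
have nearq (q : rat) : 0 <= q <= 1 -> (exists c, forall i, (c <= i)%N -> `|rq (breal z i) - q| <= e2 m.+1) ->
    (exists c, outcome Q w q c) /\ forall c, outcome Q w q c -> reg c /\ sg s c.
  move=> q01 [c hq]; have [u [vu du hu]] := outcome_dom hf q01; split.
    by have [d jd] := jdom_ex du; exists d, u.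
  move=> d [u' vu' jd]; rewrite (kapp_fun vu' vu) in jd; have [rd md] := hu d jd; split=> //.
  by apply: (near (rconst q)) => //; exists c => i ci; rewrite [rq (rconst q i)]rcK; apply: hq.
have bad (q : rat) l : 0 <= q <= 1 ->
    (exists c, forall i, (c <= i)%N -> `|rq (breal z i) - q| <= e2 m.+1) -> cert Q (~~ s) w q l -> False.
  move=> q01 hq ct; have [[c oc] hs] := nearq q q01 hq; have [rcc sc] := hs c oc.
  by apply: (sg_excl rcc sc); apply: (ct w) oc => //; exists f.
have dyadic j : (forall n, (lr w n).1 < j%:R * e2 N < (lr w n).2) ->
    (exists c, forall i, (c <= i)%N -> `|rq (breal z i) - j%:R * e2 N| <= e2 m.+1) -> False.
  move=> btw hq; have /andP[q0' q1'] := btw 0%N.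
  have q01 : 0 <= j%:R * e2 N <= 1 by rewrite (ltW q0') (ltW q1').
  have [_ hs] := nearq _ q01 hq.
  have [l cl] := cert_ex q01 (ex_intro _ f hf) (fun c oc => (hs c oc).2).
  pose n := maxn l N; have /andP[b1 b2] := btw n.+1.
  apply: (lr_gap (s := s) (w := w) (n := n) (q := j%:R * e2 N)) => //.
    by apply: dy_mem; rewrite ?leq_maxr.
  by apply: cert_le cl; rewrite leq_maxl.
have E : e2 m.+1 = e2 N + e2 N by rewrite -e2S.
have eN := e2_gt0 N; pose x : rat := (dsum z N)%:R * e2 N.
have xb i : (N <= i)%N -> x <= rq (breal z i) /\ rq (breal z i) <= x + e2 N.
  by move=> Ni; have [h1 h2] := breal_bounds zb Ni; have := e2_gt0 i; split; rewrite /x; lra.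
have zr n i : (n <= i)%N -> rq (breal z i) <= (lr w n).2.
  by move=> ni; rewrite rcK; have [h _] := zk i; have [_ h2] := lr_le w ni; apply: le_trans h h2.
have zl n i : (n <= i)%N -> (lr w n).1 <= rq (breal z i) + e2 i.
  move=> ni; rewrite rcK; have [_ h] := zk i; have [h2 _] := lr_le w ni; apply: le_trans h2 _.
  by move: h; rewrite -addn1 natrD mulrDl mul1r.
have lx n : (lr w n).1 <= x + e2 N.
  have h1 := zl n (maxn n N) (leq_maxl _ _); apply: le_trans h1 _.
  by have [_] := breal_bounds zb (leq_maxr n N).
have [sE|sE] : s = o \/ s = ~~ o by move: (s) (o) => [] []; [left|right|right|left].
  (* The point lies between [x] and [x + e2 N]. On the right two grid steps from [x] are taken, to
     get past [x + e2 N]; on the left one step is enough. *)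
  have qE : (dsum z N + 2)%:R * e2 N = x + e2 N + e2 N by rewrite natrD mulrDl /x; ring.
  case: (EM (exists n, (lr w n).2 <= x + e2 N + e2 N)) => [[n hn]|/forallNP no].
    have cl : exists c, forall i, (c <= i)%N -> `|rq (breal z i) - (lr w n).2| <= e2 m.+1.
      exists (maxn n N) => i ci; have [x1 x2] := xb i (leq_trans (leq_maxr _ _) ci).
      have := zr n i (leq_trans (leq_maxl _ _) ci); rewrite E ler_norml => ?.
      by apply/andP; split; lra.
    have r01 : 0 <= (lr w n).2 <= 1.
      by have [h1 h2] := lr01 w n; rewrite h2 andbT; apply: le_trans h1 (ltW (lr_lt w n)).
    case: (lr_right w n) => [r1|[l ct]]; last by apply: (bad _ l r01 cl); rewrite sE.
    have [[c oc] hs] := nearq _ r01 cl; have [rcc sc] := hs c oc.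
    apply: (sg_excl rcc sc); rewrite sE; apply: end1 => //.
    have [u [vu du hu]] := outcome_dom hf r01; case: oc => u' vu' jc.
    by rewrite (kapp_fun vu' vu) in jc; have [_] := hu c jc; rewrite r1.
  apply: (dyadic (dsum z N + 2)%N); rewrite qE.
    move=> n; have := lx n; have /negP := no n; rewrite -ltNge => h1 h2.
    by apply/andP; split; lra.
  exists N => i Ni; have [x1 x2] := xb i Ni; rewrite E ler_norml; apply/andP; split; lra.
case: (EM (exists n, x - e2 N <= (lr w n).1)) => [[n hn]|/forallNP no].
  have cl : exists c, forall i, (c <= i)%N -> `|rq (breal z i) - (lr w n).1| <= e2 m.+1.
    exists (maxn n N) => i ci; have [x1 x2] := xb i (leq_trans (leq_maxr _ _) ci).
    have := zl n i (leq_trans (leq_maxl _ _) ci); have := e2_le (leq_trans (leq_maxr n N) ci).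
    by rewrite E ler_norml => ? ?; apply/andP; split; lra.
  have r01 : 0 <= (lr w n).1 <= 1.
    by have [h1 h2] := lr01 w n; rewrite h1 /=; apply: le_trans (ltW (lr_lt w n)) h2.
  case: (lr_left w n) => [r1|[l ct]]; last by apply: (bad _ l r01 cl); rewrite sE negbK.
  have [[c oc] hs] := nearq _ r01 cl; have [rcc sc] := hs c oc.
  apply: (sg_excl rcc sc); rewrite sE negbK; apply: end0 => //.
  have [u [vu du hu]] := outcome_dom hf r01; case: oc => u' vu' jc.
  by rewrite (kapp_fun vu' vu) in jc; have [_] := hu c jc; rewrite r1.
have xpos : 0 < x - e2 N by have /negP := no 0%N; rewrite -ltNge.
have s1 : (1 <= dsum z N)%N.
  by rewrite lt0n; apply/negP => /eqP h; move: xpos; rewrite /x h mul0r; lra.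
have qE : (dsum z N - 1)%:R * e2 N = x - e2 N by rewrite natrB // mulrBl mul1r.
apply: (dyadic (dsum z N - 1)%N); rewrite qE.
  move=> n; have /negP := no n; rewrite -ltNge => h1; rewrite h1 /=.
  have [x1 _] := xb (maxn n N) (leq_maxr _ _); have := zr n (maxn n N) (leq_maxl _ _); lra.
exists N => i Ni; have [x1 x2] := xb i Ni; rewrite E ler_norml; apply/andP; split; lra.
Qed.

End Bisection.

Lemma valid_IVT Q : (forall p, QIVT p -> Q p) -> valid Q IVT.
Proof.
move=> hQ; have [t1 h1] := @realin_prog Q q0 q1 isT isT; have [te he] := real11_extract Q.
have [tq hq] := req_prog Q (ok_rvar Q cont_id) (@ok_rcst q0 isT) 1.
pose G := req (rvar 0) (rcst q0) 1; have [l hl] := leibniz_prog Q G 0.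
(* Which end is negative is known only after a disjunction has been eliminated, so there is one
   program for each sign [o] at 0. *)
have [T hT] : {T | forall o A f e, SRealfun Q A f (pr0 e) -> inh (SContinuous Q A f) ->
    (forall c, reg c -> inh (SMaps Q A f (rn (rconst 0)) (rn c)) -> sg o c) ->
    (forall c, reg c -> inh (SMaps Q A f (rn (rconst 1)) (rn c)) -> sg (~~ o) c) ->
    wp A (T o) e (PEx Q A (fun x => PEx Q A (fun y => PAnd (SReal_in Q A nq0 nq1 x)
      (PAnd (SMaps Q A f x y) (SReq Q A (SRvar Q A y) (SRcst nq0))))))}.
  suff H o : {T | forall A f e, SRealfun Q A f (pr0 e) -> inh (SContinuous Q A f) ->
    (forall c, reg c -> inh (SMaps Q A f (rn (rconst 0)) (rn c)) -> sg o c) ->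
    (forall c, reg c -> inh (SMaps Q A f (rn (rconst 1)) (rn c)) -> sg (~~ o) c) ->
    wp A T e (PEx Q A (fun x => PEx Q A (fun y => PAnd (SReal_in Q A nq0 nq1 x)
      (PAnd (SMaps Q A f x y) (SReq Q A (SRvar Q A y) (SRcst nq0))))))}.
    by exists (fun o => sval (H o)) => o; apply: (proj2_sig (H o)).
  eexists=> A f e hf hc end0 end1; pose w := bp A (pr0 e).
  apply: (wp_mapj (P := kset (ivt_inst Q o w))).
    apply: (wp_oracle (x := w)); last 3 first.
    - exact: cont_ivt_inst.
    - by apply: hQ; apply: ivt_inst_QIVT.
    - exact: ivt_inst_ex.
    apply: (wp_bp (P := eq A) (Q := eq (pr0 e))) => [||_ _ <- <- //]; first exact: wp_advice.
    by apply: (wp_fun cont_pr0); apply: wp_here.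
  move=> z zk; have [zb _] := proj1 (kset_ivt_inst Q o w z) zk.
  apply: (@wp_mono _ _ _ (PEx Q A (fun y => PAnd (SReal_in Q A nq0 nq1 (rn (breal z)))
      (PAnd (SMaps Q A f (rn (breal z)) y) (SReq Q A (SRvar Q A y) (SRcst nq0))))));
    first by move=> v hv; exists (rn (breal z)).
  apply: (wp_let (P := SReal_in Q A nq0 nq1 (rn (breal z)))).
    apply: (wp_call (c := t1) (P := eq (breal z))); first by apply: (wp_fun cont_breal); apply: wp_var0.
    by move=> _ <-; apply: h1; [apply: reg_breal|apply: within_breal].
  move=> r hr; apply: (wp_mapj (P := fun d => exists y, PAnd (SReal_in Q A nqN1 nq1 y)
      (SMaps Q A f (rn (breal z)) y) d)).
    have [_ [_ [h3 _]]] := hf.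
    apply: (wp_app (P := SReal_in Q A nq0 nq1 (rn (breal z)))); last by apply: wp_var0.
    do 2 apply: wp_shift; apply: (wp_fun cont_pr0); apply: (wp_fun cont_pr1); apply: (wp_fun cont_pr1).
    by apply: (wp_fun cont_pr0); apply: wp_here; exact: (h3 (rn (breal z))).
  move=> d [y [hy hm]]; have [b [rb wb yb]] := he A y (pr0 d) hy.
  apply: (@wp_mono _ _ _ (PAnd (SReal_in Q A nq0 nq1 (rn (breal z)))
      (PAnd (SMaps Q A f (rn (breal z)) y) (SReq Q A (SRvar Q A y) (SRcst nq0)))));
    first by move=> v hv; exists y.
  apply: wp_pair; first by apply: wp_shift; apply: wp_var0.
  apply: wp_pair; first by apply: (wp_fun cont_pr1); apply: wp_var0.
  have E c : sem Q A G (upd (fun=> Urel 0) 0 c) = SReq Q A (SRvar Q A c) (SRcst nq0) by [].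
  apply: (wp_let (P := PAnd (eq b) (PEq Q A y (rn b)))).
    apply: (wp_call (c := te) (P := eq (pr0 d))); first by apply: (wp_fun cont_pr0); apply: wp_var0.
    by move=> _ <-; exact: yb.
  move=> u hu; rewrite -E; apply: (wp_call (c := l) (P := PAnd (PEq Q A (rn b) y)
      (sem Q A G (upd (fun=> Urel 0) 0 (rn b))))); last by move=> v; apply: hl.
  apply: wp_pair; first by apply: wp_sym; apply: wp_snd; whyp hu.
  rewrite E; apply: (wp_call (c := tq) (P := eq b)).
    by apply: (wp_fun cont_pr0); apply: wp_var0; case: hu.
  move=> _ <-; apply: hq => k n kn; rewrite /oq -/(rq _) qv_q0 subr0.
  have hb : inh (SMaps Q A f (rn (breal z)) (rn b)).
    have [v _ [_ hv]] := yb.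
    have W : wp A (cpair (fcode (fun=> pr1 v)) (fcode (fun=> pr1 d))) d
        (PAnd (PEq Q A y (rn b)) (SMaps Q A f (rn (breal z)) y)) by apply: wp_pair; apply: wp_cst.
    exact: inh_wp (wp_mapsI (wp_in_eql (wp_opn_cong (wp_refl Q A (rn (breal z)) d) (wp_fst W))
      (wp_mapsE (wp_snd W)))).
  have sol := @ivt_solution Q o w f z b; rewrite /w pr0_bp pr1_bp in sol.
  apply: le_lt_trans (sol hf hc end0 end1 zk rb hb n) _.
  by have := e2_le kn; rewrite addn1 [e2 k]e2S; have := e2_gt0 k.+1; lra.
eexists=> A rho env; rewrite sem_IVT; wall=> f; apply: wp_lam => e [hf [hc hs]].
have hf' : inh (SRealfun Q A f) by exists (pr0 e).
have hc' : inh (SContinuous Q A f) by exists (pr0 (pr1 e)).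
apply: wp_exE; last exact: closed_Jp.
  by apply: (wp_fun cont_pr1); apply: (wp_fun cont_pr1); apply: wp_var0; exact: hs.
move=> y d hd; apply: wp_exE; [by whyp hd| |exact: closed_Jp].
move=> y' d' [v0 [v1 hor]].
have B0 c : reg c -> inh (SMaps Q A f (rn (rconst 0)) (rn c)) -> exists b',
    [/\ reg b', inh (PEq Q A y (rn b')) & forall n, (`|rq (c n) - rq (b' n)| <= e2 n + e2 n)%R].
  move=> rcc mc; apply: (@value_at_real Q A f q0) => //.
  exact: inhI v0.
have B1 c : reg c -> inh (SMaps Q A f (rn (rconst 1)) (rn c)) -> exists b',
    [/\ reg b', inh (PEq Q A y' (rn b')) & forall n, (`|rq (c n) - rq (b' n)| <= e2 n + e2 n)%R].
  move=> rcc mc; apply: (@value_at_real Q A f q1) => //.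
  exact: inhI v1.
apply: (wp_orE (P1 := PAnd (SRlt Q A (SRvar Q A y) (SRcst nq0)) (SRlt Q A (SRcst nq0) (SRvar Q A y')))
  (P2 := PAnd (SRlt Q A (SRvar Q A y') (SRcst nq0)) (SRlt Q A (SRcst nq0) (SRvar Q A y)))).
- by apply: (wp_fun cont_pr1); apply: (wp_fun cont_pr1); apply: wp_var0; exact: hor.
- move=> g [g1 g2]; apply: (wp_call (c := T false) (P := eq e)).
    by do 3 apply: wp_shift; apply: wp_var0.
  move=> _ <-; apply: hT => //.
    move=> c rcc /(B0 c rcc)[b' [rb' yb nr]]; have [H _] := rlt0_sg rcc yb nr.
    by apply: H; exists (pr0 g).
  move=> c rcc /(B1 c rcc)[b' [rb' yb nr]]; have [_ H] := rlt0_sg rcc yb nr.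
  by apply: H; exists (pr1 g).
- move=> g [g1 g2]; apply: (wp_call (c := T true) (P := eq e)).
    by do 3 apply: wp_shift; apply: wp_var0.
  move=> _ <-; apply: hT => //.
    move=> c rcc /(B0 c rcc)[b' [rb' yb nr]]; have [_ H] := rlt0_sg rcc yb nr.
    by apply: H; exists (pr1 g).
  move=> c rcc /(B1 c rcc)[b' [rb' yb nr]]; have [H _] := rlt0_sg rcc yb nr.
  by apply: H; exists (pr0 g).
exact: closed_Jp.
Qed.

(** * The five models *)

Lemma QLLPO_finite p : QLLPO p -> exists L : list baire, forall z, kset p z -> List.In z L.
Proof.
move=> h; exists [:: numeral 0; numeral 1] => z /h[->|->]; first by left.
by right; left.
Qed.

Lemma QBE_finite p : QBE p -> exists L : list baire, forall z, kset p z -> List.In z L.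
Proof.
move=> h; case: (EM (exists z, kset p z)) => [[z1 k1]|no]; last first.
  by exists [::] => z kz; case: no; exists z.
case: (EM (exists2 z, kset p z & z <> z1)) => [[z2 k2 ne]|no]; last first.
  by exists [:: z1] => z kz; left; apply: contrapT => ne; apply: no; exists z => // e; apply: ne.
by exists [:: z1; z2] => z kz; case: (h z1 z2 z k1 k2 kz) => [e|->|->]; [case: ne|left|right; left].
Qed.

Lemma const_selector b p : kset p (numeral b) ->
  kapp (fcode (fun=> numeral b)) p (numeral b).
Proof. by move=> _; apply: (@fcodeP (fun=> numeral b)); apply: cont_cst. Qed.

Lemma QLLPO_selectors p : QLLPO p -> exists G k, finite_codes G /\ forall p', agree k p p' ->
  QLLPO p' -> (exists z, kset p' z) -> exists c v, [/\ G c, kapp c p' v & kset p' v].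
Proof.
move=> _; exists (fun c => exists2 b : nat, b <= 1 & c = fcode (fun=> numeral b)), 0; split.
  exists [:: fcode (fun=> numeral 0); fcode (fun=> numeral 1)] => c [[|[|b]] // _ ->]; first by left.
  by right; left.
move=> p' _ Qp [z kz]; have sel b : b <= 1 -> z = numeral b -> exists c v,
    [/\ (exists2 b : nat, b <= 1 & c = fcode (fun=> numeral b)), kapp c p' v & kset p' v].
  move=> b1 e; rewrite e in kz; exists (fcode (fun=> numeral b)), (numeral b); split=> //.
    by exists b.
  exact: const_selector.
by case: (Qp z kz) => e; [apply: (sel 0)|apply: (sel 1)].
Qed.

(** Two codes suffice: the constant [0^omega], and [kuniq] for a singleton. *)
Lemma QRDIV_selectors p : QRDIV p -> exists G k, finite_codes G /\ forall p', agree k p p' ->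
  QRDIV p' -> (exists z, kset p' z) -> exists c v, [/\ G c, kapp c p' v & kset p' v].
Proof.
move=> _; exists (fun c => c = kuniq \/ c = fcode (fun=> numeral 0)), 0; split.
  exists [:: kuniq; fcode (fun=> numeral 0)] => c [->|->]; first by left.
  by right; left.
move=> p' _ [k0|[z hz]] _.
  by exists (fcode (fun=> numeral 0)), (numeral 0); split=> //; [right|exact: const_selector].
by exists kuniq, z; split; [left|apply: kuniqP|apply/hz].
Qed.

Definition QRB (p : baire) : Prop := QRDIV p \/ QBE p.

Lemma QRB_ranked p : QRB p -> kset p (numeral 0) \/
  exists L : list baire, forall z, kset p z -> List.In z L.
Proof.
case=> [[k0|[z hz]]|/QBE_finite]; [by left| |by right].
by right; exists [:: z] => z' /hz ->; left.
Qed.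

Theorem theorem1p1 :
  (exists j, idempotent_jump KV j
     /\ j_realizes KV j (IZF ⊕ LLPO ⊕ FNot RDIV ⊕ FNot BE)%T)
  /\ (exists j, idempotent_jump KV j
     /\ j_realizes KV j (IZF ⊕ RDIV ⊕ FNot BE)%T)
  /\ (exists j, idempotent_jump KV j
     /\ j_realizes KV j (IZF ⊕ BE ⊕ FNot RDIV)%T)
  /\ (exists j, idempotent_jump KV j
     /\ j_realizes KV j (IZF ⊕ RDIV ⊕ BE ⊕ FNot IVT)%T)
  /\ (exists j, idempotent_jump KV j
     /\ j_realizes KV j (IZF ⊕ IVT ⊕ FNot WKL)%T).
Proof.
split; last split; last split; last split.
- apply: (@valid_realizes QLLPO) => phi [[[/valid_IZF h|->]|->]|->].
  + exact: h.
  + exact: valid_LLPO.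
  + by apply: not_RDIV; apply: QLLPO_finite.
  by apply: not_BE; apply: QLLPO_selectors.
- apply: (@valid_realizes QRDIV) => phi [[/valid_IZF h|->]|->].
  + exact: h.
  + exact: valid_RDIV.
  by apply: not_BE; apply: QRDIV_selectors.
- apply: (@valid_realizes QBE) => phi [[/valid_IZF h|->]|->].
  + exact: h.
  + exact: valid_BE.
  by apply: not_RDIV; apply: QBE_finite.
- apply: (@valid_realizes QRB) => phi [[[/valid_IZF h|->]|->]|->].
  + exact: h.
  + by apply: valid_RDIV; left.
  + by apply: valid_BE; right.
  by apply: not_IVT; apply: QRB_ranked.
apply: (@valid_realizes QIVT) => phi [[/valid_IZF h|->]|->].
- exact: h.
- exact: valid_IVT.
exact: not_WKL.
Qed.
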